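(* Let $D:=-i\frac{\mathrm{d}}{\mathrm{d}x}+P_0$ on $L^2(S^1)$ and $\sigma(a):=|D|a|D|^{-1}$, and let $\mathcal{A}$ be the $*$-algebra generated by $\bigcup_{k\in\mathbb{Z}}\sigma^k(C^\infty(S^1))$, so that $(\mathcal{A},L^2(S^1),D,\sigma)$ is the regular finitely summable twisted spectral triple with simple discrete dimension spectrum obtained from saturating the weakly twisted spectral triple $(C^\infty(S^1),L^2(S^1),D,\sigma)$. Then $(\mathcal{A},L^2(S^1),D,\sigma)$ pairs non-trivially with $K_1(\mathcal{A})$, but the cochain $(\phi_m)_{m\ge1,\ m\text{ odd}}$ provided by Moscovici's ansatz is the zero cochain. Hence the equality $$\langle[(\phi_m)_{m\ \mathrm{odd}}],\mathrm{Ch}(x)\rangle=\langle[(\mathcal{A},L^2(S^1),D,\sigma)],x\rangle\qquad\text{for all }x\in K_1(\mathcal{A})$$ does not hold.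
   Context: The circle $S^1=\{z\in\mathbb{C}:|z|=1\}$ is parametrised by $x\mapsto\mathrm{e}^{ix}$; $P_0$ is the orthogonal projection of $L^2(S^1)$ onto the constant functions; $C^\infty(S^1)$ acts by multiplication. $D$ is invertible and self-adjoint; $F:=D|D|^{-1}$. For $k\in\mathbb{Z}$, $\sigma^k(a)$ is the bounded extension of $|D|^ka|D|^{-k}$. A weakly twisted spectral triple $(\mathcal{A}_0,H,D,\sigma)$: a $*$-algebra $\mathcal{A}_0\subset\mathbb{B}(H)$, a self-adjoint operator $D$, and a partially defined multiplicative map $\sigma$ of $\mathbb{B}(H)$, defined on a $*$-subalgebra containing $\mathcal{A}_0$, with $\sigma(a)^*=\sigma^{-1}(a^* )$, such that for $a\in\mathcal{A}_0$: $a\operatorname{Dom}(D)\subset\operatorname{Dom}(D)$, $[D,a]_\sigma:=Da-\sigma(a)D$ is bounded and $a(1+D^2)^{-1/2}$ is compact. It is a twisted spectral triple if moreover $\sigma$ restricts to an automorphism of the algebra. The saturation replaces $\mathcal{A}_0$ by the $*$-algebra generated by $\bigcup_{k\in\mathbb{Z}}\sigma^k(\mathcal{A}_0)$. Finitely summable: $(i+D)^{-1}\in\mathcal{L}^p(H)$ for some $p>0$. Regular: there is a $*$-algebra $\mathcal{B}\subseteq\mathbb{B}(H)$ containing $\mathcal{A}$ and $[D,\mathcal{A}]_\sigma$ to which $\sigma$ extends as a linear isomorphism $\theta$ of $\mathcal{B}$, with $\mathcal{B}$ invariant under $b\mapsto|D|b-\theta(b)|D|$. Let $\Psi$ be the algebra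 of operators (on $\bigcap_k\operatorname{Dom}(|D|^k)$) generated by $F$, $\mathcal{A}$, $[D,\mathcal{A}]_\sigma$ and $|D|^k$, $k\in\mathbb{Z}$, with $\sigma(T)=|D|T|D|^{-1}$ for $T\in\Psi$. Discrete dimension spectrum: there is a discrete set $\mathrm{Sd}\subseteq\mathbb{C}$ such that for every $T\in\Psi$ the function $\zeta_T(z)=\operatorname{Tr}(T|D|^{-2z})$, $\mathrm{Re}(z)\gg0$, extends meromorphically to $\mathbb{C}$, holomorphic outside $\mathrm{Sd}$; simple if all poles have order at most one. For $T\in\Psi$ set $T^{(0)}=T$, $T^{(k)}=D^2T^{(k-1)}-\sigma^2(T^{(k-1)})D^2$, and $\tau_j(T)=\mathrm{Res}_{z=0}\,z^j\operatorname{Tr}(T|D|^{-2z})$. Moscovici's ansatz (odd case): for $m\ge1$ odd, $j\in\mathbb{N}$, $\Bbbk=(k_1,\dots,k_m)\in\mathbb{N}^m$ (with $0\in\mathbb{N}$), $|\Bbbk|=\sum k_i$, $$\phi_{m,j,\Bbbk}(a_0,\dots,a_m)=\tau_j\Big(Fa_0[D,\sigma^{-2k_1-1}(a_1)]_\sigma^{(k_1)}\cdots[D,\sigma^{-2(k_1+\cdots+k_m)-1}(a_m)]_\sigma^{(k_m)}|D|^{-2|\Bbbk|-m}\Big),$$ $$\phi_m(a_0,\dots,a_m)=\sum_{\Bbbk\in\mathbb{N}^m}(-1)^{|\Bbbk|}\alpha(\Bbbk)\sum_{j=0}^{|\Bbbk|+(m-1)/2}\tilde\sigma_{|\Bbbk|+(m-1)/2,\,j}\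 \phi_{m,j,\Bbbk}(a_0,\dots,a_m),$$ where $\alpha(\Bbbk)^{-1}=k_1!\cdots k_m!\,(k_1+1)(k_1+k_2+2)\cdots(|\Bbbk|+m)$ and $\prod_{l=0}^{n-1}(z+l+\tfrac12)=\sum_{j=0}^nz^j\tilde\sigma_{n,j}$. Pairings: for a unitary $u$ over $\mathcal{A}$, $\langle[(\mathcal{A},H,D,\sigma)],[u]\rangle=\mathrm{Index}(PuP:PH\to PH)$ with $P=(F+1)/2$; ''pairs non-trivially with $K_1(\mathcal{A})$'' means this is non-zero for some class. $\langle[(\phi_m)],\mathrm{Ch}(u)\rangle=\sum_m\phi_m(\mathrm{Ch}_m(u))$, with $\mathrm{Ch}_{2l+1}(u)=(-1)^l\,l!\,u^*\otimes u\otimes\cdots\otimes u^*\otimes u$ ($2l+2$ factors), up to a universal normalisation, is the pairing with the Chern character. *)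

(* Defs.v *)
From HB Require Import structures.
From mathcomp Require Import all_boot all_order all_algebra ring lra.
From mathcomp Require Import sesquilinear generic_quotient ring_quotient complex.
From mathcomp Require Import all_classical all_reals all_analysis.
Set Implicit Arguments.
Unset Strict Implicit.
Unset Printing Implicit Defensive.
Import Order.TTheory GRing.Theory Num.Theory numFieldNormedType.Exports.
Local Open Scope classical_set_scope.
Local Open Scope ring_scope.
Local Open Scope quotient_scope.

(* A (possibly unbounded, partially defined) operator is represented by its   *)
(* graph; thus inclusion of sets is extension of operators, and the domain of *)
(* a sum or of a product is the natural one.                                  *)
Definition oper (K : pzRingType) (V : lmodType K) := set (V * V).

Declare Scope oper_scope.
Delimit Scope oper_scope with oper.
Bind Scope oper_scope with oper.

Section OperatorAlgebra.
Context (K : pzRingType) (V : lmodType K).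
Implicit Types S T : oper V.

Definition dom T : set V := [set x | exists y, T (x, y)].
Definition ran T : set V := [set y | exists x, T (x, y)].
Definition op0 : oper V := [set p | p.2 = 0].
Definition op1 : oper V := [set p | p.2 = p.1].
Definition opV T : oper V := [set p | T (p.2, p.1)].
Definition opD S T : oper V :=
  [set p | exists y z, [/\ S (p.1, y), T (p.1, z) & p.2 = y + z]].
Definition opZ (c : K) T : oper V :=
  [set p | exists2 y, T (p.1, y) & p.2 = c *: y].
Definition opM S T : oper V :=
  [set p | exists2 y, T (p.1, y) & S (y, p.2)].
Definition opX T (k : int) : oper V :=
  match k with
  | Posz n => iter n (opM T) op1
  | Negz n => iter n.+1 (opM (opV T)) op1
  end.
Definition oprestr (W : set V) T : oper V := [set p | W p.1 /\ T p].

Definition linear_op T :=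
  [/\ T (0, 0),
      forall c x y x' y', T (x, y) -> T (x', y') -> T (c *: x + x', c *: y + y') &
      forall x y z, T (x, y) -> T (x, z) -> y = z].

Definition opalg_closed (P : set (oper V)) :=
  [/\ forall S T, P S -> P T -> P (opD S T),
      forall c T, P T -> P (opZ c T) &
      forall S T, P S -> P T -> P (opM S T)].

(* the quotient W / M of the subspaces M `<=` W has dimension d *)
Definition quotient_dim (W M : set V) (d : nat) :=
  exists e : 'I_d -> V, (forall i, W (e i)) /\
    forall x, W x -> exists! c : 'I_d -> K, M (x - \sum_i c i *: e i).

(* T, an operator on the subspace W, is Fredholm of index n *)
Definition fredholm_index (W : set V) T (n : int) :=
  exists p q, [/\ quotient_dim [set x | T (x, 0)] [set 0] p,
    quotient_dim W (ran T) q & n = p%:Z - q%:Z].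

End OperatorAlgebra.

Arguments op0 {K V}.
Arguments op1 {K V}.
Notation "S +o T" := (opD S T) (at level 50, left associativity) : oper_scope.
Notation "S -o T" := (opD S (opZ (-1) T))
  (at level 50, left associativity) : oper_scope.
Notation "c *:o T" := (opZ c T) (at level 40) : oper_scope.
Notation "S *o T" := (opM S T) (at level 40, left associativity) : oper_scope.

Section Hilbert.
Context (R : realType).
Notation C := R[i].
Context (H : lmodType C) (ip : {dot H for Num.conj}).
Implicit Types (S T a b D : oper H) (A B : set (oper H)).
Local Open Scope oper_scope.

Definition hnorm (x : H) : R := Num.sqrt (complex.Re (ip x x)).

Definition hcvg (u : nat -> H) (l : H) := hnorm (u n - l) @[n --> \oo] --> (0 : R).

Definition hilbert := forall u : nat -> H,
  (forall e, 0 < e -> exists N, forall m n,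
     (N <= m)%N -> (N <= n)%N -> hnorm (u m - u n) < e) ->
  exists l, hcvg u l.

Definition hdense (W : set H) :=
  forall x e, 0 < e -> exists2 y, W y & hnorm (x - y) < e.

Definition bounded_op T :=
  [/\ linear_op T, dom T = setT &
      exists M, forall x y, T (x, y) -> hnorm y <= M * hnorm x].

Definition compact_op T := bounded_op T /\
  forall x y : nat -> H, (forall n, hnorm (x n) <= 1) -> (forall n, T (x n, y n)) ->
  exists s l, {homo s : m n / (m < n)%N} /\ hcvg (y \o s) l.

Definition adjoint T : oper H :=
  [set p | forall q, T q -> ip q.2 p.1 = ip q.1 p.2].

Definition self_adjoint T :=
  [/\ linear_op T, hdense (dom T) & adjoint T = T].

Definition invertible_op T := bounded_op (opV T).

(* the bounded extension of a densely defined bounded operator *)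
Definition bext T : oper H :=
  [set p | exists S, [/\ bounded_op S, T `<=` S, hdense (dom T) & S p]].

Definition orth_proj (W : set H) : oper H :=
  [set p | W p.2 /\ forall w, W w -> ip (p.1 - p.2) w = 0].

Definition orthonormal_basis (e : nat -> H) :=
  (forall m n, ip (e m) (e n) = (m == n)%:R) /\
  (forall x, (forall n, ip x (e n) = 0) -> x = 0).

(* f(D), for a self-adjoint D that has an orthonormal basis of eigenvectors,  *)
(* in particular for a self-adjoint D with compact resolvent                  *)
Definition fcalc (f : R -> C) D : oper H :=
  [set p | forall v (t : R), D (v, (t%:C)%C *: v) -> ip p.2 v = f t * ip p.1 v].

Definition opabs D : oper H := fcalc (fun t => (`|t|%:C)%C) D.

Definition opphase D : oper H := D *o opV (opabs D).

Definition cpow (t : R) (w : C) : C :=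
  Complex (expR (complex.Re w * ln t) * cos (complex.Im w * ln t))
          (expR (complex.Re w * ln t) * sin (complex.Im w * ln t)).

Definition opabs_cpow D (w : C) : oper H := fcalc (fun t => cpow `|t| w) D.

(* The approximation numbers of a bounded operator: for compact operators     *)
(* they are the singular values, numbered from 0, and they tend to 0 only for *)
(* compact operators.                                                         *)
Definition singular_value T (n : nat) : R :=
  inf [set M | 0 <= M /\ exists S,
    [/\ bounded_op S,
        exists e : 'I_n -> H, forall y, ran S y ->
          exists c : 'I_n -> C, y = \sum_i c i *: e i &
        forall x y z, T (x, y) -> S (x, z) -> hnorm (y - z) <= M * hnorm x]].

Definition schatten (p : R) T := bounded_op T /\
  (\sum_(0 <= n <oo) (singular_value T n `^ p)%:E < +oo)%E.

Definition is_trace T (t : C) := schatten 1 T /\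
  exists e y : nat -> H, [/\ orthonormal_basis e, forall n, T (e n, y n) &
    series (fun n => ip (y n) (e n) : C^o) @ \oo --> (t : C^o)].

Definition star_algebra A :=
  [/\ A `<=` bounded_op, A op0, opalg_closed A & forall T, A T -> A (adjoint T)].

Definition sigma_pow D (k : int) a : oper H :=
  bext (opX (opabs D) k *o a *o opX (opabs D) (- k)).

Definition saturation D A : set (oper H) :=
  smallest star_algebra [set b | exists k a, A a /\ b = sigma_pow D k a].

Definition twisted_comm D (sigma : oper H -> oper H) a : oper H :=
  bext (D *o a -o sigma a *o D).

(* B is the domain of sigma, a partially defined map of the bounded operators *)
Definition partial_twist B (sigma : oper H -> oper H) :=
  [/\ star_algebra B,
      forall a, B a -> bounded_op (sigma a),
      forall a b, B a -> B b -> sigma (a *o b) = sigma a *o sigma b,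
      forall a b, B a -> B b -> sigma a = sigma b -> a = b &
      forall a, B a -> B (adjoint (sigma a)) /\
                       sigma (adjoint (sigma a)) = adjoint a].

Definition weakly_twisted_triple A D (sigma : oper H -> oper H) :=
  [/\ hilbert, star_algebra A, self_adjoint D,
      exists2 B, partial_twist B sigma & A `<=` B &
      forall a, A a ->
        [/\ forall x y, dom D x -> a (x, y) -> dom D y,
            bounded_op (twisted_comm D sigma a) &
            compact_op (a *o fcalc (fun t => ((Num.sqrt (1 + t ^+ 2))^-1%:C)%C) D)]].

Definition linear_iso A (sigma : oper H -> oper H) :=
  [/\ forall a, A a -> A (sigma a),
      forall b, A b -> exists2 a, A a & sigma a = b,
      forall a b, A a -> A b -> sigma a = sigma b -> a = b,
      forall a b, A a -> A b -> sigma (a +o b) = sigma a +o sigma b &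
      forall c a, A a -> sigma (c *:o a) = c *:o sigma a].

Definition twisted_triple A D (sigma : oper H -> oper H) :=
  [/\ weakly_twisted_triple A D sigma, linear_iso A sigma &
      forall a b, A a -> A b -> sigma (a *o b) = sigma a *o sigma b].

Definition regular_triple A D (sigma : oper H -> oper H) :=
  exists B theta,
    [/\ star_algebra B /\ linear_iso B theta,
        A `<=` B,
        forall a, A a -> B (twisted_comm D sigma a),
        forall a, A a -> theta a = sigma a &
        forall b, B b -> B (bext (opabs D *o b -o theta b *o opabs D))].

Definition finitely_summable D :=
  exists2 p : R, 0 < p & schatten p (opV (Complex 0 1 *:o op1 +o D)).

Definition Hinf D : set H := [set x | forall k : nat, dom (opX (opabs D) k) x].

Definition Psi A D : set (oper H) :=
  smallest (@opalg_closed C H)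
    [set T | exists2 S, T = oprestr (Hinf D) S &
       [\/ S = opphase D, A S,
           exists2 a, A a & S = twisted_comm D (sigma_pow D 1) a |
           exists k : int, S = opX (opabs D) k]].

Definition is_zeta D T (z t : C) :=
  is_trace (bext (T *o opabs_cpow D (- (2 * z)))) t.

Definition holomorphic_at (f : C -> C) (z0 : C) :=
  \forall z \near (z0 : C^o), derivable (f : C^o -> C^o) z 1.

(* near z0, f(z) = h(z) + \sum_(k < n) c_k (z - z0)^(- k - 1), h holomorphic *)
Definition laurent_at (f : C -> C) (z0 : C) (n : nat) (c : nat -> C) :=
  exists2 h : C -> C, holomorphic_at h z0 &
  \forall z \near (z0 : C^o)^',
    f z = h z + \sum_(k < n) c k / (z - z0) ^+ k.+1.

Definition meromorphic (f : C -> C) :=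
  forall z0, exists n c, laurent_at f z0 n c.

Definition is_residue (f : C -> C) (z0 r : C) :=
  exists n c, laurent_at f z0 n.+1 c /\ r = c 0%N.

Definition zeta_extension D T (g : C -> C) :=
  meromorphic g /\
  exists x0 : R, forall z, x0 < complex.Re z -> is_zeta D T z (g z).

Definition discrete_set (Sd : set C) :=
  forall z0 : C, \forall z \near (z0 : C^o)^', ~ Sd z.

Definition simple_discrete_dimension_spectrum A D :=
  exists2 Sd, discrete_set Sd & forall T, Psi A D T ->
    exists g, [/\ zeta_extension D T g,
      forall z, ~ Sd z -> holomorphic_at g z &
      forall z, exists c, laurent_at g z 1 c].

Definition is_tau D T (j : nat) (r : C) :=
  exists2 g, zeta_extension D T g & is_residue (fun z => z ^+ j * g z) 0 r.

Fixpoint iterated_comm D T (k : nat) : oper H :=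
  if k is k'.+1 then
    let T' := iterated_comm D T k' in
    opX D 2 *o T' -o (opX (opabs D) 2 *o T' *o opX (opabs D) (- 2)) *o opX D 2
  else T.

Section Moscovici.
Variables (D : oper H) (m : nat).
Implicit Types k : m.-tuple nat.

Definition ksum k (i : 'I_m) : nat := \sum_(l < m | (l <= i)%N) tnth k l.

Definition kabs k : nat := \sum_(l < m) tnth k l.

Definition kalpha k : C :=
  (\prod_(i < m) ((tnth k i)`! * (ksum k i + i.+1))%N%:R)^-1.

Definition ksigma (n j : nat) : C :=
  (\prod_(l < n) ('X + (l%:R + 2^-1)%:P) : {poly C})`_j.

Definition moscovici_op k (a : 'I_m.+1 -> oper H) : oper H :=
  oprestr (Hinf D)
    (opphase D *o a ord0 *o
     \big[@opM C H/op1]_(i < m)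
       iterated_comm D
         (oprestr (Hinf D)
            (twisted_comm D (sigma_pow D 1)
               (sigma_pow D (- (2 * ksum k i + 1)%N%:Z) (a (lift ord0 i)))))
         (tnth k i) *o
     opX (opabs D) (- (2 * kabs k + m)%N%:Z)).

(* v is the value of phi_m at (a_0, ..., a_m); t k j stands for               *)
(* phi_{m,j,k}(a_0, ..., a_m), and only finitely many terms of the sum over   *)
(* the multi-indices k are nonzero                                            *)
Definition moscovici_value (a : 'I_m.+1 -> oper H) (v : C) :=
  exists t : m.-tuple nat -> nat -> C,
    let term k := (-1) ^+ kabs k * kalpha k *
      \sum_(j < (kabs k + m.-1./2).+1) ksigma (kabs k + m.-1./2) j * t k j in
    [/\ forall k j, (j <= kabs k + m.-1./2)%N -> is_tau D (moscovici_op k a) j (t k j),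
        finite_set [set k | term k != 0] &
        v = \sum_(k \in [set: m.-tuple nat]) term k].

End Moscovici.

Definition cochain := forall m : nat, ('I_m.+1 -> oper H) -> C.

Definition moscovici_cochain A D (phi : cochain) :=
  forall m (a : 'I_m.+1 -> oper H), odd m -> (forall i, A (a i)) ->
    moscovici_value D a (phi m a).

Definition odd_zero_cochain A (phi : cochain) :=
  forall m (a : 'I_m.+1 -> oper H), odd m -> (forall i, A (a i)) -> phi m a = 0.

Section Pairings.
Variable N : nat.
Implicit Types u : 'I_N -> 'I_N -> oper H.

Definition unitary_over A u :=
  [/\ forall i j, A (u i j),
      forall i j, \big[@opD C H/op0]_(l < N) (adjoint (u l i) *o u l j) =
                  if i == j then op1 else op0 &
      forall i j, \big[@opD C H/op0]_(l < N) (u i l *o adjoint (u j l)) =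
                  if i == j then op1 else op0].

Definition positive_proj D : oper H := (2^-1 : C) *:o (opphase D +o op1).

Definition compression D u : oper ('I_N -> H) :=
  [set p | (forall i, ran (positive_proj D) (p.1 i)) /\
     exists y : 'I_N -> 'I_N -> H, (forall i j, u i j (p.1 j, y i j)) /\
       forall i, positive_proj D (\sum_j y i j, p.2 i)].

Definition index_pairing D u (n : int) :=
  fredholm_index [set x : 'I_N -> H | forall i, ran (positive_proj D) (x i)]
    (compression D u) n.

(* phi_{2l+1}(Ch_{2l+1}(u)), phi_m being extended to N x N matrices by        *)
(* composition with the matrix trace                                          *)
Definition chern_term (phi : cochain) u (l : nat) : C :=
  (-1) ^+ l * l`!%:R *
  \sum_(I : {ffun 'I_(2 * l).+2 -> 'I_N})
    phi (2 * l).+1 (fun s : 'I_(2 * l).+2 =>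
      if odd s then u (I s) (I (ordS s)) else adjoint (u (I (ordS s)) (I s))).

(* kappa is the normalisation constant of the Chern character *)
Definition chern_pairing (kappa : C) (phi : cochain) u (v : C) :=
  series (fun l => kappa * chern_term phi u l : C^o) @ \oo --> (v : C^o).

End Pairings.

End Hilbert.

(* L^2(S^1), the circle being parametrised by t |-> e^(it): its elements are  *)
(* classes of functions on R whose restrictions to [0, 2 pi] are square       *)
(* integrable, modulo equality almost everywhere on [0, 2 pi]                 *)
Section L2circle.
Context (R : realType).
Notation C := R[i].
Notation re := (@complex.Re R).
Notation im := (@complex.Im R).

Definition circle_measure : {measure set (measurableTypeR R) -> \bar R} :=
  mrestr (@lebesgue_measure R) (measurable_itv `[0, 2 * pi]).
Notation mu := circle_measure.

Definition sq_integrable : {pred R -> C^o} :=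
  [pred f : R -> C^o | ((fun t => re (f t)) \in Lfun mu 2%:E) &&
                       ((fun t => im (f t)) \in Lfun mu 2%:E)].

Let reZD (a x y : C) : re (a * x + y) = re a * re x + (- im a) * im x + re y.
Proof. by case: a x y => [a1 a2] [b1 b2] [c1 c2]; rewrite mulNr. Qed.

Let imZD (a x y : C) : im (a * x + y) = re a * im x + im a * re x + im y.
Proof. by case: a x y => [a1 a2] [b1 b2] [c1 c2]. Qed.

Fact sq_integrable_submod : submod_closed sq_integrable.
Proof.
have one2 : (1 <= 2%:E :> \bar R)%E by rewrite lee_fin ler1n.
have [L0 LZD] := Lfun_submod_closed mu one2.
have LZ (a : R) g : g \in Lfun mu 2%:E -> (fun t => a * g t) \in Lfun mu 2%:E.
  by move=> gL; have := LZD a g 0 gL L0; rewrite addr0.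
have LB (g h : R -> R) : g \in Lfun mu 2%:E -> h \in Lfun mu 2%:E ->
    (fun t => g t + h t) \in Lfun mu 2%:E.
  by move=> gL hL; have := LZD 1 g h gL hL; rewrite scale1r.
split; first by apply/andP; split; exact: L0.
move=> a f g /andP[f1 f2] /andP[g1 g2]; apply/andP; split.
  have -> : (fun t => re ((a *: f + g) t)) =
      (fun t => (re a * re (f t) + (- im a) * im (f t)) + re (g t)).
    by apply/funext => t; exact: reZD.
  by apply: (LB _ _ _ g1); apply: LB; exact: LZ.
have -> : (fun t => im ((a *: f + g) t)) =
    (fun t => (re a * im (f t) + im a * re (f t)) + im (g t)).
  by apply/funext => t; exact: imZD.
by apply: (LB _ _ _ g2); apply: LB; exact: LZ.
Qed.
HB.instance Definition _ := GRing.isSubmodClosed.Build C (R -> C^o)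
  sq_integrable sq_integrable_submod.

Record L2fun := MkL2fun { L2val :> R -> C^o; L2valP : L2val \in sq_integrable }.
HB.instance Definition _ := [isSub for L2val].
HB.instance Definition _ := [Choice of L2fun by <:].
HB.instance Definition _ := [SubChoice_isSubLmodule of L2fun by <:].

Definition ae_null : {pred L2fun} :=
  [pred f : L2fun | `[< {ae mu, forall t, (f : R -> C^o) t = 0} >]].

Let aeF : Filter (almost_everywhere mu) := ae_filter_ringOfSetsType mu.

Fact ae_null_zmod : zmod_closed ae_null.
Proof.
split; first by apply/asboolP; apply: aeW.
move=> f g /asboolP f0 /asboolP g0; apply/asboolP.
apply: (@filterS2 _ _ aeF _ _ _ _ f0 g0) => t ft gt.
by change (f t - g t = 0 :> C^o); rewrite ft gt subr0.
Qed.
HB.instance Definition _ := GRing.isZmodClosed.Build L2fun ae_null ae_null_zmod.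

Definition L2 := Quotient.quot ae_null.
HB.instance Definition _ := GRing.Zmodule.on L2.

Fact L2_eqP (f g : L2fun) : {ae mu, forall t, f t = g t} <-> \pi_L2 f = \pi_L2 g.
Proof.
split=> [fg|/eqP].
  apply/eqP; rewrite -Quotient.idealrBE; apply/asboolP.
  apply: (@filterS _ _ aeF _ _ _ fg) => t ft.
  by change (f t - g t = 0 :> C^o); rewrite ft subrr.
rewrite -Quotient.idealrBE => /asboolP; apply: (@filterS _ _ aeF) => t fgt.
by apply/eqP; rewrite -subr_eq0; apply/eqP.
Qed.

Fact L2_reprP (f : L2fun) : {ae mu, forall t, (repr (\pi_L2 f) : L2fun) t = f t}.
Proof. by apply/L2_eqP; rewrite reprK. Qed.

Definition L2scale (a : C) (x : L2) : L2 := \pi_L2 (a *: (repr x : L2fun)).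

Let pi_scale a f : L2scale a (\pi_L2 f) = \pi_L2 (a *: f).
Proof.
apply/L2_eqP; apply: (@filterS _ _ aeF _ _ _ (L2_reprP f)) => t ft.
by change (a * (repr (\pi_L2 f) : L2fun) t = a * f t); rewrite ft.
Qed.

Let piD f g : \pi_L2 f + \pi_L2 g = \pi_L2 (f + g).
Proof. by rewrite [RHS]raddfD. Qed.

Let L2W (P : L2 -> Prop) : (forall f, P (\pi_L2 f)) -> forall x, P x.
Proof. by move=> Ppi x; rewrite -[x]reprK. Qed.

Fact L2scaleA a b x : L2scale a (L2scale b x) = L2scale (a * b) x.
Proof. by elim/L2W: x => f; rewrite 3!pi_scale scalerA. Qed.
Fact L2scale1 : left_id 1 L2scale.
Proof. by elim/L2W => f; rewrite pi_scale scale1r. Qed.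
Fact L2scaleDr : right_distributive L2scale +%R.
Proof.
move=> a; elim/L2W => f; elim/L2W => g.
by rewrite piD 3!pi_scale piD scalerDr.
Qed.
Fact L2scaleDl x : {morph L2scale^~ x : a b / a + b}.
Proof. by move=> a b; elim/L2W: x => f; rewrite 3!pi_scale piD scalerDl. Qed.
HB.instance Definition _ := GRing.Zmodule_isLmodule.Build C L2
  L2scaleA L2scale1 L2scaleDr L2scaleDl.

Definition cintegral (f : R -> C) : C :=
  Complex (\int[mu]_t re (f t)) (\int[mu]_t im (f t)).

Definition L2ip (x y : L2) : C :=
  cintegral (fun t => (repr x : L2fun) t * ((repr y : L2fun) t)^*).

Let q (A B : R -> R) : R := \int[mu]_t (A t * B t).
Let L := Lfun mu 2%:E.

Let qint A B : A \in L -> B \in L -> mu.-integrable setT (EFin \o (fun t => A t * B t)).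
Proof. by move=> AL BL; apply/Lfun1_integrable; exact: Lfun2_mul_Lfun1. Qed.

Let qC A B : q A B = q B A.
Proof. by rewrite /q; apply: eq_Rintegral => t _; rewrite mulrC. Qed.

Let qZD a A A' B : A \in L -> A' \in L -> B \in L ->
  q (fun t => a * A t + A' t) B = a * q A B + q A' B.
Proof.
move=> AL AL' BL; rewrite /q.
have -> : \int[mu]_t ((a * A t + A' t) * B t) =
    \int[mu]_t (a * (A t * B t) + A' t * B t).
  by apply: eq_Rintegral => t _; rewrite mulrDl mulrA.
rewrite RintegralD//; last exact: qint.
  by rewrite RintegralZl//; exact: qint.
by apply: (@integrableZl _ _ _ _ _ _ a (EFin \o (fun t => A t * B t))) => //; exact: qint.
Qed.

Let q_ge0 A : 0 <= q A A.
Proof. by apply: Rintegral_ge0 => t _; rewrite -expr2 sqr_ge0. Qed.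

Let q_eq0 A : A \in L -> q A A = 0 -> {ae mu, forall t, A t = 0}.
Proof.
move=> AL; rewrite /q => /eqP.
rewrite fine_eq0; last by apply: integrable_fin_num => //; exact: qint.
move=> /eqP q0.
have /integrableP[mA _] := qint AL AL.
have := (ae_eq_integral_abs mu measurableT mA).1.
have -> : (\int[mu]_t `|(EFin \o (fun t => (A t * A t)%R)) t|)%E = 0%E.
  rewrite -[RHS]q0; apply: eq_integral => t _ /=.
  by rewrite ger0_norm// -expr2 sqr_ge0.
move=> /(_ erefl); apply: (@filterS _ _ aeF) => t /(_ I) /= [] /eqP.
by rewrite mulf_eq0 orbb => /eqP.
Qed.

Let q_ae A A' B : A \in L -> A' \in L -> B \in L ->
  {ae mu, forall t, A t = A' t} -> q A B = q A' B.
Proof.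
move=> AL AL' BL AA'; rewrite /q /Rintegral; congr fine.
apply: ae_eq_integral => //.
- by have /integrableP[] := qint AL BL.
- by have /integrableP[] := qint AL' BL.
by apply: (@filterS _ _ aeF _ _ _ AA') => t /= -> _.
Qed.

Let reL (f : L2fun) : (fun t => re (f t)) \in L.
Proof. by case: f => f /= /andP[]. Qed.
Let imL (f : L2fun) : (fun t => im (f t)) \in L.
Proof. by case: f => f /= /andP[]. Qed.

Let fip (f g : L2fun) : C :=
  Complex (q (fun t => re (f t)) (fun t => re (g t)) + q (fun t => im (f t)) (fun t => im (g t)))
    (q (fun t => im (f t)) (fun t => re (g t)) - q (fun t => re (f t)) (fun t => im (g t))).

Let L2ipE x y : L2ip x y = fip (repr x) (repr y).
Proof.
rewrite /L2ip /cintegral /fip; congr Complex.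
- rewrite /q -RintegralD//; [|exact: (qint (reL _) (reL _))|exact: (qint (imL _) (imL _))].
  apply: eq_Rintegral => t _.
  by case: (L2val _ t) (L2val _ t) => [a b] [c d] /=; rewrite mulrN opprK.
- rewrite /q -RintegralB//; [|exact: (qint (imL _) (reL _))|exact: (qint (reL _) (imL _))].
  apply: eq_Rintegral => t _.
  by case: (L2val _ t) (L2val _ t) => [a b] [c d] /=; rewrite mulrN addrC.
Qed.

Let fip_herm f g : fip f g = (fip g f)^*.
Proof.
transitivity (conjc (fip g f)); last by [].
rewrite /fip /conjc opprB.
rewrite (qC (fun t => re (f t)) (fun t => re (g t))).
rewrite (qC (fun t => im (f t)) (fun t => im (g t))).
rewrite (qC (fun t => im (f t)) (fun t => re (g t))).
by rewrite (qC (fun t => re (f t)) (fun t => im (g t))).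
Qed.

Let fip_ae (f f' g : L2fun) : {ae mu, forall t, f t = f' t} -> fip f g = fip f' g.
Proof.
move=> ff'.
have r : {ae mu, forall t, re (f t) = re (f' t)}.
  by apply: (@filterS _ _ aeF _ _ _ ff') => t ->.
have i : {ae mu, forall t, im (f t) = im (f' t)}.
  by apply: (@filterS _ _ aeF _ _ _ ff') => t ->.
rewrite /fip (q_ae _ _ _ r)// ?(q_ae _ _ _ i)// ?(q_ae _ _ _ r)//;
  do ?[exact: reL|exact: imL].
Qed.

Let fipZD a (f f' g : L2fun) : fip (a *: f + f') g = a * fip f g + fip f' g.
Proof.
have one2 : (1 <= 2%:E :> \bar R)%E by rewrite lee_fin ler1n.
have LZD (c : R) A A' : A \in L -> A' \in L -> (fun t => c * A t + A' t) \in L.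
  by have [_] := Lfun_submod_closed mu one2; apply.
have rE : (fun t => re ((a *: f + f') t)) =
    (fun t => re a * re (f t) + (- im a * im (f t) + re (f' t))).
  by apply/funext => t; rewrite addrA; exact: reZD.
have iE : (fun t => im ((a *: f + f') t)) =
    (fun t => re a * im (f t) + (im a * re (f t) + im (f' t))).
  by apply/funext => t; rewrite addrA; exact: imZD.
have rf := reL f; have jf := imL f; have rf' := reL f'; have jf' := imL f'.
have rq B : B \in L -> q (fun t => re ((a *: f + f') t)) B =
    re a * q (fun t => re (f t)) B - im a * q (fun t => im (f t)) B
    + q (fun t => re (f' t)) B.
  move=> BL; rewrite rE (qZD _ rf (LZD _ _ _ jf rf') BL) (qZD _ jf rf' BL).
  by rewrite mulNr addrA.
have iq B : B \in L -> q (fun t => im ((a *: f + f') t)) B =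
    re a * q (fun t => im (f t)) B + im a * q (fun t => re (f t)) B
    + q (fun t => im (f' t)) B.
  move=> BL; rewrite iE (qZD _ jf (LZD _ _ _ rf jf') BL) (qZD _ rf jf' BL).
  by rewrite addrA.
rewrite /fip (rq _ (reL g)) (rq _ (imL g)) (iq _ (reL g)) (iq _ (imL g)).
move: (q _ _) (q _ _) (q _ _) (q _ _) (q _ _) (q _ _) (q _ _) (q _ _).
case: a {rE iE rq iq} => a b x1 x2 x3 x4 x5 x6 x7 x8 /=.
by congr Complex; ring.
Qed.

Let L2ip_repr (x x' y : L2) :
  {ae mu, forall t, (repr x : L2fun) t = (repr x' : L2fun) t} -> L2ip x y = L2ip x' y.
Proof. by rewrite !L2ipE; exact: fip_ae. Qed.

Let L2ip_herm x y : L2ip x y = (-1) ^+ false * (L2ip y x)^*.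
Proof. by rewrite expr0 mul1r !L2ipE fip_herm. Qed.

Let L2ipZD a x x' y : L2ip (a *: x + x') y = a * L2ip x y + L2ip x' y.
Proof.
rewrite !L2ipE -fipZD; apply: fip_ae; apply/L2_eqP.
by rewrite reprK -piD -pi_scale !reprK.
Qed.

Fact L2ip_bilinear : bilinear_for *%R (Num.conj \; *%R) L2ip.
Proof.
split=> [y a x x'|x a y y']; first exact: L2ipZD.
rewrite (L2ip_herm x) L2ipZD (L2ip_herm x y) (L2ip_herm x y') !expr0 !mul1r.
by rewrite rmorphD rmorphM.
Qed.
HB.instance Definition _ := bilinear_isBilinear.Build C L2 L2 C _ _ L2ip L2ip_bilinear.
HB.instance Definition _ := isHermitianSesquilinear.Build C L2 false Num.conj L2ip L2ip_herm.

Fact L2ip_gt0 (x : L2) : x != 0 -> 0 < L2ip x x.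
Proof.
move=> x0; rewrite L2ipE.
have -> : fip (repr x) (repr x) = (q (fun t => re (L2val (repr x) t))
    (fun t => re (L2val (repr x) t)) + q (fun t => im (L2val (repr x) t))
    (fun t => im (L2val (repr x) t)))%:C%C.
  by rewrite /fip [X in _ - X]qC subrr.
rewrite ltcR lt_def addr_ge0 ?q_ge0// andbT; apply: contra_neq x0.
move/eqP; rewrite paddr_eq0 ?q_ge0// => /andP[/eqP r0 /eqP i0].
have r := q_eq0 (reL _) r0; have i := q_eq0 (imL _) i0.
have -> : 0 = \pi_L2 0 by rewrite raddf0.
rewrite -[LHS]reprK; apply/L2_eqP.
apply: (@filterS2 _ _ aeF _ _ _ _ r i) => t.
by change (re (L2val (repr x) t) = 0 -> im (L2val (repr x) t) = 0 -> L2val (repr x) t = 0);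
  case: (L2val _ t) => a b /= -> ->.
Qed.
HB.instance Definition _ := isDotProduct.Build C L2 L2ip L2ip_gt0.
End L2circle.

Section Circle.
Context (R : realType).
Notation C := R[i].
Notation re := (@complex.Re R).
Notation im := (@complex.Im R).

Definition L2dot : {dot L2 R for Num.conj} := @L2ip R.

Definition L2class (f : R -> C) : L2 R := \pi_(L2 R) (insubd (0 : L2fun R) f).

Definition smooth_periodic (f : R -> C) :=
  (forall t, f (t + 2 * trigo.pi) = f t) /\
  forall n t, derivable (derive1n n (fun s => re (f s))) t 1 /\
              derivable (derive1n n (fun s => im (f s))) t 1.

Definition mult_op (f : R -> C) : oper (L2 R) :=
  [set p | p.2 = L2class (fun t => f t * (repr p.1 : L2fun R) t)].

Definition circle_smooth : set (oper (L2 R)) := mult_op @` smooth_periodic.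

Definition deriv_op : oper (L2 R) :=
  [set p | exists2 f, smooth_periodic f &
     p = (L2class f, L2class (fun t =>
       - Complex 0 1 * Complex (derive1 (fun s => re (f s)) t) (derive1 (fun s => im (f s)) t)))].

(* The adjoint of the symmetric operator - i d/dx on C^oo(S^1) is - i d/dx in *)
(* the sense of distributions, with domain the Sobolev space H^1(S^1).        *)
Definition circle_D : oper (L2 R) :=
  opD (adjoint L2dot deriv_op)
      (orth_proj L2dot [set L2class (fun=> c) | c in [set: C]]).

Definition circle_sigma : oper (L2 R) -> oper (L2 R) := sigma_pow L2dot circle_D 1.

Definition circle_algebra : set (oper (L2 R)) :=
  saturation L2dot circle_D circle_smooth.

End Circle.
Arguments L2dot R : clear implicits.
Arguments circle_smooth R : clear implicits.
Arguments circle_D R : clear implicits.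
Arguments circle_sigma R : clear implicits.
Arguments circle_algebra R : clear implicits.

(* Main.v *)
(** In the Fourier basis [D] and [|D|] are diagonal. Since [sigma(a) = |D| a |D|^-1], the twisted commutator
    is [[D, a]_sigma = |D| [F, a]], and for a smooth function [f] the commutator [[F, f]] is smoothing:
    in the Fourier basis its entries vanish unless the two frequencies [j], [k] lie on different sides of
    zero, and there they are Fourier coefficients of [f] at [j - k], where [|j - k| = |j| + |k|]. Hence
    every argument of a residue in Moscovici's ansatz is smoothing, its zeta function is entire, all
    residues are zero, and so is the cochain; the Toeplitz compression of [e^{ix}] has index [-1].

    A general element of [Psi] is, modulo operators of arbitrarily low order, a finite sum of operators
    [m F^b |D|^k] with [m] a multiplication operator, because [|D| f = f |D| - i f' F] up to smoothing
    operators. Its diagonal entries are therefore asymptotic to combinations of integer powers, and the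
    zeta function is a combination of shifted Riemann zeta functions, continued by the Euler-Maclaurin
    formula, up to a function holomorphic on a large half-plane. *)
From HB Require Import structures.
Require Import Defs.
From mathcomp Require Import all_boot all_order all_algebra ring lra zify.
From mathcomp Require Import sesquilinear generic_quotient ring_quotient complex.
From mathcomp Require Import all_classical all_reals all_analysis measurable_realfun.
Set Implicit Arguments.
Unset Strict Implicit.
Unset Printing Implicit Defensive.
Import Order.TTheory GRing.Theory Num.Theory numFieldNormedType.Exports.
Local Open Scope classical_set_scope.
Local Open Scope ring_scope.

(** The saturation contains every [sigma^k(f)], which need not be a multiplication operator; hence
    the calculus has to be closed under conjugation by [|D|]. It takes place on the smooth vectors,
    where operators are total functions and domains cause no trouble. Each operator travels with a
    formal adjoint: a bounded operator on the whole space is recovered as [clo g] from the adjoint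
    [g], its coefficients being the pairings of [x] with [g e_k], and identities between bounded
    extensions reduce to identities of functions. Holomorphy is proved through first-order
    expansions with a quadratic remainder ([jet]), which pass to series term by term. Continuations
    with different truncation orders agree on their common half-plane by telescoping, so no identity
    theorem enters. Multiplication operators are treated abstractly, through a derivation rule; the
    circle supplies the frequencies and symbols at the end. Totality of the exponentials is proved
    with trigonometric polynomials that converge to indicators of arcs, followed by Lebesgue
    differentiation. *)

Notation re := complex.Re.
Notation im := complex.Im.
Notation cabs := ComplexField.Normc.normc.

(** * Complex scalars, the exponential, and a mean value inequality *)

Section Scalars.
Context {R : realType}.
Notation C := R[i].
Implicit Types x y z : C.

Lemma cabsE z : cabs z = Num.sqrt (re z ^+ 2 + im z ^+ 2).
Proof. by case: z. Qed.
Lemma cabs_ge0 z : 0 <= cabs z.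
Proof. by rewrite cabsE sqrtr_ge0. Qed.
Lemma cabsM x y : cabs (x * y) = cabs x * cabs y.
Proof. exact: ComplexField.Normc.normcM. Qed.
Lemma cabsD x y : cabs (x + y) <= cabs x + cabs y.
Proof. exact: le_normcD. Qed.
Lemma cabsN x : cabs (- x) = cabs x.
Proof. exact: normcN. Qed.
Lemma cabsB x y : cabs (x - y) <= cabs x + cabs y.
Proof. by rewrite -(cabsN y) cabsD. Qed.
Lemma cabsC x y : cabs (x - y) = cabs (y - x).
Proof. by rewrite -cabsN opprB. Qed.
Lemma cabs0 : cabs (0 : C) = 0. Proof. exact: ComplexField.Normc.normc0. Qed.
Lemma cabs1 : cabs (1 : C) = 1. Proof. exact: ComplexField.Normc.normc1. Qed.
Lemma cabsV x : cabs (x^-1) = (cabs x)^-1.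
Proof. exact: ComplexField.Normc.normcV. Qed.
Lemma cabsX x n : cabs (x ^+ n) = cabs x ^+ n.
Proof. by elim: n => [|n IH]; rewrite ?expr0 ?cabs1 // !exprS cabsM IH. Qed.
Lemma cabs0_eq0 x : cabs x = 0 -> x = 0.
Proof. exact: ComplexField.Normc.eq0_normc. Qed.
Lemma cabs_gt0 x : x != 0 -> 0 < cabs x.
Proof.
by move=> x0; rewrite lt_def cabs_ge0 andbT; apply: contra_neq x0 => /cabs0_eq0.
Qed.
Lemma cabs_real (r : R) : cabs (r%:C)%C = `|r|.
Proof. by rewrite cabsE /= expr0n addr0 sqrtr_sqr. Qed.
Lemma sqr_cabs z : cabs z ^+ 2 = re z ^+ 2 + im z ^+ 2.
Proof. by rewrite cabsE sqr_sqrtr // addr_ge0 ?sqr_ge0. Qed.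
Lemma re_le_cabs z : `|re z| <= cabs z.
Proof.
rewrite -(@ler_pXn2r _ 2) ?nnegrE ?cabs_ge0 // sqr_cabs real_normK ?num_real //.
by rewrite lerDl sqr_ge0.
Qed.
Lemma im_le_cabs z : `|im z| <= cabs z.
Proof.
rewrite -(@ler_pXn2r _ 2) ?nnegrE ?cabs_ge0 // sqr_cabs real_normK ?num_real //.
by rewrite lerDr sqr_ge0.
Qed.
Lemma cabs_le_reim z : cabs z <= `|re z| + `|im z|.
Proof.
rewrite -(@ler_pXn2r _ 2) ?nnegrE ?cabs_ge0 ?addr_ge0 // sqr_cabs.
rewrite sqrrD !real_normK ?num_real // -addrA lerD2l lerDr.
by rewrite mulrn_wge0 // mulr_ge0.
Qed.
Lemma cabs_conj z : cabs (z^*) = cabs z.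
Proof. by case: z => a b; rewrite !cabsE /= sqrrN. Qed.
Lemma mul_conj z : z * z^* = ((cabs z ^+ 2)%:C)%C.
Proof.
rewrite sqr_cabs; case: z => a b.
by apply/eqP; rewrite eq_complex /=; apply/andP; split; apply/eqP; ring.
Qed.
Lemma re_conj z : re (z^*) = re z. Proof. by case: z. Qed.
Lemma im_conj z : im (z^*) = - im z. Proof. by case: z. Qed.
Lemma reD x y : re (x + y) = re x + re y. Proof. by case: x y => ? ? []. Qed.
Lemma imD x y : im (x + y) = im x + im y. Proof. by case: x y => ? ? []. Qed.
Lemma reN x : re (- x) = - re x. Proof. by case: x. Qed.
Lemma imN x : im (- x) = - im x. Proof. by case: x. Qed.
Lemma reB x y : re (x - y) = re x - re y. Proof. by rewrite reD reN. Qed.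
Lemma imB x y : im (x - y) = im x - im y. Proof. by rewrite imD imN. Qed.
Lemma reM x y : re (x * y) = re x * re y - im x * im y.
Proof. by case: x y => ? ? []. Qed.
Lemma imM x y : im (x * y) = re x * im y + im x * re y.
Proof. by case: x y => ? ? []. Qed.
Lemma re_sum I (r : seq I) (P : pred I) (F : I -> C) :
  re (\sum_(i <- r | P i) F i) = \sum_(i <- r | P i) re (F i).
Proof. exact: (big_morph (@complex.Re R) reD erefl). Qed.
Lemma im_sum I (r : seq I) (P : pred I) (F : I -> C) :
  im (\sum_(i <- r | P i) F i) = \sum_(i <- r | P i) im (F i).
Proof. exact: (big_morph (@complex.Im R) imD erefl). Qed.
Lemma cabs_sum I (r : seq I) (P : pred I) (F : I -> C) :
  cabs (\sum_(i <- r | P i) F i) <= \sum_(i <- r | P i) cabs (F i).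
Proof.
elim/big_ind2: _ => [|x1 x2 y1 y2 h1 h2|//]; first by rewrite cabs0.
by apply: le_trans (cabsD _ _) _; rewrite lerD.
Qed.
Lemma complex_eq x y : re x = re y -> im x = im y -> x = y.
Proof. by case: x y => a b [c d] /= -> ->. Qed.
Lemma RCD (a b : R) : ((a + b)%:C)%C = (a%:C)%C + (b%:C)%C.
Proof. exact: rmorphD. Qed.
Lemma RCM (a b : R) : ((a * b)%:C)%C = (a%:C)%C * (b%:C)%C.
Proof. exact: rmorphM. Qed.
Lemma RCN (a : R) : ((- a)%:C)%C = - (a%:C)%C.
Proof. exact: rmorphN. Qed.
Lemma RCV (a : R) : ((a^-1)%:C)%C = (a%:C)%C^-1.
Proof. exact: fmorphV. Qed.
Lemma RCX (a : R) n : ((a ^+ n)%:C)%C = (a%:C)%C ^+ n.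
Proof. exact: rmorphXn. Qed.
Lemma RCnat n : ((n%:R : R)%:C)%C = n%:R :> C.
Proof. exact: rmorph_nat. Qed.
Lemma conj_RC (a : R) : ((a%:C)%C)^* = (a%:C)%C :> C.
Proof. by apply: complex_eq; rewrite ?re_conj ?im_conj /= ?oppr0. Qed.
Lemma cabs_nat n : cabs (n%:R : C) = n%:R.
Proof. by rewrite -RCnat cabs_real ger0_norm. Qed.

Definition cexp (w : C) : C :=
  Complex (expR (re w) * cos (im w)) (expR (re w) * sin (im w)).

Lemma cexp0 : cexp 0 = 1.
Proof. by rewrite /cexp /= expR0 cos0 sin0 mulr0 mulr1. Qed.
Lemma cexpD x y : cexp (x + y) = cexp x * cexp y.
Proof.
apply: complex_eq; rewrite ?reM ?imM /= reD imD expRD ?cosD ?sinD; ring.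
Qed.
Lemma cabs_cexp w : cabs (cexp w) = expR (re w).
Proof.
rewrite cabsE /= !exprMn -mulrDr cos2Dsin2 mulr1 sqrtr_sqr ger0_norm ?expR_ge0 //.
Qed.
Lemma cpowE (t : R) w : cpow t w = cexp (w * ((ln t)%:C)%C).
Proof. by case: w => a b; rewrite /cpow /cexp /= !mulr0 subr0 add0r. Qed.

(** Componentwise, so that the real chain rule and the real mean value theorem apply. *)
Definition cder (f f' : R -> C) (t : R) :=
  is_derive t 1 (fun s => re (f s)) (re (f' t)) /\
  is_derive t 1 (fun s => im (f s)) (im (f' t)).

Lemma cder_eq (f f' g g' : R -> C) t :
  f =1 g -> f' t = g' t -> cder f f' t -> cder g g' t.
Proof. by move=> /funext -> ff [h1 h2]; split; rewrite -ff. Qed.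

Lemma cderD (f f' g g' : R -> C) t : cder f f' t -> cder g g' t ->
  cder (fun s => f s + g s) (fun s => f' s + g' s) t.
Proof.
move=> [h1 h2] [h3 h4]; split; rewrite ?reD ?imD.
  have -> : (fun s => re (f s + g s)) = (fun s => re (f s)) \+ (fun s => re (g s)).
    by apply/funext => s; rewrite reD.
  exact: is_deriveD.
have -> : (fun s => im (f s + g s)) = (fun s => im (f s)) \+ (fun s => im (g s)).
  by apply/funext => s; rewrite imD.
exact: is_deriveD.
Qed.

Lemma cderM (f f' g g' : R -> C) t : cder f f' t -> cder g g' t ->
  cder (fun s => f s * g s) (fun s => f' s * g s + f s * g' s) t.
Proof.
move=> [h1 h2] [h3 h4]; split.
  have -> : (fun s => re (f s * g s)) = (fun s => re (f s)) * (fun s => re (g s))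
     - (fun s => im (f s)) * (fun s => im (g s)).
    by apply/funext => s; rewrite reM.
  have := is_deriveB (is_deriveM h1 h3) (is_deriveM h2 h4).
  by move=> h; apply: (is_derive_eq h); rewrite reD !reM /GRing.scale /=; ring.
have -> : (fun s => im (f s * g s)) = (fun s => re (f s)) * (fun s => im (g s))
     + (fun s => im (f s)) * (fun s => re (g s)).
  by apply/funext => s; rewrite imM.
have := is_deriveD (is_deriveM h1 h4) (is_deriveM h2 h3).
by move=> h; apply: (is_derive_eq h); rewrite imD !imM /GRing.scale /=; ring.
Qed.

Lemma cder_cst (c : C) t : cder (fun=> c) (fun=> 0) t.
Proof. by split; exact: is_derive_cst. Qed.

Lemma cder_real (f f' : R -> R) (t : R) : is_derive t 1 f (f' t) ->
  cder (fun s => ((f s)%:C)%C) (fun s => ((f' s)%:C)%C) t.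
Proof. by move=> h; split => //=; exact: is_derive_cst. Qed.

Lemma cderN (f f' : R -> C) t : cder f f' t -> cder (fun s => - f s) (fun s => - f' s) t.
Proof.
move=> h; have := cderM (cder_cst (-1) t) h; apply: cder_eq => [s|].
  by rewrite mulN1r.
by rewrite mul0r add0r mulN1r.
Qed.

Lemma cder_exp (f f' : R -> C) t : cder f f' t ->
  cder (fun s => cexp (f s)) (fun s => f' s * cexp (f s)) t.
Proof.
move=> [h1 h2].
have e1 : is_derive t 1 (fun s => expR (re (f s))) (re (f' t) * expR (re (f t))).
  by have h := is_derive1_comp (is_derive_expR (re (f t))) h1; rewrite mulrC.
have e2 : is_derive t 1 (fun s => cos (im (f s))) (- im (f' t) * sin (im (f t))).
  have h := is_derive1_comp (is_derive_cos (im (f t))) h2.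
  by rewrite mulNr mulrC -mulNr.
have e3 : is_derive t 1 (fun s => sin (im (f s))) (im (f' t) * cos (im (f t))).
  by have h := is_derive1_comp (is_derive_sin (im (f t))) h2; rewrite mulrC.
split.
  have := is_deriveM e1 e2.
  by move=> h; apply: (is_derive_eq h); rewrite reM /= /GRing.scale /=; ring.
have := is_deriveM e1 e3.
by move=> h; apply: (is_derive_eq h); rewrite imM /= /GRing.scale /=; ring.
Qed.

(** The real mean value theorem is applied to the real part of [u * f], where [u] is the unit scalar
    that rotates [f b - f a] onto the positive axis. *)
Lemma cMVT (f f' : R -> C) (a b M : R) : a <= b ->
  (forall t, a <= t <= b -> cder f f' t) ->
  (forall t, a <= t <= b -> cabs (f' t) <= M) ->
  cabs (f b - f a) <= M * (b - a).
Proof.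
rewrite le_eqVlt => /predU1P[->|ab] df bf; first by rewrite !subrr cabs0 mulr0.
set z := f b - f a; have [->|z0] := eqVneq z 0.
  rewrite cabs0 mulr_ge0 ?subr_ge0 ?(ltW ab) //.
  by apply: le_trans (cabs_ge0 _) (bf a _); rewrite lexx ltW.
have zp := cabs_gt0 z0.
pose u : C := z^* / ((cabs z)%:C)%C.
have du t : a <= t <= b ->
    is_derive t 1 (fun s => re (u * f s)) (re (u * f' t)).
  move=> tab; have [] := cderM (cder_cst u t) (df t tab).
  by rewrite /= mul0r add0r.
have ct : {within `[a, b], continuous (fun s => re (u * f s))}.
  apply: derivable_within_continuous => t; rewrite in_itv /= => tab.
  by have [] := du t tab.
have du' t : t \in `]a, b[%R -> is_derive t 1 (fun s => re (u * f s)) (re (u * f' t)).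
  by rewrite in_itv /= => /andP[h1 h2]; apply: du; rewrite !ltW.
have [c cab] := MVT ab du' ct.
rewrite -reB -mulrBr -/z.
have -> : re (u * z) = cabs z.
  rewrite /u mulrAC (mulrC _ z) mul_conj expr2 RCM mulfK //.
  by rewrite eq_complex /= eqxx andbT gt_eqF.
move=> ->; apply: ler_wpM2r; first by rewrite subr_ge0 ltW.
apply: le_trans (ler_norm _) _; apply: le_trans (re_le_cabs _) _.
rewrite cabsM /u cabsM cabs_conj cabsV cabs_real ger0_norm ?cabs_ge0 //.
rewrite divff ?gt_eqF // mul1r; apply: bf.
by move: cab; rewrite in_itv /= => /andP[h1 h2]; rewrite !ltW.
Qed.

Lemma cexp_bound1 w : cabs (cexp w - 1) <= cabs w * expR (cabs w).
Proof.
pose f (t : R) := cexp ((t%:C)%C * w).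
have -> : cexp w - 1 = f 1 - f 0 by rewrite /f !mul0r mul1r cexp0.
have := @cMVT f (fun t => w * f t) 0 1 (cabs w * expR (cabs w)) ler01.
rewrite subr0 mulr1; apply => t /andP[t0 t1].
  apply: cder_exp; have := cderM (cder_real (@is_derive_id _ _ t 1)) (cder_cst w t).
  by apply: cder_eq => //; rewrite mulr0 addr0 mul1r.
rewrite cabsM ler_wpM2l ?cabs_ge0 // cabs_cexp ler_expR.
apply: le_trans (ler_norm _) _; apply: le_trans (re_le_cabs _) _.
by rewrite cabsM cabs_real ger0_norm // ler_piMl // cabs_ge0.
Qed.

(** The mean value inequality along the segment from 0 to [w]; the derivative [w * (exp(t w) - 1)]
    is controlled by the first-order bound. *)
Lemma cexp_bound2 w : cabs (cexp w - 1 - w) <= cabs w ^+ 2 * expR (cabs w).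
Proof.
pose f (t : R) := cexp ((t%:C)%C * w) - (t%:C)%C * w.
have -> : cexp w - 1 - w = f 1 - f 0.
  by rewrite /f !mul0r mul1r cexp0 subr0 addrAC.
have := @cMVT f (fun t => w * (cexp ((t%:C)%C * w) - 1)) 0 1
  (cabs w ^+ 2 * expR (cabs w)) ler01.
rewrite subr0 mulr1; apply => t /andP[t0 t1].
  have h : cder (fun t : R => (t%:C)%C * w) (fun=> w) t.
    have := cderM (cder_real (@is_derive_id _ _ t 1)) (cder_cst w t).
    by apply: cder_eq => //; rewrite mulr0 addr0 mul1r.
  have := cderD (cder_exp h) (cderN h); apply: cder_eq => //.
  by rewrite mulrBr mulr1.
rewrite cabsM expr2 -mulrA ler_wpM2l ?cabs_ge0 //.
apply: le_trans (cexp_bound1 _) _.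
have tw : cabs ((t%:C)%C * w) <= cabs w.
  by rewrite cabsM cabs_real ger0_norm // ler_piMl // cabs_ge0.
by rewrite ler_pM ?cabs_ge0 ?expR_ge0 // ler_expR.
Qed.

End Scalars.

(** * Absolutely convergent series and complex differentiability *)

Section ComplexSeries.
Context {R : realType}.
Notation C := R[i].
Implicit Types (u v : nat -> C) (l z w : C).

Definition ccvg v l := forall e : R, 0 < e ->
  exists N, forall n, (N <= n)%N -> cabs (v n - l) < e.

Definition psum u N : C := \sum_(k < N) u k.

(** A divergent series gets the value 0; otherwise uniqueness of limits makes the chosen value the
    sum. *)
Definition csum u : C := xget 0 [set l | ccvg (psum u) l].

Definition csummable u := exists M : R, forall N, \sum_(k < N) cabs (u k) <= M.

Lemma ccvg_unique v l l' : ccvg v l -> ccvg v l' -> l = l'.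
Proof.
move=> h h'; apply/eqP; apply: contraT => ll.
have e0 : 0 < cabs (l - l') / 2 by rewrite divr_gt0 // cabs_gt0 // subr_eq0.
have [N hN] := h _ e0; have [N' hN'] := h' _ e0.
have a1 := hN (maxn N N') (leq_maxl _ _); have a2 := hN' (maxn N N') (leq_maxr _ _).
rewrite cabsC in a1.
have := cabsD (l - v (maxn N N')) (v (maxn N N') - l').
by rewrite addrA subrK; lra.
Qed.

Lemma csumE u l : ccvg (psum u) l -> csum u = l.
Proof.
by move=> h; apply: (@ccvg_unique (psum u)) => //; rewrite /csum; case: xgetP => [y -> //|/(_ l)].
Qed.

Lemma ccvgD v v' l l' : ccvg v l -> ccvg v' l' -> ccvg (fun n => v n + v' n) (l + l').
Proof.
move=> h h' e e0; have e2 : 0 < e / 2 by lra.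
have [N hN] := h _ e2; have [N' hN'] := h' _ e2.
exists (maxn N N') => n; rewrite geq_max => /andP[/hN a1 /hN' a2].
have := cabsD (v n - l) (v' n - l').
by rewrite opprD addrACA; lra.
Qed.

Lemma ccvgZ c v l : ccvg v l -> ccvg (fun n => c * v n) (c * l).
Proof.
move=> h e e0; have cp : 0 < cabs c + 1 by have := cabs_ge0 c; lra.
have [N hN] := h (e / (cabs c + 1)) (divr_gt0 e0 cp).
exists N => n /hN; rewrite -mulrBr cabsM => a.
apply: (@le_lt_trans _ _ ((cabs c + 1) * cabs (v n - l))).
  by rewrite ler_wpM2r ?cabs_ge0 // lerDl.
by rewrite mulrC -ltr_pdivlMr.
Qed.

Lemma ccvg_cst l : ccvg (fun=> l) l.
Proof. by move=> e e0; exists 0%N => n _; rewrite subrr cabs0. Qed.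

Lemma ccvg_le v l M : (forall n, cabs (v n) <= M) -> ccvg v l -> cabs l <= M.
Proof.
move=> h cl; apply/ler_addgt0Pr => e e0; have [N /(_ N (leqnn _)) hN] := cl _ e0.
have := cabsD (l - v N) (v N); rewrite subrK cabsC; have := h N; lra.
Qed.

Lemma eq_ccvg v v' l : v =1 v' -> ccvg v l -> ccvg v' l.
Proof. by move=> /funext ->. Qed.

Lemma ccvg_dom K v : (forall n, cabs (v n) <= K / n.+1%:R) -> ccvg v 0.
Proof.
move=> h e e0; have K0 : 0 <= K.
  by have := le_trans (cabs_ge0 _) (h 0%N); rewrite divr1.
exists (Num.trunc (K / e)) => n Nn; rewrite subr0; apply: le_lt_trans (h n) _.
rewrite ltr_pdivrMr // mulrC -ltr_pdivrMr //.
apply: lt_le_trans (truncnS_gt _) _.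
by rewrite ler_nat.
Qed.

Lemma nbhsC (P : set C) z :
  (exists2 d : R, 0 < d & forall w, cabs (w - z) < d -> P w) -> \forall w \near (z : C^o), P w.
Proof.
case=> d d0 h; apply/nbhs_ballP; exists (d%:C)%C; first by rewrite /= ltcR.
move=> w; rewrite -ball_normE => hw; apply: h; rewrite cabsC -ltcR; exact: hw.
Qed.

Lemma nbhsC_ex (P : set C) z : (\forall w \near (z : C^o), P w) ->
  exists2 d : R, 0 < d & forall w, cabs (w - z) < d -> P w.
Proof.
move/nbhs_ballP => [[a b] /= ab h]; move: ab; rewrite ltcE /= => /andP[/eqP b0 a0].
exists a => // w wz; apply: h; rewrite -ball_normE.
have : (cabs (z - w))%:C%C < (a%:C)%C by rewrite ltcR cabsC.
by rewrite b0.
Qed.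

Lemma dnbhsC (P : set C) z :
  (exists2 d : R, 0 < d & forall w, w != z -> cabs (w - z) < d -> P w) ->
  \forall w \near (z : C^o)^', P w.
Proof.
by case=> d d0 h; apply: nbhsC; exists d => // w h1 h2; apply: h.
Qed.

Lemma ccvgP v l : ccvg v l -> (v n : C^o) @[n --> \oo] --> (l : C^o).
Proof.
move=> h; apply/cvgrPdist_lt => -[a b]; rewrite ltcE /= => /andP[/eqP -> a0].
have [N hN] := h _ a0; exists N => // n /= /hN; rewrite cabsC => hn.
by have : (cabs (l - v n))%:C%C < (a%:C)%C by rewrite ltcR.
Qed.

Lemma csummable_ex u : csummable u -> exists l, ccvg (psum u) l.
Proof.
case=> M hM.
have cv (f : nat -> R) : (forall k, `|f k| <= cabs (u k)) -> cvgn (series f).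
  move=> hf; apply: normed_cvg; apply: nondecreasing_is_cvgn.
    by apply/nondecreasing_series => n _ _; exact: normr_ge0.
  exists M => _ [N _ <-].
  have -> : [normed series f] N = \sum_(k < N) `|f k| by rewrite /normed_series_of seriesEord.
  by apply: le_trans (hM N); apply: ler_sum => k _; exact: hf.
have /cvg_ex[a ha] := cv _ (fun k => re_le_cabs (u k)).
have /cvg_ex[b hb] := cv _ (fun k => im_le_cabs (u k)).
exists (Complex a b) => e e0; have e2 : 0 < e / 2 by lra.
move/cvgrPdist_lt: ha => /(_ _ e2) [N1 _ h1].
move/cvgrPdist_lt: hb => /(_ _ e2) [N2 _ h2].
exists (maxn N1 N2) => n; rewrite geq_max => /andP[/h1 a1 /h2 a2].
move: a1 a2; rewrite /series /= !big_mkord => a1 a2.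
apply: le_lt_trans (cabs_le_reim _) _; rewrite /psum reB imB re_sum im_sum /=.
by rewrite -normrN opprB in a1; rewrite -normrN opprB in a2; lra.
Qed.

Lemma csum_cvg u : csummable u -> ccvg (psum u) (csum u).
Proof. by move=> /csummable_ex [l h]; rewrite (csumE h). Qed.

Lemma csum_le u M : (forall N, \sum_(k < N) cabs (u k) <= M) -> cabs (csum u) <= M.
Proof.
move=> h; apply: (@ccvg_le (psum u)); last by apply: csum_cvg; exists M.
by move=> N; apply: le_trans (cabs_sum _ _ _) (h N).
Qed.

Lemma psumD u v N : psum (fun k => u k + v k) N = psum u N + psum v N.
Proof. exact: big_split. Qed.
Lemma psumZ c u N : psum (fun k => c * u k) N = c * psum u N.
Proof. by rewrite /psum mulr_sumr. Qed.

Lemma csummable_dom K u v : csummable v ->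
  (forall k, cabs (u k) <= K * cabs (v k)) -> csummable u.
Proof.
move=> [M hM] h; exists (`|K| * M) => N.
apply: le_trans (ler_wpM2l (normr_ge0 K) (hM N)).
rewrite mulr_sumr; apply: ler_sum => k _; apply: le_trans (h k) _.
by rewrite ler_wpM2r ?cabs_ge0 // ler_norm.
Qed.

Lemma csummableD u v : csummable u -> csummable v -> csummable (fun k => u k + v k).
Proof.
move=> [M hM] [M' hM']; exists (M + M') => N.
apply: le_trans (lerD (hM N) (hM' N)); rewrite -big_split /=.
by apply: ler_sum => k _; exact: cabsD.
Qed.

Lemma csummableZ c u : csummable u -> csummable (fun k => c * u k).
Proof. by move=> h; apply: (csummable_dom (K := cabs c) h) => k; rewrite cabsM. Qed.

Lemma csummableN u : csummable u -> csummable (fun k => - u k).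
Proof.
move=> h; apply: (csummable_dom (K := 1) h) => k.
by rewrite cabsN mul1r.
Qed.

Lemma csumD u v : csummable u -> csummable v ->
  csum (fun k => u k + v k) = csum u + csum v.
Proof.
move=> hu hv; apply: csumE; apply: (@eq_ccvg (fun N => psum u N + psum v N)).
  by move=> N; rewrite psumD.
by apply: ccvgD; exact: csum_cvg.
Qed.

Lemma csumZ c u : csummable u -> csum (fun k => c * u k) = c * csum u.
Proof.
move=> hu; apply: csumE; apply: (@eq_ccvg (fun N => c * psum u N)).
  by move=> N; rewrite psumZ.
by apply: ccvgZ; exact: csum_cvg.
Qed.

Lemma csumN u : csummable u -> csum (fun k => - u k) = - csum u.
Proof.
move=> hu; rewrite -mulN1r -csumZ //; congr csum.
by apply/funext => k; rewrite mulN1r.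
Qed.

Lemma csum_tele v : ccvg v 0 -> ccvg (psum (fun k => v k.+1 - v k)) (- v 0%N).
Proof.
move=> h; apply: (@eq_ccvg (fun N => v N + - v 0%N)).
  move=> N; rewrite /psum -(big_mkord xpredT (fun k => v k.+1 - v k)).
  by rewrite telescope_sumr.
by rewrite -{2}[- _]add0r; apply: ccvgD => //; exact: ccvg_cst.
Qed.

(** The induction needs the sharper bound [2 - 1/N]. The number 2 returns as the constant of every
    [O(1/n^2)] series below. *)
Lemma sum_invsq N : \sum_(k < N) (k.+1%:R ^+ 2)^-1 <= 2 :> R.
Proof.
case: N => [|N]; first by rewrite big_ord0.
suff : \sum_(k < N.+1) (k.+1%:R ^+ 2)^-1 <= 2 - N.+1%:R^-1 :> R.
  by move/le_trans; apply; rewrite gerBl invr_ge0.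
elim: N => [|N IH]; first by rewrite big_ord1 expr1n invr1; lra.
rewrite big_ord_recr /=; apply: le_trans (lerD IH (lexx _)) _.
have a : 0 < N.+1%:R :> R by [].
have -> : N.+2%:R = N.+1%:R + 1 :> R by rewrite natr1.
move: (N.+1%:R : R) a => x a.
rewrite -subr_ge0.
have -> : 2 - (x + 1)^-1 - (2 - x^-1 + ((x + 1) ^+ 2)^-1) = (x * (x + 1) ^+ 2)^-1.
  by field; rewrite !gt_eqF //; lra.
by rewrite invr_ge0 mulr_ge0 ?sqr_ge0 // ltW.
Qed.

(** Differentiability with a quadratic remainder. Every holomorphic function satisfies it, and
    unlike a bare limit it survives the summation of a series as soon as the remainder constants are
    summable. *)
Definition jet (f : C -> C) z := exists (f1 : C) (M d : R), 0 < d /\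
  forall h, cabs h < d -> cabs (f (z + h) - f z - h * f1) <= M * cabs h ^+ 2.

Lemma jet_derivable (f : C -> C) z : jet f z -> derivable (f : C^o -> C^o) z 1.
Proof.
move=> [f1 [M [d [d0 h]]]]; apply/cvg_ex; exists (f1 : C^o).
apply/cvgrPdist_lt => -[e b]; rewrite ltcE /= => /andP[/eqP -> e0].
have M0 : 0 < `|M| + 1 by rewrite ltr_wpDl.
apply: dnbhsC; exists (Num.min d (e / (`|M| + 1))).
  by rewrite lt_min d0 divr_gt0.
move=> w w0; rewrite subr0 lt_min => /andP[wd we].
have wp := cabs_gt0 w0.
have : cabs (w^-1 * (f (z + w) - f z) - f1) < e.
  have -> : w^-1 * (f (z + w) - f z) - f1 = w^-1 * (f (z + w) - f z - w * f1).
    by rewrite [RHS]mulrBr mulKf.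
  rewrite cabsM cabsV mulrC ltr_pdivrMr //; apply: le_lt_trans (h w wd) _.
  rewrite expr2 mulrA ltr_pM2r //.
  move: we; rewrite ltr_pdivlMr // mulrC => /le_lt_trans; apply.
  apply: ler_wpM2r; first exact: ltW.
  by apply: le_trans (ler_norm _) _; rewrite lerDl.
rewrite cabsC -ltcR => hw; rewrite /=.
by rewrite /GRing.scale /= mulr1 [w + z]addrC.
Qed.

Lemma jet_holo (f : C -> C) z :
  (exists2 d : R, 0 < d & forall w, cabs (w - z) < d -> jet f w) -> holomorphic_at f z.
Proof.
by case=> d d0 h; apply: nbhsC; exists d => // w /h; exact: jet_derivable.
Qed.

Lemma jet_ext (f g : C -> C) z d : 0 < d ->
  (forall w, cabs (w - z) < d -> f w = g w) -> jet f z -> jet g z.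
Proof.
move=> d0 fg [f1 [M [d' [d0' h]]]]; exists f1, M, (Num.min d d').
rewrite lt_min d0 d0'; split => // w; rewrite lt_min => /andP[wd wd'].
rewrite -!fg ?subrr ?cabs0 //; first exact: h.
by rewrite addrAC subrr add0r.
Qed.

Lemma jet_cst c z : jet (fun=> c) z.
Proof.
by exists 0, 0, 1; split => // h _; rewrite mulr0 subr0 subrr cabs0 mul0r.
Qed.

Lemma jet_id z : jet id z.
Proof.
by exists 1, 0, 1; split => // h _; rewrite /= mulr1 [z + h]addrC addrK subrr cabs0 mul0r.
Qed.

Lemma jetD f g z : jet f z -> jet g z -> jet (fun w => f w + g w) z.
Proof.
move=> [f1 [M [d [d0 h]]]] [g1 [M' [d' [d0' h']]]].
exists (f1 + g1), (M + M'), (Num.min d d'); rewrite lt_min d0 d0'; split => // w.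
rewrite lt_min => /andP[/h hw /h' hw']; rewrite mulrDl.
apply: le_trans (lerD hw hw'); apply: le_trans (cabsD _ _).
rewrite le_eqVlt; apply/orP; left; apply/eqP; congr ComplexField.Normc.normc.
by ring.
Qed.

Lemma jetM f g z : jet f z -> jet g z -> jet (fun w => f w * g w) z.
Proof.
move=> [f1 [M [d [d0 h]]]] [g1 [M' [d' [d0' h']]]].
pose K := cabs f1 + `|M|; pose K' := cabs g1 + `|M'|.
exists (f1 * g z + f z * g1), (`|M| * cabs (g z) + cabs (f z) * `|M'| + K * K').
exists (Num.min 1 (Num.min d d')); rewrite !lt_min ltr01 d0 d0'; split => // w.
rewrite !lt_min => /and3P[w1 wd wd'].
have hw : cabs (f (z + w) - f z - w * f1) <= `|M| * cabs w ^+ 2.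
  by apply: le_trans (h _ wd) _; rewrite ler_wpM2r ?sqr_ge0 // ler_norm.
have hw' : cabs (g (z + w) - g z - w * g1) <= `|M'| * cabs w ^+ 2.
  by apply: le_trans (h' _ wd') _; rewrite ler_wpM2r ?sqr_ge0 // ler_norm.
have aux (N : R) (q q1 : C) : 0 <= N -> cabs (q - w * q1) <= N * cabs w ^+ 2 ->
    cabs q <= (cabs q1 + N) * cabs w.
  move=> N0 hq; have := cabsD (q - w * q1) (w * q1); rewrite subrK cabsM mulrDl.
  move=> /le_trans; apply; rewrite addrC mulrC lerD2l; apply: le_trans hq _.
  by rewrite ler_wpM2l // expr2 ler_piMl ?cabs_ge0 // ltW.
have a1 := aux _ _ _ (normr_ge0 M) hw; have a2 := aux _ _ _ (normr_ge0 M') hw'.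
have -> : f (z + w) * g (z + w) - f z * g z - w * (f1 * g z + f z * g1) =
   (f (z + w) - f z - w * f1) * g z + f z * (g (z + w) - g z - w * g1)
   + (f (z + w) - f z) * (g (z + w) - g z) by ring.
apply: le_trans (cabsD _ _) _; rewrite [in leRHS]mulrDl; apply: lerD.
  apply: le_trans (cabsD _ _) _; rewrite !cabsM mulrDl; apply: lerD.
    by rewrite mulrAC ler_wpM2r ?cabs_ge0.
  by rewrite -mulrA ler_wpM2l ?cabs_ge0.
rewrite cabsM expr2 mulrACA; apply: ler_pM; rewrite ?cabs_ge0 //.
Qed.

Lemma jet_sum I (r : seq I) (F : I -> C -> C) z : (forall i, jet (F i) z) ->
  jet (fun w => \sum_(i <- r) F i w) z.
Proof.
move=> h; elim: r => [|i r IH].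
  by apply: (@jet_ext (fun=> 0) _ _ 1) => // [w _|]; [rewrite big_nil|exact: jet_cst].
apply: (@jet_ext (fun w => F i w + \sum_(i <- r) F i w) _ _ 1) => //.
  by move=> w _; rewrite big_cons.
by apply: jetD.
Qed.

Lemma jet_affine f a b z : jet f (a * z + b) -> jet (fun w => f (a * w + b)) z.
Proof.
move=> [f1 [M [d [d0 h]]]]; have a0 : 0 < cabs a + 1 by rewrite ltr_wpDl ?cabs_ge0.
exists (a * f1), (M * cabs a ^+ 2), (d / (cabs a + 1)); split; first exact: divr_gt0.
move=> w; rewrite ltr_pdivlMr // => wd.
have := h (a * w); rewrite cabsM.
have -> : a * z + b + a * w = a * (z + w) + b by ring.
rewrite [w * (a * f1)]mulrA [w * a]mulrC exprMn mulrA; apply.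
by apply: le_lt_trans wd; rewrite mulrC ler_wpM2l ?cabs_ge0 // lerDl.
Qed.

Lemma jet_inv a z : z != a -> jet (fun w => (w - a)^-1) z.
Proof.
move=> za; have t0 : z - a != 0 by rewrite subr_eq0.
have p := cabs_gt0 t0; set t := z - a in t0 p *.
exists (- (t ^+ 2)^-1), (2 / cabs t ^+ 3), (cabs t / 2); split; first exact: divr_gt0.
move=> h hd; have -> : z + h - a = t + h by rewrite /t; ring.
have q : cabs t / 2 <= cabs (t + h).
  by have := cabsB (t + h) h; rewrite addrK; lra.
have qp : 0 < cabs (t + h) by apply: lt_le_trans q; exact: divr_gt0.
have q0 : t + h != 0 by apply: contraTneq qp => ->; rewrite cabs0 ltxx.
have -> : (t + h)^-1 - t^-1 - h * - (t ^+ 2)^-1 = h ^+ 2 / (t ^+ 2 * (t + h)).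
  by field; apply/andP; split.
rewrite cabsM cabsX mulrC ler_wpM2r ?sqr_ge0 // cabsV cabsM cabsX invfM.
have -> : 2 / cabs t ^+ 3 = (cabs t ^+ 2)^-1 * (cabs t / 2)^-1.
  by rewrite invf_div; field; rewrite gt_eqF.
rewrite ler_wpM2l ?invr_ge0 ?sqr_ge0 // lef_pV2 ?posrE //.
exact: divr_gt0.
Qed.

(** Termwise differentiation: the remainders of the terms add up to a remainder of the sum, because
    the partial sums of [B] are bounded. Summability of the derivatives [u1] is deduced on the
    way. *)
Lemma jet_series (u : nat -> C -> C) (u1 : nat -> C) (B : nat -> R) z (d M : R) :
  0 < d -> (forall N, \sum_(k < N) B k <= M) ->
  (forall h, cabs h < d -> csummable (fun n => u n (z + h))) ->
  (forall n h, cabs h < d -> cabs (u n (z + h) - u n z - h * u1 n) <= B n * cabs h ^+ 2) ->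
  jet (fun w => csum (fun n => u n w)) z.
Proof.
move=> d0 hM su hB.
have B0 n : 0 <= B n.
  have := hB n (Complex (d / 2) 0); rewrite cabs_real ger0_norm; last lra.
  have p : 0 < (d / 2) ^+ 2 by rewrite exprn_gt0 // divr_gt0.
  move=> /(_ _) hb; have : 0 <= B n * (d / 2) ^+ 2.
    by apply: le_trans (cabs_ge0 _) (hb _); lra.
  by rewrite pmulr_lge0.
have z0 : csummable (fun n => u n z).
  by have := su 0; rewrite cabs0 addr0; apply.
have srem h : cabs h < d -> csummable (fun n => u n (z + h) - u n z - h * u1 n).
  move=> hd; exists (M * cabs h ^+ 2) => N; apply: le_trans (ler_wpM2r _ (hM N)).
    by rewrite mulr_suml; apply: ler_sum => k _; exact: hB.
  exact: sqr_ge0.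
(* At the fixed increment [d / 2], [u1] is a combination of three summable sequences divided by that
   increment. *)
have s1 : csummable u1.
  pose h : C := ((d / 2)%:C)%C.
  have hd : cabs h < d by rewrite cabs_real ger0_norm; lra.
  have h0 : h != 0 by rewrite eq_complex /= eqxx andbT; lra.
  have := csummableZ h^-1 (csummableD (csummableD (su h hd) (csummableZ (-1) z0))
    (csummableZ (-1) (srem h hd))).
  move=> [K hK]; exists K => N; apply: le_trans (hK N).
  apply: ler_sum => k _; rewrite le_eqVlt; apply/orP; left; apply/eqP.
  by congr ComplexField.Normc.normc; apply: (mulfI h0); rewrite mulVKf //; ring.
exists (csum u1), M, d; split => // h hd.
have -> : csum (fun n => u n (z + h)) - csum (fun n => u n z) - h * csum u1 =
   csum (fun n => u n (z + h) - u n z - h * u1 n).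
  rewrite -csumZ // -!csumN //; last exact: csummableZ.
  by rewrite -!csumD //; do ?[exact: su|apply: csummableD|apply: csummableN|exact: csummableZ].
apply: csum_le => N; apply: le_trans (ler_wpM2r _ (hM N)).
  by rewrite mulr_suml; apply: ler_sum => k _; exact: hB.
exact: sqr_ge0.
Qed.

End ComplexSeries.

(** * Bernoulli polynomials *)

Section BernoulliPolynomials.
Context {R : realType}.

(** The primitive vanishing at 0: the multiplicity [(i != 0%N)] removes the constant coefficient,
    where [i.-1] would wrongly repeat the index 0. *)
Definition polyint (p : {poly R}) : {poly R} :=
  \poly_(i < (size p).+1) (p`_i.-1 *+ (i != 0%N) / i%:R).

Lemma deriv_polyint p : (polyint p)^`() = p.
Proof.
apply/polyP => i; rewrite coef_deriv coef_poly /=.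
case: ltnP => ip; last by rewrite mul0rn nth_default.
by rewrite mulr1n -[_ *+ i.+1]mulr_natr divfK // pnatr_eq0.
Qed.

Lemma polyint0 p : (polyint p).[0] = 0.
Proof. by rewrite horner_coef0 coef_poly /= mulr0n mul0r. Qed.

(* b_j = B_j / j! for the Bernoulli polynomials B_j *)
Fixpoint bpoly (j : nat) : {poly R} :=
  if j is j'.+1 then
    polyint (bpoly j') - (polyint (polyint (bpoly j'))).[1]%:P
  else 1.

Lemma deriv_bpoly j : (bpoly j.+1)^`() = bpoly j.
Proof. by rewrite /= derivB derivC subr0 deriv_polyint. Qed.

(** The constant in [bpoly j.+1] makes its integral over [[0, 1]] vanish, and this integral is the
    difference of the end values of [bpoly j.+2]. *)
Lemma bpoly_period j : (bpoly j.+2).[1] = (bpoly j.+2).[0].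
Proof.
rewrite -[bpoly j.+2]/(polyint (bpoly j.+1) - _%:P) !hornerD !hornerN !hornerC.
congr (_ - _); rewrite polyint0.
set q := bpoly j; set c := (polyint (polyint q)).[1].
suff -> : polyint (bpoly j.+1) = polyint (polyint q) - c *: 'X.
  by rewrite hornerD hornerN hornerZ hornerX mulr1 subrr.
have inj (p1 p2 : {poly R}) : p1^`() = p2^`() -> p1.[0] = p2.[0] -> p1 = p2.
  move=> d h; apply/polyP => -[|i]; first by rewrite -!horner_coef0.
  have := congr1 (fun p : {poly R} => p`_i) d; rewrite /= !coef_deriv => e.
  have i0 : i.+1%:R != 0 :> R by rewrite pnatr_eq0.
  by apply: (mulIf i0); rewrite !mulr_natr.
apply: inj; rewrite ?deriv_polyint.
  by rewrite derivB derivZ derivX deriv_polyint alg_polyC.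
by rewrite polyint0 hornerD hornerN hornerZ hornerX polyint0 mulr0 subr0.
Qed.

(** The exceptional index: this jump produces the summand itself in the Euler-Maclaurin formula. *)
Lemma bpoly1 : (bpoly 1).[1] - (bpoly 1).[0] = 1.
Proof.
rewrite -[bpoly 1]/(polyint 1 - _%:P) !hornerD !hornerN !hornerC polyint0.
set c := (polyint (polyint 1)).[1].
have -> : polyint 1 = 'X.
  apply/polyP => i; rewrite coef_poly size_poly1 coefX.
  by case: i => [|[|i]] //=; rewrite ?mul0r ?coef1 ?mulr1n ?divr1.
by rewrite hornerX; ring.
Qed.

Lemma horner_bound (p : {poly R}) : exists M, forall y, 0 <= y <= 1 -> `|p.[y]| <= M.
Proof.
exists (\sum_(i < size p) `|p`_i|) => y /andP[y0 y1].
rewrite horner_coef; apply: le_trans (ler_norm_sum _ _ _) _.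
apply: ler_sum => i _; rewrite normrM ler_piMr // normrX ger0_norm //.
exact: exprn_ile1.
Qed.

End BernoulliPolynomials.

(** * The Euler-Maclaurin formula on one unit interval *)

Section EulerMaclaurin.
Context {R : realType}.
Notation C := R[i].
Implicit Types (phi : nat -> R -> C) (Phi : R -> C).

(** The derivatives and a primitive are explicit data: for powers of [x] they are known in closed
    form, and towers can then be combined linearly. *)
Definition tower phi Phi := forall x : R, 0 < x ->
  cder Phi (phi 0%N) x /\ forall j, cder (phi j) (phi j.+1) x.

Definition em_coef j : C := ((bpoly j.+1).[1]%:C)%C.

Definition em_boundary J phi (x : R) : C :=
  \sum_(j < J) (-1) ^+ j * em_coef j * phi j x.

(* the local error of the Euler-Maclaurin formula with J correction terms *)
Definition em_error J phi Phi (a : R) : C :=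
  phi 0%N a + (em_boundary J phi (a + 1) - Phi (a + 1) - (em_boundary J phi a - Phi a)).

(** The derivative of [F] telescopes to its last term by [deriv_bpoly], so the mean value inequality
    bounds the error [F 1 - F 0]. [K] depends only on [J]; this uniformity lets the bound be applied
    to differences of towers with different parameters. *)
Lemma em_error_bound J : exists K : R, 0 <= K /\ forall phi Phi, tower phi Phi ->
  forall (a M : R), 1 <= a -> (forall x, a <= x <= a + 1 -> cabs (phi J.+1 x) <= M) ->
  cabs (em_error J.+1 phi Phi a) <= K * M.
Proof.
have [K hK] := horner_bound (@bpoly R J.+1).
have K0 : 0 <= K by apply: le_trans (hK 0 _); rewrite ?lexx ?ler01.
exists K; split=> // phi Phi tw a M a1 hM.
pose b j (y : R) : C := ((bpoly j).[y]%:C)%C.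
pose S n (y : R) : C := \sum_(j < n) (-1) ^+ j * (b j.+1 y * phi j (a + y)).
pose F y := S J.+1 y - Phi (a + y).
have dsh (f g : R -> C) (y : R) : cder f g (a + y) ->
    cder (fun y => f (a + y)) (fun y => g (a + y)) y.
  move=> [h1 h2]; have id1 : is_derive y 1 (fun y : R => a + y) 1.
    have := is_deriveD (is_derive_cst a y 1) (is_derive_id y 1).
    by rewrite add0r.
  split; first by have := is_derive1_comp h1 id1; rewrite mulr1.
  by have := is_derive1_comp h2 id1; rewrite mulr1.
have db j (y : R) : cder (b j.+1) (b j) y.
  have h := is_derive_poly (bpoly j.+1) y; rewrite deriv_bpoly in h.
  exact: (@cder_real _ (horner (bpoly j.+1)) (horner (bpoly j)) y h).
have dS n y : 0 <= y -> cder (S n)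
    (fun y => phi 0%N (a + y) - (-1) ^+ n * (b n y * phi n (a + y))) y.
  move=> y0; have ay : 0 < a + y by lra.
  have [tw0 twj] := tw _ ay.
  elim: n => [|n IH].
    apply: (@cder_eq _ (fun=> 0) (fun=> 0)); last exact: cder_cst.
      by move=> s; rewrite /S big_ord0.
    by rewrite expr0 mul1r /b /= hornerC mul1r subrr.
  have := cderD IH (cderM (cder_cst ((-1) ^+ n) y) (cderM (db n y) (dsh _ _ _ (twj n)))).
  apply: cder_eq; first by move=> s; rewrite /S big_ord_recr.
  by rewrite exprS; ring.
(* From index 2 on, the polynomials have equal values at 0 and 1; the jump of the first one
   contributes [phi 0 a]. *)
have -> : em_error J.+1 phi Phi a = F 1 - F 0.
  rewrite /em_error /em_boundary /F /S addr0 !big_ord_recl /=.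
  have e j : (b j.+2 0) = em_coef j.+1 by rewrite /b /em_coef bpoly_period.
  have e0 : em_coef 0 = b 1%N 0 + 1.
    by rewrite /em_coef -(subrK (bpoly 1).[0] (bpoly 1).[1]) bpoly1 RCD addrC.
  have -> : b 1%N 1 = em_coef 0 by [].
  have -> : \sum_(i < J) (-1) ^+ bump 0 i * (b (bump 0 i).+1 0 * phi (bump 0 i) a) =
    \sum_(i < J) (-1) ^+ bump 0 i * em_coef (bump 0 i) * phi (bump 0 i) a.
    by apply: eq_bigr => i _; rewrite /bump /= e mulrA.
  have -> : \sum_(i < J) (-1) ^+ bump 0 i * (b (bump 0 i).+1 1 * phi (bump 0 i) (a + 1)) =
    \sum_(i < J) (-1) ^+ bump 0 i * em_coef (bump 0 i) * phi (bump 0 i) (a + 1).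
    by apply: eq_bigr => i _; rewrite mulrA.
  by rewrite !expr0 e0; ring.
have := @cMVT _ F (fun y => - ((-1) ^+ J.+1 * (b J.+1 y * phi J.+1 (a + y)))) 0 1
  (K * M) ler01; rewrite subr0 mulr1; apply => y /andP[y0 y1].
  have ay : 0 < a + y by lra.
  have [tw0 twj] := tw _ ay.
  have := cderD (dS J.+1 y y0) (cderN (dsh _ _ _ tw0)).
  by apply: cder_eq => //; ring.
rewrite cabsN !cabsM cabsX cabsN cabs1 expr1n mul1r /b cabs_real.
apply: ler_pM; rewrite ?cabs_ge0 //; first by apply: hK; rewrite y0.
by apply: hM; apply/andP; split; lra.
Qed.

End EulerMaclaurin.

(** * The Riemann zeta function, continued by Euler-Maclaurin summation *)

Section RiemannZeta.
Context {R : realType}.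
Notation C := R[i].
Implicit Types (s h : C) (x : R).

(** The power [x^(-s)], for positive [x]. *)
Definition xp s x : C := cexp (- s * ((ln x)%:C)%C).

Lemma re_xp_arg s x : re (- s * ((ln x)%:C)%C) = - re s * ln x.
Proof. by rewrite reM reN /= mulr0 subr0. Qed.

Lemma xp1 s : xp s 1 = 1.
Proof. by rewrite /xp ln1 mulr0 cexp0. Qed.

Lemma xpD s h x : xp (s + h) x = xp s x * xp h x.
Proof. by rewrite /xp opprD mulrDl cexpD. Qed.

Lemma cabs_xp s x : cabs (xp s x) = expR (- re s * ln x).
Proof. by rewrite /xp cabs_cexp re_xp_arg. Qed.

Lemma xp_nat n x : 0 < x -> xp n%:R x = ((x ^- n)%:C)%C.
Proof.
move=> x0; elim: n => [|n IH]; first by rewrite /xp oppr0 mul0r cexp0 expr0 invr1.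
rewrite -natr1 xpD IH exprSr invfM RCM; congr (_ * _).
rewrite /xp mulN1r -RCN /cexp /= cos0 sin0 mulr0 mulr1 expRN lnK //.
Qed.

Lemma xp1E x : 0 < x -> xp 1 x = ((x^-1)%:C)%C.
Proof. by move=> x0; rewrite (xp_nat 1). Qed.

Lemma xp_bound s x m : 1 <= x -> m%:R <= re s -> cabs (xp s x) <= x ^- m.
Proof.
move=> x1 ms; have x0 : 0 < x by lra.
have <- : cabs (xp m%:R x) = x ^- m.
  by rewrite xp_nat // cabs_real ger0_norm // invr_ge0 exprn_ge0 // ltW.
rewrite !cabs_xp ler_expR ler_wpM2r ?ln_ge0 // lerN2.
by rewrite -RCnat.
Qed.

Lemma ln_ge0_le x : 1 <= x -> 0 <= ln x <= x.
Proof.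
by move=> x1; rewrite ln_ge0 //= ltW // ln_sublinear //; lra.
Qed.

Lemma cder_xp s x : 0 < x -> cder (xp s) (fun x => - s * xp (s + 1) x) x.
Proof.
move=> x0; have := cderM (cder_cst (- s) x) (cder_real (f' := @GRing.inv R) (is_derive1_ln x0)).
move=> /cder_exp; apply: cder_eq => //.
by rewrite xpD xp1E // -/(xp s x); ring.
Qed.

(** The rising factorial that appears on differentiating [x^(-s)] in [x]; [drfact] is its derivative
    in [s]. *)
Definition rfact s j : C := \prod_(i < j) (s + i%:R).
Fixpoint drfact s j : C :=
  if j is j'.+1 then drfact s j' * (s + j'%:R) + rfact s j' else 0.

Lemma rfactS s j : rfact s j.+1 = rfact s j * (s + j%:R).
Proof. by rewrite /rfact big_ord_recr. Qed.

Definition ptower s j x : C := (-1) ^+ j * rfact s j * xp (s + j%:R) x.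
(** Only differences of the primitive enter [em_error], so the jump of this formula at [s = 1], by
    the constant [1/(1-s)], is harmless. *)
Definition pprim s x : C :=
  if s == 1 then ((ln x)%:C)%C else xp (s - 1) x / (1 - s).

Lemma ptower_tower s : tower (ptower s) (pprim s).
Proof.
move=> x x0; split.
  rewrite /pprim; case: eqVneq => [->|s1].
    have := cder_real (f' := @GRing.inv R) (is_derive1_ln x0).
    apply: cder_eq => //; rewrite /ptower /rfact big_ord0 expr0 !mul1r addr0.
    by rewrite xp1E.
  have := cderM (cder_xp (s - 1) x0) (cder_cst ((1 - s)^-1) x).
  apply: cder_eq => //; rewrite mulr0 addr0 /ptower /rfact big_ord0 expr0 !mul1r addr0 subrK.
  by field; rewrite subr_eq0 eq_sym.
move=> j; have := cderM (cder_cst ((-1) ^+ j * rfact s j) x) (cder_xp (s + j%:R) x0).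
apply: cder_eq => //; rewrite mul0r add0r /ptower rfactS exprS -natr1 addrA; ring.
Qed.

(** The derivative of [ptower s] in the parameter [s]. Its primitive [dpprim] is, at [s = 1], the
    [s]-derivative of [(x^(1-s) - 1)/(1-s)]. *)
Definition dptower s j x : C :=
  (-1) ^+ j * (drfact s j - rfact s j * ((ln x)%:C)%C) * xp (s + j%:R) x.
Definition dpprim s x : C :=
  if s == 1 then - (((ln x) ^+ 2 / 2)%:C)%C
  else - ((ln x)%:C)%C * xp (s - 1) x / (1 - s) + xp (s - 1) x / (1 - s) ^+ 2.

Lemma dptower_tower s : tower (dptower s) (dpprim s).
Proof.
move=> x x0; have dl := cder_real (f' := @GRing.inv R) (is_derive1_ln x0).
have xi : ((x^-1)%:C)%C = xp 1 x by rewrite xp1E.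
split.
  rewrite /dpprim; case: eqVneq => [->|s1].
    have := cderM (cder_cst (- (2^-1 : C)) x) (cderM dl dl).
    apply: cder_eq => [t|]; first by rewrite RCM RCV RCX RCnat; ring.
    by rewrite /dptower /rfact big_ord0 /= xi expr0 addr0; field.
  have := cderD (cderM (cderM (cderN dl) (cder_xp (s - 1) x0)) (cder_cst ((1 - s)^-1) x))
    (cderM (cder_xp (s - 1) x0) (cder_cst ((1 - s) ^- 2) x)).
  apply: cder_eq => //; rewrite xi /dptower /rfact big_ord0 /= expr0 addr0 subrK.
  have -> : xp (s - 1) x = xp s x * ((x%:C)%C).
    rewrite xpD; congr (_ * _).
    have : xp (-1) x * xp 1 x = 1 by rewrite -xpD addNr /xp oppr0 mul0r cexp0.
    rewrite -xi RCV => h; have xn : (x%:C)%C != 0 :> C.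
      by rewrite eq_complex /= eqxx andbT gt_eqF.
    by rewrite -(divfK xn (xp (-1) x)) h mul1r.
  rewrite -xi RCV; field; rewrite subr_eq0 eq_sym s1 /=.
  by rewrite eq_complex /= eqxx andbT gt_eqF.
move=> j.
have := cderM (cderM (cder_cst ((-1) ^+ j) x)
  (cderD (cder_cst (drfact s j) x) (cderN (cderM (cder_cst (rfact s j) x) dl))))
  (cder_xp (s + j%:R) x0).
apply: cder_eq => //; rewrite /dptower rfactS exprS -natr1 addrA /= xi.
rewrite (xpD (s + j%:R)); ring.
Qed.

Lemma rfact_rem s j : exists2 K : R, 0 <= K & forall h, cabs h <= 1 ->
  cabs (rfact (s + h) j - rfact s j - h * drfact s j) <= K * cabs h ^+ 2.
Proof.
elim: j => [|j [K K0 IH]].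
  by exists 0 => // h _; rewrite /rfact !big_ord0 /= mulr0 subrr subr0 cabs0 mul0r.
exists (K * (cabs s + j%:R + 1) + cabs (drfact s j)).
  by rewrite addr_ge0 ?cabs_ge0 // mulr_ge0 // !addr_ge0 ?cabs_ge0.
move=> h h1; rewrite !rfactS /=; set a' := rfact (s + h) j; set a := rfact s j.
set d := drfact s j.
have -> : a' * (s + h + j%:R) - a * (s + j%:R) - h * (d * (s + j%:R) + a) =
  (a' - a - h * d) * (s + j%:R + h) + h ^+ 2 * d by ring.
apply: le_trans (cabsD _ _) _; rewrite !cabsM [leRHS]mulrDl.
apply: lerD; last by rewrite expr2 mulrC.
rewrite mulrAC; apply: ler_pM; rewrite ?cabs_ge0 //; first exact: IH.
apply: le_trans (cabsD _ _) _; apply: lerD => //.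
by apply: le_trans (cabsD _ _) _; rewrite cabs_nat.
Qed.

Lemma cabs_xp_le h x : 1 <= x -> cabs h <= 1 -> cabs (xp h x) <= x.
Proof.
move=> x1 h1; have x0 : 0 < x by lra.
rewrite cabs_xp -[leRHS](@lnK _ x) ?posrE // ler_expR ler_piMl ?ln_ge0 //.
apply: le_trans h1; apply: le_trans (re_le_cabs _); rewrite -normrN; exact: ler_norm.
Qed.

(** The factor [x^3] is crude: [x^2] bounds [(ln x)^2], and [x] bounds [exp(|h| ln x)]. The lost
    powers are regained by taking more correction terms. *)
Lemma xp_rem s h x : 1 <= x -> cabs h <= 1 ->
  cabs (xp (s + h) x - xp s x + h * ((ln x)%:C)%C * xp s x) <=
  cabs h ^+ 2 * x ^+ 3 * cabs (xp s x).
Proof.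
move=> x1 h1; have x0 : 0 < x by lra.
have /andP[l0 lx] := ln_ge0_le x1.
have -> : xp (s + h) x - xp s x + h * ((ln x)%:C)%C * xp s x =
  (cexp (- h * ((ln x)%:C)%C) - 1 - - h * ((ln x)%:C)%C) * xp s x.
  by rewrite xpD -/(xp h x); ring.
rewrite cabsM ler_wpM2r ?cabs_ge0 //; apply: le_trans (cexp_bound2 _) _.
rewrite cabsM cabsN cabs_real ger0_norm // exprMn -mulrA ler_wpM2l ?sqr_ge0 //.
rewrite [x ^+ 3]exprSr; apply: ler_pM; rewrite ?sqr_ge0 ?expR_ge0 //.
  by rewrite ler_pXn2r // ?nnegrE // ltW.
rewrite -[leRHS](@lnK _ x) ?posrE // ler_expR ler_piMl //.
Qed.

Lemma ptower_rem_aux (K H a d l e0 e1 e2 X X' x3 : R) :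
  0 <= H -> 0 <= d -> 0 <= l -> 0 <= e0 -> 0 <= e1 -> 0 <= e2 -> 0 <= X -> 0 <= X' ->
  e0 <= K * H ^+ 2 -> X' <= x3 * X -> e1 <= a + d -> e2 <= H ^+ 2 * x3 * X -> l <= x3 ->
  e0 * X' + e1 * e2 + H * H * d * l * X <= (K + (a + d) + d) * H ^+ 2 * (x3 * X).
Proof.
move=> H0 d0 l0 e00 e10 e20 X0 X'0 h0 hX h1 h2 hl.
have -> : (K + (a + d) + d) * H ^+ 2 * (x3 * X) =
  K * H ^+ 2 * (x3 * X) + (a + d) * (H ^+ 2 * x3 * X) + H * H * d * x3 * X by ring.
apply: lerD; last by rewrite ler_wpM2r // ler_wpM2l // !mulr_ge0.
by apply: lerD; apply: ler_pM.
Qed.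

Lemma ptower_rem s j : exists2 K : R, 0 <= K & forall h x, cabs h <= 1 -> 1 <= x ->
  cabs (ptower (s + h) j x - ptower s j x - h * dptower s j x) <=
  K * cabs h ^+ 2 * (x ^+ 3 * cabs (xp (s + j%:R) x)).
Proof.
have [K K0 hK] := rfact_rem s j.
exists (K + (cabs (rfact s j) + cabs (drfact s j)) + cabs (drfact s j)).
  by rewrite !addr_ge0 ?cabs_ge0.
move=> h x h1 x1; have x0 : 0 <= x by lra.
have /andP[l0 lx] := ln_ge0_le x1.
rewrite /ptower /dptower; have -> : s + h + j%:R = s + j%:R + h by ring.
set a' := rfact (s + h) j; set a := rfact s j; set d := drfact s j.
set X' := xp (s + j%:R + h) x; set X := xp (s + j%:R) x; set l := ((ln x)%:C)%C.
have -> : (-1) ^+ j * a' * X' - (-1) ^+ j * a * X - h * ((-1) ^+ j * (d - a * l) * X) =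
  (-1) ^+ j * ((a' - a - h * d) * X' + (a + h * d) * (X' - X + h * l * X) - h * h * d * l * X)
  by ring.
rewrite cabsM cabsX cabsN cabs1 expr1n mul1r.
have X'X : cabs X' <= x ^+ 3 * cabs X.
  rewrite /X' xpD cabsM mulrC ler_wpM2r ?cabs_ge0 //.
  apply: le_trans (cabs_xp_le x1 h1) _.
  by rewrite exprS ler_peMr // exprn_ege1.
have adE : cabs (a + h * d) <= cabs a + cabs d.
  by apply: le_trans (cabsD _ _) _; rewrite lerD2l cabsM ler_piMl ?cabs_ge0.
have lE : cabs l <= x ^+ 3.
  rewrite cabs_real ger0_norm //; apply: le_trans lx _.
  by rewrite exprS ler_peMr // exprn_ege1.
apply: le_trans (cabsB _ _) _; apply: le_trans (lerD (cabsD _ _) (lexx _)) _.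
rewrite !cabsM; apply: ptower_rem_aux; rewrite ?cabs_ge0 //; first exact: hK.
exact: (xp_rem (s + j%:R) x1 h1).
Qed.

(** Makes the first-order remainder of a tower in the parameter [s] a tower itself, to which
    [em_error_bound] applies. *)
Lemma tower_lin (p p1 p2 : nat -> R -> C) (P P1 P2 : R -> C) h :
  tower p P -> tower p1 P1 -> tower p2 P2 ->
  tower (fun j x => p j x - p1 j x - h * p2 j x) (fun x => P x - P1 x - h * P2 x).
Proof.
have lin (f g f' g' k k' : R -> C) x : cder f f' x -> cder g g' x -> cder k k' x ->
    cder (fun x => f x - g x - h * k x) (fun x => f' x - g' x - h * k' x) x.
  move=> h1 h2 h3; have := cderD (cderD h1 (cderN h2)) (cderN (cderM (cder_cst h x) h3)).
  by apply: cder_eq => //; rewrite mul0r add0r.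
move=> t t1 t2 x x0; have [a b] := t x x0; have [a1 b1] := t1 x x0; have [a2 b2] := t2 x x0.
by split=> [|j]; apply: lin.
Qed.

Lemma em_error_lin J (p p1 p2 : nat -> R -> C) (P P1 P2 : R -> C) h a :
  em_error J (fun j x => p j x - p1 j x - h * p2 j x) (fun x => P x - P1 x - h * P2 x) a
  = em_error J p P a - em_error J p1 P1 a - h * em_error J p2 P2 a.
Proof.
have l x : em_boundary J (fun j x => p j x - p1 j x - h * p2 j x) x =
    em_boundary J p x - em_boundary J p1 x - h * em_boundary J p2 x.
  rewrite /em_boundary mulr_sumr -!sumrB; apply: eq_bigr => i _; ring.
rewrite /em_error !l; ring.
Qed.

Definition zerr J s (n : nat) : C := em_error J.+1 (ptower s) (pprim s) n.+1%:R.

Lemma inv_nat_pow (x : R) (n m : nat) : n.+1%:R <= x -> x ^- m <= (n.+1%:R ^+ m)^-1.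
Proof.
move=> nx; have x0 : 0 < x by apply: lt_le_trans nx.
by rewrite lef_pV2 ?posrE ?exprn_gt0 // lerXn2r // ?nnegrE // ltW.
Qed.

Lemma natS_ge1 (n : nat) : 1 <= n.+1%:R :> R. Proof. by rewrite ler1n. Qed.

Lemma ptower_bound s j m x : 1 <= x -> m%:R <= re s + j%:R ->
  cabs (ptower s j x) <= cabs (rfact s j) * x ^- m.
Proof.
move=> x1 ms; rewrite /ptower !cabsM cabsX cabsN cabs1 expr1n mul1r.
by rewrite ler_wpM2l ?cabs_ge0 // xp_bound // reD -RCnat /= .
Qed.

Lemma zerr_bound J s : 2 <= re s + J.+1%:R -> exists K,
  forall n, cabs (zerr J s n) <= K * (n.+1%:R ^+ 2)^-1.
Proof.
move=> hs; have [K [K0 hK]] := em_error_bound (R := R) J.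
exists (K * cabs (rfact s J.+1)) => n; rewrite -mulrA.
apply: hK; [exact: ptower_tower|exact: natS_ge1|move=> x /andP[nx _]].
apply: le_trans (ptower_bound (m := 2) _ hs) _; first exact: le_trans (natS_ge1 n) nx.
by rewrite ler_wpM2l ?cabs_ge0 // inv_nat_pow.
Qed.

Lemma csummable_invsq (u : nat -> C) (K : R) :
  (forall n, cabs (u n) <= K * (n.+1%:R ^+ 2)^-1) -> csummable u.
Proof.
move=> h; have K0 : 0 <= K.
  by have := le_trans (cabs_ge0 _) (h 0%N); rewrite expr1n invr1 mulr1.
exists (K * 2) => N; apply: le_trans (ler_wpM2l K0 (sum_invsq N)).
by rewrite mulr_sumr; apply: ler_sum => i _; exact: h.
Qed.

Lemma zerr_summable J s : 2 <= re s + J.+1%:R -> csummable (zerr J s).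
Proof. by move=> /zerr_bound [K hK]; exact: csummable_invsq hK. Qed.

Lemma re_dist s h : cabs h < 1 -> re s - 1 <= re (s + h).
Proof.
move=> h1; rewrite reD lerD2l lerNl; apply: ltW; apply: le_lt_trans h1.
by apply: le_trans (re_le_cabs _); rewrite -normrN ler_norm.
Qed.

(** By linearity the error of the remainder tower is the remainder of the error. The number 5 is 2,
    for a summable [1/n^2], plus the 3 powers lost in [ptower_rem]. *)
Lemma zerr_jet J s : 5 <= re s + J.+1%:R -> jet (fun s => csum (zerr J s)) s.
Proof.
move=> hs; have [K [K0 hK]] := em_error_bound (R := R) J.
have [L L0 hL] := ptower_rem s J.+1.
pose u1 n : C := em_error J.+1 (dptower s) (dpprim s) n.+1%:R.
apply: (@jet_series _ (fun n s => zerr J s n) u1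
  (fun n => K * L * (n.+1%:R ^+ 2)^-1) s 1 (K * L * 2)) => //.
- by move=> N; rewrite -mulr_sumr ler_wpM2l ?sum_invsq // mulr_ge0.
- move=> h h1; apply: zerr_summable; have := re_dist s h1; lra.
move=> n h h1; rewrite /zerr /u1 -em_error_lin.
have -> : K * L * (n.+1%:R ^+ 2)^-1 * cabs h ^+ 2 = K * (L * cabs h ^+ 2 * (n.+1%:R ^+ 2)^-1).
  by ring.
apply: hK; first by apply: tower_lin; do ?[exact: ptower_tower|exact: dptower_tower].
  exact: natS_ge1.
move=> x /andP[nx _]; have x1 := le_trans (natS_ge1 n) nx.
apply: le_trans (hL h x (ltW h1) x1) _.
rewrite ler_wpM2l ?(mulr_ge0 L0 (sqr_ge0 _)) //.
apply: le_trans (inv_nat_pow 2 nx).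
have x0 : 0 < x by lra.
have -> : x ^- 2 = x ^+ 3 * x ^- 5 by field; rewrite gt_eqF.
rewrite ler_wpM2l ?exprn_ge0 ?(ltW x0) // xp_bound //.
by rewrite reD -RCnat.
Qed.

(* zeta(s) - 1/(s-1) on the half-plane Re s + J >= 3 *)
Definition zreg J s : C := csum (zerr J s) + em_boundary J.+1 (ptower s) 1.

Lemma rfact_jet j s : jet (fun s => rfact s j) s.
Proof.
have [K K0 hK] := rfact_rem s j.
by exists (drfact s j), K, 1; split=> // h /ltW; exact: hK.
Qed.

Lemma zreg_jet J s : 5 <= re s + J.+1%:R -> jet (zreg J) s.
Proof.
move=> hs; apply: jetD; first exact: zerr_jet.
apply: jet_sum => j; apply: jetM; first exact: jet_cst.
rewrite /ptower; apply: jetM.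
  by apply: jetM; [exact: jet_cst|exact: rfact_jet].
by apply: (@jet_ext _ (fun=> 1) _ _ 1) => // [w _|]; [rewrite xp1|exact: jet_cst].
Qed.

Lemma ptower_cvg0 s j : 1 <= re s + j%:R -> ccvg (fun n => ptower s j n.+1%:R) 0.
Proof.
move=> h; apply: (@ccvg_dom _ (cabs (rfact s j))) => n.
by have := ptower_bound (m := 1) (natS_ge1 n) h; rewrite expr1.
Qed.

(** The additional correction term changes the local errors by differences [v n.+1 - v n]. These sum
    to [- v 0], which cancels the new boundary term at 1. *)
Lemma zreg_step J s : 3 <= re s + J.+1%:R -> zreg J.+1 s = zreg J s.
Proof.
move=> hs; rewrite /zreg /em_boundary [in LHS]big_ord_recr /= -!/(em_boundary _ _ _).
set c := (-1) ^+ J.+1 * em_coef J.+1.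
pose v n := c * ptower s J.+1 n.+1%:R.
have cv : ccvg v 0.
  rewrite -(mulr0 c); apply: ccvgZ; apply: ptower_cvg0; lra.
have := csum_tele cv => /csumE hv.
have e n : zerr J.+1 s n = zerr J s n + (v n.+1 - v n).
  rewrite /zerr /em_error /em_boundary ![\sum_(j < J.+2) _]big_ord_recr /=.
  by rewrite /v -/c natr1; ring.
have s1 : csummable (zerr J s) by apply: zerr_summable; lra.
have s2 : csummable (zerr J.+1 s) by apply: zerr_summable; rewrite -natr1; lra.
have s3 : csummable (fun n => v n.+1 - v n).
  have := csummableD s2 (csummableN s1); congr csummable; apply/funext => n.
  by rewrite e; ring.
have -> : csum (zerr J.+1 s) = csum (zerr J s) + csum (fun n => v n.+1 - v n).
  by rewrite -csumD //; congr csum; apply/funext => n; rewrite e.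
by rewrite hv /v; ring.
Qed.

Lemma zreg_stable J J' s : 3 <= re s + J.+1%:R -> (J <= J')%N -> zreg J' s = zreg J s.
Proof.
move=> hs; elim: J' => [|J' IH]; first by rewrite leqn0 => /eqP ->.
rewrite leq_eqVlt => /predU1P[-> //|]; rewrite ltnS => JJ.
rewrite zreg_step ?IH //; apply: le_trans hs _.
by rewrite lerD2l ler_nat.
Qed.

(** The local errors telescope against [G], leaving the sum of the powers; the value
    [- pprim s 1 = 1/(s-1)] at the lower end is the pole. *)
Lemma zreg_zeta J s : 2 <= re s -> ccvg (psum (fun n => xp s n.+1%:R)) (zreg J s + (s - 1)^-1).
Proof.
move=> hs; have s1 : s != 1 by apply: contraTneq hs => -> /=; rewrite -ltNge; lra.
pose G n := em_boundary J.+1 (ptower s) n.+1%:R - pprim s n.+1%:R.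
have G0 : ccvg G 0.
  rewrite -(addr0 0); apply: ccvgD.
    rewrite /em_boundary; elim: J.+1 => [|k IH].
      by apply: eq_ccvg (ccvg_cst 0) => n; rewrite big_ord0.
    have := ccvgD IH (ccvgZ ((-1) ^+ k * em_coef k) (@ptower_cvg0 s k _)).
    rewrite mulr0 addr0 => h; apply: eq_ccvg (h _) => [n|]; first by rewrite big_ord_recr.
    by have : 0 <= k%:R :> R by []; lra.
  apply: (@ccvg_dom _ (cabs ((1 - s)^-1))) => n.
  rewrite cabsN /pprim (negbTE s1) cabsM mulrC ler_wpM2l ?cabs_ge0 //.
  by have := @xp_bound (s - 1) n.+1%:R 1 (natS_ge1 n); rewrite expr1; apply; rewrite reB /=; lra.
have tele := csum_tele G0.
have sz : csummable (zerr J s).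
  by apply: zerr_summable; have : 0 <= J.+1%:R :> R by []; lra.
have := ccvgD (csum_cvg sz) (ccvgZ (-1) tele).
have -> : csum (zerr J s) + -1 * - G 0%N = zreg J s + (s - 1)^-1.
  rewrite /zreg /G /pprim (negbTE s1) xp1.
  have -> : (s - 1)^-1 = - (1 / (1 - s)).
    by rewrite mul1r -invrN opprB.
  by ring.
apply: eq_ccvg => N; rewrite -psumZ -psumD; apply: eq_bigr => n _.
rewrite /zerr /em_error /G natr1 /ptower /rfact expr0 big_ord0 !mul1r addr0; ring.
Qed.

(** The number of correction terms grows with [|s|], so that every [s] lies inside the half-plane
    where its own formula is valid. *)
Definition zeta_reg s : C := zreg (Num.trunc (cabs s)).+4 s.

Lemma zeta_regE J s : 3 <= re s + J.+1%:R -> zeta_reg s = zreg J s.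
Proof.
move=> hs; rewrite /zeta_reg; set K := _.+4.
have hK : 3 <= re s + K.+1%:R.
  have := truncnS_gt (cabs s); have := re_le_cabs s; rewrite ler_norml => /andP[+ _].
  rewrite /K; set n := Num.trunc _; have -> : n.+4.+1%:R = n.+1%:R + 4 :> R by rewrite -natrD; congr (_%:R); lia.
  lra.
case: (leqP J K) => JK; first by rewrite (zreg_stable hs).
by rewrite (zreg_stable hK) // ltnW.
Qed.

(** Although the formula changes with [s], on the unit disc around a point it agrees with [zreg J]
    for one fixed [J]. *)
Lemma zeta_reg_jet s : jet zeta_reg s.
Proof.
pose J := (Num.trunc (cabs s)).+4.+3.
have hJ : 6 <= re s + J.+1%:R.
  have := truncnS_gt (cabs s); have := re_le_cabs s; rewrite ler_norml => /andP[+ _].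
  rewrite /J; set n := Num.trunc _; have -> : n.+4.+4%:R = n.+1%:R + 7 :> R by rewrite -natrD; congr (_%:R); lia.
  lra.
apply: (@jet_ext _ (zreg J) _ _ 1) => // [w ws|]; last by apply: zreg_jet; lra.
rewrite (@zeta_regE J) //; have := re_dist s ws.
by rewrite [s + _]addrC subrK; lra.
Qed.

Lemma zetaP s : 2 <= re s -> ccvg (psum (fun n => xp s n.+1%:R)) (zeta_reg s + (s - 1)^-1).
Proof. exact: zreg_zeta. Qed.

End RiemannZeta.

(** * Functions with at most simple poles *)

Section SimplePoles.
Context {R : realType}.
Notation C := R[i].
Implicit Types (f g : C -> C) (z w a c : C).

(** The value of [f] at [z] itself is unconstrained, since at a pole the formulas take whatever
    value the inverse of 0 produces. *)
Definition pole1 f z := exists c H (d : R), [/\ 0 < d,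
  forall w, cabs (w - z) < d -> jet H w &
  forall w, w != z -> cabs (w - z) < d -> f w = H w + c / (w - z)].

Lemma pole1_jet f z d : 0 < d -> (forall w, cabs (w - z) < d -> jet f w) -> pole1 f z.
Proof. by move=> d0 h; exists 0, f, d; split=> // w _ _; rewrite mul0r addr0. Qed.

Lemma pole1D f g z : pole1 f z -> pole1 g z -> pole1 (fun w => f w + g w) z.
Proof.
move=> [c [H [d [d0 jH fH]]]] [c' [H' [d' [d0' jH' fH']]]].
exists (c + c'), (fun w => H w + H' w), (Num.min d d').
split; first by rewrite lt_min d0.
  by move=> w; rewrite lt_min => /andP[h1 h2]; apply: jetD; auto.
move=> w wz; rewrite lt_min => /andP[h1 h2]; rewrite fH // fH' // mulrDl; ring.
Qed.

Lemma pole1Z a f z : pole1 f z -> pole1 (fun w => a * f w) z.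
Proof.
move=> [c [H [d [d0 jH fH]]]]; exists (a * c), (fun w => a * H w), d; split=> //.
  by move=> w h; apply: jetM; [exact: jet_cst|exact: jH].
by move=> w wz h; rewrite fH // mulrDr mulrA.
Qed.

Lemma pole1_sum n (p : nat -> C) (F : nat -> C -> C) z : (forall i, pole1 (F i) z) ->
  pole1 (fun w => \sum_(i < n) p i * F i w) z.
Proof.
move=> h; elim: n => [|n IH].
  apply: (@pole1_jet _ _ 1) => // w _.
  by apply: (@jet_ext _ (fun=> 0) _ _ 1) => // [v _|]; [rewrite big_ord0|exact: jet_cst].
have := pole1D IH (pole1Z (p n) (h n)); congr pole1; apply/funext => w.
by rewrite big_ord_recr.
Qed.

Lemma pole1_inv a z : pole1 (fun w => (w - a)^-1) z.
Proof.
have [->|za] := eqVneq z a.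
  by exists 1, (fun=> 0), 1; split=> // [w _|w _ _]; [exact: jet_cst|rewrite add0r mul1r].
apply: (@pole1_jet _ _ (cabs (z - a))); first by rewrite cabs_gt0 // subr_eq0.
by move=> w wz; apply: jet_inv; apply: contraTneq wz => ->; rewrite cabsC ltxx.
Qed.

Lemma pole1_ext f g z d : 0 < d -> (forall w, cabs (w - z) < d -> f w = g w) ->
  pole1 f z -> pole1 g z.
Proof.
move=> d0 fg [c [H [d' [d0' jH fH]]]]; exists c, H, (Num.min d d').
split; first by rewrite lt_min d0.
  by move=> w; rewrite lt_min => /andP[_ h2]; exact: jH.
by move=> w wz; rewrite lt_min => /andP[h1 h2]; rewrite -fg // fH.
Qed.

Lemma pole1_scale f a z : a != 0 -> pole1 f (a * z) -> pole1 (fun w => f (a * w)) z.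
Proof.
move=> a0 [c [H [d [d0 jH fH]]]]; have ap := cabs_gt0 a0.
exists (c / a), (fun w => H (a * w)), (d / cabs a); split; first exact: divr_gt0.
  move=> w; rewrite ltr_pdivlMr // => wz; have := @jet_affine _ H a 0 w; rewrite addr0 => h.
  apply: (@jet_ext _ (fun w => H (a * w + 0)) _ _ 1) => // [v _|]; first by rewrite addr0.
  by apply: h; apply: jH; rewrite -mulrBr cabsM mulrC.
move=> w wz; rewrite ltr_pdivlMr // => h; rewrite fH; last by rewrite -mulrBr cabsM mulrC.
  by rewrite -mulrBr invfM mulrA.
by rewrite (inj_eq (mulfI a0)).
Qed.

Lemma pole1_laurent f z : pole1 f z -> exists r, laurent_at f z 1 r.
Proof.
move=> [c [H [d [d0 jH fH]]]]; exists (fun=> c); exists H.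
  by apply: jet_holo; exists d.
apply: dnbhsC; exists d => // w wz h; rewrite fH // big_ord1 expr1 //.
Qed.

End SimplePoles.

(** * Dirichlet series of sequences with expansions in integer powers *)

Section ZetaOfExpansion.
Context {R : realType}.
Notation C := R[i].
Implicit Types (t : nat -> C) (s : C) (P Q : {poly C}).

(** An asymptotic expansion in integer powers of [n], in truncated form: up to bounded terms, [P] is
    [n^J] times the part of the expansion above the order [-J]. *)
Definition expands t := forall J : nat, exists P (M : R),
  forall n, cabs (n.+1%:R ^+ J * t n - P.[n.+1%:R]) <= M.

Definition zeta s : C := zeta_reg s + (s - 1)^-1.

(** The continuation of the series with terms [P(n) n^(-s)]. *)
Definition zpoly P s : C := \sum_(i < size P) P`_i * zeta (s - i%:R).

Lemma zpolyE P s m : (size P <= m)%N -> zpoly P s = \sum_(i < m) P`_i * zeta (s - i%:R).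
Proof.
move=> sP; rewrite /zpoly (big_ord_widen _ (fun i => P`_i * zeta (s - i%:R)) sP).
rewrite big_mkcond /=; apply: eq_bigr => i _.
by case: ltnP => // h; rewrite nth_default // mul0r.
Qed.

Lemma zpolyB P Q s : zpoly (P - Q) s = zpoly P s - zpoly Q s.
Proof.
pose m := maxn (size P) (size Q).
have h1 : (size (P - Q)%R <= m)%N.
  by apply: leq_trans (size_polyD _ _) _; rewrite size_polyN.
rewrite (zpolyE _ h1) (zpolyE _ (leq_maxl (size P) (size Q))) (zpolyE _ (leq_maxr (size P) (size Q))).
by rewrite -sumrB; apply: eq_bigr => i _; rewrite coefB mulrBl.
Qed.

Lemma zpolyMX P s : zpoly ('X * P) (s + 1) = zpoly P s.
Proof.
have h : (size ('X * P)%R <= (size P).+1)%N.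
  by apply: leq_trans (size_polyMleq _ _) _; rewrite size_polyX.
rewrite (zpolyE _ h) big_ord_recl coefXM /= mul0r add0r; apply: eq_bigr => i _.
rewrite coefXM /= /bump /= add1n; congr (_ * zeta _); rewrite -natr1; ring.
Qed.

Lemma xp_pow s (i n : nat) : n.+1%:R ^+ i * xp s n.+1%:R = xp (s - i%:R) n.+1%:R :> C.
Proof.
rewrite -{1}(subrK i%:R s) (xpD (s - i%:R)) xp_nat // RCV RCX RCnat mulrC -mulrA mulVf ?mulr1 //.
Qed.

Lemma zpoly_sum P s : (size P)%:R + 1 <= re s ->
  ccvg (psum (fun n => P.[n.+1%:R] * xp s n.+1%:R)) (zpoly P s).
Proof.
move=> hs.
have aux m : (m <= size P)%N ->
    ccvg (psum (fun n => (\sum_(i < m) P`_i * n.+1%:R ^+ i) * xp s n.+1%:R))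
         (\sum_(i < m) P`_i * zeta (s - i%:R)).
  elim: m => [|m IH] hm.
    rewrite big_ord0; apply: eq_ccvg (ccvg_cst 0) => N.
    by rewrite /psum big1 // => n _; rewrite big_ord0 mul0r.
  have h2 : 2 <= re (s - m%:R).
    rewrite reB -RCnat /=; have : (m.+1)%:R <= (size P)%:R :> R by rewrite ler_nat.
    by rewrite -natr1; lra.
  have := ccvgD (IH (ltnW hm)) (ccvgZ P`_m (zetaP h2)).
  rewrite big_ord_recr /= -/(zeta _); apply: eq_ccvg => N.
  rewrite -psumZ -psumD; apply: eq_bigr => n _.
  by rewrite big_ord_recr /= mulrDl -xp_pow mulrA.
have := aux _ (leqnn _); apply: eq_ccvg => N.
by apply: eq_bigr => n _; rewrite horner_coef.
Qed.

(** If the degree [k] were at least 2, division by [n^(k-1)] would bound [|Q_k| n] uniformly in [n],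
    against the leading coefficient being nonzero. *)
Lemma linear_poly_size Q (M : R) :
  (forall n, cabs Q.[n.+1%:R] <= M * n.+1%:R) -> (size Q <= 2)%N.
Proof.
move=> hQ; rewrite leqNgt; apply/negP => sQ.
pose k := (size Q).-1; have k2 : (2 <= k)%N by rewrite /k; lia.
have sk : size Q = k.+1 by rewrite /k; lia.
have c0 : 0 < cabs Q`_k.
  by apply: cabs_gt0; rewrite -[k]/(size Q).-1 -/(lead_coef Q) lead_coef_eq0 -size_poly_gt0 sk.
pose S := \sum_(i < k) cabs Q`_i.
have S0 : 0 <= S by apply: sumr_ge0 => i _; exact: cabs_ge0.
have M0 : 0 <= M by have := le_trans (cabs_ge0 _) (hQ 0%N); rewrite mulr1.
have key n : cabs Q`_k * n.+1%:R <= S + M.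
  have n0 : 0 < n.+1%:R :> R by [].
  have n1 : 1 <= n.+1%:R :> R by rewrite ler1n.
  have p0 : 0 < n.+1%:R ^+ k.-1 :> R by rewrite exprn_gt0.
  rewrite -(ler_pM2r p0) -mulrA -exprS prednK; last lia.
  have -> : cabs Q`_k * n.+1%:R ^+ k = cabs (Q`_k * n.+1%:R ^+ k).
    by rewrite cabsM cabsX cabs_nat.
  have := hQ n; rewrite horner_coef sk big_ord_recr /= => h.
  set A := \sum_(i < k) _ in h.
  have -> : Q`_k * n.+1%:R ^+ k = (A + Q`_k * n.+1%:R ^+ k) - A by ring.
  apply: le_trans (cabsB _ _) _; rewrite addrC mulrDl; apply: lerD.
    rewrite /A; apply: le_trans (cabs_sum _ _ _) _; rewrite /S mulr_suml.
    apply: ler_sum => i _; rewrite cabsM cabsX cabs_nat ler_wpM2l ?cabs_ge0 //.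
    by rewrite ler_weXn2l //; case: i => i /= ik; lia.
  apply: le_trans h _; rewrite ler_wpM2l //.
  by have -> : k.-1 = (k.-2).+1 by [lia]; rewrite exprS ler_peMr // exprn_ege1.
have := truncnS_gt ((S + M) / cabs Q`_k).
by rewrite ltr_pdivrMr // mulrC ltNge key.
Qed.

Lemma zpoly_pole1 P b z : pole1 (fun s => zpoly P (s + b)) z.
Proof.
apply: (@pole1_sum _ _ (fun i => P`_i) (fun i s => zeta (s + b - i%:R))) => i.
apply: pole1D.
  apply: (@pole1_jet _ _ _ 1) => // w _.
  apply: (@jet_ext _ (fun s => zeta_reg (1 * s + (b - i%:R))) _ _ 1) => //.
    by move=> v _; rewrite mul1r addrA.
  exact/jet_affine/zeta_reg_jet.
have := pole1_inv (1 - (b - i%:R)) z; congr pole1; apply/funext => w.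
by congr (_^-1); ring.
Qed.

Lemma zpoly_jet P b z : (forall i : nat, z != i%:R - b + 1) -> jet (fun s => zpoly P (s + b)) z.
Proof.
move=> hz; apply: jet_sum => i; apply: jetM; first exact: jet_cst.
apply: jetD.
  apply: (@jet_ext _ (fun s => zeta_reg (1 * s + (b - i%:R))) _ _ 1) => //.
    by move=> v _; rewrite mul1r addrA.
  exact/jet_affine/zeta_reg_jet.
apply: (@jet_ext _ (fun w => (w - (i%:R - b + 1))^-1) _ _ 1) => //.
  by move=> v _; congr (_^-1); ring.
exact: jet_inv.
Qed.

(** Again 5 is 2 for summability plus the 3 powers lost in [xp_rem]. *)
Lemma dirichlet_jet (a : nat -> C) (M : R) s : 5 <= re s -> (forall n, cabs (a n) <= M) ->
  jet (fun s => csum (fun n => a n * xp s n.+1%:R)) s.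
Proof.
move=> hs ha; have M0 : 0 <= M := le_trans (cabs_ge0 _) (ha 0%N).
have b2 s' n : 2 <= re s' -> cabs (a n * xp s' n.+1%:R) <= M * (n.+1%:R ^+ 2)^-1.
  by move=> h; rewrite cabsM; apply: ler_pM; rewrite ?cabs_ge0 // xp_bound // ler1n.
pose u1 n : C := - a n * ((ln n.+1%:R : R)%:C)%C * xp s n.+1%:R.
apply: (@jet_series _ (fun n s => a n * xp s n.+1%:R) u1
  (fun n => M * (n.+1%:R ^+ 2)^-1) s 1 (M * 2)) => //.
- by move=> N; rewrite -mulr_sumr ler_wpM2l ?sum_invsq.
- move=> h h1; apply: (@csummable_invsq _ _ M) => n; apply: b2.
  by have := re_dist s h1; lra.
move=> n h h1.
have -> : a n * xp (s + h) n.+1%:R - a n * xp s n.+1%:R - h * u1 n =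
   a n * (xp (s + h) n.+1%:R - xp s n.+1%:R + h * ((ln n.+1%:R : R)%:C)%C * xp s n.+1%:R).
  by rewrite /u1; ring.
rewrite cabsM -[M / _ * _]mulrA; apply: ler_pM; rewrite ?cabs_ge0 //.
have hx := @xp_rem R s h n.+1%:R (natS_ge1 n) (ltW h1); apply: (le_trans hx).
rewrite [leRHS]mulrC -mulrA ler_wpM2l ?sqr_ge0 //.
have x0 : 0 < n.+1%:R :> R by [].
have -> : n.+1%:R ^- 2 = n.+1%:R ^+ 3 * n.+1%:R ^- 5 :> R by field; rewrite gt_eqF.
by rewrite ler_wpM2l ?exprn_ge0 // xp_bound // ler1n.
Qed.

Lemma xp_summable (a : nat -> C) (M : R) s : 2 <= re s -> (forall n, cabs (a n) <= M) ->
  csummable (fun n => a n * xp s n.+1%:R).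
Proof.
move=> hs ha; apply: (@csummable_invsq _ _ M) => n.
by rewrite cabsM; apply: ler_pM; rewrite ?cabs_ge0 // xp_bound // ler1n.
Qed.

(** [G J] is the series of the truncation remainders plus the continued polynomial part. Consecutive
    [G J] agree for [re s + J >= 2], so choosing [J] according to [|s|] glues them to one
    function. *)
Lemma zeta_of_expansion t : expands t -> exists g : C -> C,
  [/\ exists x0 : R, forall s, x0 <= re s ->
        csummable (fun n => t n * xp s n.+1%:R) /\ csum (fun n => t n * xp s n.+1%:R) = g s,
      forall z, pole1 g z &
      forall z, (forall m : int, z != m%:~R) -> jet g z].
Proof.
move=> /choice[P /choice[M hP]].
pose a J n := n.+1%:R ^+ J * t n - (P J).[n.+1%:R].
pose D J s := csum (fun n => a J n * xp (s + J%:R) n.+1%:R).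
pose G J s := D J s + zpoly (P J) (s + J%:R).
have reJ (J : nat) s : re (s + J%:R) = re s + J%:R by rewrite reD -RCnat.
have stepG J s : 2 <= re s + J%:R -> G J.+1 s = G J s.
  (* The passage from [J] to [J + 1] moves [Q] between the two parts of [G]. Being a combination of
     bounded remainders, [Q] grows at most linearly and has degree at most 1, so its series
     converges already for [re s + J >= 2], whatever the degrees of the [P J]. *)
  move=> hs; pose Q := 'X * P J - P J.+1.
  have sQ : (size Q <= 2)%N.
    apply: (@linear_poly_size _ (M J + M J.+1)) => n.
    have -> : Q.[n.+1%:R] = a J.+1 n - n.+1%:R * a J n.
      by rewrite /Q /a hornerD hornerN hornerM hornerX exprS; ring.
    apply: le_trans (cabsB _ _) _; rewrite mulrDl addrC; apply: lerD.
      by rewrite cabsM cabs_nat mulrC ler_wpM2r //; exact: hP.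
    apply: le_trans (hP _ _) _; rewrite ler_peMr ?ler1n //.
    exact: le_trans (cabs_ge0 _) (hP J.+1 0%N).
  have hs1 : 2 <= re (s + J%:R) by rewrite reJ.
  have sz : (size Q)%:R + 1 <= re (s + J.+1%:R).
    rewrite reJ -natr1; have : (size Q)%:R <= 2%:R :> R by rewrite ler_nat.
    lra.
  have q0 := zpoly_sum sz.
  have s1 := xp_summable hs1 (hP J).
  have hs2 : 2 <= re (s + J.+1%:R) by rewrite reJ -natr1; lra.
  have s2 := xp_summable hs2 (hP J.+1).
  have e n : a J.+1 n * xp (s + J.+1%:R) n.+1%:R =
     a J n * xp (s + J%:R) n.+1%:R + Q.[n.+1%:R] * xp (s + J.+1%:R) n.+1%:R.
    have -> : xp (s + J%:R) n.+1%:R = n.+1%:R ^+ 1 * xp (s + J.+1%:R) n.+1%:R.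
      by rewrite xp_pow -[J.+1%:R]natr1 addrA addrK.
    by rewrite /a /Q hornerD hornerN hornerM hornerX exprS expr1; ring.
  have sQs : csummable (fun n => Q.[n.+1%:R] * xp (s + J.+1%:R) n.+1%:R).
    have := csummableD s2 (csummableN s1); congr csummable; apply/funext => n.
    by rewrite -/(a J.+1 n) -/(a J n) e; ring.
  have : D J.+1 s = D J s + zpoly Q (s + J.+1%:R).
    rewrite /D -(csumE q0) -csumD //; congr csum; apply/funext => n; exact: e.
  have eJ : s + J.+1%:R = (s + J%:R) + 1 by rewrite -addrA natr1.
  rewrite /G => ->; rewrite zpolyB eJ zpolyMX -addrA; congr (_ + _).
  by rewrite addrC subrKC || rewrite subrK.
have stabG J J' s : 2 <= re s + J%:R -> (J <= J')%N -> G J' s = G J s.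
  move=> hs; elim: J' => [|J' IH]; first by rewrite leqn0 => /eqP ->.
  rewrite leq_eqVlt => /predU1P[-> //|]; rewrite ltnS => JJ.
  rewrite stepG ?IH //; apply: le_trans hs _; by rewrite lerD2l ler_nat.
pose J s := (Num.trunc (cabs s)).+4.
have hJ s : 3 <= re s + (J s)%:R.
  have := truncnS_gt (cabs s); have := re_le_cabs s; rewrite ler_norml => /andP[+ _].
  rewrite /J; set n := Num.trunc _; have -> : n.+4%:R = n.+1%:R + 3 :> R by rewrite -natrD; congr (_%:R); lia.
  lra.
pose g s := G (J s) s.
have gE K s : 2 <= re s + K%:R -> g s = G K s.
  move=> hs; rewrite /g; have hJs := hJ s; case: (leqP K (J s)) => KJ; first by rewrite (stabG K).
  by rewrite (stabG (J s) K) //; [lra|exact: ltnW].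
have gnear z : exists K, [/\ 5 <= re z + K%:R - 1 & forall w, cabs (w - z) < 1 -> G K w = g w].
  have h := hJ z; have e3 : (J z + 3)%:R = (J z)%:R + 3 :> R by rewrite natrD.
  exists (J z + 3)%N; rewrite e3; split; first lra.
  move=> w wz; rewrite (@gE (J z + 3)%N) // e3.
  by have := re_dist z wz; rewrite [z + _]addrC subrK; lra.
have Djet K w : 5 <= re w + K%:R -> jet (D K) w.
  move=> h; have h' : 5 <= re (1 * w + K%:R) by rewrite mul1r reJ.
  have hj := jet_affine (dirichlet_jet h' (hP K)).
  by apply: (jet_ext ltr01 _ hj) => v _; rewrite mul1r.
exists g; split.
- have hs s : 2 <= re s -> (size (P 0%N))%:R + 1 <= re s ->
     csummable (fun n => t n * xp s n.+1%:R) /\ csum (fun n => t n * xp s n.+1%:R) = g s.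
    move=> s2 sP; have q0 := zpoly_sum sP; have s1 := xp_summable s2 (hP 0%N).
    have e n : t n * xp s n.+1%:R = a 0%N n * xp s n.+1%:R + (P 0%N).[n.+1%:R] * xp s n.+1%:R.
      by rewrite /a expr0 mul1r; ring.
    have cv : ccvg (psum (fun n => t n * xp s n.+1%:R)) (g s).
      rewrite (@gE 0%N) ?addr0 // /G /D !addr0.
      have := ccvgD (csum_cvg s1) q0; apply: eq_ccvg => N.
      by rewrite -psumD; apply: eq_bigr => n _; rewrite -e.
    split; last exact: csumE.
    have -> : (fun n => t n * xp s n.+1%:R) = (fun n => a 0%N n * xp s n.+1%:R + (P 0%N).[n.+1%:R] * xp s n.+1%:R).
      by apply/funext.
    apply: csummableD => //.
    have -> : (fun n => (P 0%N).[n.+1%:R] * xp s n.+1%:R) = (fun n =>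
       \sum_(i < size (P 0%N)) (P 0%N)`_i * xp (s - i%:R) n.+1%:R).
      apply/funext => n; rewrite horner_coef mulr_suml; apply: eq_bigr => i _.
      by rewrite -mulrA xp_pow.
    move: sP; elim: (size _) => [|m IH] sP.
      by exists 0 => N; rewrite big1 // => n _; rewrite big_ord0 cabs0.
    rewrite -natr1 in sP.
    have -> : (fun n => \sum_(i < m.+1) (P 0%N)`_i * xp (s - i%:R) n.+1%:R) =
      (fun n => \sum_(i < m) (P 0%N)`_i * xp (s - i%:R) n.+1%:R + (P 0%N)`_m * xp (s - m%:R) n.+1%:R).
      by apply/funext => n; rewrite big_ord_recr.
    apply: csummableD; first by apply: IH; lra.
    apply: (@xp_summable (fun=> (P 0%N)`_m) (cabs (P 0%N)`_m)) => //.
    by rewrite reB -RCnat /=; lra.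
  exists (Num.max 2 ((size (P 0%N))%:R + 1)) => s; rewrite ge_max => /andP[]; exact: hs.
- move=> z; have [K [hK eK]] := gnear z.
  apply: (pole1_ext ltr01 eK); apply: pole1D; last exact: zpoly_pole1.
  apply: (@pole1_jet _ _ _ 1) => // w wz; apply: Djet.
  by have := re_dist z wz; rewrite [z + _]addrC subrK; lra.
move=> z hz; have [K [hK eK]] := gnear z.
apply: (jet_ext ltr01 eK); apply: jetD; first by apply: Djet; lra.
(* The shifted zeta functions can have poles only at the integers [i - K + 1]. *)
apply: zpoly_jet => i; apply: contraNneq (hz (i%:Z - K%:Z + 1)) => ->.
by rewrite !rmorphD rmorphN /= !pmulrn.
Qed.

End ZetaOfExpansion.

(** * Inner products and norms *)

Section InnerProduct.
Context {R : realType} {H : lmodType R[i]} (ip : {dot H for Num.conj}).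
Notation C := R[i].
Implicit Types (x y z : H) (c : C).
Notation nrm := (hnorm ip).

Lemma ip_conj x y : (ip x y)^* = ip y x.
Proof. by rewrite (hermC ip y x) /= expr0 mul1r. Qed.
Lemma ipDl x y z : ip (x + y) z = ip x z + ip y z. Proof. exact: linearDl. Qed.
Lemma ipBl x y z : ip (x - y) z = ip x z - ip y z. Proof. exact: linearBl. Qed.
Lemma ipNl x z : ip (- x) z = - ip x z. Proof. exact: linearNl. Qed.
Lemma ip0l z : ip 0 z = 0. Proof. exact: linear0l. Qed.
Lemma ipZl c x z : ip (c *: x) z = c * ip x z. Proof. exact: linearZl_LR. Qed.
Lemma ipDr x y z : ip z (x + y) = ip z x + ip z y. Proof. exact: linearDr. Qed.
Lemma ipBr x y z : ip z (x - y) = ip z x - ip z y. Proof. exact: linearBr. Qed.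
Lemma ip0r z : ip z 0 = 0. Proof. exact: linear0r. Qed.
Lemma ipZr c x z : ip z (c *: x) = c^* * ip z x. Proof. exact: linearZr_LR. Qed.
Lemma ip_suml I (r : seq I) (P : pred I) (F : I -> H) z :
  ip (\sum_(i <- r | P i) F i) z = \sum_(i <- r | P i) ip (F i) z.
Proof. exact: linear_sumlz. Qed.
Lemma ip_sumr I (r : seq I) (P : pred I) (F : I -> H) z :
  ip z (\sum_(i <- r | P i) F i) = \sum_(i <- r | P i) ip z (F i).
Proof. exact: linear_sumr. Qed.

Lemma nrm_ge0 x : 0 <= nrm x. Proof. exact: sqrtr_ge0. Qed.

Lemma ip_nrm x : ip x x = ((nrm x ^+ 2)%:C)%C.
Proof.
have := dnorm_ge0 ip x; rewrite lecE /= => /andP[/eqP i0 r0].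
rewrite /hnorm sqr_sqrtr //; case: (ip x x) i0 => a b /= -> //.
Qed.

Lemma re_ip_nrm x : re (ip x x) = nrm x ^+ 2. Proof. by rewrite ip_nrm. Qed.

Lemma nrm_eq0 x : nrm x = 0 -> x = 0.
Proof.
by move=> h; apply/eqP; rewrite -(dnorm_eq0 ip) ip_nrm h expr0n.
Qed.

Lemma nrmZ c x : nrm (c *: x) = cabs c * nrm x.
Proof.
apply/eqP; rewrite -(@eqrXn2 _ 2) ?nrm_ge0 ?mulr_ge0 ?cabs_ge0 ?nrm_ge0 //.
rewrite -re_ip_nrm ipZl ipZr mulrA mul_conj ip_nrm -RCM /= exprMn //.
Qed.

Lemma nrmN x : nrm (- x) = nrm x.
Proof. by rewrite -scaleN1r nrmZ cabsN cabs1 mul1r. Qed.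

Lemma nrmC x y : nrm (x - y) = nrm (y - x). Proof. by rewrite -nrmN opprB. Qed.

Lemma cauchy_schwarz x y : cabs (ip x y) <= nrm x * nrm y.
Proof.
have [y0|y0] := eqVneq (nrm y) 0.
  by rewrite y0 (nrm_eq0 y0) ip0r cabs0 mulr0.
have yp : 0 < nrm y by rewrite lt_def y0 nrm_ge0.
pose a := ip x y / ((nrm y ^+ 2)%:C)%C.
have y2 : ((nrm y ^+ 2)%:C)%C != 0 :> C by rewrite eq_complex /= eqxx andbT expf_neq0.
have : 0 <= nrm (x - a *: y) ^+ 2 by exact: sqr_ge0.
have -> : nrm (x - a *: y) ^+ 2 = nrm x ^+ 2 - cabs (ip x y) ^+ 2 / nrm y ^+ 2.
  have e1 : ip (x - a *: y) y = 0 by rewrite ipBl ipZl ip_nrm divfK // subrr.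
  rewrite -re_ip_nrm ipBr ipZr e1 mulr0 subr0 ipBl ipZl reB re_ip_nrm; congr (_ - _).
  by rewrite /a mulrAC -(ip_conj x y) mul_conj -RCV -RCM.
rewrite subr_ge0 ler_pdivrMr ?exprn_gt0 // -exprMn => h.
by rewrite -(@ler_pXn2r _ 2) ?nnegrE ?cabs_ge0 ?mulr_ge0 ?nrm_ge0.
Qed.

Lemma nrmD x y : nrm (x + y) <= nrm x + nrm y.
Proof.
rewrite -(@ler_pXn2r _ 2) ?nnegrE ?nrm_ge0 ?addr_ge0 ?nrm_ge0 //.
rewrite -re_ip_nrm ipDl !ipDr !reD !re_ip_nrm -(ip_conj x y) re_conj sqrrD.
have := cauchy_schwarz x y; have := re_le_cabs (ip x y); have := ler_norm (re (ip x y)).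
lra.
Qed.

Lemma nrmB x y : nrm (x - y) <= nrm x + nrm y.
Proof. by rewrite -(nrmN y) nrmD. Qed.

Lemma hcvgP (u : nat -> H) l :
  hcvg ip u l <-> forall e, 0 < e -> exists N, forall n, (N <= n)%N -> nrm (u n - l) < e.
Proof.
split=> [/cvgrPdist_lt h e e0|h].
  have [N _ hN] := h e e0; exists N => n /hN /=.
  by rewrite sub0r normrN ger0_norm // nrm_ge0.
apply/cvgrPdist_lt => e /h [N hN]; exists N => // n /= /hN.
by rewrite sub0r normrN ger0_norm // nrm_ge0.
Qed.

Lemma hcvg_ip (u : nat -> H) l y : hcvg ip u l -> ccvg (fun n => ip (u n) y) (ip l y).
Proof.
move=> /hcvgP h e e0; have y1 : 0 < nrm y + 1 by have := nrm_ge0 y; lra.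
have [N hN] := h (e / (nrm y + 1)) (divr_gt0 e0 y1).
exists N => n /hN; rewrite -ipBl => a; apply: le_lt_trans (cauchy_schwarz _ _) _.
apply: (@le_lt_trans _ _ (nrm (u n - l) * (nrm y + 1))).
  by rewrite ler_wpM2l ?nrm_ge0 // lerDl.
by rewrite -ltr_pdivlMr.
Qed.

End InnerProduct.

(** * Coefficients in an orthonormal basis, and diagonal operators *)

Section HilbertBasis.
Context {R : realType} {H : lmodType R[i]} (ip : {dot H for Num.conj}).
Context (hilb : hilbert ip) (e : nat -> H) (onb : orthonormal_basis ip e).
Notation C := R[i].
Implicit Types (x y z : H) (c : C) (a b : nat -> C) (S T : oper H).
Notation nrm := (hnorm ip).

Definition hcoef x k : C := ip x (e k).

Lemma ip_basis m n : ip (e m) (e n) = (m == n)%:R. Proof. by have [] := onb. Qed.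

Lemma coef_e m n : hcoef (e m) n = (m == n)%:R. Proof. exact: ip_basis. Qed.

Lemma coef_inj x y : (forall k, hcoef x k = hcoef y k) -> x = y.
Proof.
move=> h; apply/eqP; rewrite -subr_eq0; apply/eqP; have [_] := onb; apply=> n.
by rewrite ipBl -/(hcoef x n) h subrr.
Qed.

Lemma hcoefD x y k : hcoef (x + y) k = hcoef x k + hcoef y k. Proof. exact: ipDl. Qed.
Lemma hcoefB x y k : hcoef (x - y) k = hcoef x k - hcoef y k. Proof. exact: ipBl. Qed.
Lemma hcoefN x k : hcoef (- x) k = - hcoef x k. Proof. exact: ipNl. Qed.
Lemma hcoefZ c x k : hcoef (c *: x) k = c * hcoef x k. Proof. exact: ipZl. Qed.
Lemma hcoef0 k : hcoef 0 k = 0. Proof. exact: ip0l. Qed.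

Definition fsum a N : H := \sum_(k < N) a k *: e k.

Lemma coef_fsum a N k : hcoef (fsum a N) k = if (k < N)%N then a k else 0.
Proof.
rewrite /hcoef ip_suml; have [kN|kN] := ltnP k N.
  rewrite (bigD1 (Ordinal kN)) //= ipZl ip_basis eqxx mulr1 big1 ?addr0 // => i ik.
  by rewrite ipZl ip_basis (_ : (i == k :> nat) = false) ?mulr0 //; exact: negbTE.
rewrite big1 // => i _; rewrite ipZl ip_basis.
by rewrite (_ : (i == k :> nat) = false) ?mulr0 //; apply/eqP; case: i => i /= ? ?; lia.
Qed.

Lemma ip_fsum a N x : ip (fsum a N) x = \sum_(k < N) a k * (hcoef x k)^*.
Proof. by rewrite ip_suml; apply: eq_bigr => i _; rewrite ipZl -ip_conj. Qed.

Lemma nrm_fsum a N : nrm (fsum a N) ^+ 2 = \sum_(k < N) cabs (a k) ^+ 2.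
Proof.
rewrite -re_ip_nrm ip_fsum re_sum; apply: eq_bigr => i _.
by rewrite coef_fsum ltn_ord mul_conj.
Qed.

(** The partial sum pairs with [x] to [s] and has norm the root of [s]; Cauchy-Schwarz compares the
    two. *)
Lemma bessel x N : \sum_(k < N) cabs (hcoef x k) ^+ 2 <= nrm x ^+ 2.
Proof.
set s := \sum_(k < N) _; have s0 : 0 <= s by apply: sumr_ge0 => i _; exact: sqr_ge0.
have h1 : cabs (ip (fsum (hcoef x) N) x) = s.
  rewrite ip_fsum; have -> : \sum_(k < N) hcoef x k * (hcoef x k)^* = (s%:C)%C.
    rewrite /s (big_morph _ (@RCD R) erefl); apply: eq_bigr => i _.
    by rewrite mul_conj.
  by rewrite cabs_real ger0_norm.
have := cauchy_schwarz ip (fsum (hcoef x) N) x; rewrite h1.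
have [-> _|sn] := eqVneq s 0; first exact: sqr_ge0.
have sp : 0 < s by rewrite lt_def sn.
move=> h; rewrite -(ler_pM2l sp) -[X in X * nrm x ^+ 2]nrm_fsum -exprMn -expr2.
by rewrite ler_pXn2r ?nnegrE // mulr_ge0 ?nrm_ge0.
Qed.

(** The squared distance of two partial sums is a difference of values of the bounded increasing
    sequence [A], so they form a Cauchy sequence; continuity of the inner product gives the
    coefficients of the limit. *)
Lemma riesz_fischer a (M : R) : 0 <= M -> (forall N, \sum_(k < N) cabs (a k) ^+ 2 <= M ^+ 2) ->
  exists z, [/\ forall k, hcoef z k = a k, nrm z <= M & hcvg ip (fsum a) z].
Proof.
move=> M0 hM; pose A N := \sum_(k < N) cabs (a k) ^+ 2.
have ndA : {homo A : m n / (m <= n)%N >-> m <= n}.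
  apply: homo_leq => // [x y z|n]; first exact: le_trans.
  by rewrite /A big_ord_recr /= lerDl sqr_ge0.
have cvA : cvgn A.
  apply: nondecreasing_is_cvgn; first by move=> m n; exact: ndA.
  by exists (M ^+ 2) => _ [N _ <-]; exact: hM.
have dA m n : (m <= n)%N -> nrm (fsum a n - fsum a m) ^+ 2 = A n - A m.
  move=> mn; have -> : fsum a n - fsum a m = fsum (fun k => if (k < m)%N then 0 else a k) n.
    apply: coef_inj => k; rewrite hcoefB !coef_fsum.
    by case: (ltnP k m) => km; case: (ltnP k n) => kn; rewrite ?subrr ?subr0 //; lia.
  rewrite nrm_fsum /A (big_ord_widen n (fun k => cabs (a k) ^+ 2) mn).
  rewrite [in X in _ = _ - X]big_mkcond /=.
  rewrite -sumrB; apply: eq_bigr => i _.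
  by case: ltnP => _; rewrite ?subrr ?subr0 // cabs0 expr0n.
have [|z hz] := @hilb (fsum a).
  move=> eps eps0; have e2 : 0 < eps ^+ 2 / 2 by rewrite divr_gt0 // exprn_gt0.
  have /cvg_ex[l hl] := cvA; move/cvgrPdist_lt: hl => /(_ _ e2) [N _ hN].
  exists N.
  have key m n : (N <= m)%N -> (m <= n)%N -> nrm (fsum a n - fsum a m) < eps.
    move=> Nm mn; rewrite -(@ltr_pXn2r _ 2) ?nnegrE ?nrm_ge0 ?(ltW eps0) // dA //.
    have := hN _ Nm; have := hN _ (leq_trans Nm mn).
    by rewrite /= !ltr_norml => /andP[h1 h2] /andP[h3 h4]; lra.
  move=> m n Nm Nn; case: (leqP n m) => mn; first exact: key.
  by rewrite nrmC; apply: key => //; exact: ltnW.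
have ck k : hcoef z k = a k.
  have h1 := hcvg_ip (e k) hz.
  have h2 : ccvg (fun n => ip (fsum a n) (e k)) (a k).
    move=> eps eps0; exists k.+1 => n kn.
    by rewrite -/(hcoef _ _) coef_fsum kn subrr cabs0.
  exact: ccvg_unique h1 h2.
exists z; split=> //; apply/ler_addgt0Pr => eps eps0.
have [N /(_ N (leqnn _)) hN] := (hcvgP _ _ _).1 hz _ eps0.
have hf : nrm (fsum a N) <= M.
  by rewrite -(@ler_pXn2r _ 2) ?nnegrE ?nrm_ge0 // nrm_fsum.
by have := nrmD ip (z - fsum a N) (fsum a N); rewrite subrK nrmC; lra.
Qed.

Lemma fsum_cvg x : hcvg ip (fsum (hcoef x)) x.
Proof.
have [z [hz _ hc]] := riesz_fischer (nrm_ge0 ip x) (bessel x).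
by move: hc; rewrite (coef_inj hz).
Qed.

Lemma ip_cvg x y : ccvg (psum (fun k => hcoef x k * (hcoef y k)^*)) (ip x y).
Proof.
by have := hcvg_ip y (fsum_cvg x); apply: eq_ccvg => n; rewrite ip_fsum.
Qed.

Lemma eq_ip x y x' y' : (forall k, hcoef x k * (hcoef y k)^* = hcoef x' k * (hcoef y' k)^*) ->
  ip x y = ip x' y'.
Proof.
move=> h; have h1 := ip_cvg x y; have := ip_cvg x' y'.
move=> h2; apply: ccvg_unique h1 _; apply: eq_ccvg h2 => N.
by apply: eq_bigr => k _; rewrite h.
Qed.

Lemma nrm_le x (M : R) : 0 <= M -> (forall N, \sum_(k < N) cabs (hcoef x k) ^+ 2 <= M ^+ 2) ->
  nrm x <= M.
Proof.
move=> M0 /(riesz_fischer M0) [z [hz hM _]].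
by rewrite -(coef_inj hz).
Qed.

Lemma dom_sum a x (K : R) : 0 <= K -> (forall k, cabs (a k) <= K * cabs (hcoef x k)) ->
  forall N, \sum_(k < N) cabs (a k) ^+ 2 <= (K * nrm x) ^+ 2.
Proof.
move=> K0 h N; rewrite exprMn; apply: le_trans (ler_wpM2l (sqr_ge0 K) (bessel x N)).
rewrite mulr_sumr; apply: ler_sum => k _; rewrite -exprMn ler_pXn2r ?nnegrE ?cabs_ge0 //.
by rewrite mulr_ge0 ?cabs_ge0.
Qed.

Lemma dom_vec a x (K : R) : 0 <= K -> (forall k, cabs (a k) <= K * cabs (hcoef x k)) ->
  exists2 z, forall k, hcoef z k = a k & nrm z <= K * nrm x.
Proof.
move=> K0 h; have [z [hz hn _]] := riesz_fischer (mulr_ge0 K0 (nrm_ge0 ip x)) (dom_sum K0 h).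
by exists z.
Qed.

Lemma nrm_dom x y (K : R) : 0 <= K -> (forall k, cabs (hcoef x k) <= K * cabs (hcoef y k)) ->
  nrm x <= K * nrm y.
Proof.
by move=> K0 h; apply: nrm_le; [rewrite mulr_ge0 ?nrm_ge0|exact: dom_sum].
Qed.

Lemma coef_le_nrm x k : cabs (hcoef x k) <= nrm x.
Proof.
have := bessel x k.+1; rewrite big_ord_recr /= => h.
rewrite -(@ler_pXn2r _ 2) ?nnegrE ?cabs_ge0 ?nrm_ge0 //; apply: le_trans h.
by rewrite lerDr sumr_ge0 // => i _; exact: sqr_ge0.
Qed.

Lemma nrm_e k : nrm (e k) = 1.
Proof. by rewrite /hnorm ip_basis eqxx /= sqrtr1. Qed.

Lemma dense_fsum (W : set H) : (forall a N, W (fsum a N)) -> hdense ip W.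
Proof.
move=> h x eps eps0; have [N /(_ N (leqnn _)) hN] := (hcvgP _ _ _).1 (fsum_cvg x) _ eps0.
by exists (fsum (hcoef x) N) => //; rewrite nrmC.
Qed.

(** The domain is maximal: all [x] whose multiplied coefficients belong to a vector. With this
    domain the operator is self-adjoint for real [a]. *)
Definition Diag a : oper H := [set p | forall k, hcoef p.2 k = a k * hcoef p.1 k].

Lemma Diag_uniq a x y y' : Diag a (x, y) -> Diag a (x, y') -> y = y'.
Proof. by move=> h h'; apply: coef_inj => k; rewrite h h'. Qed.

Lemma Diag_linear a : linear_op (Diag a).
Proof.
split=> [k|c x y x' y' h h' k|x y z]; last exact: Diag_uniq.
  by rewrite /= !hcoef0 mulr0.
by rewrite /= !hcoefD !hcoefZ h h' /=; ring.
Qed.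

Lemma Diag_fsum a b N : Diag a (fsum b N, fsum (fun k => a k * b k) N).
Proof. by move=> k /=; rewrite !coef_fsum; case: ifP; rewrite ?mulr0. Qed.

Lemma Diag_dense a : hdense ip (dom (Diag a)).
Proof. by apply: dense_fsum => b N; exists (fsum (fun k => a k * b k) N); exact: Diag_fsum. Qed.

Lemma Diag_ex a (K : R) : 0 <= K -> (forall k, cabs (a k) <= K) ->
  forall x, exists2 y, Diag a (x, y) & nrm y <= K * nrm x.
Proof.
move=> K0 h x; have [|z hz hn] := @dom_vec (fun k => a k * hcoef x k) x K K0.
  by move=> k; rewrite cabsM ler_wpM2r ?cabs_ge0.
by exists z.
Qed.

Lemma Diag_bounded a (K : R) : (forall k, cabs (a k) <= K) -> bounded_op ip (Diag a).
Proof.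
move=> h; have K0 : 0 <= K := le_trans (cabs_ge0 _) (h 0%N).
split; first exact: Diag_linear.
  by apply/seteqP; split=> // x _; have [y hy _] := Diag_ex K0 h x; exists y.
exists K => x y hxy; have [y' hy' hn] := Diag_ex K0 h x.
by rewrite (Diag_uniq hxy hy').
Qed.

Lemma opV_Diag a : (forall k, a k != 0) -> opV (Diag a) = Diag (fun k => (a k)^-1).
Proof.
move=> a0; apply/seteqP; split=> -[x y] /= h k.
  by have := h k => /= ->; rewrite mulKf.
by have := h k => /= ->; rewrite mulVKf.
Qed.

(** A product of relations has the natural domain; the bound on [b] makes the intermediate vector
    exist whenever the result does. *)
Lemma opM_Diag a b (K : R) : 0 <= K -> (forall k, cabs (b k) <= K * cabs (a k * b k)) ->
  opM (Diag a) (Diag b) = Diag (fun k => a k * b k).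
Proof.
move=> K0 h; apply/seteqP; split=> -[x y] /=.
  by case=> z hz hy k /=; rewrite hy hz /= mulrA.
move=> hy; have [|z hz _] := @dom_vec (fun k => b k * hcoef x k) y K K0.
  by move=> k; rewrite hy /= !cabsM mulrA ler_wpM2r ?cabs_ge0 // -cabsM.
by exists z => // k /=; rewrite hz hy mulrA.
Qed.

Lemma opM_Diag_bounded a b (K : R) : (forall k, cabs (b k) <= K) ->
  opM (Diag a) (Diag b) = Diag (fun k => a k * b k).
Proof.
move=> h; have K0 : 0 <= K := le_trans (cabs_ge0 _) (h 0%N).
apply/seteqP; split=> -[x y] /=.
  by case=> z hz hy k /=; rewrite hy hz /= mulrA.
move=> hy; have [z hz _] := Diag_ex K0 h x.
by exists z => // k /=; rewrite hy hz /= mulrA.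
Qed.

(** The basis vectors lie in every diagonal domain, and testing on them determines the coefficients
    of an adjoint vector. *)
Lemma adjoint_Diag a : adjoint ip (Diag a) = Diag (fun k => (a k)^*).
Proof.
apply/seteqP; split=> -[x y] /= h => [k|[u v] hu /=].
  have := h (e k, a k *: e k); rewrite /= ipZl => hk.
  rewrite /hcoef -(ip_conj ip (e k) y) -(ip_conj ip (e k) x) -rmorphM; congr (_^*).
  rewrite hk // => j /=; rewrite hcoefZ !coef_e.
  by case: eqP => [->|]; rewrite ?mulr0.
by apply: eq_ip => k; rewrite h hu /= rmorphM /= conjCK; ring.
Qed.

Lemma Diag_self_adjoint a : (forall k, (a k)^* = a k) -> self_adjoint ip (Diag a).
Proof.
move=> h; split; [exact: Diag_linear|exact: Diag_dense|].
by rewrite adjoint_Diag; congr Diag; apply/funext.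
Qed.

(** An eigenvector for [t] has nonzero coefficients only where [d k = t], so the condition for all
    eigenvectors follows from the one for basis vectors. *)
Lemma fcalc_Diag (f : R -> C) (d : nat -> R) :
  fcalc ip f (Diag (fun k => ((d k)%:C)%C)) = Diag (fun k => f (d k)).
Proof.
apply/seteqP; split=> -[x y] /= h.
  move=> k /=; apply: (h (e k) (d k)) => j /=; rewrite hcoefZ !coef_e.
  by case: eqP => [->|]; rewrite ?mulr0.
move=> v t hv.
have -> : f t * ip x v = ip (f t *: x) v by rewrite ipZl.
apply: eq_ip => k; rewrite hcoefZ h /=; have := hv k; rewrite /= hcoefZ => hk.
have [->|v0] := eqVneq (hcoef v k) 0; first by rewrite rmorph0 !mulr0.
have : ((d k)%:C)%C = (t%:C)%C :> C by apply: (mulIf v0); rewrite -hk.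
by move=> hdt; have -> : d k = t by case: hdt.
Qed.

Lemma Diag1 : Diag (fun=> 1) = op1.
Proof.
apply/seteqP; split=> -[x y] /= h; last by move: h; rewrite /op1 /= => -> k /=; rewrite mul1r.
by apply: coef_inj => k; rewrite h /= mul1r.
Qed.

End HilbertBasis.

(** * Diagonal subsequences *)

Section DiagonalSubsequence.
Context {R : realType}.
Notation C := R[i].

(** The cube [[-1, 1]^nat] is compact by Tychonoff's theorem. [p] is a cluster point, and [s m] is
    picked beyond the previous index in the neighbourhood of [p] that controls the first [m]
    coordinates. *)
Lemma diagonal_subsequence (c : nat -> nat -> R) : (forall n k, `|c n k| <= 1) ->
  exists (p : nat -> R) (s : nat -> nat), {homo s : m n / (m < n)%N} /\
    forall m k, (k < m)%N -> `|c (s m) k - p k| < m.+1%:R^-1.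
Proof.
move=> hc.
have /(_ _ (fmap_proper_filter c eventually_filter)) [] :=
  @tychonoff nat (fun=> R) (fun=> `[-1, 1]%classic) (fun=> @segment_compact R (-1) 1).
  by exists 0%N => // n _ k; rewrite /= in_itv /= -ler_norml; exact: hc.
move=> p [_ clp]; exists p.
have nbh m : nbhs (p : prod_topology (fun _ : nat => R))
    [set f : prod_topology (fun _ : nat => R) | forall k, (k < m)%N -> `|f k - p k| < m.+1%:R^-1].
  suff h (N : nat) : nbhs (p : prod_topology (fun _ : nat => R))
    [set f : prod_topology (fun _ : nat => R) | forall k, (k < N)%N -> `|f k - p k| < m.+1%:R^-1].
    exact: h.
  elim: N => [|N IH]; first by apply: filterE.
  have h := @proj_continuous nat (fun=> R) N p
    (ball (p N) m.+1%:R^-1) (nbhsx_ballx (p N) m.+1%:R^-1 _).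
  have {}h : nbhs (p : prod_topology (fun _ : nat => R)) (fun f => ball (p N) m.+1%:R^-1 (f N)).
    by apply: h; rewrite invr_gt0.
  apply: filterS2 IH h => f hf; rewrite /ball /= => hN k; rewrite ltnS leq_eqVlt => /orP[/eqP ->|/hf //].
  by rewrite distrC.
have ex (m N : nat) : exists n, (N < n)%N /\ forall k, (k < m)%N -> `|c n k - p k| < m.+1%:R^-1.
  have [|f [[n /= Nn <-] hn]] := clp (c @` [set n | (N < n)%N]) _ _ (nbh m).
    by exists N.+1 => // n Nn; exists n.
  by exists n.
have [g hg] : {g : nat -> nat -> nat | forall m N, (N < g m N)%N /\
    forall k, (k < m)%N -> `|c (g m N) k - p k| < m.+1%:R^-1}.
  exists (fun m N => projT1 (cid (ex m N))) => m N; exact: projT2 (cid (ex m N)).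
pose s := fix s m := if m is m'.+1 then g m (s m') else 0%N.
exists s; split; first by apply: homo_ltn => [|n]; [exact: ltn_trans|have [] := hg n.+1 (s n)].
by case=> // m k km; have [_] := hg m.+1 (s m); apply.
Qed.

(** Real and imaginary parts are interleaved as even and odd coordinates of one real sequence; the
    factor 2 adds their errors. *)
Lemma diagonal_subsequenceC (c : nat -> nat -> C) : (forall n k, cabs (c n k) <= 1) ->
  exists (p : nat -> C) (s : nat -> nat), {homo s : m n / (m < n)%N} /\
    forall m k, (k < m)%N -> cabs (c (s m) k - p k) <= 2 / m.+1%:R.
Proof.
move=> hc; pose c' n k := if odd k then im (c n k./2) else re (c n k./2).
have [|p [s [hs hp]]] := @diagonal_subsequence c'.
  move=> n k; rewrite /c'; case: ifP => _.
    by apply: le_trans (hc n k./2); exact: im_le_cabs.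
  by apply: le_trans (hc n k./2); exact: re_le_cabs.
exists (fun k => Complex (p k.*2) (p k.*2.+1)), (fun m => s m.*2); split.
  by move=> m n mn; apply: hs; rewrite ltn_double.
move=> m k km; apply: le_trans (cabs_le_reim _) _.
have h1 : `|re (c (s m.*2) k) - p k.*2| <= m.+1%:R^-1.
  have := hp m.*2 k.*2; rewrite /c' odd_double doubleK ltn_double => /(_ km) /ltW h.
  by apply: le_trans h _; rewrite lef_pV2 ?posrE // ler_nat ltnS -addnn leq_addr.
have h2 : `|im (c (s m.*2) k) - p k.*2.+1| <= m.+1%:R^-1.
  have := hp m.*2 k.*2.+1; rewrite /c' /= odd_double uphalf_double -doubleS.
  have -> : (k.*2.+1 < m.*2)%N by lia.
  move=> /(_ isT) /ltW h.
  by apply: le_trans h _; rewrite lef_pV2 ?posrE // ler_nat ltnS -addnn leq_addr.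
case: (c (s m.*2) k) h1 h2 => a b /= h1 h2.
by rewrite mulrC mulr_natr mulr2n lerD.
Qed.

End DiagonalSubsequence.

(** * Smooth vectors *)

Section RapidVectors.
Context {R : realType} {H : lmodType R[i]} (ip : {dot H for Num.conj}).
Context (e : nat -> H) (d : nat -> R).
Notation C := R[i].

(** The vectors in all domains of [|D|^n], expressed through coefficients ([HinfP]). Packaged as a
    type, they let operators be total functions. *)
Definition rapid : {pred H} := [pred x | `[< forall n : nat, exists M : R,
  forall k, `|d k| ^+ n * cabs (hcoef ip e x k) <= M >]].

Fact rapid_submod : submod_closed rapid.
Proof.
split.
  by apply/asboolP => n; exists 0 => k; rewrite hcoef0 cabs0 mulr0.
move=> c x y /asboolP hx /asboolP hy; apply/asboolP => n.
have [M hM] := hx n; have [M' hM'] := hy n; exists (cabs c * M + M') => k.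
have p : 0 <= `|d k| ^+ n by rewrite exprn_ge0.
rewrite hcoefD hcoefZ; apply: le_trans (ler_wpM2l p (cabsD _ _)) _.
by rewrite mulrDr cabsM mulrCA lerD // ler_wpM2l ?cabs_ge0.
Qed.
HB.instance Definition _ := GRing.isSubmodClosed.Build C H rapid rapid_submod.

Record smoothv := MkSmooth { Vval :> H; VvalP : Vval \in rapid }.
HB.instance Definition _ := [isSub for Vval].
HB.instance Definition _ := [Choice of smoothv by <:].
HB.instance Definition _ := [SubChoice_isSubLmodule of smoothv by <:].

Lemma VvalD (x y : smoothv) : Vval (x + y) = Vval x + Vval y. Proof. by []. Qed.
Lemma VvalB (x y : smoothv) : Vval (x - y) = Vval x - Vval y. Proof. by []. Qed.
Lemma VvalN (x : smoothv) : Vval (- x) = - Vval x. Proof. by []. Qed.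
Lemma VvalZ c (x : smoothv) : Vval (c *: x) = c *: Vval x. Proof. by []. Qed.
Lemma Vval0 : Vval 0 = 0. Proof. by []. Qed.
Lemma Vval_inj (x y : smoothv) : Vval x = Vval y -> x = y. Proof. exact: val_inj. Qed.
Lemma Vval_sum I (r : seq I) (P : pred I) (f : I -> smoothv) :
  Vval (\sum_(i <- r | P i) f i) = \sum_(i <- r | P i) Vval (f i).
Proof. exact: (big_morph _ VvalD Vval0). Qed.

End RapidVectors.

(** * Operators of finite order on the Sobolev scale *)

Section OperatorOrder.
Context {R : realType} {H : lmodType R[i]} (ip : {dot H for Num.conj}).
Context (hilb : hilbert ip) (e : nat -> H) (onb : orthonormal_basis ip e).
(** The constant 3 is that of the enumeration [0, 1, -1, 2, -2, ...] of the frequencies, attained at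
    [-1]. The growth condition turns decay in [|d k|] into decay in the index [k]. *)
Context (d : nat -> R) (d_ge1 : forall k, 1 <= `|d k|)
  (d_growth : forall k, k.+1%:R <= 3 * `|d k|).
Notation C := R[i].
Notation nrm := (hnorm ip).
Notation coef := (hcoef ip e).
Notation V := (smoothv ip e d).
Implicit Types (x y : H) (u v w : V) (a b : nat -> C) (f g : V -> V).

Lemma d_gt0 k : 0 < `|d k|. Proof. exact: lt_le_trans (d_ge1 k). Qed.

(** By [d_growth] the squares are at most [9 M^2 / (k+1)^2], with sum at most [18 M^2]; 5 is the
    least integer whose square exceeds 18. *)
Lemma invsq_sum a (M : R) : 0 <= M -> (forall k, cabs (a k) * `|d k| <= M) ->
  forall N, \sum_(k < N) cabs (a k) ^+ 2 <= (5 * M) ^+ 2.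
Proof.
move=> M0 h N; have s := sum_invsq (R := R) N.
have M2 : 0 <= 9 * M ^+ 2 by rewrite mulr_ge0 // sqr_ge0.
apply: (@le_trans _ _ (9 * M ^+ 2 * \sum_(k < N) (k.+1%:R ^+ 2)^-1)); last first.
  apply: le_trans (ler_wpM2l M2 s) _; rewrite exprMn; have := sqr_ge0 M; lra.
rewrite mulr_sumr; apply: ler_sum => k _.
have k0 : 0 < k.+1%:R :> R by [].
rewrite ler_pdivlMr ?exprn_gt0 // -exprMn.
have -> : 9 * M ^+ 2 = (3 * M) ^+ 2 by rewrite exprMn; congr (_ * _); rewrite expr2 -natrM.
rewrite ler_pXn2r ?nnegrE ?mulr_ge0 ?cabs_ge0 //.
apply: le_trans (ler_wpM2l (cabs_ge0 _) (d_growth k)) _.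
by rewrite mulrCA ler_wpM2l.
Qed.

Lemma rapidP x : reflect (forall n : nat, exists M : R,
  forall k, `|d k| ^+ n * cabs (coef x k) <= M) (x \in rapid ip e d).
Proof. exact: asboolP. Qed.

Lemma coefV v (n : nat) : exists M, forall k, `|d k| ^+ n * cabs (coef v k) <= M.
Proof. by case: v => x /= /rapidP. Qed.

Lemma smooth_ex a : (forall n : nat, exists M : R, forall k, `|d k| ^+ n * cabs (a k) <= M) ->
  exists v, forall k, coef v k = a k.
Proof.
move=> h; have [M hM] := h 1%N.
have M0 : 0 <= M by apply: le_trans (hM 0%N); rewrite mulr_ge0 ?cabs_ge0.
have hs : forall k, cabs (a k) * `|d k| <= M by move=> k; rewrite mulrC -[X in X * _]expr1.
have M5 : 0 <= 5 * M by rewrite mulr_ge0.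
have [z [hz _ _]] := riesz_fischer hilb onb M5 (invsq_sum M0 hs).
have hr : z \in rapid ip e d.
  by apply/rapidP => n; have [M' hM'] := h n; exists M' => k; rewrite hz.
by exists (MkSmooth hr).
Qed.

Lemma smooth_inj v w : (forall k, coef v k = coef w k) -> v = w.
Proof. by move=> h; apply: Vval_inj; exact: (coef_inj onb). Qed.

(** For polynomially bounded [a] a vector with these coefficients exists ([coef_vdiag]), so that the
    default 0 is not met. *)
Definition vdiag a v : V := xget 0 [set w : V | forall k, coef w k = a k * coef v k].

Definition pbnd a := exists (n : nat) (K : R), forall k, cabs (a k) <= K * `|d k| ^+ n.

Lemma coef_vdiag a v k : pbnd a -> coef (vdiag a v) k = a k * coef v k.
Proof.
move=> [m [K hK]]; rewrite /vdiag; case: xgetP => [w _ -> //|no].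
have [|w hw] := @smooth_ex (fun k => a k * coef v k); last by have := no _ hw.
move=> n; have [M hM] := coefV v (n + m); exists (`|K| * M) => j.
apply: le_trans (ler_wpM2l (normr_ge0 K) (hM j)).
rewrite cabsM exprD mulrA [leRHS]mulrA ler_wpM2r ?cabs_ge0 // mulrCA.
rewrite ler_wpM2l ?exprn_ge0 //; apply: le_trans (hK j) _.
by rewrite ler_wpM2r ?exprn_ge0 // ler_norm.
Qed.

Lemma vdiag_linear a : pbnd a -> linear (vdiag a).
Proof.
move=> pa c v w; apply: smooth_inj => k.
by rewrite VvalD VvalZ hcoefD hcoefZ !coef_vdiag // VvalD VvalZ hcoefD hcoefZ; ring.
Qed.

Lemma pbndM a b : pbnd a -> pbnd b -> pbnd (fun k => a k * b k).
Proof.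
move=> [n [K hK]] [m [L hL]]; exists (n + m)%N, (K * L) => k.
by rewrite cabsM exprD mulrACA; apply: ler_pM; rewrite ?cabs_ge0.
Qed.

Lemma pbnd_bounded a (K : R) : (forall k, cabs (a k) <= K) -> pbnd a.
Proof. by move=> h; exists 0%N, K => k; rewrite expr0 mulr1. Qed.

Lemma vdiag_comp a b v : pbnd a -> pbnd b -> vdiag a (vdiag b v) = vdiag (fun k => a k * b k) v.
Proof.
move=> pa pb; apply: smooth_inj => k; rewrite !coef_vdiag //; first by rewrite mulrA.
exact: pbndM.
Qed.

Lemma vdiagC a b v : pbnd a -> pbnd b -> vdiag a (vdiag b v) = vdiag b (vdiag a v).
Proof.
move=> pa pb; rewrite !vdiag_comp //; congr vdiag.
by apply/funext => k; rewrite mulrC.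
Qed.

Definition dpow (q : int) k : C := ((`|d k| ^ q)%:C)%C.

Lemma cabs_dpow q k : cabs (dpow q k) = `|d k| ^ q.
Proof. by rewrite cabs_real ger0_norm // exprz_ge0. Qed.

Lemma d_neq0 k : `|d k| != 0. Proof. by rewrite gt_eqF // d_gt0. Qed.

Lemma dpowD q r k : dpow (q + r) k = dpow q k * dpow r k.
Proof. by rewrite /dpow -RCM expfzDr // d_neq0. Qed.

Lemma dpow0 k : dpow 0 k = 1. Proof. by []. Qed.

Lemma dpow_neq0 q k : dpow q k != 0.
Proof. by rewrite eq_complex /= eqxx andbT expfz_neq0 // d_neq0. Qed.

Lemma dpowN q k : dpow (- q) k = (dpow q k)^-1.
Proof.
by apply: (mulfI (dpow_neq0 q k)); rewrite -dpowD subrr dpow0 divff // dpow_neq0.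
Qed.

Lemma dpow_le q r k : q <= r -> `|d k| ^ q <= `|d k| ^ r.
Proof. by move=> qr; rewrite ler_weXz2l. Qed.

Lemma pbnd_dpow q : pbnd (dpow q).
Proof.
exists `|q|%N, 1 => k; rewrite cabs_dpow mul1r.
by apply: le_trans (dpow_le k (lez_abs q)) _.
Qed.

Definition Apow q v : V := vdiag (dpow q) v.

Lemma coef_Apow q v k : coef (Apow q v) k = dpow q k * coef v k.
Proof. by rewrite coef_vdiag //; exact: pbnd_dpow. Qed.

Lemma ApowD q r v : Apow q (Apow r v) = Apow (q + r) v.
Proof. by apply: smooth_inj => k; rewrite !coef_Apow dpowD mulrA. Qed.

Lemma Apow0 v : Apow 0 v = v.
Proof. by apply: smooth_inj => k; rewrite coef_Apow dpow0 mul1r. Qed.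

Lemma ApowNK q v : Apow (- q) (Apow q v) = v.
Proof. by rewrite ApowD addNr Apow0. Qed.

Lemma ApowKN q v : Apow q (Apow (- q) v) = v.
Proof. by rewrite ApowD subrr Apow0. Qed.

Lemma Apow_linear q : linear (Apow q). Proof. exact/vdiag_linear/pbnd_dpow. Qed.

Lemma linear0f f : linear f -> f 0 = 0.
Proof. by move=> h; have := h (-1) 0 0; rewrite scaler0 addr0 scaleN1r addNr. Qed.
Lemma linearDf f v w : linear f -> f (v + w) = f v + f w.
Proof. by move=> h; have := h 1 v w; rewrite !scale1r. Qed.
Lemma linearZf f c v : linear f -> f (c *: v) = c *: f v.
Proof. by move=> h; have := h c v 0; rewrite (linear0f h) !addr0. Qed.
Lemma linearNf f v : linear f -> f (- v) = - f v.
Proof. by move=> h; rewrite -scaleN1r linearZf // scaleN1r. Qed.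
Lemma linearBf f v w : linear f -> f (v - w) = f v - f w.
Proof. by move=> h; rewrite linearDf // linearNf. Qed.

(** The Sobolev norm of order [q], of either sign. *)
Definition snorm (q : int) v : R := nrm (Apow q v).

Lemma snorm_ge0 q v : 0 <= snorm q v. Proof. exact: nrm_ge0. Qed.

Lemma snorm_le q r v : q <= r -> snorm q v <= snorm r v.
Proof.
move=> qr; rewrite /snorm -[leRHS]mul1r; apply: (nrm_dom hilb onb) => // k.
rewrite !coef_Apow !cabsM mul1r !cabs_dpow ler_wpM2r ?cabs_ge0 //; exact: dpow_le.
Qed.

Lemma snorm_Apow q r v : snorm q (Apow r v) = snorm (q + r) v.
Proof. by rewrite /snorm ApowD. Qed.

Lemma snorm0 v : snorm 0 v = nrm v. Proof. by rewrite /snorm Apow0. Qed.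

Lemma snormD q v w : snorm q (v + w) <= snorm q v + snorm q w.
Proof. by rewrite /snorm (linearDf _ _ (Apow_linear q)) VvalD nrmD. Qed.

Lemma snormZ q c v : snorm q (c *: v) = cabs c * snorm q v.
Proof. by rewrite /snorm (linearZf _ _ (Apow_linear q)) VvalZ nrmZ. Qed.

(** The estimate is demanded at all Sobolev orders, negative ones included, because composition with
    powers of [|D|] shifts the scale in both directions. *)
Definition OP (q : int) f := linear f /\
  forall k : int, exists M : R, forall v, snorm k (f v) <= M * snorm (k + q) v.

Lemma OP_pos q f : OP q f -> forall k, exists2 M : R, 0 <= M &
  forall v, snorm k (f v) <= M * snorm (k + q) v.
Proof.
move=> [_ h] k; have [M hM] := h k; exists `|M| => // v; apply: le_trans (hM v) _.
by rewrite ler_wpM2r ?snorm_ge0 // ler_norm.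
Qed.

Lemma OP_lin q f : OP q f -> linear f. Proof. by case. Qed.

Lemma OP_comp q r f g : OP q f -> OP r g -> OP (r + q) (f \o g).
Proof.
move=> of_ og; split=> [c v w|k].
  by rewrite /= (OP_lin og) (OP_lin of_).
have [M M0 hM] := OP_pos of_ k; have [M' M'0 hM'] := OP_pos og (k + q).
exists (M * M') => v; apply: le_trans (hM _) _.
by rewrite -mulrA ler_wpM2l // addrA addrAC hM'.
Qed.

Lemma OP_add q f g : OP q f -> OP q g -> OP q (fun v => f v + g v).
Proof.
move=> of_ og; split=> [c v w|k].
  by rewrite (OP_lin of_) (OP_lin og) scalerDr addrACA.
have [M M0 hM] := OP_pos of_ k; have [M' M'0 hM'] := OP_pos og k.
exists (M + M') => v; apply: le_trans (snormD _ _ _) _.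
by rewrite mulrDl lerD.
Qed.

Lemma OP_scale q c f : OP q f -> OP q (fun v => c *: f v).
Proof.
move=> of_; split=> [b v w|k].
  by rewrite (OP_lin of_) scalerDr !scalerA mulrC.
have [M M0 hM] := OP_pos of_ k; exists (cabs c * M) => v.
by rewrite snormZ -mulrA ler_wpM2l ?cabs_ge0.
Qed.

Lemma OP_opp q f : OP q f -> OP q (fun v => - f v).
Proof.
move=> /(OP_scale (-1)); congr OP; apply/funext => v; exact: scaleN1r.
Qed.

Lemma OP_sub q f g : OP q f -> OP q g -> OP q (fun v => f v - g v).
Proof. by move=> h /OP_opp; exact: OP_add. Qed.

Lemma OP_le q r f : q <= r -> OP q f -> OP r f.
Proof.
move=> qr of_; split; first exact: OP_lin of_.
move=> k; have [M M0 hM] := OP_pos of_ k; exists M => v; apply: le_trans (hM v) _.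
by rewrite ler_wpM2l // snorm_le // lerD2l.
Qed.

Lemma OP_zero q : OP q (fun=> 0).
Proof.
split=> [c v w|k]; first by rewrite scaler0 addr0.
by exists 0 => v; rewrite mul0r -(scale0r 0) snormZ cabs0 mul0r.
Qed.

Lemma OP_vdiag q a (K : R) : (forall k, cabs (a k) <= K * `|d k| ^ q) -> OP q (vdiag a).
Proof.
move=> h.
have K0 : 0 <= K.
  by have := le_trans (cabs_ge0 _) (h 0%N); rewrite pmulr_lge0 // exprz_gt0 // d_gt0.
have pa : pbnd a.
  exists `|q|%N, K => k; apply: le_trans (h k) _; rewrite ler_wpM2l //.
  by apply: le_trans (dpow_le k (lez_abs q)) _.
split=> [|k]; first exact: vdiag_linear.
exists K => v; apply: (nrm_dom hilb onb) => // j.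
rewrite !coef_Apow coef_vdiag // !cabsM !cabs_dpow expfzDr ?d_neq0 //.
rewrite mulrA [leRHS]mulrA ler_wpM2r ?cabs_ge0 // mulrCA.
by rewrite ler_wpM2l ?exprz_ge0.
Qed.

Lemma OP_Apow q : OP q (Apow q).
Proof. by apply: (@OP_vdiag _ _ 1) => k; rewrite mul1r cabs_dpow. Qed.

Lemma OP_id : OP 0 id.
Proof. by split=> // k; exists 1 => v; rewrite mul1r addr0. Qed.

Definition sgd k : C := ((Num.sg (d k))%:C)%C.

Lemma cabs_sgd k : cabs (sgd k) = 1.
Proof.
rewrite cabs_real normr_sg; have := d_neq0 k; rewrite normr_eq0 => ->.
by [].
Qed.

Lemma pbnd_sgd : pbnd sgd.
Proof. by apply: (@pbnd_bounded _ 1) => k; rewrite cabs_sgd. Qed.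

Definition Fphase v : V := vdiag sgd v.

Lemma coef_F v k : coef (Fphase v) k = sgd k * coef v k.
Proof. by rewrite coef_vdiag //; exact: pbnd_sgd. Qed.

Lemma sgd_sq k : sgd k * sgd k = 1.
Proof.
rewrite /sgd -RCM -expr2; have := d_neq0 k; rewrite normr_eq0 => dk.
by rewrite sqr_sg dk.
Qed.

Lemma FK v : Fphase (Fphase v) = v.
Proof. by apply: smooth_inj => k; rewrite !coef_F mulrA sgd_sq mul1r. Qed.

Lemma F_Apow q v : Fphase (Apow q v) = Apow q (Fphase v).
Proof. by apply: vdiagC; [exact: pbnd_sgd|exact: pbnd_dpow]. Qed.

Lemma OP_F : OP 0 Fphase.
Proof. by apply: (@OP_vdiag _ _ 1) => k; rewrite mul1r cabs_sgd. Qed.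

Lemma snorm_F q v : snorm q (Fphase v) = snorm q v.
Proof.
have h w : snorm q (Fphase w) <= snorm q w.
  rewrite -[leRHS]mul1r; apply: (nrm_dom hilb onb) => // k.
  by rewrite !coef_Apow coef_F !cabsM cabs_sgd !mul1r.
by apply/eqP; rewrite eq_le h /= -{1}(FK v) h.
Qed.

Definition smoothing f := forall q, OP q f.

Lemma e_rapid k : e k \in rapid ip e d.
Proof.
apply/rapidP => n; exists (`|d k| ^+ n) => j; rewrite coef_e //.
case: eqP => [->|_]; first by rewrite cabs1 mulr1.
by rewrite cabs0 mulr0 exprn_ge0.
Qed.

Definition ve k : V := MkSmooth (e_rapid k).

Lemma coef_ve m n : coef (ve m) n = (m == n)%:R. Proof. exact: coef_e. Qed.

Lemma vdiag_ve a k : pbnd a -> vdiag a (ve k) = a k *: ve k.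
Proof.
move=> pa; apply: smooth_inj => j; rewrite coef_vdiag // VvalZ hcoefZ !coef_ve.
by case: eqP => [->|]; rewrite ?mulr0.
Qed.

Lemma Apow_ve q k : Apow q (ve k) = dpow q k *: ve k.
Proof. exact/vdiag_ve/pbnd_dpow. Qed.

Lemma F_ve k : Fphase (ve k) = sgd k *: ve k.
Proof. exact/vdiag_ve/pbnd_sgd. Qed.

Definition vsum a N : V := \sum_(k < N) a k *: ve k.

Lemma Vval_vsum a N : Vval (vsum a N) = fsum e a N.
Proof. by rewrite /vsum Vval_sum. Qed.

Lemma linear_vsum f a N : linear f -> f (vsum a N) = \sum_(k < N) a k *: f (ve k).
Proof.
move=> lf; rewrite /vsum; elim: N => [|N IH]; first by rewrite !big_ord0 linear0f.
by rewrite !big_ord_recr /= linearDf // linearZf // IH.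
Qed.

Lemma approx x (eps : R) : 0 < eps -> exists v : V, nrm (x - Vval v) < eps.
Proof.
move=> e0; have [N /(_ N (leqnn _)) hN] := (hcvgP _ _ _).1 (fsum_cvg hilb onb x) _ e0.
by exists (vsum (coef x) N); rewrite Vval_vsum nrmC.
Qed.

Lemma approxV v (eps : R) : 0 < eps -> exists N, nrm (Vval v - Vval (vsum (coef v) N)) < eps.
Proof.
move=> e0; have [N /(_ N (leqnn _)) hN] := (hcvgP _ _ _).1 (fsum_cvg hilb onb v) _ e0.
by exists N; rewrite Vval_vsum nrmC.
Qed.

Lemma small_eq0 (z : C) (K : R) : 0 <= K -> (forall eps, 0 < eps -> cabs z <= K * eps) -> z = 0.
Proof.
move=> K0 h; apply: cabs0_eq0; apply/eqP; rewrite eq_le cabs_ge0 andbT.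
apply/ler_addgt0Pr => eps e0; rewrite add0r.
have K1 : 0 < K + 1 by lra.
apply: le_trans (h (eps / (K + 1)) (divr_gt0 e0 K1)) _.
by rewrite mulrCA ler_piMr ?(ltW e0) // ler_pdivrMr // mul1r lerDl.
Qed.

(** * Bounded extensions of operators on smooth vectors *)

Definition bdd g := linear g /\ exists2 M : R, 0 <= M & forall v, nrm (g v) <= M * nrm v.

Lemma OP0_bdd g : OP 0 g -> bdd g.
Proof.
move=> og; split; first exact: OP_lin og.
have [M M0 hM] := OP_pos og 0; exists M => // v.
by have := hM v; rewrite addr0 !snorm0.
Qed.

Definition adjp f g := forall v w : V, ip (f v) w = ip v (g w).

Lemma adjpC f g : adjp f g -> adjp g f.
Proof. by move=> h v w; rewrite -(ip_conj ip w) -h ip_conj. Qed.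

Lemma linear_opB T x y x' y' : linear_op T -> T (x, y) -> T (x', y') -> T (x - x', y - y').
Proof.
move=> [_ l _] h h'; have := l (-1) _ _ _ _ h' h.
by rewrite !scaleN1r ![- _ + _]addrC.
Qed.

Lemma bounded_pos T : bounded_op ip T ->
  exists2 M : R, 0 <= M & forall x y, T (x, y) -> nrm y <= M * nrm x.
Proof.
move=> [_ _ [M hM]]; exists `|M| => // x y /hM /le_trans; apply.
by rewrite ler_wpM2r ?nrm_ge0 // ler_norm.
Qed.

Lemma bounded_ex T x : bounded_op ip T -> exists y, T (x, y).
Proof. by move=> [_ dT _]; have : dom T x by rewrite dT. Qed.

Lemma bounded_fun T x y y' : bounded_op ip T -> T (x, y) -> T (x, y') -> y = y'.
Proof. by move=> [[_ _ u] _ _]; exact: u. Qed.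

Lemma bounded_sub_eq S T : S `<=` T -> bounded_op ip S -> bounded_op ip T -> S = T.
Proof.
move=> ST bS bT; apply/seteqP; split=> // -[x y] h.
by have [z hz] := bounded_ex x bS; rewrite (bounded_fun bT h (ST _ hz)).
Qed.

Lemma bounded_unique S T : bounded_op ip S -> bounded_op ip T ->
  (forall v : V, exists2 y, S (Vval v, y) & T (Vval v, y)) -> S = T.
Proof.
move=> bS bT h; apply: bounded_sub_eq => // -[x y] hS.
have [M M0 hM] := bounded_pos bS; have [M' M'0 hM'] := bounded_pos bT.
have lS : linear_op S by case: bS.
have lT : linear_op T by case: bT.
have [y' hT] := bounded_ex x bT.
suff -> : y = y' by [].
apply/eqP; rewrite -subr_eq0; apply/eqP/(nrm_eq0 (ip := ip)).
suff /(congr1 (fun z : C => cabs z)) : ((nrm (y - y'))%:C)%C = 0 :> C.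
  by rewrite cabs_real cabs0 ger0_norm // nrm_ge0.
apply: (small_eq0 (addr_ge0 M0 M'0)) => eps e0; rewrite cabs_real ger0_norm ?nrm_ge0 //.
have [v hv] := approx x e0; have [z z1 z2] := h v.
have a1 := hM _ _ (linear_opB lS hS z1); have a2 := hM' _ _ (linear_opB lT hT z2).
have := nrmD ip (y - z) (z - y'); rewrite addrA subrK => /le_trans; apply.
rewrite mulrDl; apply: lerD; first by apply: le_trans a1 _; rewrite ler_wpM2l // ltW.
by rewrite nrmC; apply: le_trans a2 _; rewrite ler_wpM2l // ltW.
Qed.

(** For a pair [adjp f g] of bounded maps this is the bounded extension of [f]: the pairings of [x]
    with [g e_k] make sense for every [x], without a limiting process. As the argument is the
    adjoint, composition is reversed in [clo_comp] and the sign of [k] flips in [sigma_clo]. *)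
Definition clo g : oper H := [set p | forall k, coef p.2 k = ip p.1 (g (ve k))].

Lemma clo_uniq g x y y' : clo g (x, y) -> clo g (x, y') -> y = y'.
Proof. by move=> h h'; apply: (coef_inj onb) => k; rewrite h h'. Qed.

(** Pairing [x] with [g] of a partial sum of the candidate gives its sum of squares, so boundedness
    of [g] bounds that sum; [riesz_fischer] then provides [y]. *)
Lemma clo_ex g : bdd g -> exists2 M : R, 0 <= M &
  forall x, exists2 y, clo g (x, y) & nrm y <= M * nrm x.
Proof.
move=> [lg [M M0 hM]]; exists M => // x.
pose c k := ip x (g (ve k)).
have M1 : 0 <= M * nrm x by rewrite mulr_ge0 ?nrm_ge0.
have [|y [hy hn _]] := riesz_fischer hilb onb (a := c) M1; last by exists y.
move=> N; set s := \sum_(k < N) _.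
have s0 : 0 <= s by apply: sumr_ge0 => i _; exact: sqr_ge0.
have e1 : ip x (g (vsum c N)) = (s%:C)%C.
  rewrite linear_vsum // Vval_sum ip_sumr /s (big_morph _ (@RCD R) erefl).
  by apply: eq_bigr => k _; rewrite VvalZ ipZr mulrC mul_conj.
have e2 : nrm (vsum c N) ^+ 2 = s by rewrite Vval_vsum nrm_fsum.
have h1 : s <= M * nrm x * nrm (vsum c N).
  have := cauchy_schwarz ip x (g (vsum c N)); rewrite e1 cabs_real ger0_norm //.
  move/le_trans; apply; rewrite [M * _]mulrC -mulrA.
  by rewrite ler_wpM2l ?nrm_ge0.
have [q0|q0] := eqVneq (nrm (vsum c N)) 0; first by rewrite -e2 q0 expr0n sqr_ge0.
have qp : 0 < nrm (vsum c N) by rewrite lt_def q0 nrm_ge0.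
rewrite -e2 ler_pXn2r ?nnegrE ?nrm_ge0 // -(ler_pM2r qp).
by rewrite -expr2 e2.
Qed.

Lemma clo_linear g : linear_op (clo g).
Proof.
split=> [k|c x y x' y' h h' k|x y z]; last exact: clo_uniq.
  by rewrite /= hcoef0 ip0l.
by rewrite /= hcoefD hcoefZ h h' /= ipDl ipZl.
Qed.

Lemma clo_bounded g : bdd g -> bounded_op ip (clo g).
Proof.
move=> bg; have [M M0 hM] := clo_ex bg; split; first exact: clo_linear.
  by apply/seteqP; split=> // x _; have [y hy _] := hM x; exists y.
by exists M => x y h; have [y' hy' hn] := hM x; rewrite (clo_uniq h hy').
Qed.

(** The defining relation extends from finite combinations of basis vectors to all smooth [v], both
    sides being continuous in [v]. *)
Lemma clo_ip g x y v : bdd g -> clo g (x, y) -> ip y v = ip x (g v).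
Proof.
move=> [lg [M M0 hM]] h; apply/eqP; rewrite -subr_eq0; apply/eqP.
have K0 : 0 <= nrm y + nrm x * M by rewrite addr_ge0 ?mulr_ge0 ?nrm_ge0.
apply: (small_eq0 K0) => eps e0; have [N hN] := approxV v e0.
set w := vsum _ _ in hN.
have e1 : ip y w = ip x (g w).
  rewrite linear_vsum // !Vval_sum !ip_sumr; apply: eq_bigr => k _.
  by rewrite !VvalZ !ipZr -/(coef y k) h.
have -> : ip y v - ip x (g v) = ip y (v - w) - ip x (g (v - w)).
  by rewrite linearBf // !VvalB !ipBr e1; ring.
apply: le_trans (cabsB _ _) _; rewrite mulrDl; apply: lerD.
  apply: le_trans (cauchy_schwarz _ _ _) _; rewrite ler_wpM2l ?nrm_ge0 //.
  by rewrite VvalB ltW.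
apply: le_trans (cauchy_schwarz _ _ _) _; rewrite -mulrA ler_wpM2l ?nrm_ge0 //.
by apply: le_trans (hM _) _; rewrite ler_wpM2l // VvalB ltW.
Qed.

Lemma clo_sub f g v : adjp f g -> clo g (Vval v, Vval (f v)).
Proof. by move=> h k; exact: (h v (ve k)). Qed.

(** One inclusion tests the adjoint relation on basis vectors; the other approximates [u] by smooth
    vectors, on which [clo g] acts as [f]. *)
Lemma clo_adjoint f g : bdd f -> bdd g -> adjp f g -> adjoint ip (clo g) = clo f.
Proof.
move=> bf bg h; apply/seteqP; split=> -[x y] /= hxy.
  move=> k; rewrite /= -[coef y k]/(ip y (e k)) -(ip_conj ip _ y) -(ip_conj ip _ x).
  congr (_^*).
  by rewrite (hxy _ (clo_sub (ve k) h)).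
move=> [u v] huv /=; have [M M0 hM] := clo_ex bg.
rewrite -(ip_conj ip x) -(ip_conj ip y); congr (_^*).
apply/eqP; rewrite -subr_eq0; apply/eqP.
have K0 : 0 <= nrm x * M + nrm y by rewrite addr_ge0 ?mulr_ge0 ?nrm_ge0.
apply: (small_eq0 K0) => eps e0; have [w hw] := approx u e0.
have e1 : ip x (f w) = ip y w by rewrite (clo_ip w bf hxy).
have -> : ip x v - ip y u = ip x (v - Vval (f w)) - ip y (u - Vval w).
  by rewrite !ipBr e1; ring.
apply: le_trans (cabsB _ _) _; rewrite mulrDl; apply: lerD.
  apply: le_trans (cauchy_schwarz _ _ _) _; rewrite -mulrA ler_wpM2l ?nrm_ge0 //.
  have [z hz hn] := hM (u - Vval w).
  have hz' := linear_opB (clo_linear g) huv (clo_sub w h).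
  by rewrite (clo_uniq hz' hz); apply: le_trans hn _; rewrite ler_wpM2l // ltW.
by apply: le_trans (cauchy_schwarz _ _ _) _; rewrite ler_wpM2l ?nrm_ge0 // ltW.
Qed.

Lemma fun_sub_eq S T : S `<=` T -> (forall x, exists y, S (x, y)) ->
  (forall x y y', T (x, y) -> T (x, y') -> y = y') -> S = T.
Proof.
move=> ST tS uT; apply/seteqP; split=> // -[x y] h.
by have [z hz] := tS x; rewrite (uT _ _ _ h (ST _ hz)).
Qed.

Lemma clo_exists g x : bdd g -> exists y, clo g (x, y).
Proof. by move=> /clo_ex [M _ /(_ x) [y hy _]]; exists y. Qed.

Lemma clo_add g g' : bdd g -> bdd g' -> opD (clo g) (clo g') = clo (fun v => g v + g' v).
Proof.
move=> bg bg'; apply: fun_sub_eq => [|x|x y y']; last exact: clo_uniq.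
  by move=> [x y] [/= u [v [hu hv ->]]] k; rewrite /= hcoefD hu hv /= ipDr.
have [u hu] := clo_exists x bg; have [v hv] := clo_exists x bg'.
by exists (u + v), u, v.
Qed.

Lemma clo_scale c g : bdd g -> opZ c (clo g) = clo (fun v => c^* *: g v).
Proof.
move=> bg; apply: fun_sub_eq => [|x|x y y']; last exact: clo_uniq.
  by move=> [x y] [/= u hu ->] k; rewrite /= hcoefZ hu /= ipZr conjCK.
by have [u hu] := clo_exists x bg; exists (c *: u), u.
Qed.

Lemma clo_comp g g' : bdd g -> bdd g' -> opM (clo g) (clo g') = clo (g' \o g).
Proof.
move=> bg bg'; apply: fun_sub_eq => [|x|x y y']; last exact: clo_uniq.
  by move=> [x y] [/= u hu hv] k; rewrite hv /= (clo_ip _ bg' hu).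
have [u hu] := clo_exists x bg'; have [v hv] := clo_exists u bg.
by exists v, u.
Qed.

Lemma clo_zero : clo (fun=> 0) = op0.
Proof.
apply/seteqP; split=> -[x y] /=.
  by move=> h; apply: (coef_inj onb) => k; rewrite h /= ip0r hcoef0.
by rewrite /op0 /= => -> k; rewrite /= hcoef0 ip0r.
Qed.

Lemma clo_id : clo id = op1.
Proof.
apply/seteqP; split=> -[x y] /=.
  by move=> h; apply: (coef_inj onb) => k; rewrite h.
by rewrite /op1 /= => -> k.
Qed.

(** Bounded operators extending [T] agree on the dense smooth vectors. This is the way in which the
    bounded extensions of the definitions are computed. *)
Lemma bext_clo T g : bdd g -> T `<=` clo g -> (forall v : V, dom T v) -> bext ip T = clo g.
Proof.
move=> bg Tg dT; have dd : hdense ip (dom T).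
  by apply: (dense_fsum hilb onb) => a N; rewrite -Vval_vsum.
apply/seteqP; split=> [p [S [bS TS _ hp]]|p hp]; last first.
  by exists (clo g); split=> //; exact: clo_bounded.
suff <- : S = clo g by [].
apply: bounded_unique => //; first exact: clo_bounded.
by move=> v; have [y hy] := dT v; exists y; [exact: TS|exact: Tg].
Qed.

Lemma adjp_vdiag a : pbnd a -> (forall k, (a k)^* = a k) -> adjp (vdiag a) (vdiag a).
Proof.
move=> pa ra v w; apply: (eq_ip hilb onb) => k; rewrite !coef_vdiag // rmorphM /= ra; ring.
Qed.

Lemma adjp_Apow q : adjp (Apow q) (Apow q).
Proof. by apply: adjp_vdiag; [exact: pbnd_dpow|move=> k; exact: conj_RC]. Qed.

Lemma adjp_F : adjp Fphase Fphase.
Proof. by apply: adjp_vdiag; [exact: pbnd_sgd|move=> k; exact: conj_RC]. Qed.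

Lemma adjpD f g f' g' : adjp f g -> adjp f' g' ->
  adjp (fun v => f v + f' v) (fun v => g v + g' v).
Proof. by move=> h h' v w; rewrite !VvalD ipDl ipDr h h'. Qed.

Lemma adjpZ c f g : adjp f g -> adjp (fun v => c *: f v) (fun v => c^* *: g v).
Proof. by move=> h v w; rewrite !VvalZ ipZl ipZr conjCK h. Qed.

Lemma adjp_comp f g f' g' : adjp f g -> adjp f' g' -> adjp (f \o f') (g' \o g).
Proof. by move=> h h' v w; rewrite /= h h'. Qed.

Lemma adjpB f g f' g' : adjp f g -> adjp f' g' ->
  adjp (fun v => f v - f' v) (fun v => g v - g' v).
Proof. by move=> h h' v w; rewrite !VvalB ipBl ipBr h h'. Qed.

(* The bounded operators T on H that, together with their adjoint, restrict to  *)
(* operators f and g of order 0 on the smooth vectors satisfying a property P.  *)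
Definition Bsub (P : (V -> V) -> Prop) : set (oper H) :=
  [set T | exists f g, [/\ OP 0 f /\ OP 0 g, adjp f g, P f /\ P g & T = clo g]].

Lemma Bsub_star (P : (V -> V) -> Prop) :
  P (fun=> 0) -> (forall f g, P f -> P g -> P (fun v => f v + g v)) ->
  (forall c f, P f -> P (fun v => c *: f v)) -> (forall f g, P f -> P g -> P (f \o g)) ->
  star_algebra ip (Bsub P).
Proof.
move=> P0 PD PZ PM; split.
- by move=> _ [f [g [[_ og] _ _ ->]]]; apply/clo_bounded/OP0_bdd.
- exists (fun=> 0), (fun=> 0); split=> //; [by split; exact: OP_zero| |by rewrite clo_zero].
  by move=> v w; rewrite ip0l ip0r.
- split.
  + move=> _ _ [f [g [[of_ og] a [pf pg] ->]]] [f' [g' [[of' og'] a' [pf' pg'] ->]]].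
    exists (fun v => f v + f' v), (fun v => g v + g' v); split.
    * by split; exact: OP_add.
    * exact: adjpD.
    * by split; apply: PD.
    * by rewrite clo_add //; exact: OP0_bdd.
  + move=> c _ [f [g [[of_ og] a [pf pg] ->]]].
    exists (fun v => c *: f v), (fun v => c^* *: g v); split.
    * by split; exact: OP_scale.
    * exact: adjpZ.
    * by split; apply: PZ.
    * by rewrite clo_scale //; exact: OP0_bdd.
  + move=> _ _ [f [g [[of_ og] a [pf pg] ->]]] [f' [g' [[of' og'] a' [pf' pg'] ->]]].
    exists (f \o f'), (g' \o g); split.
    * by split; [have := OP_comp of_ of'|have := OP_comp og' og].
    * exact: adjp_comp.
    * by split; apply: PM.
    * by rewrite clo_comp //; exact: OP0_bdd.
- move=> _ [f [g [[of_ og] a [pf pg] ->]]]; exists g, f; split=> //; first exact: adjpC.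
  by rewrite (clo_adjoint (OP0_bdd of_) (OP0_bdd og) a).
Qed.

(** * The operator D, its modulus and phase, and the twisted commutators *)

Definition Dop : oper H := Diag ip e (fun k => ((d k)%:C)%C).

Lemma opabsE : opabs ip Dop = Diag ip e (dpow 1).
Proof. by rewrite /opabs /Dop (fcalc_Diag hilb onb). Qed.

Lemma opX_Diag (k : int) : opX (Diag ip e (dpow 1)) k = Diag ip e (dpow k).
Proof.
case: k => n.
  elim: n => [|n IH]; first by rewrite /= -(Diag1 onb).
  rewrite -[opX _ _]/(opM (Diag ip e (dpow 1)) (opX (Diag ip e (dpow 1)) n)) IH.
  rewrite (@opM_Diag _ _ _ hilb _ onb _ _ 1) //.
    by congr (Diag _ _); apply/funext => k; rewrite -dpowD.
  move=> k; rewrite mul1r cabsM !cabs_dpow expr1z ler_peMl ?exprz_ge0 //.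
have h (m : nat) : iter m (opM (opV (Diag ip e (dpow 1)))) op1 = Diag ip e (dpow (- m%:Z)).
  elim: m => [|m IH]; first by rewrite /= -(Diag1 onb).
  rewrite iterS IH opV_Diag; last exact: dpow_neq0.
  rewrite (@opM_Diag_bounded _ _ _ hilb _ onb _ _ 1).
    congr (Diag _ _); apply/funext => k; rewrite -dpowN -dpowD; congr dpow.
    by rewrite -opprD -intS.
  move=> k; rewrite cabs_dpow; have := @dpow_le (- m%:Z) 0 k; rewrite expr0z; apply.
  by rewrite oppr_le0.
by rewrite NegzE -h.
Qed.

Lemma opphaseE : opphase ip Dop = Diag ip e sgd.
Proof.
rewrite /opphase opabsE opV_Diag; last exact: dpow_neq0.
rewrite (@opM_Diag_bounded _ _ _ hilb _ onb _ _ 1).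
  congr (Diag _ _); apply/funext => k; rewrite -dpowN /dpow -RCM /sgd.
  by congr ((_%:C)%C); rewrite {1}(numEsg (d k)) -mulrA exprN1 mulfV ?mulr1 // d_neq0.
move=> k; rewrite -dpowN cabs_dpow; have := @dpow_le (-1) 0 k; rewrite expr0z; exact.
Qed.

Lemma HinfP x : Hinf ip Dop x <-> exists v : V, x = v.
Proof.
split=> [h|[v ->] k].
  suff hx : x \in rapid ip e d by exists (MkSmooth hx).
  apply/rapidP => n; have [y] := h n; rewrite opabsE opX_Diag => hy.
  exists (nrm y) => k; have := coef_le_nrm onb y k.
  by rewrite hy /= cabsM cabs_dpow.
exists (Vval (Apow k v)); rewrite opabsE opX_Diag => j /=; exact: coef_Apow.
Qed.

Definition sgm (k : int) f : V -> V := fun v => Apow k (f (Apow (- k) v)).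

Lemma sgm_OP k f : OP 0 f -> OP 0 (sgm k f).
Proof.
move=> h; have := OP_comp (OP_comp (OP_Apow k) h) (OP_Apow (- k)).
by rewrite add0r addNr.
Qed.

Lemma sgm_adj k f g : adjp f g -> adjp (sgm k f) (sgm (- k) g).
Proof.
by move=> h v w; rewrite /sgm opprK adjp_Apow h adjp_Apow.
Qed.

Lemma sgmD k l f : sgm k (sgm l f) = sgm (k + l) f.
Proof. by apply/funext => v; rewrite /sgm !ApowD opprD [- l - k]addrC. Qed.

Lemma sgm0 f : sgm 0 f = f.
Proof. by apply/funext => v; rewrite /sgm oppr0 !Apow0. Qed.

Lemma ip_Diag a x y v : pbnd a -> Diag ip e a (x, y) ->
  ip y v = ip x (vdiag (fun k => (a k)^*) v).
Proof.
move=> pa h; apply: (eq_ip hilb onb) => k; rewrite h coef_vdiag.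
  by rewrite rmorphM /= conjCK; ring.
by have [n [K hK]] := pa; exists n, K => j; rewrite cabs_conj.
Qed.

Lemma ip_Diag_Apow k x y v : Diag ip e (dpow k) (x, y) -> ip y v = ip x (Apow k v).
Proof.
move=> /(ip_Diag v (pbnd_dpow k)) ->; congr (ip _ (Vval (vdiag _ _))).
by apply/funext => j; exact: conj_RC.
Qed.

Lemma Diag_Apow k v : Diag ip e (dpow k) (Vval v, Vval (Apow k v)).
Proof. by move=> j /=; exact: coef_Apow. Qed.

Lemma sigma_clo k f g : OP 0 f -> OP 0 g -> adjp f g ->
  sigma_pow ip Dop k (clo g) = clo (sgm (- k) g).
Proof.
move=> of_ og a; rewrite /sigma_pow opabsE !opX_Diag.
apply: bext_clo => [|[x y]|v]; first exact/OP0_bdd/sgm_OP.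
  move=> [/= u hu [w hw hy]] j.
  have {}hy : Diag ip e (dpow k) (w, y) by [].
  have {}hw : clo g (u, w) by [].
  rewrite -[LHS]/(ip y (Vval (ve j))) (ip_Diag_Apow (ve j) hy).
  by rewrite (clo_ip _ (OP0_bdd og) hw) (ip_Diag_Apow _ hu) /sgm opprK.
exists (Vval (sgm k f v)), (Vval (Apow (- k) v)); first exact: Diag_Apow.
exists (Vval (f (Apow (- k) v))); first exact: clo_sub.
exact: Diag_Apow.
Qed.

Definition commF f : V -> V := fun v => Fphase (f v) - f (Fphase v).

(* [D, a]_sigma = |D| [F, a] *)
Definition tcomm f : V -> V := fun v => Apow 1 (commF f v).
(** The formal adjoint of [|D| [F, f]]: the commutator changes sign and [|D|] moves to the right. *)
Definition tcomm_adj g : V -> V := fun v => - commF g (Apow 1 v).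

Lemma F_linear : linear Fphase. Proof. exact: OP_lin OP_F. Qed.

Lemma tcomm_adjp f g : adjp f g -> adjp (tcomm f) (tcomm_adj g).
Proof.
move=> h v w; rewrite /tcomm /tcomm_adj /commF adjp_Apow VvalN !VvalB opprB ipBl ipBr.
by rewrite adjp_F h h adjp_F.
Qed.

Lemma smoothing_comp_l q f g : smoothing f -> OP q g -> smoothing (f \o g).
Proof. by move=> sf og r; have := OP_comp (sf (r - q)) og; rewrite subrKC. Qed.

Lemma smoothing_comp_r q f g : OP q f -> smoothing g -> smoothing (f \o g).
Proof. by move=> of_ sg r; have := OP_comp of_ (sg (r - q)); rewrite subrK. Qed.

Lemma tcomm_smoothing f : smoothing (commF f) -> smoothing (tcomm f).
Proof. exact: smoothing_comp_r (OP_Apow 1). Qed.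

Lemma tcomm_adj_smoothing g : smoothing (commF g) -> smoothing (tcomm_adj g).
Proof. by move=> sg q; apply: OP_opp; exact: (smoothing_comp_l sg (OP_Apow 1)). Qed.

Lemma pbnd_d : pbnd (fun k => ((d k)%:C)%C).
Proof. by exists 1%N, 1 => k; rewrite cabs_real expr1 mul1r. Qed.

Lemma dE k : ((d k)%:C)%C = sgd k * dpow 1 k.
Proof. by rewrite /sgd /dpow -RCM expr1z -numEsg. Qed.

Lemma ip_Dop x y v : Dop (x, y) -> ip y v = ip x (Fphase (Apow 1 v)).
Proof.
move=> /(ip_Diag v pbnd_d) ->; congr (ip _ (Vval _)); apply: smooth_inj => k.
rewrite coef_vdiag; last by exists 1%N, 1 => j; rewrite cabs_conj cabs_real expr1 mul1r.
by rewrite conj_RC coef_F coef_Apow dE mulrA.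
Qed.

Lemma Dop_V v : Dop (Vval v, Vval (Fphase (Apow 1 v))).
Proof. by move=> k /=; rewrite coef_F coef_Apow dE mulrA. Qed.

Lemma Dop_ve k : Fphase (Apow 1 (ve k)) = ((d k)%:C)%C *: ve k.
Proof. by rewrite Apow_ve (linearZf _ _ F_linear) F_ve scalerA dE mulrC. Qed.

(** Since [|D|^-1 D = F], the expression [D a - |D| a |D|^-1 D] is [|D| (F a - a F)]; smoothness of
    the commutator absorbs the unbounded factor. *)
Lemma twisted_comm_clo f g : OP 0 f -> OP 0 g -> adjp f g -> smoothing (commF g) ->
  twisted_comm ip Dop (sigma_pow ip Dop 1) (clo g) = clo (tcomm_adj g).
Proof.
move=> of_ og a sg; rewrite /twisted_comm (sigma_clo 1 of_ og a).
have og' := OP0_bdd (sgm_OP (- 1) og).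
apply: bext_clo => [|[x y]|v]; first exact/OP0_bdd/tcomm_adj_smoothing.
  move=> [/= y1 [z [[u hu hy1] [z' [w hw hz'] /= hz] hy]]] k; rewrite {}hy {}hz.
  have {}hy1 : Dop (u, y1) by [].
  have {}hu : clo g (x, u) by [].
  have {}hw : Dop (x, w) by [].
  have {}hz' : clo (sgm (- 1) g) (w, z') by [].
  rewrite scaleN1r /= hcoefB -[coef y1 k]/(ip y1 (Vval (ve k))) -[coef z' k]/(ip z' (Vval (ve k))).
  rewrite (ip_Dop _ hy1) (clo_ip _ (OP0_bdd og) hu) (clo_ip _ og' hz') (ip_Dop _ hw) -ipBr.
  congr (ip x _).
  by rewrite opprB /sgm opprK F_Apow ApowKN -!F_Apow.
exists (Vval (Fphase (Apow 1 (f v))) + -1 *: Vval (sgm 1 f (Fphase (Apow 1 v)))).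
exists (Vval (Fphase (Apow 1 (f v)))), (-1 *: Vval (sgm 1 f (Fphase (Apow 1 v)))); split=> //.
  by exists (Vval (f v)); [exact: clo_sub|exact: Dop_V].
exists (Vval (sgm 1 f (Fphase (Apow 1 v)))) => //.
exists (Vval (Fphase (Apow 1 v))); first exact: Dop_V.
by apply: clo_sub; exact: (sgm_adj 1 a).
Qed.

(** The twist is conjugation by [|D|], so twisted commutators with [|D|] vanish; regularity becomes
    immediate with [theta] equal to the twist. *)
Lemma absD_comm_clo f g : OP 0 f -> OP 0 g -> adjp f g ->
  bext ip (opM (opabs ip Dop) (clo g) -o opM (sigma_pow ip Dop 1 (clo g)) (opabs ip Dop))%oper
  = op0.
Proof.
move=> of_ og a; rewrite (sigma_clo 1 of_ og a) opabsE -clo_zero.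
have og' := OP0_bdd (sgm_OP (- 1) og).
apply: bext_clo => [|[x y]|v]; first exact/OP0_bdd/OP_zero.
  move=> [/= y1 [z [[u hu hy1] [z' [w hw hz'] /= hz] hy]]] k; rewrite {}hy {}hz.
  have {}hy1 : Diag ip e (dpow 1) (u, y1) by [].
  have {}hu : clo g (x, u) by [].
  have {}hw : Diag ip e (dpow 1) (x, w) by [].
  have {}hz' : clo (sgm (- 1) g) (w, z') by [].
  rewrite scaleN1r /= hcoefB -[coef y1 k]/(ip y1 (Vval (ve k))) -[coef z' k]/(ip z' (Vval (ve k))).
  rewrite (ip_Diag_Apow _ hy1) (clo_ip _ (OP0_bdd og) hu) (clo_ip _ og' hz').
  by rewrite (ip_Diag_Apow _ hw) /sgm opprK ApowKN ip0r subrr.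
exists (Vval (Apow 1 (f v)) + -1 *: Vval (sgm 1 f (Apow 1 v))).
exists (Vval (Apow 1 (f v))), (-1 *: Vval (sgm 1 f (Apow 1 v))); split=> //.
  by exists (Vval (f v)); [exact: clo_sub|exact: Diag_Apow].
exists (Vval (sgm 1 f (Apow 1 v))) => //.
exists (Vval (Apow 1 v)); first exact: Diag_Apow.
by apply: clo_sub; exact: (sgm_adj 1 a).
Qed.

(* MM plays the role of the multiplication operators by smooth functions, the  *)
(* operator m' of the third clause being multiplication by -i times the        *)
(* derivative; the last clause is the invariance under rotations.              *)
Record mult_class (MM : (V -> V) -> Prop) : Prop := MultClass {
  mm_id : MM id;
  mm_comp : forall m m', MM m -> MM m' -> MM (m \o m');
  mm_deriv : forall m, MM m -> exists2 m', MM m' &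
    smoothing (fun v => Apow 1 (m v) - m (Apow 1 v) - m' (Fphase v));
  mm_F : forall m, MM m -> smoothing (commF m);
  mm_OP : forall m, MM m -> OP 0 m;
  mm_diag : forall m, MM m -> exists c, forall k, coef (m (ve k)) k = c
}.

(** * The pseudodifferential calculus modulo low order *)

Section Pseudodifferential.
Context (MM : (V -> V) -> Prop) (MMc : mult_class MM).

Definition Fe (b : bool) v : V := if b then Fphase v else v.

Lemma OP_Fe (b : bool) : OP 0 (Fe b). Proof. by case: b; [exact: OP_F|exact: OP_id]. Qed.

(* finite sums of the operators m F^b |D|^k, modulo operators of order -J *)
Inductive psd (J : int) : (V -> V) -> Prop :=
| psd_op f of OP (- J) f : psd J f
| psd_basic m (b : bool) k of MM m : psd J (fun v => m (Fe b (Apow k v)))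
| psd_add f g of psd J f & psd J g : psd J (fun v => f v + g v)
| psd_scale c f of psd J f : psd J (fun v => c *: f v).

(** The order is recorded beside the expansions, because composing truncated expansions costs as
    much precision as the order of the inner factor ([psd_comp]). *)
Definition Psd f := (exists p, OP p f) /\ forall J, psd J f.

Lemma OP_basic m (b : bool) k : MM m -> OP k (fun v => m (Fe b (Apow k v))).
Proof.
move=> hm; have := OP_comp (OP_comp (mm_OP MMc hm) (OP_Fe b)) (OP_Apow k).
by rewrite !addr0.
Qed.

Lemma eq_psd J f g : f =1 g -> psd J f -> psd J g.
Proof. by move=> /funext ->. Qed.

Lemma eq_OP q f g : f =1 g -> OP q f -> OP q g.
Proof. by move=> /funext ->. Qed.

Lemma FeF (b : bool) v : Fe (~~ b) v = Fphase (Fe b v).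
Proof. by case: b => //=; rewrite FK. Qed.

Lemma psd_F J f : psd J f -> psd J (fun v => Fphase (f v)).
Proof.
elim=> {f} [f of_|m b k hm|f g _ pf _ pg|c f _ pf].
- by apply: psd_op; have := OP_comp OP_F of_; rewrite addr0.
- have s1 : psd J (fun v => commF m (Fe b (Apow k v))).
    apply: psd_op.
    exact: (smoothing_comp_l (smoothing_comp_l (mm_F MMc hm) (OP_Fe b)) (OP_Apow k)).
  have := psd_add (psd_basic J (~~ b) k hm) s1; apply: eq_psd => v.
  by rewrite FeF /commF addrC subrK.
- by have := psd_add pf pg; apply: eq_psd => v; rewrite (linearDf _ _ F_linear).
- by have := psd_scale c pf; apply: eq_psd => v; rewrite (linearZf _ _ F_linear).
Qed.

Lemma psd_mult J m f : MM m -> psd J f -> psd J (fun v => m (f v)).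
Proof.
move=> hm; have lm := OP_lin (mm_OP MMc hm); elim=> {f} [f of_|m' b k hm'|f g _ pf _ pg|c f _ pf].
- by apply: psd_op; have := OP_comp (mm_OP MMc hm) of_; rewrite addr0.
- exact: (psd_basic J b k (mm_comp MMc hm hm')).
- by have := psd_add pf pg; apply: eq_psd => v; rewrite (linearDf _ _ lm).
- by have := psd_scale c pf; apply: eq_psd => v; rewrite (linearZf _ _ lm).
Qed.

Lemma FFe (b : bool) v : Fphase (Fe b v) = Fe b (Fphase v).
Proof. by case: b. Qed.

Lemma Fe_Apow (b : bool) k v : Fe b (Apow k v) = Apow k (Fe b v).
Proof. by case: b => //=; exact: F_Apow. Qed.

(** By [mm_deriv], [|D| m] is [m |D| + m' F] up to smoothing operators. One more order is needed in
    the hypothesis, as [|D|] raises that of the remainder. *)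
Lemma psd_A J f : psd (J + 1) f -> psd J (fun v => Apow 1 (f v)).
Proof.
elim=> {f} [f of_|m b k hm|f g _ pf _ pg|c f _ pf].
- by apply: psd_op; have := OP_comp (OP_Apow 1) of_; rewrite opprD subrK.
- have [m' hm' sm'] := mm_deriv MMc hm.
  have s1 := smoothing_comp_l (smoothing_comp_l sm' (OP_Fe b)) (OP_Apow k).
  have := psd_add (psd_add (psd_basic J b (1 + k) hm) (psd_basic J (~~ b) k hm')) (psd_op (s1 _)).
  apply: eq_psd => v; rewrite /= FeF -ApowD Fe_Apow.
  by rewrite -[_ - _ - _]addrA -opprD subrKC.
- by have := psd_add pf pg; apply: eq_psd => v; rewrite (linearDf _ _ (Apow_linear 1)).
- by have := psd_scale c pf; apply: eq_psd => v; rewrite (linearZf _ _ (Apow_linear 1)).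
Qed.

(** Multiplying the relation for [|D| m] by [|D|^-1] on both sides exchanges [|D|^-1] with [m], at
    the price of a term of the same shape with [k] lowered by one. After [n] exchanges the order is
    at most [-J]. *)
Lemma psd_Ainv_basic J m (b : bool) k : MM m -> psd J (fun v => Apow (- 1) (m (Fe b (Apow k v)))).
Proof.
have [n hn] : exists n : nat, k - n%:Z <= 1 - J by exists (absz (k - (1 - J))%R); lia.
elim: n k m b hn => [|n IH] k m b hn hm.
  apply: psd_op; apply: (@OP_le (k - 1)); first by lia.
  by have := OP_comp (OP_Apow (-1)) (OP_basic b k hm).
have [m' hm' sm'] := mm_deriv MMc hm.
have hn' : k - 1 - n%:Z <= 1 - J by lia.
have s1 := smoothing_comp_l (smoothing_comp_l (smoothing_comp_l sm' (OP_Apow (-1))) (OP_Fe b)) (OP_Apow k).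
have s2 := smoothing_comp_r (OP_Apow (-1)) s1.
have p1 := psd_scale (-1) (IH (k - 1) m' (~~ b) hn' hm').
have := psd_add (psd_add (psd_basic J b (k - 1) hm) p1) (psd_scale (-1) (psd_op (s2 _))).
apply: eq_psd => v; rewrite /= !scaleN1r.
have eF c : Apow (-1) (Fe c (Apow k v)) = Fe c (Apow (k - 1) v).
  by rewrite -Fe_Apow ApowD [-1 + k]addrC.
rewrite !eF FeF; set w := Fe b (Apow (k - 1) v).
have -> : Apow 1 w = Fe b (Apow k v) by rewrite /w -eF ApowKN.
have lA := Apow_linear (-1).
rewrite !(linearBf _ _ lA) ApowNK; set x := m w; set y := Apow (-1) (m' _).
by rewrite opprB addrA subrK opprB addrC subrK.
Qed.

Lemma psd_Ainv J f : psd J f -> psd J (fun v => Apow (- 1) (f v)).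
Proof.
elim=> {f} [f of_|m b k hm|f g _ pf _ pg|c f _ pf].
- apply: psd_op; apply: (@OP_le (- J - 1)); first by rewrite gerBl.
  by have := OP_comp (OP_Apow (-1)) of_.
- exact: psd_Ainv_basic.
- by have := psd_add pf pg; apply: eq_psd => v; rewrite (linearDf _ _ (Apow_linear _)).
- by have := psd_scale c pf; apply: eq_psd => v; rewrite (linearZf _ _ (Apow_linear _)).
Qed.

Lemma psd_Apow k f : (forall J, psd J f) -> forall J, psd J (fun v => Apow k (f v)).
Proof.
move=> pf; case: k => n; elim: n => [|n IH] J.
- by have := pf J; apply: eq_psd => v; rewrite Apow0.
- by have := psd_A (IH (J + 1)); apply: eq_psd => v; rewrite ApowD -intS.
- by have := psd_Ainv (pf J); apply: eq_psd => v.
- have := psd_Ainv (IH J); apply: eq_psd => v; rewrite ApowD; congr (Apow _ _); lia.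
Qed.

Lemma psd_comp J p f g : psd (J + p) f -> OP p g -> (forall J, psd J g) ->
  psd J (fun v => f (g v)).
Proof.
move=> pf og pg; elim: {f} pf => [f of_|m b k hm|f f' _ pf _ pf'|c f _ pf].
- by apply: psd_op; have := OP_comp of_ og; rewrite opprD subrKC.
- apply: psd_mult => //; have := psd_Apow k pg J.
  by case: b => //; exact: psd_F.
- exact: psd_add.
- exact: psd_scale.
Qed.

Lemma Psd_comp f g : Psd f -> Psd g -> Psd (f \o g).
Proof.
move=> [[p of_] pf] [[q og] pg]; split; first by exists (q + p); exact: OP_comp.
by move=> J; exact: (psd_comp (pf (J + q)) og pg).
Qed.

Lemma OP_common p q f g : OP p f -> OP q g -> OP (Num.max p q) f /\ OP (Num.max p q) g.
Proof. by move=> of_ og; split; [apply: OP_le of_|apply: OP_le og]; rewrite le_max lexx ?orbT. Qed.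

Lemma Psd_add f g : Psd f -> Psd g -> Psd (fun v => f v + g v).
Proof.
move=> [[p of_] pf] [[q og] pg]; split; last by move=> J; exact: psd_add.
by exists (Num.max p q); have [] := OP_common of_ og; exact: OP_add.
Qed.

Lemma Psd_scale c f : Psd f -> Psd (fun v => c *: f v).
Proof.
move=> [[p of_] pf]; split; last by move=> J; exact: psd_scale.
by exists p; exact: OP_scale.
Qed.

Lemma Psd_smoothing f : smoothing f -> Psd f.
Proof. by move=> sf; split; [exists 0|move=> J; exact: psd_op]. Qed.

Lemma Psd_mult m : MM m -> Psd m.
Proof.
move=> hm; split; first by exists 0; exact: (mm_OP MMc hm).
by move=> J; have := psd_basic J false 0 hm; apply: eq_psd => v /=; rewrite Apow0.
Qed.

Lemma Psd_F : Psd Fphase.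
Proof.
split; first by exists 0; exact: OP_F.
by move=> J; have := psd_basic J true 0 (mm_id MMc); apply: eq_psd => v /=; rewrite Apow0.
Qed.

Lemma Psd_Apow k : Psd (Apow k).
Proof.
split; first by exists k; exact: OP_Apow.
by move=> J; exact: (psd_basic J false k (mm_id MMc)).
Qed.

Lemma Psd_zero : Psd (fun=> 0).
Proof. by apply: Psd_smoothing => q; exact: OP_zero. Qed.

Lemma Psd_sgm k f : Psd f -> Psd (sgm k f).
Proof. by move=> pf; exact: (Psd_comp (Psd_comp (Psd_Apow k) pf) (Psd_Apow (- k))). Qed.

(** For order [q] the expansion at [J = -q] suffices: its remainder has that order, and in a basic
    operator [F] commutes with all factors but [m], where [mm_F] applies. *)
Lemma Psd_commF f : Psd f -> smoothing (commF f).
Proof.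
move=> [_ pf] q; have := pf (- q); move E : (- q) => J h; have -> : q = - J by rewrite -E opprK.
elim: {f pf} h => [f of_|m b k hm|f g _ sf _ sg|c f _ sf].
- apply: OP_sub; first by have := OP_comp OP_F of_; rewrite addr0.
  by have := OP_comp of_ OP_F; rewrite add0r.
- have := smoothing_comp_l (smoothing_comp_l (mm_F MMc hm) (OP_Fe b)) (OP_Apow k).
  move=> /(_ (- J)); apply: eq_OP => v; rewrite /commF /=; congr (_ - m _).
  by rewrite FFe F_Apow.
- have := OP_add sf sg; apply: eq_OP => v; rewrite /commF (linearDf _ _ F_linear).
  by rewrite opprD addrACA.
- have := OP_scale c sf; apply: eq_OP => v; rewrite /commF (linearZf _ _ F_linear).
  by rewrite scalerBr.
Qed.

Lemma Psd_tcomm f : Psd f -> Psd (tcomm f).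
Proof. by move=> /Psd_commF /tcomm_smoothing /Psd_smoothing. Qed.

(* diagonal entries along a subsequence of the basis where |D| takes the values 1, 2, ... *)
Lemma psd_diag (iota : nat -> nat) (s : C) (J : nat) f :
  (forall n, `|d (iota n)| = n.+1%:R) -> (forall n, sgd (iota n) = s) -> cabs s = 1 ->
  psd J f -> exists P (M : R), forall n,
    cabs (n.+1%:R ^+ J * coef (f (ve (iota n))) (iota n) - P.[n.+1%:R]) <= M.
Proof.
move=> hd hs s1; elim=> {f} [f of_|m b k hm|f g _ [P [M hP]] _ [Q [L hQ]]|c f _ [P [M hP]]].
(* An operator of order [-J] has diagonal entries [O(n^(-J))], so the zero polynomial serves. *)
- have [M hM] := (proj2 of_) 0; exists 0, M => n; rewrite horner0 subr0 cabsM cabsX cabs_nat.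
  have := coef_le_nrm onb (f (ve (iota n))) (iota n); have := hM (ve (iota n)).
  rewrite snorm0 add0r /snorm Apow_ve VvalZ nrmZ cabs_dpow nrm_e // mulr1 hd => h1 h2.
  have p : 0 < n.+1%:R ^+ J :> R by rewrite exprn_gt0.
  apply: le_trans (ler_wpM2l (ltW p) (le_trans h2 h1)) _.
  rewrite mulrCA ler_piMr //; last by rewrite -exprnN mulfV ?gt_eqF.
  have := le_trans (nrm_ge0 _ _) h1; rewrite pmulr_lge0 // exprz_gt0 //.
(* The diagonal of [m] is constant, so a basic operator has exactly the entry [r n^k]; times [n^J]
   it is a monomial, or bounded if [J + k < 0]. *)
- have [c hc] := mm_diag MMc hm; have lm := OP_lin (mm_OP MMc hm).
  pose r : C := (if b then s else 1) * c.
  have e1 n : coef (m (Fe b (Apow k (ve (iota n))))) (iota n) = ((n.+1%:R ^ k)%:C)%C * r.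
    have eb w : linear (Fe b) by case: (b); [exact: F_linear|].
    rewrite Apow_ve (linearZf _ _ (eb 0)) (linearZf _ _ lm) VvalZ hcoefZ.
    rewrite -[dpow k (iota n)]/((`|d (iota n)| ^ k)%:C)%C hd /r; congr (_ * _).
    case: (b) => /=; last by rewrite hc mul1r.
    by rewrite F_ve (linearZf _ _ lm) VvalZ hcoefZ hc hs.
  have [Jk|Jk] := boolP (0 <= J%:Z + k).
    have [j hj] : exists j : nat, J%:Z + k = j by exists (absz (J%:Z + k)%R); lia.
    exists (r *: 'X^j), 0 => n; rewrite e1 hornerZ hornerXn.
    have <- : n.+1%:R ^+ J * ((n.+1%:R ^ k : R)%:C)%C = n.+1%:R ^+ j :> C.
      by rewrite -!RCnat -!RCX -RCM !exprnP -hj expfzDr ?pnatr_eq0.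
    by rewrite mulrA mulrC subrr cabs0.
  exists 0, (cabs r) => n; rewrite horner0 subr0 e1 mulrA cabsM ler_piMl ?cabs_ge0 //.
  rewrite cabsM cabsX cabs_nat cabs_real ger0_norm ?exprz_ge0 // exprnP -expfzDr ?pnatr_eq0 //.
  rewrite -[leRHS](expr0z (n.+1%:R : R)) ler_weXz2l ?ler1n //; lia.
- exists (P + Q), (M + L) => n; rewrite hornerD VvalD hcoefD mulrDr opprD addrACA.
  by apply: le_trans (cabsD _ _) _; exact: lerD.
- exists (c *: P), (cabs c * M) => n; rewrite hornerZ VvalZ hcoefZ mulrCA -mulrBr cabsM.
  by rewrite ler_wpM2l ?cabs_ge0.
Qed.

End Pseudodifferential.

(** * Singular values and Schatten classes *)

Lemma singular_value_ge0 T n : 0 <= singular_value ip T n.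
Proof.
rewrite /singular_value; set A := [set _ | _].
have [->|/set0P A0] := eqVneq A set0; first by rewrite inf0.
by apply: lb_le_inf => // x [].
Qed.

Lemma singular_value_le T n (M : R) S : 0 <= M -> bounded_op ip S ->
  (exists f : 'I_n -> H, forall y, ran S y -> exists c : 'I_n -> C, y = \sum_i c i *: f i) ->
  (forall x y z, T (x, y) -> S (x, z) -> nrm (y - z) <= M * nrm x) ->
  singular_value ip T n <= M.
Proof.
move=> M0 bS fS hM; apply: ge_inf; first by exists 0 => x [].
by split=> //; exists S.
Qed.

Lemma bounded_opM S T : bounded_op ip S -> bounded_op ip T -> bounded_op ip (opM S T).
Proof.
move=> bS bT; have [K K0 hK] := bounded_pos bS; have [K1 K10 hK1] := bounded_pos bT.
have [lS0 lS uS] : linear_op S by case: bS.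
have [lT0 lT uT] : linear_op T by case: bT.
split.
- split; first by exists 0.
    move=> c x y x' y' [u /= hu hy] [u' /= hu' hy'].
    by exists (c *: u + u'); [exact: lT|exact: lS].
  move=> x y z [u /= hu hy] [u' /= hu' hz].
  by apply: (uS u) => //; rewrite (uT _ _ _ hu hu').
- apply/seteqP; split=> // x _; have [u hu] := bounded_ex x bT.
  by have [y hy] := bounded_ex u bS; exists y, u.
- exists (K * K1) => x y [u /hK1 hu /hK hy]; apply: le_trans hy _.
  by rewrite -mulrA ler_wpM2l.
Qed.

(** Cutting the diagonal factor after [n] entries leaves rank at most [n], and the discarded
    diagonal part has norm at most [b n]. *)
Lemma singular_value_bound T a (b : nat -> R) : bounded_op ip T ->
  (forall k, cabs (a k) <= b k) -> (forall m n, (m <= n)%N -> b n <= b m) ->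
  exists2 K, 0 <= K & forall n, singular_value ip (opM T (Diag ip e a)) n <= K * b n.
Proof.
move=> bT ab nb; have [K K0 hK] := bounded_pos bT; exists K => // n.
have b0 k : 0 <= b k := le_trans (cabs_ge0 _) (ab k).
pose a1 k := if (k < n)%N then a k else 0.
pose a2 k := if (k < n)%N then 0 else a k.
have ba1 k : cabs (a1 k) <= b 0%N.
  rewrite /a1; case: ifP => _; last by rewrite cabs0.
  by apply: le_trans (ab k) _; exact: nb.
have ba2 k : cabs (a2 k) <= b n.
  rewrite /a2; case: ltnP => kn; first by rewrite cabs0.
  by apply: le_trans (ab k) _; exact: nb.
have ba k : cabs (a k) <= b 0%N by apply: le_trans (ab k) _; exact: nb.
have lT : linear_op T by case: bT.
have bD1 := Diag_bounded hilb onb ba1.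
have bS := bounded_opM bT bD1.
apply: (singular_value_le _ bS); first by rewrite mulr_ge0.
  have [f hf] : exists f : 'I_n -> H, forall i : 'I_n, T (e i, f i).
    have h (i : 'I_n) : exists y, T (e i, y) by exact: bounded_ex.
    by have [f hf] := choice h; exists f.
  exists f => y [x [u hu hy]]; exists (fun i => a i * coef x i).
  have eu : u = \sum_(i < n) (a i * coef x i) *: e i.
    rewrite -/(fsum e (fun i => a i * coef x i) n); apply: (coef_inj onb) => k.
    by rewrite coef_fsum // hu /= /a1; case: ifP => _; rewrite ?mul0r.
  apply: (bounded_fun bT hy); rewrite eu.
  have [l0 l _] := lT.
  elim/big_ind2: _ => // [x1 y1 x2 y2 h1 h2|i _].
    by have := l 1 _ _ _ _ h1 h2; rewrite !scale1r.
  by have := l (a i * coef x i) _ _ _ _ (hf i) l0; rewrite !addr0.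
move=> x y z [u hu hy] [w hw hz]; rewrite -mulrA.
apply: le_trans (hK _ _ (linear_opB lT hy hz)) _; rewrite ler_wpM2l //.
apply: (nrm_dom hilb onb) => // k; rewrite hcoefB hu hw /= -mulrBl cabsM.
rewrite ler_wpM2r ?cabs_ge0 //; apply: le_trans (ba2 k).
by rewrite /a1 /a2; case: ifP => _; rewrite ?subrr ?subr0.
Qed.

Lemma schatten_bound (p K : R) T : bounded_op ip T ->
  (forall n, singular_value ip T n `^ p <= K * (n.+1%:R ^+ 2)^-1) -> schatten ip p T.
Proof.
move=> bT hK; split=> //.
have K0 : 0 <= K.
  by have := le_trans (powR_ge0 _ _) (hK 0%N); rewrite expr1n invr1 mulr1.
apply: (@le_lt_trans _ _ (K * 2)%:E); last exact: ltry.
apply: lime_le; first by apply: is_cvg_nneseries => n _ _; rewrite lee_fin powR_ge0.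
near=> N; rewrite sumEFin lee_fin big_mkord.
apply: le_trans (ler_wpM2l K0 (sum_invsq N)); rewrite mulr_sumr.
by apply: ler_sum => i _; exact: hK.
Unshelve. all: by end_near. Qed.

Lemma d_inv_le k : (`|d k|)^-1 <= 3 / k.+1%:R.
Proof.
rewrite ler_pdivlMr // mulrC ler_pdivrMr ?d_gt0 //; exact: d_growth.
Qed.

(** The eigenvalues of the resolvent are [O(1/n)], so the exponent 2 is enough. *)
Lemma Dop_finitely_summable : finitely_summable ip Dop.
Proof.
pose a k : C := (Complex 0 1 + ((d k)%:C)%C)^-1.
have dC k : `|d k| <= cabs (Complex 0 1 + ((d k)%:C)%C).
  by apply: le_trans (re_le_cabs _); rewrite /= add0r.
have n0 k : Complex 0 1 + ((d k)%:C)%C != 0.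
  apply/eqP => h; have := dC k; rewrite h cabs0; have := d_gt0 k; lra.
have eT : (opV (Complex 0 1 *:o op1 +o Dop))%oper = opM op1 (Diag ip e a).
  have -> : (Complex 0 1 *:o op1 +o Dop)%oper = Diag ip e (fun k => Complex 0 1 + ((d k)%:C)%C).
    apply/seteqP; split=> -[x y] /=.
      move=> [u [v [[w /= hw hu] hv /= ->]]] k; rewrite hu (_ : w = x) //.
      by rewrite hcoefD hcoefZ hv /= mulrDl.
    move=> hy; exists (Complex 0 1 *: x), (y - Complex 0 1 *: x); split.
    - by exists x.
    - by move=> k; rewrite /= hcoefB hcoefZ hy /=; ring.
    - by rewrite subrKC.
  rewrite opV_Diag //; apply/seteqP; split=> -[x y] /=; first by move=> h; exists y.
  by case=> u hu hy; rewrite (_ : y = u).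
have ab k : cabs (a k) <= 3 / k.+1%:R.
  rewrite cabsV; apply: le_trans (d_inv_le k); rewrite lef_pV2 ?posrE ?d_gt0 //.
  exact: cabs_gt0.
have nb m n : (m <= n)%N -> 3 / n.+1%:R <= 3 / m.+1%:R :> R.
  by move=> mn; rewrite ler_wpM2l // lef_pV2 ?posrE // ler_nat.
have bo : bounded_op ip op1 by rewrite -clo_id; apply/clo_bounded/OP0_bdd/OP_id.
have [K K0 hK] := singular_value_bound bo ab nb.
exists 2 => //; rewrite eT; apply: (@schatten_bound _ ((K * 3) ^+ 2)).
  have -> : opM op1 (Diag ip e a) = Diag ip e a.
    apply/seteqP; split=> -[x y] /=; last by move=> h; exists y.
    by case=> u hu hy; rewrite (_ : y = u).
  apply: (@Diag_bounded _ _ _ hilb _ onb _ 3) => k; apply: le_trans (ab k) _.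
  by rewrite ler_pdivrMr // ler_peMr // ler1n.
move=> n; rewrite -[2]/(2%:R) powR_mulrn ?singular_value_ge0 //.
have -> : (K * 3) ^+ 2 * (n.+1%:R ^+ 2)^-1 = (K * (3 / n.+1%:R)) ^+ 2 by rewrite mulrA expr_div_n.
by rewrite ler_pXn2r ?nnegrE ?singular_value_ge0 ?mulr_ge0.
Qed.

Lemma clo_Apow q : clo (Apow q) = Diag ip e (dpow q).
Proof.
apply/seteqP; split=> -[x y] /= h k; rewrite h /= ?Apow_ve VvalZ ipZr conj_RC //.
Qed.

(** Factoring [g] as [|D|^-2] after the bounded map [h] puts a diagonal factor with entries
    [O(1/n^2)] to the right of [clo h]. *)
Lemma clo_schatten1 f g : OP (-2) f -> OP (-2) g -> adjp f g -> schatten ip 1 (clo g).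
Proof.
move=> of_ og a; pose h := Apow 2 \o g.
have bh : bdd h by apply: OP0_bdd; have := OP_comp (OP_Apow 2) og; rewrite addNr.
have bA : bdd (Apow (-2)) by apply/OP0_bdd/(@OP_le (-2))/OP_Apow.
have bg : bdd g by apply/OP0_bdd/(@OP_le (-2)).
have eT : clo g = opM (clo h) (Diag ip e (dpow (-2))).
  rewrite -clo_Apow clo_comp //; congr clo; apply/funext => v.
  by rewrite /h /= ApowNK.
have ab k : cabs (dpow (-2) k) <= 9 / k.+1%:R ^+ 2.
  rewrite cabs_dpow -exprnN -exprVn.
  have -> : 9 / k.+1%:R ^+ 2 = (3 / k.+1%:R) ^+ 2 :> R.
    by rewrite expr_div_n; congr (_ / _); rewrite expr2 -natrM.
  by rewrite ler_pXn2r ?nnegrE ?invr_ge0 ?divr_ge0 // d_inv_le.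
have nb m n : (m <= n)%N -> 9 / n.+1%:R ^+ 2 <= 9 / m.+1%:R ^+ 2 :> R.
  move=> mn; rewrite ler_wpM2l // lef_pV2 ?posrE ?exprn_gt0 // lerXn2r ?nnegrE //.
  by rewrite ler_nat.
have [K K0 hK] := singular_value_bound (clo_bounded bh) ab nb.
apply: (@schatten_bound _ (K * 9)); first exact: clo_bounded.
by move=> n; rewrite powRr1 ?singular_value_ge0 // eT -mulrA.
Qed.

(** Elements of [Psi] may be unbounded and are defined on smooth vectors only, so they are
    represented by graphs there instead of closures. *)
Definition gr f : oper H := [set q | exists v : V, q = (Vval v, Vval (f v))].

Lemma gr_add f g : opD (gr f) (gr g) = gr (fun v => f v + g v).
Proof.
apply/seteqP; split=> -[x y] /=.
  move=> [u [w [[v [-> ->]] [v' [/Vval_inj <- ->]] /= hy]]]; exists v.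
  by rewrite hy.
move=> [v [-> ->]]; exists (Vval (f v)), (Vval (g v)).
by split; [exists v|exists v|].
Qed.

Lemma gr_scale c f : opZ c (gr f) = gr (fun v => c *: f v).
Proof.
apply/seteqP; split=> -[x y] /=; first by move=> [u [v [-> ->]] /= hy]; exists v; rewrite hy.
by move=> [v [-> ->]]; exists (Vval (f v)) => //; exists v.
Qed.

Lemma gr_comp f g : opM (gr f) (gr g) = gr (f \o g).
Proof.
apply/seteqP; split=> -[x y] /=.
  by move=> [u [v [-> ->]] [v' [/Vval_inj <- ->]]]; exists v.
by move=> [v [-> ->]]; exists (Vval (g v)); [exists v|exists (g v)].
Qed.

Lemma gr_restr S f : (forall v, S (Vval v, Vval (f v))) ->
  (forall v y, S (Vval v, y) -> y = f v) -> oprestr (Hinf ip Dop) S = gr f.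
Proof.
move=> h u; apply/seteqP; split=> -[x y] /=.
  by move=> [/HinfP /= [v ->] /u ->]; exists v.
by move=> [v [-> ->]]; split=> //; apply/HinfP; exists v.
Qed.

Lemma gr_restr_clo f g : adjp f g -> oprestr (Hinf ip Dop) (clo g) = gr f.
Proof.
move=> a; apply: gr_restr => v; first exact: clo_sub.
by move=> y h; apply: (clo_uniq h); exact: clo_sub.
Qed.

Lemma gr_restr_Diag a : pbnd a -> oprestr (Hinf ip Dop) (Diag ip e a) = gr (vdiag a).
Proof.
move=> pa; have h v : Diag ip e a (Vval v, Vval (vdiag a v)) by move=> k /=; rewrite coef_vdiag.
by apply: gr_restr => // v y hy; exact: (Diag_uniq onb hy (h v)).
Qed.

(** * Zeta functions, the dimension spectrum, and the residues of the ansatz *)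

Section Zeta.
Context (d_zero : d 0 = 1) (d_odd : forall n, d n.*2.+1 = n.+1%:R)
  (d_even : forall n, d n.*2.+2 = - n.+1%:R).

Definition zw (z : C) k : C := cpow `|d k| (- (2 * z)).

Lemma zwE z k : zw z k = xp (2 * z) `|d k|. Proof. by rewrite /zw cpowE. Qed.

Lemma zw_bound z k (m : nat) : m%:R <= re (2 * z) -> cabs (zw z k) <= `|d k| ^ (- m%:Z).
Proof. by move=> h; rewrite zwE -exprnN; exact: xp_bound. Qed.

Definition diagonal f k : C := coef (f (ve k)) k.

Lemma diagonal_bound p f : OP p f -> exists M, forall k, cabs (diagonal f k) <= M * `|d k| ^ p.
Proof.
move=> [_ /(_ 0) [M hM]]; exists M => k.
have := coef_le_nrm onb (f (ve k)) k; have := hM (ve k).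
rewrite snorm0 add0r /snorm Apow_ve VvalZ nrmZ cabs_dpow nrm_e // mulr1 => h1 h2.
exact: le_trans h2 h1.
Qed.

Lemma re_double z : re (2 * z) = re z + re z :> R.
Proof. by rewrite mulr_natl mulr2n reD. Qed.

(** For [re z] above [m = |p| + 2] the operator [T |D|^(-2z)] has order at most -2 and is of trace
    class; in the eigenbasis of [|D|] its trace involves only the diagonal of [T]. *)
Lemma zeta_trace p f g : OP p f -> OP p g -> adjp f g -> exists x0 : R,
  forall z, x0 < re z ->
    csummable (fun k => zw z k * diagonal f k) /\
    is_zeta ip Dop (gr f) z (csum (fun k => zw z k * diagonal f k)).
Proof.
move=> of_ og a; pose m := (`|p| + 2)%N.
exists m%:R => z hz.
have hm : m%:R <= re (2 * z).
  by rewrite re_double; have : 0 <= m%:R :> R by []; lra.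
have mp : - m%:Z + p <= -2 by rewrite /m; lia.
have zb k := zw_bound k hm.
have ow : OP (- m%:Z) (vdiag (zw z)).
  by apply: (@OP_vdiag _ _ 1) => k; rewrite mul1r.
have ow' : OP (- m%:Z) (vdiag (fun k => (zw z k)^*)).
  by apply: (@OP_vdiag _ _ 1) => k; rewrite mul1r cabs_conj.
have pw : pbnd (zw z).
  apply: (@pbnd_bounded _ 1) => k; apply: le_trans (zb k) _.
  by have := @dpow_le (- m%:Z) 0 k; rewrite expr0z; apply; rewrite oppr_le0.
have pw' : pbnd (fun k => (zw z k)^*).
  by have [n [K hK]] := pw; exists n, K => k; rewrite cabs_conj.
pose ft := f \o vdiag (zw z); pose gt := vdiag (fun k => (zw z k)^*) \o g.
have oft : OP (-2) ft by apply: (OP_le mp); exact: OP_comp.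
have ogt : OP (-2) gt by apply: (OP_le mp); have := OP_comp ow' og; rewrite addrC.
have aw : adjp (vdiag (zw z)) (vdiag (fun k => (zw z k)^*)).
  by move=> v w; apply: (eq_ip hilb onb) => k; rewrite !coef_vdiag // rmorphM /= conjCK; ring.
have at_ : adjp ft gt by exact: adjp_comp.
have bgt : bdd gt by apply/OP0_bdd/(@OP_le (-2)).
have eT : bext ip (gr f *o opabs_cpow ip Dop (- (2 * z)))%oper = clo gt.
  rewrite /opabs_cpow (fcalc_Diag hilb onb) -/(zw z).
  apply: bext_clo => // [[x y]|v].
    move=> [/= u hu [v [eu ->]]] k; rewrite eu in hu.
    by rewrite /= -[LHS]/(ip (f v) (Vval (ve k))) a (ip_Diag _ pw hu).
  exists (Vval (ft v)), (Vval (vdiag (zw z) v)); last by exists (vdiag (zw z) v).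
  by move=> k /=; rewrite coef_vdiag.
have [M hM] := diagonal_bound of_.
have sm : csummable (fun k => zw z k * diagonal f k).
  apply: (@csummable_invsq _ _ (`|M| * 9)) => k; rewrite cabsM.
  apply: (@le_trans _ _ (`|M| * `|d k| ^ (-2))).
    apply: (@le_trans _ _ (`|d k| ^ (- m%:Z) * (`|M| * `|d k| ^ p))).
      apply: ler_pM; rewrite ?cabs_ge0 //; apply: le_trans (hM k) _.
      by rewrite ler_wpM2r ?exprz_ge0 // ler_norm.
    by rewrite mulrCA -expfzDr ?d_neq0 // ler_wpM2l // dpow_le.
  rewrite -mulrA ler_wpM2l // -exprnN -exprVn.
  have -> : 9 / k.+1%:R ^+ 2 = (3 / k.+1%:R) ^+ 2 :> R.
    by rewrite expr_div_n; congr (_ / _); rewrite expr2 -natrM.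
  by rewrite ler_pXn2r ?nnegrE ?invr_ge0 ?divr_ge0 // d_inv_le.
split=> //; rewrite /is_zeta eT; split; first exact: (clo_schatten1 oft ogt at_).
exists e, (fun k => Vval (ft (ve k))); split=> //.
  by move=> n; exact: (clo_sub (ve n) at_).
have := ccvgP (csum_cvg sm).
have -> : psum (fun k => zw z k * diagonal f k) =
   series (fun n => ip (ft (ve n)) (e n) : C^o).
  apply/funext => N; rewrite /series /= big_mkord; apply: eq_bigr => k _.
  rewrite /ft /= vdiag_ve // (linearZf _ _ (OP_lin of_)) VvalZ ipZl //.
by [].
Qed.

(** Index 0 is the constant mode, odd indices are positive and the other even ones negative
    frequencies; each half becomes a Dirichlet series over [n >= 1]. *)
Lemma psum_split (u : nat -> C) : csummable u ->
  csummable (fun n => u n.*2.+1) -> csummable (fun n => u n.*2.+2) ->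
  csum u = u 0%N + csum (fun n => u n.*2.+1) + csum (fun n => u n.*2.+2).
Proof.
move=> su s1 s2; have := csum_cvg su => cu.
have c3 := ccvgD (ccvgD (ccvg_cst (u 0%N)) (csum_cvg s1)) (csum_cvg s2).
apply: ccvg_unique c3; move=> eps e0; have [N hN] := cu _ e0; exists N => n Nn.
have -> : u 0%N + psum (fun n => u n.*2.+1) n + psum (fun n => u n.*2.+2) n = psum u n.*2.+1.
  elim: n {Nn} => [|n IH]; first by rewrite /psum !big_ord0 !addr0 big_ord1.
  rewrite /psum doubleS 2![in RHS]big_ord_recr /= -/(psum u n.*2.+1) -IH.
  by rewrite /psum 2!big_ord_recr /=; ring.
by apply: hN; rewrite -addnn; lia.
Qed.

Lemma d_odd_abs n : `|d n.*2.+1| = n.+1%:R. Proof. by rewrite d_odd ger0_norm. Qed.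
Lemma d_even_abs n : `|d n.*2.+2| = n.+1%:R. Proof. by rewrite d_even normrN ger0_norm. Qed.

Lemma zw0 z : zw z 0 = 1. Proof. by rewrite zwE d_zero normr1 xp1. Qed.

Lemma zw_odd z n : zw z n.*2.+1 = xp (2 * z) n.+1%:R.
Proof. by rewrite zwE d_odd_abs. Qed.
Lemma zw_even z n : zw z n.*2.+2 = xp (2 * z) n.+1%:R.
Proof. by rewrite zwE d_even_abs. Qed.

(** On each half the sign of [D] is constant and the diagonal has an expansion in powers of [n]. The
    argument [2 z] appears because [|D|^(-2z)] has the eigenvalues [n^(-2z)]. *)
Lemma Psd_zeta MM f g : mult_class MM -> Psd MM f -> Psd MM g -> adjp f g ->
  exists G : C -> C, [/\ zeta_extension ip Dop (gr f) G,
    forall z, pole1 G z & forall z, (forall m : int, 2 * z != m%:~R) -> jet G z].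
Proof.
move=> mc [[p of_] pf] [[q og] _] a.
have [of2 og2] := OP_common of_ og.
have [x0 hx0] := zeta_trace of2 og2 a.
have so n : sgd n.*2.+1 = 1 by rewrite /sgd d_odd gtr0_sg.
have se n : sgd n.*2.+2 = -1 by rewrite /sgd d_even sgrN gtr0_sg //; exact: RCN.
have e1 : expands (fun n => diagonal f n.*2.+1).
  by move=> J; apply: (psd_diag mc (iota := fun n => n.*2.+1) d_odd_abs so (cabs1) (pf J)).
have e2 : expands (fun n => diagonal f n.*2.+2).
  move=> J; apply: (psd_diag mc (iota := fun n => n.*2.+2) d_even_abs se _ (pf J)).
  by rewrite cabsN cabs1.
have [g1 [[x1 h1] p1 j1]] := zeta_of_expansion e1.
have [g2 [[x2 h2] p2 j2]] := zeta_of_expansion e2.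
exists (fun z => diagonal f 0 + g1 (2 * z) + g2 (2 * z)).
have two0 : (2 : C) != 0 by rewrite pnatr_eq0.
have pG z : pole1 (fun z => diagonal f 0 + g1 (2 * z) + g2 (2 * z)) z.
  apply: pole1D; last exact: pole1_scale.
  by apply: pole1D; [apply: (@pole1_jet _ _ _ 1) => // w _; exact: jet_cst|exact: pole1_scale].
split=> //; last first.
  move=> z hz; have js G : jet G (2 * z) -> jet (fun z => G (2 * z)) z.
    move=> jG; have := @jet_affine _ G 2 0 z; rewrite addr0 => /(_ jG).
    by apply: (jet_ext ltr01) => w _; rewrite addr0.
  apply: jetD; last by apply: js; exact: j2.
  by apply: jetD; [exact: jet_cst|apply: js; exact: j1].
split; first by move=> z0; have [c hc] := pole1_laurent (pG z0); exists 1%N, c.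
exists (Num.max 0 (Num.max x0 (Num.max x1 x2))) => z.
rewrite !gt_max => /and4P[z0 zx0 zx1 zx2].
have [sm iz] := hx0 z zx0.
have [|s1 c1] := h1 (2 * z); first by rewrite re_double; lra.
have [|s2 c2] := h2 (2 * z); first by rewrite re_double; lra.
suff <- : csum (fun k => zw z k * diagonal f k) = diagonal f 0 + g1 (2 * z) + g2 (2 * z) by [].
have eo : (fun n => zw z n.*2.+1 * diagonal f n.*2.+1) =
   (fun n => diagonal f n.*2.+1 * xp (2 * z) n.+1%:R).
  by apply/funext => n; rewrite zw_odd mulrC.
have ee : (fun n => zw z n.*2.+2 * diagonal f n.*2.+2) =
   (fun n => diagonal f n.*2.+2 * xp (2 * z) n.+1%:R).
  by apply/funext => n; rewrite zw_even mulrC.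
rewrite (psum_split sm) ?eo ?ee // c1 c2 zw0 mul1r //.
Qed.

(** Rapid decay allows [n^m] to be moved into the coefficients, with [m] so large that [s + m] lies
    in the half-plane of [dirichlet_jet]. *)
Lemma rapid_dirichlet_jet (a : nat -> C) :
  (forall m : nat, exists M : R, forall n, n.+1%:R ^+ m * cabs (a n) <= M) -> forall s,
  (csummable (fun n => a n * xp s n.+1%:R)) /\ jet (fun s => csum (fun n => a n * xp s n.+1%:R)) s.
Proof.
move=> ha s; pose m := (Num.trunc (cabs s)).+4.+2.
have hm : 5 <= re s + m%:R.
  have := truncnS_gt (cabs s); have := re_le_cabs s; rewrite ler_norml => /andP[+ _].
  rewrite /m; set n := Num.trunc _; have -> : n.+4.+2%:R = n.+1%:R + 5 :> R by rewrite -natrD; congr (_%:R); lia.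
  lra.
have [M hM] := ha m; pose b n : C := n.+1%:R ^+ m * a n.
have hb n : cabs (b n) <= M by rewrite cabsM cabsX cabs_nat.
have e1 (w : C) n : a n * xp w n.+1%:R = b n * xp (w + m%:R) n.+1%:R.
  rewrite /b -mulrA mulrCA mulrA -mulrA; congr (_ * _).
  by rewrite xp_pow addrK.
have rem (w : C) : re (w + m%:R) = re w + m%:R by rewrite reD -RCnat.
split.
  have -> : (fun n => a n * xp s n.+1%:R) = (fun n => b n * xp (s + m%:R) n.+1%:R).
    by apply/funext => n; exact: e1.
  by apply: (@xp_summable _ _ M) => //; rewrite rem; lra.
have h5 : 5 <= re (1 * s + m%:R) by rewrite mul1r rem.
apply: (jet_ext ltr01 _ (jet_affine (dirichlet_jet h5 hb))) => w _.
by congr csum; apply/funext => n; rewrite mul1r -e1.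
Qed.

(** The continuation [G] is entire, hence so is [z^j] times it; the residue is read off a Laurent
    expansion whose only coefficient is 0. *)
Lemma smoothing_tau f g j : smoothing f -> smoothing g -> adjp f g -> is_tau ip Dop (gr f) j 0.
Proof.
move=> sf sg a.
have rap (i : nat -> nat) : (forall n, `|d (i n)| = n.+1%:R) ->
    forall m : nat, exists M : R, forall n, n.+1%:R ^+ m * cabs (diagonal f (i n)) <= M.
  move=> hi m; have [M hM] := diagonal_bound (sf (- m%:Z)); exists M => n.
  have p : 0 < n.+1%:R ^+ m :> R by rewrite exprn_gt0.
  have := hM (i n); rewrite hi -exprnN => h; apply: le_trans (ler_wpM2l (ltW p) h) _.
  by rewrite mulrCA mulfV ?gt_eqF // mulr1.
have [x0 hx0] := zeta_trace (sf 0) (sg 0) a.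
pose g1 s := csum (fun n => diagonal f n.*2.+1 * xp s n.+1%:R).
pose g2 s := csum (fun n => diagonal f n.*2.+2 * xp s n.+1%:R).
pose G z := diagonal f 0 + g1 (2 * z) + g2 (2 * z).
have js F z : jet F (2 * z) -> jet (fun z => F (2 * z)) z.
  move=> jF; have := @jet_affine _ F 2 0 z; rewrite addr0 => /(_ jF).
  by apply: (jet_ext ltr01) => w _; rewrite addr0.
have jG z : jet G z.
  apply: jetD; last by apply: js; have [] := rapid_dirichlet_jet (rap _ d_even_abs) (2 * z).
  apply: jetD; first exact: jet_cst.
  by apply: js; have [] := rapid_dirichlet_jet (rap _ d_odd_abs) (2 * z).
exists G.
  split; first by move=> z0; have [c hc] := pole1_laurent (pole1_jet ltr01 (fun (w : C) _ => jG w) : pole1 G z0); exists 1%N, c.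
  exists x0 => z zx0; have [sm iz] := hx0 z zx0.
  suff <- : csum (fun k => zw z k * diagonal f k) = G z by [].
  have [s1 _] := rapid_dirichlet_jet (rap _ d_odd_abs) (2 * z).
  have [s2 _] := rapid_dirichlet_jet (rap _ d_even_abs) (2 * z).
  have eo : (fun n => zw z n.*2.+1 * diagonal f n.*2.+1) =
     (fun n => diagonal f n.*2.+1 * xp (2 * z) n.+1%:R).
    by apply/funext => n; rewrite zw_odd mulrC.
  have ee : (fun n => zw z n.*2.+2 * diagonal f n.*2.+2) =
     (fun n => diagonal f n.*2.+2 * xp (2 * z) n.+1%:R).
    by apply/funext => n; rewrite zw_even mulrC.
  by rewrite (psum_split sm) ?eo ?ee // zw0 mul1r.
exists 0%N, (fun=> 0); split=> //; exists (fun z : C => z ^+ j * G z).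
  apply: jet_holo; exists 1 => // w _; apply: jetM => //.
  elim: j => [|j IH]; first by apply: (jet_ext ltr01 _ (jet_cst 1 w)) => v _; rewrite expr0.
  by apply: (jet_ext ltr01 _ (jetM (jet_id w) IH)) => v _; rewrite exprS.
by apply: dnbhsC; exists 1 => // w _ _; rewrite big1 ?addr0 // => i _; rewrite mul0r.
Qed.

(** Half-integers closer than 1/2 coincide, so at most one of them other than [z0] lies within 1/4
    of [z0], and a smaller radius excludes it. *)
Lemma half_int_discrete : discrete_set [set z : C | exists m : int, 2 * z = m%:~R].
Proof.
move=> z0; pose S := [set z : C | exists m : int, 2 * z = m%:~R].
have sep (z w : C) : S z -> S w -> cabs (z - w) < 1 / 2 -> z = w.
  move=> [m hm] [n hn] h; have : cabs (2 * (z - w)) < 1.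
    by rewrite cabsM -[2]/(2%:R) cabs_nat; lra.
  rewrite mulrBr hm hn -rmorphB /=; have -> : (m - n)%:~R = (((m - n)%:~R : R)%:C)%C :> C.
    by rewrite rmorph_int.
  rewrite cabs_real -intr_norm ltrz1 => h1; have emn : m = n by lia.
  by apply: (mulfI (_ : (2 : C) != 0)); rewrite ?pnatr_eq0 // hm hn emn.
have [[w [Sw wz h]]|no] := pselect (exists w : C, [/\ S w, w != z0 & cabs (w - z0) < 1 / 4]).
  apply: dnbhsC; exists (cabs (w - z0)); first by rewrite cabs_gt0 // subr_eq0.
  move=> v vz hv Sv; have vw : v = w.
    apply: sep => //; have := cabsD (v - z0) (z0 - w); rewrite addrA subrK.
    by rewrite (cabsC z0 w); lra.
  by move: hv; rewrite vw ltxx.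
apply: dnbhsC; exists (1 / 4); first by lra.
by move=> w wz hw Sw; apply: no; exists w.
Qed.

(** Graphs with a pseudodifferential representative and adjoint are closed under the operations that
    define [Psi] and include its generators. Poles at integers [2 z] confine the spectrum to the
    half-integers. *)
Lemma dimension_spectrum MM A : mult_class MM -> A `<=` Bsub (Psd MM) ->
  simple_discrete_dimension_spectrum ip A Dop.
Proof.
move=> mc AB; pose P := [set T | exists f g, [/\ Psd MM f, Psd MM g, adjp f g & T = gr f]].
have PsiP : Psi ip A Dop `<=` P.
  apply: smallest_sub.
    split.
    - move=> _ _ [f [g [pf pg a ->]]] [f' [g' [pf' pg' a' ->]]].
      exists (fun v => f v + f' v), (fun v => g v + g' v).
      by split; [exact: Psd_add|exact: Psd_add|exact: adjpD|rewrite gr_add].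
    - move=> c _ [f [g [pf pg a ->]]]; exists (fun v => c *: f v), (fun v => c^* *: g v).
      by split; [exact: Psd_scale|exact: Psd_scale|exact: adjpZ|rewrite gr_scale].
    - move=> _ _ [f [g [pf pg a ->]]] [f' [g' [pf' pg' a' ->]]].
      exists (f \o f'), (g' \o g).
      by split; [exact: Psd_comp|exact: Psd_comp|exact: adjp_comp|rewrite gr_comp].
  move=> T [S -> [->|AS|[a Aa ->]|[k ->]]].
  - exists Fphase, Fphase; split; [exact: Psd_F|exact: Psd_F|exact: adjp_F|].
    by rewrite opphaseE gr_restr_Diag //; exact: pbnd_sgd.
  - have [f [g [_ a [pf pg] ->]]] := AB _ AS.
    by exists f, g; split=> //; exact: gr_restr_clo.
  - have [f [g [[of_ og] h [pf pg] ->]]] := AB _ Aa.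
    exists (tcomm f), (tcomm_adj g); split.
    + exact: Psd_tcomm.
    + by apply: Psd_smoothing; apply: tcomm_adj_smoothing; exact: (Psd_commF mc pg).
    + exact: tcomm_adjp.
    + rewrite (twisted_comm_clo of_ og h (Psd_commF mc pg)).
      by apply: gr_restr_clo; exact: tcomm_adjp.
  - exists (Apow k), (Apow k); split; [exact: Psd_Apow|exact: Psd_Apow|exact: adjp_Apow|].
    by rewrite opabsE opX_Diag gr_restr_Diag //; exact: pbnd_dpow.
exists [set z | exists m : int, 2 * z = m%:~R]; first exact: half_int_discrete.
move=> T /PsiP [f [g [pf pg a ->]]].
have [G [zG pG jG]] := Psd_zeta mc pf pg a; exists G; split=> //.
  move=> z hz; apply: jet_holo.
  have hz' : forall m : int, 2 * z != m%:~R.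
    by move=> m; apply/eqP => h; apply: hz; exists m.
  (* Holomorphy at [z] needs a whole neighbourhood without half-integers. *)
  have [d1 d10 hd1] := nbhsC_ex (half_int_discrete z).
  exists d1 => // w wz; apply: jG => m; apply/eqP => hm.
  have [wz0|wz0] := eqVneq w z; first by move: (hz' m); rewrite -wz0 hm eqxx.
  by apply: (hd1 w wz) => //; exists m.
by move=> z; exact: pole1_laurent.
Qed.

Definition smoothing_graph (T : oper H) :=
  exists f g, [/\ smoothing f, smoothing g, adjp f g & T = gr f].

Lemma opM_gr S f g : (forall v, S (Vval v, Vval (g v))) ->
  (forall v y, S (Vval v, y) -> y = g v) -> opM S (gr f) = gr (g \o f).
Proof.
move=> h1 h2; apply/seteqP; split=> -[x y] /=.
  by move=> [z [v [-> ->]] /= /h2 ->]; exists v.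
by move=> [v [-> ->]]; exists (Vval (f v)); [exists v|exact: h1].
Qed.

Lemma Diag_Apow_eq k v y : Diag ip e (dpow k) (Vval v, y) -> y = Apow k v.
Proof. by move=> h; apply: (Diag_uniq onb h); exact: Diag_Apow. Qed.

Lemma gr_opM_Diag k f : opM (gr f) (Diag ip e (dpow k)) = gr (f \o Apow k).
Proof.
apply/seteqP; split=> -[x y] /=.
  move=> [z h [v [/= zv ->]]]; exists (Apow (- k) v).
  rewrite /= ApowKN; congr pair; apply: (coef_inj onb) => i.
  by have := h i; rewrite /= zv coef_Apow => ->; rewrite dpowN mulKf // dpow_neq0.
by move=> [v [-> ->]]; exists (Vval (Apow k v)); [exact: Diag_Apow|exists (Apow k v)].
Qed.

Lemma Dop_sq : opX Dop 2 = Diag ip e (dpow 2).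
Proof.
rewrite /opX /= -(Diag1 onb) (@opM_Diag_bounded _ _ _ hilb _ onb _ _ 1) => [|k]; last by rewrite cabs1.
rewrite (_ : (fun k => _) = (fun k => ((d k)%:C)%C)); last by apply/funext => k; rewrite mulr1.
rewrite (@opM_Diag _ _ _ hilb _ onb _ _ 1) // => [|k].
  congr Diag; apply/funext => k; rewrite -RCM /dpow; congr (_%:C)%C.
  by change (d k * d k = `|d k| ^+ 2); rewrite real_normK // num_real.
by rewrite mul1r cabsM ler_peMl ?cabs_ge0 // cabs_real.
Qed.

(** Smoothing operators absorb powers of [|D|] on either side, and [D^2 = |D|^2]. *)
Lemma iterated_comm_smoothing T k : smoothing_graph T -> smoothing_graph (iterated_comm ip Dop T k).
Proof.
move=> hT; elim: k => [//|k [f [g [sf sg a E]]]].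
rewrite /iterated_comm -/(iterated_comm ip Dop T k) E.
exists (fun v => Apow 2 (f v) - Apow 2 (f (Apow (- 2) (Apow 2 v)))).
exists (fun v => g (Apow 2 v) - Apow 2 (Apow (- 2) (g (Apow 2 v)))); split.
- move=> q; apply: OP_sub; first exact: (smoothing_comp_r (OP_Apow 2) sf).
  by have h := smoothing_comp_r (OP_Apow 2) (smoothing_comp_l (smoothing_comp_l sf (OP_Apow (- 2))) (OP_Apow 2)); exact: h.
- move=> q; apply: OP_sub; first exact: (smoothing_comp_l sg (OP_Apow 2)).
  by have h := smoothing_comp_r (OP_Apow 2) (smoothing_comp_r (OP_Apow (- 2)) (smoothing_comp_l sg (OP_Apow 2))); exact: h.
- apply: adjpB; first exact: (adjp_comp (adjp_Apow 2) a).
  by move=> v w; rewrite adjp_Apow a adjp_Apow adjp_Apow.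
rewrite Dop_sq opabsE !opX_Diag (@opM_gr _ _ (Apow 2)); first last.
- by move=> v y; exact: Diag_Apow_eq.
- by move=> v; exact: Diag_Apow.
by rewrite !gr_opM_Diag gr_scale gr_add; congr gr; apply/funext => v; rewrite /= scaleN1r.
Qed.

(** The range is nonempty, since the empty product is the identity, which is not smoothing. This is
    where [m >= 1] enters. *)
Lemma bigop_smoothing m (T : 'I_m.+1 -> oper H) : (forall i, smoothing_graph (T i)) ->
  smoothing_graph (\big[@opM _ H/op1]_(i < m.+1) T i).
Proof.
elim: m T => [|m IH] T hT; rewrite big_ord_recl.
  rewrite big_ord0; have [f [g [sf sg a ->]]] := hT ord0; exists f, g; split=> //.
  apply/seteqP; split=> -[x y] /=; first by move=> [z]; rewrite /op1 /= => ->.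
  by move=> [v [-> ->]]; exists (Vval v) => //; exists v.
have [f [g [sf sg a ->]]] := hT ord0.
have [f' [g' [sf' sg' a' ->]]] := IH _ (fun i => hT (lift ord0 i)).
exists (f \o f'), (g' \o g); split; [exact: (smoothing_comp_l sf (sf' 0))| |exact: adjp_comp|exact: gr_comp].
exact: (smoothing_comp_l sg' (sg 0)).
Qed.

(** Each twisted commutator is [|D|] times a commutator with [F], hence smoothing; the outer factors
    have finite order and preserve this. *)
Lemma moscovici_op_smoothing MM A m (k : m.+1.-tuple nat) (a : 'I_m.+2 -> oper H) :
  mult_class MM -> A `<=` Bsub (Psd MM) -> (forall i, A (a i)) ->
  smoothing_graph (moscovici_op ip Dop k a).
Proof.
move=> mc AB Aa; rewrite /moscovici_op.
set B := \big[_/_]_(i < _) _.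
have [f [g [sf sg adj ->]]] : smoothing_graph B.
  apply: bigop_smoothing => i; apply: iterated_comm_smoothing.
  have [f [g [[of_ og] h [pf pg] ->]]] := AB _ (Aa (lift ord0 i)).
  rewrite (sigma_clo _ of_ og h); set q := - - _.
  have cg := Psd_commF mc (Psd_sgm mc q pg).
  have cf := Psd_commF mc (Psd_sgm mc (- q) pf).
  have hq : adjp (sgm (- q) f) (sgm q g).
    by have := sgm_adj (- q) h; rewrite opprK.
  rewrite (twisted_comm_clo (sgm_OP (- q) of_) (sgm_OP q og) hq cg).
  exists (tcomm (sgm (- q) f)), (tcomm_adj (sgm q g)).
  split; [exact: tcomm_smoothing|exact: tcomm_adj_smoothing|exact: tcomm_adjp|].
  by apply: gr_restr_clo; exact: tcomm_adjp.
have [f0 [g0 [[of_ og] h [pf pg] ->]]] := AB _ (Aa ord0).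
rewrite opphaseE opabsE opX_Diag.
rewrite (@opM_gr _ _ (Fphase \o f0)); first last.
- move=> v y /= [z /(clo_uniq (clo_sub v h)) <- hz]; apply: (Diag_uniq onb hz).
  by move=> i; rewrite coef_F.
- move=> v; exists (Vval (f0 v)); first exact: clo_sub.
  by move=> i; rewrite coef_F.
rewrite gr_opM_Diag; set n := - _.
exists ((Fphase \o f0) \o f \o Apow n), (Apow n \o (g \o (g0 \o Fphase))); split.
- by have h' := smoothing_comp_l (smoothing_comp_r (OP_comp OP_F of_) sf) (OP_Apow n); exact: h'.
- by have h' := smoothing_comp_r (OP_Apow n) (smoothing_comp_l sg (OP_comp og OP_F)); exact: h'.
- apply: adjp_comp (adjp_Apow n); apply: adjp_comp adj; exact: (adjp_comp adjp_F h).
by apply: gr_restr => [v|v y [w [vw ->]]]; [exists v|rewrite (Vval_inj vw)].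
Qed.

Lemma moscovici_value_zero MM A m (a : 'I_m.+1 -> oper H) :
  mult_class MM -> A `<=` Bsub (Psd MM) -> odd m -> (forall i, A (a i)) ->
  moscovici_value ip Dop a 0.
Proof.
move=> mc AB; case: m a => // m a _ Aa.
(* All residues are 0, so the set of multi-indices with nonzero term is empty. *)
exists (fun _ _ => 0) => term.
have t0 k : term k = 0 by rewrite /term big1 ?mulr0 // => j _; rewrite mulr0.
split.
- move=> k j _; have [f [g [sf sg h ->]]] := moscovici_op_smoothing k mc AB Aa.
  exact: (smoothing_tau j sf sg h).
- by rewrite (_ : [set k | _] = set0) //; apply/seteqP; split=> k //=; rewrite t0 eqxx.
by rewrite fsbig1 // => k _; exact: t0.
Qed.

End Zeta.

(** * Compactness of the resolvent *)

Lemma compact_opM_Diag T a : bounded_op ip T -> (forall k, cabs (a k) <= 3 / k.+1%:R) ->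
  compact_op ip (opM T (Diag ip e a)).
Proof.
move=> bT ha; have a3 k : cabs (a k) <= 3.
  by apply: le_trans (ha k) _; rewrite ler_pdivrMr // ler_peMr // ler1n.
split=> [|x y hx hy]; first exact: bounded_opM bT (Diag_bounded hilb onb a3).
have [M M0 hM] := bounded_pos bT.
(* Along this subsequence all coefficients converge at an explicit rate: low coefficients of
   differences become small, and high ones are damped by [a]. *)
have [|p [s [hs hp]]] := @diagonal_subsequenceC _ (fun n k => coef (x n) k).
  by move=> n k; apply: le_trans (hx n); exact: coef_le_nrm.
exists s; suff hc eps : 0 < eps -> exists N, forall m n, (N <= m)%N -> (N <= n)%N ->
    nrm (y (s m) - y (s n)) < eps.
  by have [l hl] := hilb (u := y \o s) hc; exists l; split.
(* The square of 18 is [144 * 2 + 9 * 4]. For [k < N], [|a k| <= 3/(k+1)] and differences at most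
   [4/(N+1)] give [144 = 9 * 16], and 2 bounds the inverse squares; for the others,
   [|a k| <= 3/(N+1)] gives 9 and a difference of unit vectors has squared norm at most 4. *)
move=> eps0; pose N := Num.bound (M * 18 / eps); exists N => m n Nm Nn.
have N0 : 0 < N.+1%:R :> R by [].
have bN : M * (18 / N.+1%:R) < eps.
  rewrite mulrA ltr_pdivrMr // -ltr_pdivrMl // mulrC.
  have := archi_boundP (_ : 0 <= M * 18 / eps); rewrite -/N => h.
  apply: lt_trans (h _) _; last by rewrite ltr_nat.
  by apply: divr_ge0 (ltW eps0); apply: mulr_ge0.
apply: le_lt_trans bN; have [z1 h1 t1] := hy (s m); have [z2 h2 t2] := hy (s n).
have [lT _ _] := bT; apply: le_trans (hM _ _ (linear_opB lT t1 t2)) _; apply: ler_wpM2l => //.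
apply: (nrm_le hilb onb); first by rewrite divr_ge0.
move=> K; pose w := x (s m) - x (s n).
have hz k : coef (z1 - z2) k = a k * coef w k by rewrite !hcoefB h1 h2 mulrBr.
have hw k : (k < N)%N -> cabs (coef w k) <= 4 / N.+1%:R.
  move=> kN; have := cabsB (coef (x (s m)) k - p k) (coef (x (s n)) k - p k).
  rewrite opprB addrA subrK -hcoefB => h; apply: le_trans h _.
  have c1 j : (N <= j)%N -> cabs (coef (x (s j)) k - p k) <= 2 / N.+1%:R.
    move=> Nj; apply: le_trans (hp j k (leq_trans kN Nj)) _.
    by rewrite ler_wpM2l // lef_pV2 ?posrE // ler_nat.
  by have := c1 _ Nm; have := c1 _ Nn; set q := N.+1%:R^-1; lra.
have term k : cabs (coef (z1 - z2) k) ^+ 2 <=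
    N.+1%:R^-2 * (144 * (k.+1%:R ^+ 2)^-1 + 9 * cabs (coef w k) ^+ 2).
  rewrite hz cabsM exprMn; set A := cabs (a k); set W := cabs (coef w k).
  have A0 : 0 <= A := cabs_ge0 _; have W0 : 0 <= W := cabs_ge0 _.
  have i0 : 0 <= (N.+1%:R : R) ^- 2 by rewrite invr_ge0 exprn_ge0.
  have k0 : 0 <= (k.+1%:R ^+ 2 : R)^-1 by rewrite invr_ge0 exprn_ge0.
  have [kN|Nk] := ltnP k N.
    have hA : A ^+ 2 <= 9 * (k.+1%:R ^+ 2)^-1.
      have := ha k; rewrite -/A => h; rewrite (_ : 9 = 3 ^+ 2); last by rewrite -natrX.
      by rewrite -exprVn -exprMn ler_pXn2r // nnegrE ?divr_ge0.
    have hW : W ^+ 2 <= 16 * N.+1%:R^-2.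
      have := hw k kN; rewrite -/W => h; rewrite (_ : 16 = 4 ^+ 2); last by rewrite -natrX.
      by rewrite -exprVn -exprMn ler_pXn2r // nnegrE ?divr_ge0.
    apply: le_trans (ler_pM (sqr_ge0 _) (sqr_ge0 _) hA hW) _.
    move: i0 k0 (sqr_ge0 W); set i := N.+1%:R^-2; set j := (_ ^+ 2)^-1; set q := W ^+ 2.
    by move=> *; nra.
  have hA : A ^+ 2 <= 9 * N.+1%:R^-2.
    have h : A <= 3 / N.+1%:R.
      by apply: le_trans (ha k) _; rewrite ler_wpM2l // lef_pV2 ?posrE // ler_nat.
    rewrite (_ : 9 = 3 ^+ 2); last by rewrite -natrX.
    by rewrite -exprVn -exprMn ler_pXn2r // nnegrE ?divr_ge0.
  apply: le_trans (ler_wpM2r (sqr_ge0 W) hA) _.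
  move: i0 k0; set i := _ ^- 2; set j := _ ^- 2; set q := W ^+ 2 => i0 k0.
  by have := mulr_ge0 i0 k0; lra.
apply: le_trans (ler_sum _ (fun (k : 'I_K) _ => term k)) _.
rewrite -mulr_sumr big_split /= -!mulr_sumr exprMn -exprVn mulrC.
rewrite ler_wpM2r ?exprn_ge0 ?invr_ge0 //.
have s1 := @sum_invsq R K; have s2 := bessel onb w K.
have s3 : nrm w ^+ 2 <= 4.
  rewrite (_ : 4 = 2 ^+ 2); last by rewrite -natrX.
  rewrite ler_pXn2r ?nnegrE ?nrm_ge0 //; apply: le_trans (nrmB _ _ _) _.
  by have := hx (s m); have := hx (s n); lra.
rewrite (_ : 18 ^+ 2 = 144 * 2 + 9 * 4); last by rewrite -!natrM -natrD -natrX.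
by apply: lerD; apply: ler_wpM2l => //; exact: le_trans s3.
Qed.

Lemma resolvent_Diag : exists2 a,
  fcalc ip (fun t => ((Num.sqrt (1 + t ^+ 2))^-1%:C)%C) Dop = Diag ip e a &
  forall k, cabs (a k) <= 3 / k.+1%:R.
Proof.
exists (fun k => ((Num.sqrt (1 + d k ^+ 2))^-1%:C)%C); first exact: fcalc_Diag.
move=> k; rewrite cabs_real ger0_norm ?invr_ge0 ?sqrtr_ge0 //.
have d1 := d_ge1 k; apply: le_trans (d_inv_le k).
rewrite lef_pV2 ?posrE ?sqrtr_gt0; first last.
- exact: lt_le_trans ltr01 d1.
- by apply: ltr_wpDr; [exact: sqr_ge0|].
by rewrite -sqrtr_sqr ler_wsqrtr // lerDr.
Qed.

(** * The twist on operators of order zero *)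

Notation BT := (Bsub (fun=> True)).
Notation sig := (sigma_pow ip Dop).

Lemma BT_star : star_algebra ip BT.
Proof. exact: Bsub_star. Qed.

Lemma Bsub_sub (P Q : (V -> V) -> Prop) : (forall f, P f -> Q f) -> Bsub P `<=` Bsub Q.
Proof. by move=> PQ _ [f [g [ofg h [/PQ pf /PQ pg] ->]]]; exists f, g. Qed.

Lemma Bsub_BT (P : (V -> V) -> Prop) : Bsub P `<=` BT.
Proof. exact: Bsub_sub. Qed.

Lemma Bsub_sig (P : (V -> V) -> Prop) k T : (forall q f, P f -> P (sgm q f)) ->
  Bsub P T -> Bsub P (sig k T).
Proof.
move=> hP [f [g [[of_ og] h [pf pg] ->]]]; exists (sgm k f), (sgm (- k) g).
by rewrite (sigma_clo k of_ og h); split; [split; exact: sgm_OP|exact: sgm_adj|split; exact: hP|].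
Qed.

Lemma sigD k l T : BT T -> sig k (sig l T) = sig (k + l) T.
Proof.
move=> [f [g [[of_ og] h _ ->]]]; rewrite (sigma_clo l of_ og h).
rewrite (sigma_clo k (sgm_OP l of_) (sgm_OP (- l) og) (sgm_adj l h)) sgmD.
by rewrite (sigma_clo _ of_ og h) opprD.
Qed.

Lemma sig0 T : BT T -> sig 0 T = T.
Proof. by move=> [f [g [[of_ og] h _ ->]]]; rewrite (sigma_clo _ of_ og h) oppr0 sgm0. Qed.

Lemma sigNK k T : BT T -> sig (- k) (sig k T) = T.
Proof. by move=> hT; rewrite sigD // addNr sig0. Qed.

Lemma sigKN k T : BT T -> sig k (sig (- k) T) = T.
Proof. by move=> hT; rewrite sigD // addrN sig0. Qed.

Lemma sig_add k S T : BT S -> BT T -> sig k (opD S T) = opD (sig k S) (sig k T).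
Proof.
move=> [f [g [[of_ og] h _ ->]]] [f' [g' [[of' og'] h' _ ->]]].
rewrite clo_add; [|exact: OP0_bdd..].
rewrite (sigma_clo k (OP_add of_ of') (OP_add og og') (adjpD h h')).
rewrite (sigma_clo k of_ og h) (sigma_clo k of' og' h').
rewrite clo_add; [|exact/OP0_bdd/sgm_OP..].
congr clo; apply/funext => v; rewrite /sgm opprK.
by rewrite [LHS](linearDf _ _ (OP_lin (OP_Apow _))).
Qed.

Lemma sig_scale k c T : BT T -> sig k (opZ c T) = opZ c (sig k T).
Proof.
move=> [f [g [[of_ og] h _ ->]]]; rewrite clo_scale; last exact: OP0_bdd.
have h' : adjp (fun v => c *: f v) (fun v => c^* *: g v) by exact: adjpZ.
rewrite (sigma_clo k (OP_scale c of_) (OP_scale _ og) h') (sigma_clo k of_ og h).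
rewrite clo_scale; last exact/OP0_bdd/sgm_OP.
by congr clo; apply/funext => v; rewrite /sgm (linearZf _ _ (OP_lin (OP_Apow _))).
Qed.

Lemma sig_comp k S T : BT S -> BT T -> sig k (opM S T) = opM (sig k S) (sig k T).
Proof.
move=> [f [g [[of_ og] h _ ->]]] [f' [g' [[of' og'] h' _ ->]]].
rewrite clo_comp; [|exact: OP0_bdd..].
have o1 := OP_comp of_ of'; have o2 := OP_comp og' og; rewrite !addr0 in o1 o2.
rewrite (sigma_clo k o1 o2 (adjp_comp h h')).
rewrite (sigma_clo k of_ og h) (sigma_clo k of' og' h').
rewrite clo_comp; [|exact/OP0_bdd/sgm_OP..].
by congr clo; apply/funext => v; rewrite /sgm /= ApowNK.
Qed.

Lemma sig_zero k : sig k op0 = op0.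
Proof.
have z : OP 0 (fun=> 0) := OP_zero 0.
have h : adjp (fun=> 0) (fun=> 0) by move=> v w; rewrite /= ip0l ip0r.
rewrite -clo_zero (sigma_clo k z z h); congr clo; apply/funext => v.
exact: (linear0f (OP_lin (OP_Apow _))).
Qed.

Lemma sig_adjoint k T : BT T -> adjoint ip (sig k T) = sig (- k) (adjoint ip T).
Proof.
move=> [f [g [[of_ og] h _ ->]]]; rewrite (sigma_clo k of_ og h).
rewrite (clo_adjoint (OP0_bdd (sgm_OP k of_)) (OP0_bdd (sgm_OP (- k) og)) (sgm_adj k h)).
rewrite (clo_adjoint (OP0_bdd of_) (OP0_bdd og) h).
by rewrite (sigma_clo (- k) og of_ (adjpC h)) opprK.
Qed.

Lemma BT_bounded T : BT T -> bounded_op ip T.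
Proof. by have [h _ _ _] := BT_star; exact: h. Qed.

(** The inverse power of the twist is defined on the same algebra, which yields injectivity and the
    relation between twist and adjoint. *)
Lemma sig_partial_twist : partial_twist ip BT (sig 1).
Proof.
have BTs k T : BT T -> BT (sig k T) by exact: Bsub_sig.
have [_ _ _ adj] := BT_star.
split=> //.
- exact: BT_star.
- by move=> a /(BTs 1)/BT_bounded.
- by move=> a b; exact: sig_comp.
- by move=> a b /(sigNK 1) {2}<- /(sigNK 1) {2}<- ->.
move=> a Ba; split; first by apply: adj; exact: BTs.
by rewrite sig_adjoint // sigKN //; exact: adj.
Qed.

(** [D a x] is found as the bounded operator [|D| F a F |D|^-1] applied to [D x], since [F |D|^-1]
    inverts [D]. *)
Lemma clo_dom_Dop f g x y : OP 0 f -> OP 0 g -> adjp f g ->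
  dom Dop x -> clo g (x, y) -> dom Dop y.
Proof.
move=> of_ og h [z Dz] gy.
have o0 : OP 0 (Fphase \o g \o Fphase) by have := OP_comp (OP_comp OP_F og) OP_F; rewrite !addr0.
have o1 := sgm_OP (- 1) o0.
have [y' hy'] := clo_exists z (OP0_bdd o1); exists y' => k /=.
rewrite /hcoef (clo_ip (ve k) (OP0_bdd o1) hy') (ip_Dop _ Dz) /sgm /= opprK ApowKN FK.
rewrite -(clo_ip _ (OP0_bdd og) gy) Dop_ve ipZr conj_RC //.
Qed.

Lemma Dop_weakly_twisted MM A : mult_class MM -> A `<=` Bsub (Psd MM) -> star_algebra ip A ->
  weakly_twisted_triple ip A Dop (sig 1).
Proof.
move=> mc AB sA; split=> //.
- by apply: (Diag_self_adjoint hilb onb) => k; exact: conj_RC.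
- exists BT; first exact: sig_partial_twist.
  by move=> T /AB; exact: Bsub_BT.
move=> T /AB [f [g [[of_ og] h [pf pg] ->]]]; split.
- by move=> x y; exact: (clo_dom_Dop of_ og h).
- have sg := Psd_commF mc pg; rewrite (twisted_comm_clo of_ og h sg).
  by apply/clo_bounded/OP0_bdd; exact: tcomm_adj_smoothing.
have [a -> ha] := resolvent_Diag; apply: compact_opM_Diag => //.
exact/clo_bounded/OP0_bdd.
Qed.

Lemma Dop_invertible : invertible_op ip Dop.
Proof.
have d0 k : d k != 0 by rewrite -normr_gt0; exact: lt_le_trans ltr01 (d_ge1 k).
rewrite /invertible_op /Dop opV_Diag => [|k]; last first.
  by apply: contra_neq (d0 k) => /(congr1 (@complex.Re R)).
apply: (@Diag_bounded _ _ _ hilb _ onb _ 1) => k; rewrite cabsV cabs_real.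
by rewrite invf_le1 ?d_ge1 // normr_gt0.
Qed.

(** * The saturated algebra and its twisted spectral triple *)

Section Saturation.
Context (MM : (V -> V) -> Prop) (mc : mult_class MM).
Context (G : set (oper H)) (GB : G `<=` Bsub (Psd MM)).
Notation A := (saturation ip Dop G).

Lemma Psd_star : star_algebra ip (Bsub (Psd MM)).
Proof.
apply: Bsub_star; [exact: Psd_zero|exact: Psd_add|exact: Psd_scale|exact: (Psd_comp mc)].
Qed.

Lemma saturation_sub : A `<=` Bsub (Psd MM).
Proof.
apply: smallest_sub; first exact: Psd_star.
by move=> _ [k [a [/GB Ba ->]]]; apply: Bsub_sig => // q f; exact: Psd_sgm.
Qed.

Lemma saturation_BT : A `<=` BT.
Proof. by move=> T /saturation_sub; exact: Bsub_BT. Qed.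

Lemma saturation_star : star_algebra ip A.
Proof.
split.
- by move=> T /saturation_BT; exact: BT_bounded.
- by move=> B [[]].
- split=> [S T AS AT|c T AT|S T AS AT] B hB; have [[_ _ [bD bZ bM] _] _] := hB.
  + exact: bD (AS B hB) (AT B hB).
  + exact: bZ (AT B hB).
  + exact: bM (AS B hB) (AT B hB).
- by move=> T AT B hB; have [[_ _ _ ba] _] := hB; exact: ba (AT B hB).
Qed.

Lemma saturation_gen k T : G T -> A (sig k T).
Proof. by move=> GT B [_]; apply; exists k, T. Qed.

(** By minimality: the elements of [A] whose images under all powers of the twist stay in [A] form a
    star algebra containing the generators. All powers are treated together, as the adjoint
    exchanges [sigma^q] and [sigma^(-q)]. *)
Lemma saturation_sig k T : A T -> A (sig k T).
Proof.
have [ab a0 [aD aZ aM] aa] := saturation_star.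
suff : A `<=` [set T | A T /\ forall q, A (sig q T)] by move=> h /h [].
apply: smallest_sub; last first.
  move=> _ [l [S [GS ->]]]; split=> [|q]; first exact: saturation_gen.
  by rewrite sigD; [exact: saturation_gen|exact/Bsub_BT/GB].
split.
- by move=> S [/ab].
- by split=> // q; rewrite sig_zero.
- split=> [S S' [AS hS] [AS' hS']|c S [AS hS]|S S' [AS hS] [AS' hS']]; split=> [|q].
  + exact: aD.
  + by rewrite sig_add; [exact: aD|exact: saturation_BT..].
  + exact: aZ.
  + by rewrite sig_scale; [exact: aZ|exact: saturation_BT].
  + exact: aM.
  + by rewrite sig_comp; [exact: aM|exact: saturation_BT..].
- move=> S [AS hS]; split=> [|q]; first exact: aa.
  by rewrite -[q]opprK -sig_adjoint; [exact: aa|exact: saturation_BT].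
Qed.

Lemma sig_linear_iso (B : set (oper H)) : B `<=` BT -> (forall k T, B T -> B (sig k T)) ->
  linear_iso B (sig 1).
Proof.
move=> BB hB; split=> [a|b Bb|a b|a b|c a]; first exact: hB.
- by exists (sig (- 1) b); [exact: hB|rewrite sigKN //; exact: BB].
- by move=> /BB/(sigNK 1) {2}<- /BB/(sigNK 1) {2}<- ->.
- by move=> /BB Ba /BB Bb; exact: sig_add.
- by move=> /BB Ba; exact: sig_scale.
Qed.

Lemma saturation_twisted : twisted_triple ip A Dop (sig 1).
Proof.
split.
- by apply: (Dop_weakly_twisted mc) saturation_star; exact: saturation_sub.
- by apply: sig_linear_iso; [exact: saturation_BT|exact: saturation_sig].
by move=> a b /saturation_BT Ba /saturation_BT Bb; exact: sig_comp.
Qed.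

(** [B] consists of all operators of order 0 with adjoint of order 0. It contains the twisted
    commutators, which are smoothing, and the derivation by [|D|] is zero on it. *)
Lemma saturation_regular : regular_triple ip A Dop (sig 1).
Proof.
exists BT, (sig 1); split=> //.
- split; first exact: BT_star.
  by apply: sig_linear_iso => // k T; exact: Bsub_sig.
- exact: saturation_BT.
- move=> T /saturation_sub [f [g [[of_ og] h [pf pg] ->]]].
  have sf := Psd_commF mc pf; have sg := Psd_commF mc pg.
  rewrite (twisted_comm_clo of_ og h sg); exists (tcomm f), (tcomm_adj g).
  split=> //; last exact: tcomm_adjp.
  by split; [exact: tcomm_smoothing|exact: tcomm_adj_smoothing].
move=> T [f [g [[of_ og] h _ ->]]]; rewrite (absD_comm_clo of_ og h).
by have [] := BT_star.
Qed.

End Saturation.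

(** Duality: the estimate for [g] at order [q] gives the one for [f] at order [-q], by pairing [f v]
    with itself in the norm of order [-q] and dividing by that norm. *)
Lemma OP_of_adjp f g : linear f -> adjp f g ->
  (forall n : nat, exists M : R, forall v, snorm n (f v) <= M * snorm n v) ->
  (forall n : nat, exists M : R, forall v, snorm n (g v) <= M * snorm n v) -> OP 0 f.
Proof.
move=> lf a hf hg; split=> // -[n|n]; rewrite addr0; first exact: hf.
have [M hM] := hg n.+1; exists M => v; rewrite NegzE; set q : int := n.+1.
have [f0|f0] := eqVneq (snorm (- q) (f v)) 0.
  have h := hM (Apow (- q - q) v).
  have := le_trans (snorm_ge0 _ _) h; rewrite f0 snorm_Apow -/q addrCA subrr addr0 //.
have fp : 0 < snorm (- q) (f v) by rewrite lt_def f0 snorm_ge0.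
rewrite -(ler_pM2r fp) -expr2.
have -> : snorm (- q) (f v) ^+ 2 = cabs (ip (Apow (- q) v) (Apow q (g (Apow (- q - q) (f v))))).
  rewrite (adjp_Apow (- q) v) ApowNK -a -ApowD -adjp_Apow.
  by rewrite ip_nrm cabs_real ger0_norm ?sqr_ge0.
apply: le_trans (cauchy_schwarz _ _ _) _.
apply: (@le_trans _ _ (snorm (- q) v * (M * snorm (- q) (f v)))).
  apply: ler_wpM2l; first exact: snorm_ge0.
  by apply: le_trans (hM _) _; rewrite snorm_Apow addrCA subrr addr0.
by rewrite mulrCA mulrA.
Qed.

(** The coefficient of [f v] at [i] pairs [v] in the norm of order [r] with [g e_i] in the norm of
    order [-r]. One factor 5 comes from the norm of [g e_i], the other from the sum over [i], both
    by [invsq_sum]. *)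
Lemma kernel_smoothing f g : linear f -> adjp f g ->
  (forall N : nat, exists M : R, forall j k,
     `|d j| ^+ N * `|d k| ^+ N * cabs (coef (f (ve j)) k) <= M) -> smoothing f.
Proof.
move=> lf a hk q; split=> // k; pose r := k + q.
pose N := maxn `|k|.+1 `|r|.+1; have [C0 hC] := hk N.
have pw (z : int) i : z + 1 <= N%:Z -> `|d i| ^ z * `|d i| <= `|d i| ^+ N.
  move=> zN; rewrite -[X in _ * X]expr1z -expfzDr ?d_neq0 //.
  exact: (@dpow_le (z + 1) N i).
have C00 : 0 <= C0.
  by apply: le_trans (hC 0%N 0%N); rewrite !mulr_ge0 ?exprn_ge0 ?cabs_ge0.
have hg j i : cabs (coef (g (ve i)) j) = cabs (coef (f (ve j)) i).
  by rewrite /hcoef -[ip (g _) _]ip_conj cabs_conj -[e j]/(Vval (ve j)) -a.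
have b1 i : nrm (Apow (- r) (g (ve i))) * `|d i| ^+ N <= 5 * C0.
  have dN : 0 < `|d i| ^+ N by rewrite exprn_gt0 // d_gt0.
  rewrite -ler_pdivlMr // -mulrA; apply: (nrm_le hilb onb).
    by rewrite mulr_ge0 // divr_ge0 // ltW.
  apply: invsq_sum => [|j]; first by rewrite divr_ge0 // ltW.
  rewrite coef_Apow cabsM cabs_dpow ler_pdivlMr // hg.
  apply: le_trans (hC j i); rewrite [X in X * _ <= _]mulrAC [leLHS]mulrAC.
  apply: ler_wpM2r; first exact: cabs_ge0.
  by apply: ler_wpM2r; [exact: ltW|apply: pw; rewrite /N; lia].
exists (5 * (5 * C0)) => v; rewrite -mulrA -/r.
have s0 : 0 <= 5 * C0 * snorm r v by rewrite !mulr_ge0 ?snorm_ge0.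
apply: (nrm_le hilb onb); first by rewrite mulr_ge0.
apply: invsq_sum => // i; rewrite coef_Apow cabsM cabs_dpow.
have -> : coef (f v) i = ip (Apow r v) (Apow (- r) (g (ve i))).
  by rewrite adjp_Apow ApowKN -a.
apply: le_trans (ler_wpM2r (normr_ge0 _) (ler_wpM2l (exprz_ge0 _ (normr_ge0 _)) (cauchy_schwarz _ _ _))) _.
rewrite -/(snorm r v); rewrite [snorm r v * _]mulrC mulrA [leLHS]mulrAC [_ ^ k * _]mulrC -[_ * _ * `|d i|]mulrA.
apply: ler_wpM2r; first exact: snorm_ge0.
apply: le_trans (b1 i); apply: ler_wpM2l; first exact: nrm_ge0.
by apply: pw; rewrite /N; lia.
Qed.

(** * Multiplication operators from a derivation rule *)

Section MultiplicationOperators.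
(** Symbols [X] act by [T]; [cj] and [dr] stand for conjugation and [-i] times the derivative, and
    [nu] for the frequencies, from which [d] differs only at index 0. *)
Context (X : Type) (T : X -> H -> H) (cj dr : X -> X) (one : X) (mul : X -> X -> X).
Context (nu : nat -> R) (nu0 : nu 0%N = 0) (nu_d : forall k, d k = nu k + (k == 0%N)%:R).
Context (gap : forall j k, sgd j != sgd k -> `|d j| <= `|nu k - nu j| /\ `|d k| <= `|nu k - nu j|).
Context (Tlin : forall s c x y, T s (c *: x + y) = c *: T s x + T s y).
Context (Tbd : forall s, exists2 K : R, 0 <= K & forall x, nrm (T s x) <= K * nrm x).
Context (Tcj : forall s x y, ip (T s x) y = ip x (T (cj s) y)).
Context (Tdr : forall s x y, Diag ip e (fun k => ((nu k)%:C)%C) (x, y) ->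
  Diag ip e (fun k => ((nu k)%:C)%C) (T s x, T s y + T (dr s) x)).
Context (Tone : forall x, T one x = x) (Tmul : forall s t x, T (mul s t) x = T s (T t x)).
Context (Tdiag : forall s, exists c, forall k, ip (T s (e k)) (e k) = c).

Definition nuc k : C := ((nu k)%:C)%C.
Definition del0 k : C := (k == 0%N)%:R.

Lemma d0E : d 0%N = 1. Proof. by rewrite nu_d nu0 add0r. Qed.

Lemma cabs_nuc k : cabs (nuc k) <= 1 * `|d k| ^ 1.
Proof.
rewrite cabs_real mul1r expr1z; case: k => [|k]; first by rewrite nu0 normr0.
by rewrite nu_d addr0.
Qed.

Lemma cabs_del0 q k : cabs (del0 k) <= 1 * `|d k| ^ q.
Proof.
rewrite mul1r /del0; case: k => [|k]; first by rewrite cabs1 d0E normr1 exp1rz.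
by rewrite cabs0 exprz_ge0.
Qed.

Lemma OP_nuc : OP 1 (vdiag nuc). Proof. exact: OP_vdiag cabs_nuc. Qed.
Lemma OP_del0 q : OP q (vdiag del0). Proof. exact: OP_vdiag (cabs_del0 q). Qed.

Lemma pbnd_nuc : pbnd nuc.
Proof. by exists 1%N, 1 => k; have := cabs_nuc k. Qed.
Lemma pbnd_del0 : pbnd del0.
Proof. by exists 0%N, 1 => k; have := cabs_del0 0 k. Qed.

Lemma nuc_del0 k : dpow 1 k = sgd k * nuc k + del0 k.
Proof.
rewrite /dpow expr1z /nuc /del0; case: k => [|k].
  by rewrite nu0 mulr0 add0r d0E normr1.
by rewrite addr0 -RCM; congr (_%:C)%C; rewrite normrEsg nu_d addr0.
Qed.

(** Induction on the power: the derivation rule trades a factor [nu k] for [T s] and [T (dr s)]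
    applied to rapid vectors. Index 0, where [nu] vanishes, is bounded separately. *)
Lemma T_rapid s v : T s v \in rapid ip e d.
Proof.
apply/rapidP => n; elim: n s v => [|n IH] s v.
  by exists (nrm (T s v)) => k; rewrite expr0 mul1r; exact: coef_le_nrm.
have [M1 h1] := IH s (vdiag nuc v); have [M2 h2] := IH (dr s) v.
have hc : Diag ip e nuc (T s v, T s (vdiag nuc v) + T (dr s) v).
  by apply: Tdr => k /=; rewrite coef_vdiag //; exact: pbnd_nuc.
have M10 : 0 <= M1 by apply: le_trans (h1 0%N); rewrite mulr_ge0 ?exprn_ge0 ?cabs_ge0.
have M20 : 0 <= M2 by apply: le_trans (h2 0%N); rewrite mulr_ge0 ?exprn_ge0 ?cabs_ge0.
exists (M1 + M2 + nrm (T s v)) => -[|k].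
  rewrite d0E normr1 expr1n mul1r; apply: le_trans (coef_le_nrm onb _ _) _.
  by rewrite lerDr addr_ge0.
have := hc k.+1; rewrite /= hcoefD => hk.
have -> : `|d k.+1| ^+ n.+1 * cabs (coef (T s v) k.+1) =
    `|d k.+1| ^+ n * cabs (coef (T s (vdiag nuc v)) k.+1 + coef (T (dr s) v) k.+1).
  by rewrite hk cabsM cabs_real exprSr -mulrA nu_d addr0.
apply: (@le_trans _ _ (M1 + M2)); last by rewrite lerDl nrm_ge0.
apply: le_trans (ler_wpM2l _ (cabsD _ _)) _; first exact: exprn_ge0.
by rewrite mulrDr lerD.
Qed.

Definition mop s v : V := MkSmooth (T_rapid s v).

Lemma mop_lin s : linear (mop s).
Proof. move=> c v w; apply: Vval_inj.
by change (T s (Vval (c *: v + w)) = Vval (c *: mop s v + mop s w)); rewrite !VvalD !VvalZ Tlin. Qed.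

Lemma adjp_mop s : adjp (mop s) (mop (cj s)).
Proof. by move=> v w; exact: Tcj. Qed.

Lemma nuc_mop s v : vdiag nuc (mop s v) = mop s (vdiag nuc v) + mop (dr s) v.
Proof.
apply: smooth_inj => k; rewrite coef_vdiag; last exact: pbnd_nuc.
have hc : Diag ip e nuc (T s v, T s (vdiag nuc v) + T (dr s) v).
  by apply: Tdr => j /=; rewrite coef_vdiag //; exact: pbnd_nuc.
by rewrite VvalD -(hc k).
Qed.

Lemma Apow1E v : Apow 1 v = Fphase (vdiag nuc v) + vdiag del0 v.
Proof.
apply: smooth_inj => k; rewrite VvalD hcoefD coef_Apow coef_F.
rewrite (coef_vdiag _ _ pbnd_nuc) (coef_vdiag _ _ pbnd_del0).
by rewrite nuc_del0 mulrDl mulrA.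
Qed.

(** The derivation rule gives nonnegative orders by induction; negative ones follow by
    [OP_of_adjp]. *)
Lemma mop_snorm s (n : nat) : exists M : R, forall v, snorm n (mop s v) <= M * snorm n v.
Proof.
suff : exists2 M : R, 0 <= M & forall v, snorm n (mop s v) <= M * snorm n v by case=> M; exists M.
elim: n s => [|n IH] s.
  by have [K K0 hK] := Tbd s; exists K => // v; rewrite !snorm0; exact: hK.
have [M1 M10 h1] := IH s; have [M2 M20 h2] := IH (dr s).
have [N1 N10 g1] := OP_pos OP_nuc n; have [N2 N20 g2] := OP_pos (OP_del0 0) n.
exists (M1 * N1 + M2 + N2 * M1).
  by rewrite !addr_ge0 ?mulr_ge0.
move=> v; have nS : n.+1%:Z = n%:Z + 1 by lia.
have le1 : snorm n v <= snorm n.+1 v by apply: snorm_le; lia.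
have e1 : snorm n.+1 (mop s v) <= snorm n (vdiag nuc (mop s v)) + snorm n (vdiag del0 (mop s v)).
  rewrite nS -snorm_Apow Apow1E; apply: le_trans (snormD _ _ _) _.
  by rewrite snorm_F.
apply: le_trans e1 _; rewrite mulrDl; apply: lerD; last first.
  have := g2 (mop s v); rewrite addr0 => h; apply: le_trans h _; rewrite -mulrA.
  apply: ler_wpM2l => //; apply: le_trans (h1 v) _; exact: ler_wpM2l.
rewrite nuc_mop mulrDl; apply: le_trans (snormD _ _ _) _; apply: lerD.
  apply: le_trans (h1 _) _; rewrite -mulrA; apply: ler_wpM2l => //.
  by rewrite nS; exact: g1.
by apply: le_trans (h2 v) _; exact: ler_wpM2l.
Qed.

Lemma OP_mop s : OP 0 (mop s).
Proof. exact: OP_of_adjp (@mop_lin s) (@adjp_mop s) (mop_snorm s) (mop_snorm (cj s)). Qed.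

(** In a matrix entry each factor [nu k - nu j] replaces the symbol by its derivative, which still
    acts boundedly. *)
Lemma mop_offdiag s (N : nat) : exists M : R, forall j k,
  `|nu k - nu j| ^+ N * cabs (coef (mop s (ve j)) k) <= M.
Proof.
elim: N s => [|N IH] s.
  have [K _ hK] := Tbd s; exists K => j k; rewrite expr0 mul1r.
  apply: le_trans (coef_le_nrm onb _ _) _.
  by have := hK (e j); rewrite (nrm_e onb) mulr1.
have [M hM] := IH (dr s); exists M => j k.
have := congr1 (fun w : V => coef w k) (nuc_mop s (ve j)).
rewrite VvalD hcoefD coef_vdiag; last exact: pbnd_nuc.
rewrite (vdiag_ve _ pbnd_nuc) (linearZf _ _ (@mop_lin s)) VvalZ hcoefZ => h.
have {}h : ((nu k - nu j)%:C)%C * coef (mop s (ve j)) k = coef (mop (dr s) (ve j)) k.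
  by rewrite RCD RCN mulrDl mulNr -/(nuc k) -/(nuc j) h addrAC subrr add0r.
by rewrite exprSr -mulrA (_ : `|_| * _ = cabs (coef (mop (dr s) (ve j)) k)) // -h cabsM cabs_real.
Qed.

(** Entries of the commutator carry the factor [sgd k - sgd j]. Where it is nonzero, [gap] bounds
    both [|d j|] and [|d k|] by the frequency difference, and [N + N] powers of that cover both. *)
Lemma commF_mop s : smoothing (commF (mop s)).
Proof.
have lin : linear (commF (mop s)).
  by apply: OP_lin; apply: OP_sub; [exact: (OP_comp OP_F (OP_mop s))|exact: (OP_comp (OP_mop s) OP_F)].
apply: (@kernel_smoothing _ (fun v => mop (cj s) (Fphase v) - Fphase (mop (cj s) v))) => //.
  apply: adjpB; first exact: (adjp_comp adjp_F (@adjp_mop s)).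
  exact: (adjp_comp (@adjp_mop s) adjp_F).
move=> N; have [M hM] := mop_offdiag s (N + N); exists (2 * M) => j k.
have M0 : 0 <= M by apply: le_trans (hM 0%N 0%N); rewrite mulr_ge0 ?exprn_ge0 ?cabs_ge0.
have -> : coef (commF (mop s) (ve j)) k = (sgd k - sgd j) * coef (mop s (ve j)) k.
  rewrite /commF VvalB hcoefB coef_F F_ve (linearZf _ _ (@mop_lin s)) VvalZ hcoefZ.
  by rewrite mulrBl.
have [->|ne] := eqVneq (sgd j) (sgd k); first by rewrite subrr mul0r cabs0 mulr0 mulr_ge0.
have [g1 g2] := gap ne; rewrite cabsM mulrCA; apply: ler_pM => //.
- exact: cabs_ge0.
- by rewrite !mulr_ge0 ?exprn_ge0 ?cabs_ge0.
- by apply: le_trans (cabsB _ _) _; rewrite !cabs_sgd.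
apply: le_trans (hM j k); rewrite exprD; apply: ler_wpM2r; first exact: cabs_ge0.
by apply: ler_pM; rewrite ?exprn_ge0 // lerXn2r ?nnegrE.
Qed.

Definition mops (m : V -> V) := exists s, m = mop s.

Lemma mops_class : mult_class mops.
Proof.
split.
- by exists one; apply/funext => v; apply: Vval_inj; rewrite /= Tone.
- move=> _ _ [s ->] [t ->]; exists (mul s t); apply/funext => v; apply: Vval_inj.
  by rewrite /= Tmul.
- move=> _ [s ->]; exists (mop (dr s)); first by exists (dr s).
  (* Splitting [|D|] as in [Apow1E] leaves commutators with [F] and terms with the rank-one
     projection [vdiag del0], all smoothing. *)
  have h : (fun v => Apow 1 (mop s v) - mop s (Apow 1 v) - mop (dr s) (Fphase v)) =
      (fun v => (commF (mop s) (vdiag nuc v) + commF (mop (dr s)) v) +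
         (vdiag del0 (mop s v) - mop s (vdiag del0 v))).
    apply/funext => v; rewrite (Apow1E (mop s v)) (Apow1E v) nuc_mop /commF.
    rewrite (linearDf _ _ (OP_lin OP_F)) (linearDf _ _ (@mop_lin s)).
    move: (Fphase (mop s (vdiag nuc v))) (Fphase (mop (dr s) v)) (vdiag del0 (mop s v))
      (mop s (Fphase (vdiag nuc v))) (mop s (vdiag del0 v)) (mop (dr s) (Fphase v)) => z1 z2 z3 z4 z5 z6.
    apply: smooth_inj => k; rewrite !(VvalD, VvalN) !(hcoefD, hcoefN).
    move: (coef z1 k) (coef z2 k) (coef z3 k) (coef z4 k) (coef z5 k) (coef z6 k) => *; ring.
  rewrite h => q; apply: OP_add; first apply: OP_add.
  + exact: (smoothing_comp_l (commF_mop s) OP_nuc).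
  + exact: commF_mop.
  have sd : smoothing (vdiag del0) by move=> r; exact: OP_del0.
  apply: OP_sub.
  + exact: (smoothing_comp_l sd (OP_mop s)).
  + exact: (smoothing_comp_r (OP_mop s) sd).
- by move=> _ [s ->]; exact: commF_mop.
- by move=> _ [s ->]; exact: OP_mop.
- by move=> _ [s ->]; have [c hc] := Tdiag s; exists c => k; exact: hc.
Qed.

Lemma mop_Bsub s : Bsub (Psd mops) [set p | p.2 = T s p.1].
Proof.
exists (mop s), (mop (cj s)); split.
- by split; exact: OP_mop.
- exact: adjp_mop.
- by split; apply: (Psd_mult mops_class); eexists.
apply/seteqP; split=> -[x y] /=.
  by move=> -> k; rewrite /hcoef Tcj.
move=> h; apply: (coef_inj onb) => k; have := h k; rewrite /= => ->.
by rewrite -Tcj.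
Qed.

End MultiplicationOperators.

End OperatorOrder.

(** * Completeness of square-integrable functions *)

Section L2complete.
Context d (T : measurableType d) {R : realType} (mu : {measure set T -> \bar R}).
Hypothesis muT : (mu setT < +oo)%E.
Local Notation sq f := (\int[mu]_x ((f x) ^+ 2)%:E)%E.

Lemma Lfun2P (f : T -> R) : f \in Lfun mu 2%:E <->
  measurable_fun setT f /\ (sq f < +oo)%E.
Proof.
split=> [fL|[mf if_]].
  split; first by move: fL; rewrite inE => /andP[/[!inE]].
  exact: (integrable_lty measurableT (Lfun2_integrable_sqr fL)).
rewrite inE; apply/andP; split; rewrite inE //= /finite_norm unlock.
rewrite poweR_lty //; apply: le_lt_trans if_; rewrite le_eqVlt; apply/orP; left.
by apply/eqP/eq_integral => x _ /=; rewrite powR_mulrn // real_normK // num_real.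
Qed.

Lemma sq_ge0 (f : T -> R) : (0 <= sq f)%E.
Proof. by apply: integral_ge0 => x _; rewrite lee_fin sqr_ge0. Qed.

Lemma limn_einf_le (u : nat -> \bar R) (c : \bar R) N :
  (forall n, (N <= n)%N -> (u n <= c)%E) -> (limn_einf u <= c)%E.
Proof.
move=> h; rewrite limn_einf_lim; apply: lime_le; first exact: is_cvg_einfs.
apply: nearW => k; apply: (@le_trans _ _ (u (maxn k N))); last by apply: h; rewrite leq_maxr.
by apply: ereal_inf_lbound; exists (maxn k N) => //=; rewrite leq_maxl.
Qed.

(** A subsequence whose differences have square integral below [16^-k] converges almost everywhere,
    and Fatou's lemma makes the pointwise limit a limit in mean. *)
Lemma L2_complete (h : nat -> T -> R) : (forall n, h n \in Lfun mu 2%:E) ->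
  (forall e : R, 0 < e -> exists N, forall m n, (N <= m)%N -> (N <= n)%N ->
     (sq (fun t => h m t - h n t)%R < e%:E)%E) ->
  exists2 l, l \in Lfun mu 2%:E & forall e : R, 0 < e -> exists N, forall n, (N <= n)%N ->
     (sq (fun t => h n t - l t)%R <= e%:E)%E.
Proof.
move=> hL cau.
have mh n : measurable_fun setT (h n) by have [] := (Lfun2P _).1 (hL n).
have p16 k : 0 < (16^-1 ^+ k : R) by rewrite exprn_gt0.
pose N k := projT1 (cid (cau _ (p16 k))).
have hN k m n : (N k <= m)%N -> (N k <= n)%N -> (sq (fun t => h m t - h n t)%R < (16^-1 ^+ k)%:E)%E.
  exact: (projT2 (cid (cau _ (p16 k)))).
pose s := fix s k := if k is k'.+1 then maxn (s k') (N k) else N 0%N.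
have sN k : (N k <= s k)%N by case: k => //= k; rewrite leq_maxr.
have sS k : (s k <= s k.+1)%N by rewrite /= leq_maxl.
have smon : {homo s : m n / (m <= n)%N} by apply: homo_leq => //; exact: leq_trans.
pose g k := h (s k); pose D k t : R := `|g k.+1 t - g k t|.
have mg k : measurable_fun setT (g k) by exact: mh.
have mD k : measurable_fun setT (EFin \o D k).
  by apply/measurable_EFinP/measurableT_comp => //; exact: measurable_funB.
have D0 k t : (0 <= (D k t)%:E)%E by rewrite lee_fin normr_ge0.
pose c : R := fine (mu setT); have c0 : 0 <= c by rewrite fine_ge0.
have muE : mu setT = c%:E by rewrite fineK // ge0_fin_numE.
have iD k : (\int[mu]_t (D k t)%:E <= ((c + 1) * 4^-1 ^+ k)%:E)%E.
  have k4 : 0 < (4^-1 ^+ k : R) by rewrite exprn_gt0.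
  have hk : (sq (fun t => g k.+1 t - g k t)%R < (16^-1 ^+ k)%:E)%E.
    by apply: hN => //; exact: leq_trans (sS _).
  (* The inequality [|x| <= q + x^2 / q] with [q = 4^-k] converts [16^-k] for squares into a
     multiple of [4^-k] for absolute values, the total mass being finite. *)
  apply: (@le_trans _ _ (\int[mu]_t ((4^-1 ^+ k)%:E + ((4 ^+ k)%:E * ((g k.+1 t - g k t) ^+ 2)%:E)))%E).
    apply: ge0_le_integral => //.
    - exact: (mD k).
    - apply: emeasurable_funD => //; apply: emeasurable_funM => //.
      by apply/measurable_EFinP/measurable_funX; exact: measurable_funB.
    move=> t _; rewrite -EFinM -EFinD lee_fin /D -real_normK ?num_real //.
    set x := `|_|; have x0 : 0 <= x by exact: normr_ge0.
    rewrite (_ : 4 ^+ k = (4^-1 ^+ k)^-1); last by rewrite -exprVn invrK.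
    set q := 4^-1 ^+ k in k4 *; rewrite -(ler_pM2l k4) mulrDr mulrA mulfV ?gt_eqF // mul1r.
    by have := sqr_ge0 (q - x); nra.
  rewrite ge0_integralD //; first last.
  - by apply: emeasurable_funM => //; apply/measurable_EFinP/measurable_funX; exact: measurable_funB.
  - by move=> t _; rewrite -EFinM lee_fin mulr_ge0 ?sqr_ge0 // exprn_ge0.
  rewrite integral_cst // muE ge0_integralZl //; first last.
  - by move=> t _; rewrite lee_fin sqr_ge0.
  - by apply/measurable_EFinP/measurable_funX; exact: measurable_funB.
  rewrite mulrDl mul1r EFinD mulrC EFinM; apply: leeD => //.
  apply: (@le_trans _ _ ((4 ^+ k)%:E * (16^-1 ^+ k)%:E)%E).
    by apply: lee_wpmul2l; [rewrite lee_fin exprn_ge0|exact: ltW].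
  by rewrite -EFinM lee_fin -exprMn; rewrite (_ : 4 * 16^-1 = 4^-1 :> R) //; lra.
have S_fin : (\int[mu]_t (\sum_(0 <= k <oo) (D k t)%:E) < +oo)%E.
  rewrite integral_nneseries //.
  apply: (@le_lt_trans _ _ (\sum_(0 <= k <oo) ((c + 1) * 4^-1 ^+ k)%:E)%E).
    by apply: lee_nneseries => k *; [exact: integral_ge0|exact: iD].
  have q1 : `|4^-1| < 1 :> R by rewrite ger0_norm ?invr_ge0 //; lra.
  have hg := @cvg_geometric_series R (c + 1) 4^-1 q1.
  rewrite (_ : (fun n => _) = (fun n => (series (geometric (c + 1) 4^-1) n)%:E)).
    rewrite (_ : limn _ = ((c + 1) / (1 - 4^-1))%:E) ?ltry //.
    by apply: cvg_lim => //; apply: cvg_EFin => //; exact: nearW.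
  by apply/funext => n; rewrite /series /= sumEFin.
have mS : measurable_fun setT (fun t => (\sum_(0 <= k <oo) (D k t)%:E)%E).
  by apply: ge0_emeasurable_sum => // k _; exact: (mD k).
have aeF : Filter (almost_everywhere mu) := ae_filter_ringOfSetsType mu.
have cv : {ae mu, forall t, cvgn (g ^~ t)}.
  have iS : mu.-integrable setT (fun t => (\sum_(0 <= k <oo) (D k t)%:E)%E).
    apply/integrableP; split=> //.
    under eq_integral => t _ do rewrite gee0_abs ?nneseries_ge0 //.
    by [].
  have := integrable_ae measurableT iS; apply: (@filterS _ _ aeF) => t /(_ I) ft.
  have : cvgn (series (fun k => g k.+1 t - g k t)).
    apply: normed_cvg; rewrite /normed_series_of.
    apply: nondecreasing_is_cvgn.
      by apply: nondecreasing_series => k _ _; exact: normr_ge0.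
    exists (fine (\sum_(0 <= k <oo) (D k t)%:E)%E) => _ [n _ <-].
    rewrite -lee_fin fineK // /series /= -sumEFin; apply: nneseries_lim_ge => k _ _ //.
  move=> /cvg_ex[l hl]; apply/cvg_ex; exists (l + g 0%N t).
  have -> : g ^~ t = (fun n => series (fun k => g k.+1 t - g k t) n + g 0%N t).
    by apply/funext => n; rewrite /series /= telescope_sumr // subrK.
  by apply: cvgD => //; exact: cvg_cst.
(* The upper limit is total and measurable, and equals the limit wherever that exists. *)
pose l t := fine (limn_esup (fun k => (g k t)%:E)).
have ml : measurable_fun setT l.
  apply: measurableT_comp; first exact: fine_measurable.
  by apply: measurable_fun_limn_esup => k; exact/measurable_EFinP.
have gl : {ae mu, forall t, g ^~ t @ \oo --> l t}.
  apply: (@filterS _ _ aeF _ _ _ cv) => t /cvg_ex[x hx].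
  have hE : (fun k => (g k t)%:E) @ \oo --> x%:E by apply: cvg_EFin => //; exact: nearW.
  by rewrite /l (cvg_limn_einf_sup hE).
have fat n K : (N K <= n)%N -> (sq (fun t => h n t - l t)%R <= (16^-1 ^+ K)%:E)%E.
  move=> Kn; pose f k t := ((h n t - g k t) ^+ 2)%:E.
  have mf k : measurable_fun setT (f k).
    by apply/measurable_EFinP/measurable_funX; exact: measurable_funB.
  apply: (@le_trans _ _ (\int[mu]_t limn_einf (f ^~ t))%E).
    rewrite le_eqVlt; apply/orP; left; apply/eqP/ge0_ae_eq_integral => //.
    - by apply/measurable_EFinP/measurable_funX; exact: measurable_funB.
    - rewrite /limn_einf; apply: (measurableT_comp (@oppe_measurable R setT)) => //.
      by apply: measurable_fun_limn_esup => k; apply: measurableT_comp => //; exact: (mf k).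
    - by move=> t _; rewrite lee_fin sqr_ge0.
    - move=> t _; rewrite limn_einf_lim; apply: lime_ge; first exact: is_cvg_einfs.
      apply: nearW => k; apply: le_ereal_inf_tmp => _ [j /= _ <-].
      by rewrite lee_fin sqr_ge0.
    apply: (@filterS _ _ aeF _ _ _ gl) => t hg _.
    have /cvg_limn_einf_sup [-> _] // : f ^~ t @ \oo --> ((h n t - l t) ^+ 2)%:E.
    apply: cvg_EFin; first exact: nearW.
    have hB : (fun k => h n t - g k t) @ \oo --> h n t - l t.
      by apply: cvgB => //; exact: cvg_cst.
    by have := cvgM hB (hB : (fun k => h n t - g k t) @ \oo --> _); exact.
  apply: le_trans (fatou mu measurableT mf _) _.
    by move=> k t _; rewrite lee_fin sqr_ge0.
  apply: (@limn_einf_le _ _ K) => k Kk; apply: ltW; apply: hN => //.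
  by apply: leq_trans (sN K) (smon _ _ Kk).
exists l.
  apply/Lfun2P; split => //.
  have L1 : (fun t => h (N 0%N) t - l t) \in Lfun mu 2%:E.
    apply/Lfun2P; split; first exact: measurable_funB.
    by apply: le_lt_trans (fat _ _ (leqnn _)) _; rewrite ltry.
  have one2 : (1 <= 2%:E :> \bar R)%E by rewrite lee_fin ler1n.
  have [_ LZD] := Lfun_submod_closed mu one2.
  have /Lfun2P [_] := LZD (-1) _ _ L1 (hL (N 0%N)).
  apply: le_lt_trans; rewrite le_eqVlt; apply/orP; left; apply/eqP.
  by apply: eq_integral => t _ /=; congr (_ ^+ 2)%:E; change (l t = -1 * (h (N 0%N) t - l t) + h (N 0%N) t); ring.
move=> e e0; have [K hK] : exists K, 16^-1 ^+ K <= e :> R.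
  have q1 : `|16^-1| < 1 :> R by rewrite ger0_norm ?invr_ge0 //; lra.
  have /cvgrPdist_lt/(_ e e0)[K _ /(_ K (leqnn K))] := cvg_expr q1.
  by rewrite sub0r normrN ger0_norm ?exprn_ge0 ?invr_ge0 // => /ltW; exists K.
by exists (N K) => n Kn; apply: le_trans (fat _ _ Kn) _; rewrite lee_fin.
Qed.

End L2complete.

(** * The Hilbert space of the circle *)

Section CircleL2.
Local Open Scope quotient_scope.
Context {R : realType}.
Notation C := R[i].
Notation mu := (circle_measure R).
Notation ip := (L2dot R).
Notation nrm := (hnorm ip).
Implicit Types (f g : R -> C) (x y : L2 R).

Lemma aeF : Filter (almost_everywhere mu).
Proof. exact: ae_filter_ringOfSetsType mu. Qed.

Lemma circle_measureT : mu setT = (2 * pi)%:E.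
Proof.
rewrite /circle_measure /= /mrestr setTI lebesgue_measure_itv /= lte_fin.
by rewrite mulr_gt0 ?pi_gt0 // -EFinB subr0.
Qed.

Lemma circle_measure_fin : (mu setT < +oo)%E.
Proof. by rewrite circle_measureT ltry. Qed.

Definition sq f := (f : R -> C^o) \in @sq_integrable R.

Lemma sqP f : sq f <-> (fun t => re (f t)) \in Lfun mu 2%:E /\ (fun t => im (f t)) \in Lfun mu 2%:E.
Proof. by split=> [/andP[]|[h1 h2]]; rewrite /sq ?inE //; apply/andP. Qed.

Lemma sq_repr x : sq (repr x : L2fun R).
Proof. exact: L2valP. Qed.

Lemma sqZD c f g : sq f -> sq g -> sq (fun t => c * f t + g t).
Proof. by have [_ h] := sq_integrable_submod R; exact: h. Qed.

Lemma sq_zero : sq (fun=> 0).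
Proof. by have [h _] := sq_integrable_submod R; exact: h. Qed.

Lemma sqZ c f : sq f -> sq (fun t => c * f t).
Proof.
by move=> hf; have := sqZD c hf sq_zero; congr (is_true (sq _)); apply/funext => t; rewrite addr0.
Qed.

Lemma L2class_pi f (hf : sq f) : L2class f = \pi_(L2 R) (MkL2fun hf).
Proof.
rewrite /L2class; congr (\pi_(L2 R) _); apply: val_inj; rewrite insubdK //.
Qed.

Lemma L2class_ae f : sq f -> {ae mu, forall t, (repr (L2class f) : L2fun R) t = f t}.
Proof. by move=> hf; rewrite (L2class_pi hf); exact: L2_reprP. Qed.

Lemma eq_L2class f g : sq f -> sq g -> {ae mu, forall t, f t = g t} -> L2class f = L2class g.
Proof. by move=> hf hg h; rewrite (L2class_pi hf) (L2class_pi hg); apply/L2_eqP. Qed.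

Lemma L2class_repr x : L2class (repr x : L2fun R) = x.
Proof.
rewrite (L2class_pi (sq_repr x)) -[RHS]reprK; congr (\pi_(L2 R) _).
exact: val_inj.
Qed.

Lemma L2classZD c f g : sq f -> sq g ->
  L2class (fun t => c * f t + g t) = c *: L2class f + L2class g :> L2 R.
Proof.
move=> hf hg; rewrite (L2class_pi (sqZD c hf hg)) (L2class_pi hf) (L2class_pi hg).
have scE (z : C) (F : L2fun R) : z *: (\pi_(L2 R) F : L2 R) = \pi_(L2 R) (z *: F).
  apply/L2_eqP; apply: (@filterS _ _ aeF _ _ _ (L2_reprP F)) => t ft.
  by change (z * (repr (\pi_(L2 R) F) : L2fun R) t = z * F t); rewrite ft.
rewrite scE; transitivity (\pi_(L2 R) (c *: MkL2fun hf + MkL2fun hg)); last by rewrite raddfD.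
by congr (\pi_(L2 R) _); apply: val_inj.
Qed.

Lemma L2classZ c f : sq f -> L2class (fun t => c * f t) = c *: L2class f :> L2 R.
Proof.
move=> hf; have := L2classZD (c - 1) hf hf; rewrite scalerBl scale1r subrK => <-.
by congr L2class; apply/funext => t; rewrite mulrBl mul1r subrK.
Qed.

Lemma L2classD f g : sq f -> sq g ->
  L2class (fun t => f t + g t) = L2class f + L2class g :> L2 R.
Proof.
move=> hf hg; rewrite -[X in X + _](scale1r) -L2classZD //.
by congr L2class; apply/funext => t; rewrite mul1r.
Qed.

Lemma Lfun2_measurable (h : R -> R) : h \in Lfun mu 2%:E -> measurable_fun setT h.
Proof. by move=> /Lfun2P []. Qed.

Lemma mul_integrable (h k : R -> R) : h \in Lfun mu 2%:E -> k \in Lfun mu 2%:E ->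
  mu.-integrable setT (EFin \o (fun t => h t * k t)).
Proof. by move=> hL kL; apply/Lfun1_integrable; exact: Lfun2_mul_Lfun1. Qed.

Lemma ae_eq_Rintegral (h k : R -> R) : measurable_fun setT h -> measurable_fun setT k ->
  {ae mu, forall t, h t = k t} -> \int[mu]_t h t = \int[mu]_t k t.
Proof.
move=> mh mk hk; rewrite /Rintegral; congr fine; apply: ae_eq_integral => //.
- exact/measurable_EFinP.
- exact/measurable_EFinP.
by apply: (@filterS _ _ aeF _ _ _ hk) => t /= -> _.
Qed.

Lemma sq_mul_measurable f g : sq f -> sq g ->
  measurable_fun setT (fun t => re (f t * (g t)^*)) /\
  measurable_fun setT (fun t => im (f t * (g t)^*)).
Proof.
move=> /sqP [/Lfun2_measurable a1 /Lfun2_measurable a2] /sqP [/Lfun2_measurable b1 /Lfun2_measurable b2].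
split.
  rewrite (_ : (fun t => _) = (fun t => re (f t) * re (g t) + im (f t) * im (g t))).
    by apply: measurable_funD; exact: measurable_funM.
  by apply/funext => t; rewrite reM re_conj im_conj mulrN opprK.
rewrite (_ : (fun t => _) = (fun t => im (f t) * re (g t) - re (f t) * im (g t))).
  by apply: measurable_funB; exact: measurable_funM.
by apply/funext => t; rewrite imM re_conj im_conj mulrN addrC.
Qed.

Lemma ip_class f g : sq f -> sq g ->
  ip (L2class f) (L2class g) = cintegral (fun t => f t * (g t)^*).
Proof.
move=> hf hg; change (L2ip (L2class f) (L2class g) = cintegral (fun t => f t * (g t)^*)).
rewrite /L2ip /cintegral.
have [m1 m2] := sq_mul_measurable (sq_repr (L2class f)) (sq_repr (L2class g)).
have [n1 n2] := sq_mul_measurable hf hg.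
have ae : {ae mu, forall t, (repr (L2class f) : L2fun R) t * ((repr (L2class g) : L2fun R) t)^*
    = f t * (g t)^*}.
  by apply: (@filterS2 _ _ aeF _ _ _ _ (L2class_ae hf) (L2class_ae hg)) => t -> ->.
by congr Complex; apply: ae_eq_Rintegral => //; apply: (@filterS _ _ aeF _ _ _ ae) => t ->.
Qed.

Lemma nrm_class f : sq f -> ((nrm (L2class f)) ^+ 2)%:E =
  (\int[mu]_t ((re (f t)) ^+ 2)%:E + \int[mu]_t ((im (f t)) ^+ 2)%:E)%E.
Proof.
move=> hf; rewrite -re_ip_nrm ip_class // /cintegral /=.
have /sqP [h1 h2] := hf; have i1 := mul_integrable h1 h1; have i2 := mul_integrable h2 h2.
rewrite (_ : \int[mu]_t _ = \int[mu]_t (re (f t) * re (f t) + im (f t) * im (f t))); last first.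
  by apply: eq_Rintegral => t _; rewrite reM re_conj im_conj mulrN opprK.
rewrite RintegralD // EFinD /Rintegral !fineK //; exact: integrable_fin_num.
Qed.

(** The squared norm splits into the integrals of the squared real and imaginary parts, so both are
    Cauchy and converge separately. *)
Theorem circle_hilbert : hilbert ip.
Proof.
move=> u cau; pose r n t := re ((repr (u n) : L2fun R) t); pose s n t := im ((repr (u n) : L2fun R) t).
have hr n : r n \in Lfun mu 2%:E by have /sqP [] := sq_repr (u n).
have hs n : s n \in Lfun mu 2%:E by have /sqP [] := sq_repr (u n).
have uB m n : u m - u n = L2class (fun t => (repr (u m) : L2fun R) t - (repr (u n) : L2fun R) t).
  rewrite -[in LHS](L2class_repr (u m)) -[in LHS](L2class_repr (u n)) addrC -scaleN1r.
  rewrite -L2classZD; [|exact: sq_repr..].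
  by congr L2class; apply/funext => t; rewrite mulN1r addrC.
have sB f g : sq f -> sq g -> sq (fun t => f t - g t).
  move=> hf hg; have := sqZD (-1) hg hf; congr (is_true (sq _)).
  by apply/funext => t; rewrite mulN1r addrC.
have key m n : (((nrm (u m - u n)) ^+ 2)%:E =
    \int[mu]_t ((r m t - r n t) ^+ 2)%:E + \int[mu]_t ((s m t - s n t) ^+ 2)%:E)%E.
  rewrite uB nrm_class; last by apply: sB; exact: sq_repr.
  by congr (_ + _)%E; apply: eq_integral => t _; rewrite ?reB ?imB.
have caur (v : nat -> R -> R) : (forall m n, (\int[mu]_t ((v m t - v n t) ^+ 2)%:E <=
    ((nrm (u m - u n)) ^+ 2)%:E)%E) ->
    forall e : R, 0 < e -> exists N, forall m n, (N <= m)%N -> (N <= n)%N ->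
     (\int[mu]_t ((fun t => v m t - v n t)%R t ^+ 2)%:E < e%:E)%E.
  move=> hv e e0; have [|N hN] := cau (Num.sqrt e); first by rewrite sqrtr_gt0.
  exists N => m n Nm Nn; apply: le_lt_trans (hv m n) _; rewrite lte_fin.
  rewrite -(sqr_sqrtr (ltW e0)) ltr_pXn2r ?nnegrE ?nrm_ge0 ?sqrtr_ge0 //.
  exact: hN.
have [a aL ha] := L2_complete circle_measure_fin hr (caur r ltac:(by move=> m n; rewrite key leeDl // sq_ge0)).
have [b bL hb] := L2_complete circle_measure_fin hs (caur s ltac:(by move=> m n; rewrite key leeDr // sq_ge0)).
pose l := fun t => Complex (a t) (b t) : C.
have lsq : sq l by apply/sqP.
exists (L2class l); apply/hcvgP => e e0.
have e4 : 0 < e ^+ 2 / 4 by rewrite divr_gt0 // exprn_gt0.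
have [N1 h1] := ha _ e4; have [N2 h2] := hb _ e4.
exists (maxn N1 N2) => n; rewrite geq_max => /andP[n1 n2].
rewrite -(@ltr_pXn2r _ 2) ?nnegrE ?nrm_ge0 ?ltW // -lte_fin.
have -> : u n - L2class l = L2class (fun t => (repr (u n) : L2fun R) t - l t).
  rewrite -[in LHS](L2class_repr (u n)) addrC -scaleN1r -L2classZD //; last exact: sq_repr.
  by congr L2class; apply/funext => t; rewrite mulN1r addrC.
rewrite nrm_class; last by apply: sB => //; exact: sq_repr.
apply: (@le_lt_trans _ _ ((e ^+ 2 / 4)%:E + (e ^+ 2 / 4)%:E)%E).
  apply: leeD.
    apply: le_trans (h1 n n1); rewrite le_eqVlt; apply/orP; left; apply/eqP.
    by apply: eq_integral => t _; rewrite reB.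
  apply: le_trans (h2 n n2); rewrite le_eqVlt; apply/orP; left; apply/eqP.
  by apply: eq_integral => t _; rewrite imB.
by rewrite -EFinD lte_fin; have := exprn_gt0 2 e0; lra.
Qed.

End CircleL2.

(** * Smooth periodic functions *)

Section SmoothPeriodic.
Context {R : realType}.
Notation C := R[i].
Notation pi := (@trigo.pi R).
Implicit Types (f g : R -> C) (p q : R -> R).

Definition has_deriv p q := forall t : R, is_derive t 1 p (q t).

Lemma is_derive_cast p q (t a b : R) : is_derive t 1 p a -> p =1 q -> a = b -> is_derive t 1 q b.
Proof. by move=> h /funext <- <-. Qed.

Lemma has_deriv_unique p q q' : has_deriv p q -> has_deriv p q' -> q = q'.
Proof.
move=> h h'; apply/funext => t; have := @derive_val _ _ _ _ _ _ _ (h t).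
by rewrite (@derive_val _ _ _ _ _ _ _ (h' t)).
Qed.

Lemma has_deriv_derive1 p q : has_deriv p q -> derive1 p = q.
Proof. by move=> h; apply/funext => t; rewrite derive1E (@derive_val _ _ _ _ _ _ _ (h t)). Qed.

Lemma derive1_has_deriv p : (forall t, derivable p t 1) -> has_deriv p (derive1 p).
Proof. by move=> h t; rewrite derive1E; apply: DeriveDef. Qed.

Lemma has_deriv_continuous p q : has_deriv p q -> continuous p.
Proof.
move=> h t; apply/differentiable_continuous/derivable1_diffP.
exact: (@ex_derive _ _ _ _ _ _ _ (h t)).
Qed.

Lemma has_derivD p q p' q' : has_deriv p p' -> has_deriv q q' ->
  has_deriv (fun t => p t + q t) (fun t => p' t + q' t).
Proof. by move=> h1 h2 t; have := is_deriveD (h1 t) (h2 t); exact. Qed.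

Lemma has_derivM p q p' q' : has_deriv p p' -> has_deriv q q' ->
  has_deriv (fun t => p t * q t) (fun t => p' t * q t + p t * q' t).
Proof.
move=> h1 h2 t; apply: (is_derive_cast (is_deriveM (h1 t) (h2 t))) => //.
by rewrite /GRing.scale /= addrC [q t * _]mulrC.
Qed.

Lemma has_deriv_cst (c : R) : has_deriv (fun=> c) (fun=> 0).
Proof. by move=> t; exact: is_derive_cst. Qed.

(** Written with a phase shift by [pi / 2], the derivative stays in the same family; sines are
    shifted cosines. *)
Lemma has_deriv_cos (c a b : R) : has_deriv (fun t => c * cos (a * t + b))
  (fun t => (c * a) * cos (a * t + (b + pi / 2))).
Proof.
move=> t; have h1 : is_derive t 1 (fun s : R => a * s + b) a.
  apply: (is_derive_cast (is_deriveD (is_deriveM (is_derive_cst a t 1) (is_derive_id t 1))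
    (is_derive_cst b t 1))) => //.
  by rewrite /GRing.scale /= mulr0 addr0 mulr1 addr0.
have h2 := @is_derive1_comp _ (@cos R) (fun s : R => a * s + b) t _ _ (is_derive_cos (a * t + b)) h1.
apply: (is_derive_cast (is_deriveM (is_derive_cst c t 1) h2)) => //.
rewrite /GRing.scale /= mulr0 addr0 addrA cosDpihalf; ring.
Qed.

(** As a chain of existing derivatives, smoothness of sums and products is a plain induction; [cnP]
    returns to iterated [derive1n]. *)
Fixpoint cn (n : nat) p : Prop := if n is n'.+1 then exists2 q, has_deriv p q & cn n' q else True.

Lemma cnS n p : cn n.+1 p -> cn n p.
Proof. by elim: n p => // n IH p [q hq /IH hn]; exists q. Qed.

Lemma cnD n p q : cn n p -> cn n q -> cn n (fun t => p t + q t).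
Proof.
elim: n p q => // n IH p q [p' h1 n1] [q' h2 n2].
by exists (fun t => p' t + q' t); [exact: has_derivD|exact: IH].
Qed.

Lemma cnM n p q : cn n p -> cn n q -> cn n (fun t => p t * q t).
Proof.
elim: n p q => // n IH p q hp hq; have [p' h1 n1] := hp; have [q' h2 n2] := hq.
exists (fun t => p' t * q t + p t * q' t); first exact: has_derivM.
by apply: cnD; apply: IH => //; exact: cnS.
Qed.

Lemma cn_cst n c : cn n (fun=> c).
Proof.
by elim: n c => // n IH c; exists (fun=> 0); [exact: has_deriv_cst|exact: IH].
Qed.

Lemma cn_cos n c a b : cn n (fun t => c * cos (a * t + b)).
Proof. by elim: n c b => // n IH c b; eexists; [exact: has_deriv_cos|exact: IH]. Qed.

Lemma cnN n p : cn n p -> cn n (fun t => - p t).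
Proof.
by move=> h; have := cnM (cn_cst n (-1)) h; congr cn; apply/funext => t; rewrite mulN1r.
Qed.

Lemma cnP p : (forall n, cn n p) <-> forall n t, derivable (derive1n n p) t 1.
Proof.
split=> [h n t|h n].
  elim: n p {h}(h n.+1) => [|n IH] p [q hq hn].
    exact: (@ex_derive _ _ _ _ _ _ _ (hq t)).
  by rewrite /derive1n iterSr (has_deriv_derive1 hq); exact: IH.
elim: n p h => // n IH p h; exists (derive1 p); first exact/derive1_has_deriv/(h 0%N).
by apply: IH => k t; have := h k.+1 t; rewrite /derive1n iterSr.
Qed.

Definition sm f := smooth_periodic f.

Lemma smP f : sm f <-> [/\ forall t, f (t + 2 * pi) = f t, forall n, cn n (fun t => re (f t)) &
  forall n, cn n (fun t => im (f t))].
Proof.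
split=> [[per h]|[per /cnP h1 /cnP h2]].
  by split; [exact: per|apply/cnP => n t; have [] := h n t|apply/cnP => n t; have [] := h n t].
by split; [exact: per|move=> n t; split; [exact: h1|exact: h2]].
Qed.

Definition Df f (t : R) : C :=
  - Complex 0 1 * Complex (derive1 (fun s => re (f s)) t) (derive1 (fun s => im (f s)) t).

Lemma DfE f p q : has_deriv (fun t => re (f t)) p -> has_deriv (fun t => im (f t)) q ->
  Df f = fun t => Complex (q t) (- p t).
Proof.
move=> /has_deriv_derive1 hp /has_deriv_derive1 hq; apply/funext => t.
rewrite /Df hp hq; apply: complex_eq; rewrite ?reM ?imM /=; ring.
Qed.

Lemma sm_deriv f : sm f -> exists p q,
  [/\ has_deriv (fun t => re (f t)) p, has_deriv (fun t => im (f t)) q,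
      forall n, cn n p & forall n, cn n q].
Proof.
move=> /smP [_ h1 h2]; have [p hp _] := h1 1%N; have [q hq _] := h2 1%N.
exists p, q; split=> // n.
  by have [p' hp' cp'] := h1 n.+1; rewrite (has_deriv_unique hp hp').
by have [q' hq' cq'] := h2 n.+1; rewrite (has_deriv_unique hq hq').
Qed.

Lemma has_deriv_shift p q (c : R) : has_deriv p q -> has_deriv (fun t => p (t + c)) (fun t => q (t + c)).
Proof.
move=> h t; have h1 : is_derive t 1 (fun s : R => s + c) 1.
  apply: (is_derive_cast (is_deriveD (is_derive_id t 1) (is_derive_cst c t 1))) => //.
  by rewrite addr0.
by apply: (is_derive_cast (@is_derive1_comp _ p (fun s : R => s + c) t _ _ (h (t + c)) h1)) => //; rewrite mulr1.
Qed.

Lemma sm_Df f : sm f -> sm (Df f).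
Proof.
move=> hf; have [p [q [hp hq cp cq]]] := sm_deriv hf; rewrite (DfE hp hq).
have /smP [per _ _] := hf; apply/smP; split=> [t|n|n] /=; [|exact: cq|exact/cnN/cp].
have pp := has_deriv_shift (2 * pi) hp; have qq := has_deriv_shift (2 * pi) hq.
have e1 : (fun t => re (f (t + 2 * pi))) = (fun t => re (f t)) by apply/funext => s; rewrite per.
have e2 : (fun t => im (f (t + 2 * pi))) = (fun t => im (f t)) by apply/funext => s; rewrite per.
rewrite e1 in pp; rewrite e2 in qq.
have /(congr1 (fun h => h t)) /= -> := has_deriv_unique pp hp.
by have /(congr1 (fun h => h t)) /= -> := has_deriv_unique qq hq.
Qed.

Lemma sm_cst c : sm (fun=> c).
Proof. by apply/smP; split=> // n; exact: cn_cst. Qed.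

Lemma smD f g : sm f -> sm g -> sm (fun t => f t + g t).
Proof.
move=> /smP [p1 r1 i1] /smP [p2 r2 i2]; apply/smP; split=> [t|n|n].
- by rewrite p1 p2.
- by have := cnD (r1 n) (r2 n); congr cn; apply/funext => t; rewrite reD.
- by have := cnD (i1 n) (i2 n); congr cn; apply/funext => t; rewrite imD.
Qed.

Lemma smM f g : sm f -> sm g -> sm (fun t => f t * g t).
Proof.
move=> /smP [p1 r1 i1] /smP [p2 r2 i2]; apply/smP; split=> [t|n|n].
- by rewrite p1 p2.
- have := cnD (cnM (r1 n) (r2 n)) (cnN (cnM (i1 n) (i2 n))); congr cn.
  by apply/funext => t; rewrite reM.
- have := cnD (cnM (r1 n) (i2 n)) (cnM (i1 n) (r2 n)); congr cn.
  by apply/funext => t; rewrite imM.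
Qed.

Lemma smZ c f : sm f -> sm (fun t => c * f t).
Proof. by move=> h; exact: (smM (sm_cst c) h). Qed.

Lemma sm_conj f : sm f -> sm (fun t => (f t)^*).
Proof.
move=> /smP [p1 r1 i1]; apply/smP; split=> [t|n|n].
- by rewrite p1.
- by have := r1 n; congr cn; apply/funext => t; rewrite re_conj.
- by have := cnN (i1 n); congr cn; apply/funext => t; rewrite im_conj.
Qed.

Lemma has_derivN p q : has_deriv p q -> has_deriv (fun t => - p t) (fun t => - q t).
Proof. by move=> h t; have := is_deriveN (h t); exact. Qed.

Lemma Df_mul f g : sm f -> sm g -> Df (fun t => f t * g t) = fun t => Df f t * g t + f t * Df g t.
Proof.
move=> /sm_deriv [p [q [hp hq _ _]]] /sm_deriv [p' [q' [hp' hq' _ _]]].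
have hr : has_deriv (fun t => re (f t * g t)) (fun t => (p t * re (g t) + re (f t) * p' t) +
    - (q t * im (g t) + im (f t) * q' t)).
  have := has_derivD (has_derivM hp hp') (has_derivN (has_derivM hq hq')); congr has_deriv.
  by apply/funext => t; rewrite reM.
have hi : has_deriv (fun t => im (f t * g t)) (fun t => (p t * im (g t) + re (f t) * q' t) +
    (q t * re (g t) + im (f t) * p' t)).
  have := has_derivD (has_derivM hp hq') (has_derivM hq hp'); congr has_deriv.
  by apply/funext => t; rewrite imM.
rewrite (DfE hr hi) (DfE hp hq) (DfE hp' hq'); apply/funext => t.
by apply: complex_eq; rewrite ?reD ?imD ?reM ?imM /=; ring.
Qed.

Lemma Df_conj f : sm f -> Df (fun t => (f t)^*) = fun t => - (Df f t)^*.
Proof.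
move=> /sm_deriv [p [q [hp hq _ _]]].
have hr : has_deriv (fun t => re ((f t)^*)) p.
  by have := hp; congr has_deriv; apply/funext => t; rewrite re_conj.
have hi : has_deriv (fun t => im ((f t)^*)) (fun t => - q t).
  by have := has_derivN hq; congr has_deriv; apply/funext => t; rewrite im_conj.
rewrite (DfE hr hi) (DfE hp hq); apply/funext => t.
by apply: complex_eq; rewrite ?reN ?imN ?re_conj ?im_conj //= opprK.
Qed.

Definition E (n : int) (t : R) : C := Complex (cos (n%:~R * t)) (sin (n%:~R * t)).

Lemma sin_cos (x : R) : sin x = cos (x - pi / 2).
Proof. by rewrite cosBpihalf. Qed.

Lemma E_mul m n t : E m t * E n t = E (m + n) t.
Proof.
by apply: complex_eq; rewrite ?reM ?imM /= rmorphD mulrDl ?cosD ?sinD //; ring.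
Qed.

Lemma E_conj n t : (E n t)^* = E (- n) t.
Proof. by apply: complex_eq; rewrite ?re_conj ?im_conj /= rmorphN mulNr ?cosN ?sinN. Qed.

Lemma E0 t : E 0 t = 1.
Proof. by apply: complex_eq; rewrite /= mul0r ?cos0 ?sin0. Qed.

Lemma E_norm n t : E n t * (E n t)^* = 1.
Proof. by rewrite E_conj E_mul subrr E0. Qed.

Lemma E_has_deriv n : has_deriv (fun t => re (E n t)) (fun t => - (n%:~R * sin (n%:~R * t))) /\
  has_deriv (fun t => im (E n t)) (fun t => n%:~R * cos (n%:~R * t)).
Proof.
have h b := @has_deriv_cos 1 n%:~R b; split.
  have := h 0; congr has_deriv; apply/funext => t /=; rewrite ?mul1r ?addr0 //.
  by rewrite add0r cosDpihalf mulrN.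
have := h (- (pi / 2)); congr has_deriv; apply/funext => t /=; rewrite ?mul1r.
  by rewrite -sin_cos.
by rewrite addNr addr0.
Qed.

Lemma Df_E n : Df (E n) = fun t => n%:~R * E n t.
Proof.
have [h1 h2] := E_has_deriv n; rewrite (DfE h1 h2); apply/funext => t.
rewrite opprK (_ : n%:~R = (n%:~R : R)%:C%C); last by rewrite rmorph_int.
by apply: complex_eq; rewrite ?reM ?imM /=; ring.
Qed.

Lemma sm_E n : sm (E n).
Proof.
apply/smP; split=> [t|k|k].
- have h (m : nat) (x : R) : cos (x + m%:R * (2 * pi)) = cos x /\ sin (x + m%:R * (2 * pi)) = sin x.
    elim: m => [|m [IH1 IH2]]; first by rewrite mul0r addr0.
    rewrite -natr1 mulrDl mul1r addrA (_ : 2 * pi = pi *+ 2); last by rewrite mulr_natl.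
    by rewrite cosD2pi sinD2pi -[pi *+ 2]mulr_natl.
  apply: complex_eq => /=; rewrite mulrDr; case: n => m.
  + by have [] := h m (m%:R * t).
  + have -> : (Negz m)%:~R = - m.+1%:R :> R by rewrite NegzE rmorphN.
    by have := (h m.+1 (- m.+1%:R * t + - m.+1%:R * (2 * pi))).1; rewrite -addrA -mulrDl addNr mul0r addr0.
  + by have [] := h m (m%:R * t).
  + have -> : (Negz m)%:~R = - m.+1%:R :> R by rewrite NegzE rmorphN.
    by have := (h m.+1 (- m.+1%:R * t + - m.+1%:R * (2 * pi))).2; rewrite -addrA -mulrDl addNr mul0r addr0.
- by have := cn_cos k 1 n%:~R 0; congr cn; apply/funext => t; rewrite mul1r addr0.
- have := cn_cos k 1 n%:~R (- (pi / 2)); congr cn; apply/funext => t.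
  by rewrite mul1r -sin_cos.
Qed.

End SmoothPeriodic.

(** * Integration over the circle *)

Section CircleIntegral.
Context {R : realType}.
Notation C := R[i].
Notation pi := (@trigo.pi R).
Notation mu := (circle_measure R).
Notation leb := (@lebesgue_measure R).
Notation ip := (L2dot R).
Notation nrm := (hnorm ip).
Notation I := (`[0, 2 * pi]%classic : set R).
Implicit Types (f g : R -> C) (p q h k : R -> R) (x y : L2 R).

Lemma measurable_circle : measurable (I : set (measurableTypeR R)).
Proof. exact: measurable_itv. Qed.

Lemma circle_measureC : mu (~` I) = 0.
Proof. by rewrite /circle_measure /= /mrestr setICl measure0. Qed.

Lemma circle_ae (P : R -> Prop) : (forall t, I t -> P t) -> {ae mu, forall t, P t}.
Proof.
move=> h; exists (~` I); split; [exact: measurableC measurable_circle|exact: circle_measureC|].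
by move=> t /= nP It; apply: nP; exact: h.
Qed.

Lemma circle_ae_null (P : R -> Prop) (s : seq R) :
  (forall t, I t -> t \notin s -> P t) -> {ae mu, forall t, P t}.
Proof.
move=> h; have ns : {ae mu, forall t, t \notin s}.
  elim: s {h} => [|a s IH]; first exact: aeW.
  have na : {ae mu, forall t, t != a}.
    exists [set a]; split; [exact: measurable_set1| |by move=> t /= /negP; rewrite negbK => /eqP].
    apply/eqP; rewrite eq_le measure_ge0 andbT /circle_measure /= /mrestr.
    rewrite -[leRHS](lebesgue_measure_set1 a); apply: le_measure; rewrite ?inE //.
    by apply: measurableI => //; exact: measurable_circle.
  by apply: (@filterS2 _ _ aeF _ _ _ _ na IH) => t h1 h2; rewrite inE negb_or h1.
by apply: (@filterS2 _ _ aeF _ _ _ _ (circle_ae (fun t It => It)) ns) => t /h; apply.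
Qed.

Lemma integral_circle h : mu.-integrable setT (EFin \o h) ->
  \int[mu]_t h t = \int[leb]_(t in I) h t.
Proof.
move=> ih; rewrite /Rintegral; congr fine.
rewrite (negligible_integral (measurableC measurable_circle) _ ih) //; last exact: circle_measureC.
rewrite setTD setCK; apply: eq_measure_integral => A mA AI.
by rewrite /circle_measure /= /mrestr setIidl.
Qed.

Lemma bounded_mul_L2 h k (K : R) : h \in Lfun mu 2%:E -> measurable_fun setT k ->
  {ae mu, forall t, `|k t| <= K} -> (fun t => k t * h t) \in Lfun mu 2%:E.
Proof.
move=> /Lfun2P [mh ih] mk hk; apply/Lfun2P; split; first exact: measurable_funM.
apply: (@le_lt_trans _ _ (\int[mu]_t ((K ^+ 2)%:E * ((h t) ^+ 2)%:E))%E).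
  apply: ae_ge0_le_integral => //.
  - by move=> t _; rewrite lee_fin sqr_ge0.
  - by apply/measurable_EFinP/measurable_funX; exact: measurable_funM.
  - by move=> t _; rewrite -EFinM lee_fin mulr_ge0 ?sqr_ge0.
  - apply: emeasurable_funM => //; apply/measurable_EFinP.
    exact: measurable_funX.
  apply: (@filterS _ _ aeF _ _ _ hk) => t ht _; rewrite -EFinM lee_fin exprMn.
  apply: ler_wpM2r; first exact: sqr_ge0.
  rewrite -real_normK ?num_real // ler_pXn2r ?nnegrE //.
  exact: le_trans (normr_ge0 _) ht.
rewrite ge0_integralZl //.
- by apply: lte_mul_pinfty => //; rewrite lee_fin sqr_ge0.
- by apply/measurable_EFinP; exact: measurable_funX.
- by move=> t _; rewrite lee_fin sqr_ge0.
by rewrite lee_fin sqr_ge0.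
Qed.

Lemma cst_L2 (c : R) : (fun=> c) \in Lfun mu 2%:E.
Proof.
apply/Lfun2P; split=> //; rewrite integral_cst // circle_measureT -EFinM ltry //.
Qed.

Lemma bounded_L2 k (K : R) : measurable_fun setT k ->
  {ae mu, forall t, `|k t| <= K} -> k \in Lfun mu 2%:E.
Proof.
move=> mk hk; have := bounded_mul_L2 (cst_L2 1) mk hk.
by rewrite (_ : (fun t => _) = k) //; apply/funext => t; rewrite mulr1.
Qed.

Lemma continuous_bounded p : continuous p -> exists K : R, forall t, I t -> `|p t| <= K.
Proof.
move=> cp; have /compact_bounded [M [_ hM]] : compact (p @` I).
  by apply: continuous_compact; [exact: continuous_subspaceT|exact: segment_compact].
by exists (M + 1) => t It; apply: (hM (M + 1)); [rewrite ltrDl|exists t].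
Qed.

Lemma L2_integrable h : h \in Lfun mu 2%:E -> mu.-integrable setT (EFin \o h).
Proof.
move=> hL; apply/Lfun1_integrable; apply: Lfun_subset12 hL.
by rewrite ge0_fin_numE //; exact: circle_measure_fin.
Qed.

Lemma continuous_L2 p : continuous p -> p \in Lfun mu 2%:E.
Proof.
move=> cp; have [K hK] := continuous_bounded cp.
by apply: (@bounded_L2 _ K); [exact: continuous_measurable_fun|exact: circle_ae].
Qed.

Lemma circle_FTC p q : has_deriv p q -> continuous q -> \int[mu]_t q t = p (2 * pi) - p 0.
Proof.
move=> hp cq; rewrite integral_circle; last exact/L2_integrable/continuous_L2.
have cp := has_deriv_continuous hp.
have pi2 : 0 < 2 * pi by rewrite mulr_gt0 ?pi_gt0.
rewrite /Rintegral (@continuous_FTC2 _ q p _ _ pi2) //.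
- exact: continuous_subspaceT.
- split=> [t _||].
  + exact: (@ex_derive _ _ _ _ _ _ _ (hp t)).
  + exact: cvg_at_right_filter (cp 0).
  + exact: cvg_at_left_filter (cp _).
by move=> t _; rewrite (has_deriv_derive1 hp).
Qed.

Lemma cn_continuous p : (forall n, cn n p) -> continuous p.
Proof. by move=> /(_ 1%N) [q hq _]; exact: has_deriv_continuous hq. Qed.

(** The boundary values at 0 and [2 pi] coincide by periodicity; applied to products, this is
    integration by parts. *)
Lemma cintegral_Df f : sm f -> cintegral (Df f) = 0.
Proof.
move=> hf; have [p [q [hp hq cp cq]]] := sm_deriv hf; have /smP [per _ _] := hf.
have e0 : f (2 * pi) = f 0 by rewrite -(per 0) add0r.
rewrite (DfE hp hq) /cintegral /=; apply: complex_eq => /=.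
  by rewrite (circle_FTC hq (cn_continuous cq)) e0 subrr.
rewrite (_ : (fun t => - p t) = (fun t => - p t)) //.
by rewrite (circle_FTC (has_derivN hp) (cn_continuous (fun n => cnN (cp n)))) e0 subrr.
Qed.

Lemma sm_bounded f : sm f -> exists2 K : R, 0 <= K & {ae mu, forall t, cabs (f t) <= K}.
Proof.
move=> /smP [_ /cn_continuous/continuous_bounded [K h1] /cn_continuous/continuous_bounded [L h2]].
exists (`|K| + `|L|); first exact: addr_ge0.
apply: circle_ae => t It; apply: le_trans (cabs_le_reim _) _; apply: lerD.
  by apply: le_trans (h1 t It) (ler_norm _).
by apply: le_trans (h2 t It) (ler_norm _).
Qed.

Lemma sm_measurable f : sm f ->
  measurable_fun setT (fun t => re (f t)) /\ measurable_fun setT (fun t => im (f t)).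
Proof.
move=> /smP [_ /cn_continuous h1 /cn_continuous h2].
by split; exact: continuous_measurable_fun.
Qed.

Lemma sq_mul f g : sm f -> sq g -> sq (fun t => f t * g t).
Proof.
move=> hf /sqP [rg ig]; have [mr mi] := sm_measurable hf; have [K K0 hK] := sm_bounded hf.
have br : {ae mu, forall t, `|re (f t)| <= K}.
  by apply: (@filterS _ _ aeF _ _ _ hK) => t; apply: le_trans; exact: re_le_cabs.
have bi : {ae mu, forall t, `|im (f t)| <= K}.
  by apply: (@filterS _ _ aeF _ _ _ hK) => t; apply: le_trans; exact: im_le_cabs.
have one2 : (1 <= 2%:E :> \bar R)%E by rewrite lee_fin ler1n.
have [L0 LZD] := Lfun_submod_closed mu one2.
have r1 := bounded_mul_L2 rg mr br; have r2 := bounded_mul_L2 ig mi bi.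
have i1 := bounded_mul_L2 ig mr br; have i2 := bounded_mul_L2 rg mi bi.
apply/sqP; split.
  have := LZD (-1) _ _ r2 r1; rewrite (_ : _ + _ = (fun t => re (f t * g t))) //.
  by apply/funext => t; rewrite reM scaleN1r addrC.
have := LZD 1 _ _ i2 i1; rewrite (_ : _ + _ = (fun t => im (f t * g t))) //.
by apply/funext => t; rewrite imM scale1r addrC.
Qed.

Lemma sq_sm f : sm f -> sq f.
Proof.
move=> /smP [_ /cn_continuous h1 /cn_continuous h2].
by apply/sqP; split; exact: continuous_L2.
Qed.

Lemma eq_cintegral f g : f =1 g -> cintegral f = cintegral g.
Proof. by move=> /funext ->. Qed.

Lemma cintegralZ c f : sq f -> cintegral (fun t => c * f t) = c * cintegral f.
Proof.
move=> /sqP [/L2_integrable h1 /L2_integrable h2]; rewrite /cintegral.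
have z (a : R) (h : R -> R) : mu.-integrable setT (EFin \o h) ->
    mu.-integrable setT (EFin \o (fun t => a * h t)).
  move=> ih; rewrite (_ : _ \o _ = (fun t => (a%:E * (EFin \o h) t)%E)); last first.
    by apply/funext => t; rewrite /= EFinM.
  exact: integrableZl.
apply: complex_eq; rewrite ?reM ?imM /=.
  rewrite (_ : \int[mu]_t _ = \int[mu]_t (re c * re (f t) - im c * im (f t))); last first.
    by apply: eq_Rintegral => t _; rewrite reM.
  by rewrite RintegralB ?RintegralZl //; exact: z.
rewrite (_ : \int[mu]_t _ = \int[mu]_t (re c * im (f t) + im c * re (f t))); last first.
  by apply: eq_Rintegral => t _; rewrite imM.
by rewrite RintegralD ?RintegralZl //; exact: z.
Qed.

Lemma cintegral_E n : cintegral (E n) = if n == 0 then ((2 * pi)%:C)%C else 0.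
Proof.
have [->|n0] := eqVneq n 0.
  rewrite (eq_cintegral (@E0 R)) /cintegral.
  apply: complex_eq => /=; rewrite Rintegral_cst // ?mul0r // mul1r.
  by rewrite circle_measureT.
have := cintegral_Df (@sm_E R n); rewrite Df_E cintegralZ; last exact/sq_sm/sm_E.
by move/eqP; rewrite mulf_eq0 intr_eq0 (negPf n0) => /eqP.
Qed.

End CircleIntegral.

(** * Totality of the trigonometric system *)

Section FourierCompleteness.
Context {R : realType}.
Notation pi := (@trigo.pi R).
Notation mu := (circle_measure R).
Notation leb := (@lebesgue_measure R).
Notation I := (`[0, 2 * pi]%classic : set R).
Implicit Types (h k p q r : R -> R).

(* (1 - v^n)^(2^n) tends to 1 for v < 1/2 and to 0 for v > 1/2 *)
Definition bump (v : R) (n : nat) : R := (1 - v ^+ n) ^+ (2 ^ n).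

Lemma bump_itv v n : 0 <= v <= 1 -> 0 <= bump v n <= 1.
Proof.
move=> /andP[v0 v1]; have h1 : 0 <= v ^+ n <= 1 by rewrite exprn_ge0 //= exprn_ile1.
by rewrite exprn_ge0 ?exprn_ile1 //; lra.
Qed.

Lemma bernoulli_le (x : R) m : 0 <= x <= 1 -> 1 - m%:R * x <= (1 - x) ^+ m.
Proof.
move=> /andP[x0 x1]; elim: m => [|m IH]; first by rewrite expr0; lra.
rewrite exprS -natr1; have h0 : 0 <= 1 - x by lra.
apply: le_trans (ler_wpM2l h0 IH); have m0 : 0 <= m%:R :> R by [].
by have := mulr_ge0 m0 (mulr_ge0 x0 x0); nra.
Qed.

Lemma bernoulli_ge (x : R) m : 0 <= x -> 1 + m%:R * x <= (1 + x) ^+ m.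
Proof.
move=> x0; elim: m => [|m IH]; first by rewrite expr0; lra.
rewrite exprS -natr1; have h0 : 0 <= 1 + x by lra.
apply: le_trans (ler_wpM2l h0 IH); have m0 : 0 <= m%:R :> R by [].
by have := mulr_ge0 m0 (mulr_ge0 x0 x0); nra.
Qed.

(** Bernoulli's inequality gives [1 - (2v)^n <= bump v n]. *)
Lemma bump_cvg1 v : 0 <= v < 2^-1 -> bump v @ \oo --> (1 : R).
Proof.
move=> /andP[v0 v2]; have q1 : `|2 * v| < 1 by rewrite ger0_norm; lra.
apply: (@squeeze_cvgr _ _ _ _ (fun n => 1 - (2 * v) ^+ n) (cst 1)); last exact: cvg_cst.
- apply: nearW => n; have /(@bump_itv _ n)/andP[_ ->] : 0 <= v <= 1 by lra.
  rewrite andbT; have hx : 0 <= v ^+ n <= 1 by rewrite exprn_ge0 //= exprn_ile1; lra.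
  by have := bernoulli_le (2 ^ n) hx; rewrite natrX exprMn.
rewrite -[X in _ --> X]subr0; apply: cvgB; [exact: cvg_cst|exact: cvg_expr].
Qed.

(** As [(1 - v^n)(1 + v^n) <= 1], the bump is at most the inverse of [(1 + v^n)^(2^n)], which
    Bernoulli's inequality makes at most [1/(2v)^n]. *)
Lemma bump_cvg0 v : 2^-1 < v <= 1 -> bump v @ \oo --> (0 : R).
Proof.
move=> /andP[v2 v1]; have v0 : 0 < v by lra.
have q1 : `|(2 * v)^-1| < 1.
  by rewrite ger0_norm ?invr_ge0; [rewrite invf_lt1; lra|lra].
apply: (@squeeze_cvgr _ _ _ _ (cst 0) (fun n => (2 * v)^-1 ^+ n)); [|exact: cvg_cst|exact: cvg_expr].
apply: nearW => n; have /(@bump_itv _ n)/andP[-> _] /= : 0 <= v <= 1 by lra.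
have hx : 0 <= v ^+ n <= 1 by rewrite exprn_ge0 //= ?exprn_ile1; lra.
have /andP[x0 x1] := hx; rewrite exprVn -[_^-1]mul1r ler_pdivlMr; last by rewrite exprn_gt0; lra.
have h1 : (2 * v) ^+ n <= (1 + v ^+ n) ^+ (2 ^ n).
  by apply: le_trans (bernoulli_ge _ x0); rewrite natrX exprMn; lra.
have b0 : 0 <= bump v n by apply: exprn_ge0; lra.
apply: le_trans (ler_wpM2l b0 h1) _; rewrite /bump -exprMn.
apply: exprn_ile1; first by apply: mulr_ge0; lra.
by have := mulr_ge0 x0 x0; nra.
Qed.

(** Cosine decreases on [[0, pi]]; an angle beyond [pi] is reflected to [2 pi] minus it, which still
    exceeds [b / 2]. Thus one shifted cosine separates an arc from its complement. *)
Lemma cos_arc (b t : R) : 0 < b < 2 * pi -> 0 <= t <= 2 * pi -> t != 0 -> t != b -> t != 2 * pi ->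
  (t < b -> cos (b / 2) < cos (t - b / 2)) /\ (b < t -> cos (t - b / 2) < cos (b / 2)).
Proof.
move=> /andP[b0 b2] /andP[t0 t2] tn0 tnb tn2; have tp : 0 < t by rewrite lt_def tn0.
have tl : t < 2 * pi by rewrite lt_neqAle tn2.
have mono (u v : R) : 0 <= u -> u < v -> v <= pi -> cos v < cos u.
  by move=> u0 uv vp; rewrite ltr_cos // in_itv /=; apply/andP; split; lra.
split=> h.
  have [c|c] := leP (b / 2) t; first by apply: mono; lra.
  by rewrite -[t - _]opprB cosN; apply: mono; lra.
have [c|c] := leP (t - b / 2) pi; first by apply: mono; lra.
rewrite -[cos (t - b / 2)]cosN -(cosD2pi (- (t - b / 2))) -[pi *+ 2]mulr_natl.
by apply: mono; lra.
Qed.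

Lemma cos_mul (a b : R) : cos a * cos b = 2^-1 * (cos (a + b) + cos (a - b)).
Proof. by rewrite cosD cosB; field. Qed.

Section Annihilator.
Context (h : R -> R) (hL : h \in Lfun mu 2%:E).
Hypothesis h_orth : forall n : int,
  \int[mu]_t (h t * cos (n%:~R * t)) = 0 /\ \int[mu]_t (h t * sin (n%:~R * t)) = 0.

Lemma mul_cont_L2 k : continuous k -> (fun t => h t * k t) \in Lfun mu 2%:E.
Proof.
move=> ck; have [K hK] := continuous_bounded ck.
have := bounded_mul_L2 hL (continuous_measurable_fun ck) (circle_ae hK).
by rewrite (_ : (fun t => k t * h t) = (fun t => h t * k t)) //; apply/funext => t; rewrite mulrC.
Qed.

Lemma mul_cont_int k : continuous k -> mu.-integrable setT (EFin \o (fun t => h t * k t)).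
Proof. by move=> ck; exact/L2_integrable/mul_cont_L2. Qed.

Lemma cont_cos (a b : R) : continuous (fun t : R => cos (a * t + b)).
Proof.
have -> : (fun t : R => cos (a * t + b)) = (fun t => 1 * cos (a * t + b)).
  by apply/funext => t; rewrite mul1r.
exact: has_deriv_continuous (@has_deriv_cos _ _ _ _).
Qed.

(** Functions whose products with all trigonometric polynomials integrate to 0 against [h]. The free
    phase covers sines and absorbs the shifts arising in [annih_cos]. *)
Definition annih k := continuous k /\
  forall (n : int) (th : R), \int[mu]_t (h t * (k t * cos (n%:~R * t + th))) = 0.

Lemma contM p q : continuous p -> continuous q -> continuous (fun t : R => p t * q t : R).
Proof. by move=> cp cq t; apply: cvgM; [exact: cp|exact: cq]. Qed.
Lemma contB p q : continuous p -> continuous q -> continuous (fun t : R => p t - q t : R).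
Proof. by move=> cp cq t; apply: cvgB; [exact: cp|exact: cq]. Qed.
Lemma contD p q : continuous p -> continuous q -> continuous (fun t : R => p t + q t : R).
Proof. by move=> cp cq t; apply: cvgD; [exact: cp|exact: cq]. Qed.
Lemma cont_cst (c : R) : continuous (fun _ : R => c).
Proof. by move=> t; exact: cvg_cst. Qed.

Lemma int_lin (a b : R) p q : continuous p -> continuous q ->
  \int[mu]_t (h t * (a * p t + b * q t)) =
  a * \int[mu]_t (h t * p t) + b * \int[mu]_t (h t * q t).
Proof.
move=> cp cq; have ip := mul_cont_int cp; have iq := mul_cont_int cq.
have z (c : R) r : continuous r -> mu.-integrable setT (EFin \o (fun t => c * (h t * r t))).
  move=> cr; have := mul_cont_int (contM (@cont_cst c) cr).
  by congr (_.-integrable _ (EFin \o _)); apply/funext => t; rewrite mulrCA.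
rewrite -!RintegralZl // -RintegralD //; [|exact: z..].
by apply: eq_Rintegral => t _; ring.
Qed.

Lemma annih1 : annih (fun=> 1).
Proof.
split=> [|n th]; first exact: cont_cst.
have [h1 h2] := h_orth n.
have cs : continuous (fun t : R => sin (n%:~R * t)).
  rewrite (_ : (fun t => _) = (fun t : R => cos (n%:~R * t + - (pi / 2)))).
    exact: cont_cos.
  by apply/funext => t; rewrite -sin_cos.
have cc : continuous (fun t : R => cos (n%:~R * t)).
  rewrite (_ : (fun t => _) = (fun t : R => cos (n%:~R * t + 0))); first exact: cont_cos.
  by apply/funext => t; rewrite addr0.
have := int_lin (cos th) (- sin th) cc cs; rewrite h1 h2 !mulr0 addr0 => <-.
by apply: eq_Rintegral => t _; rewrite mul1r cosD mulNr [cos th * _]mulrC [sin th * _]mulrC.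
Qed.

Lemma annihB k l : annih k -> annih l -> annih (fun t => k t - l t).
Proof.
move=> [ck ak] [cl al]; split=> [|n th]; first exact: contB.
have c := @cont_cos n%:~R th.
have := int_lin 1 (-1) (contM ck c) (contM cl c); rewrite ak al !mulr0 addr0 => <-.
by apply: eq_Rintegral => t _; congr (_ * _); ring.
Qed.

(** The product-to-sum formula turns the factor [cos (t - c)] into the frequencies [n + 1] and
    [n - 1] with phases [th - c] and [th + c]. *)
Lemma annih_cos (al be c : R) k : annih k -> annih (fun t => (al + be * cos (t - c)) * k t).
Proof.
move=> [ck ak]; have cc : continuous (fun t : R => cos (t - c)).
  rewrite (_ : (fun t => _) = (fun t : R => cos (1 * t + - c))); first exact: cont_cos.
  by apply/funext => t; rewrite mul1r.
split=> [|n th].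
  by apply: contM => //; apply: contD; [exact: cont_cst|apply: contM => //; exact: cont_cst].
have c0 := contM ck (@cont_cos n%:~R th).
have c1 := contM ck (@cont_cos (n + 1)%:~R (th - c)).
have c2 := contM ck (@cont_cos (n - 1)%:~R (th + c)).
have h1 := int_lin 1 1 c1 c2; rewrite !ak !mulr0 addr0 in h1.
have c12 : continuous (fun t => 1 * (k t * cos ((n + 1)%:~R * t + (th - c))) +
    1 * (k t * cos ((n - 1)%:~R * t + (th + c)))).
  by apply: contD; apply: contM => //; exact: cont_cst.
have := int_lin al (be / 2) c0 c12; rewrite ak h1 !mulr0 addr0 => <-.
apply: eq_Rintegral => t _; congr (_ * _).
have := cos_mul (n%:~R * t + th) (t - c).
rewrite (_ : n%:~R * t + th + (t - c) = (n + 1)%:~R * t + (th - c)); last by rewrite rmorphD /=; ring.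
rewrite (_ : n%:~R * t + th - (t - c) = (n - 1)%:~R * t + (th + c)); last by rewrite rmorphB /=; ring.
set A := cos (_ + (th - c)); set B := cos (_ + (th + c)) => e1.
rewrite mulrDl mulrDl !mul1r -mulrDr -mulrA; congr (_ + _).
rewrite (_ : A + B = 2 * (cos (n%:~R * t + th) * cos (t - c))); last by rewrite e1 mulrA divff ?mul1r // pnatr_eq0.
by field.
Qed.

Lemma annih_int k : annih k -> \int[mu]_t (h t * k t) = 0.
Proof.
move=> [_ /(_ 0 0)] <-; apply: eq_Rintegral => t _.
by rewrite mul0r addr0 cos0 mulr1.
Qed.

(** Takes the threshold value 1/2 of [bump] at the ends of the arc from 0 to [b]; the quarters keep
    the values in [[0, 1]]. *)
Definition arcv (b t : R) : R := (2^-1 + cos (b / 2) / 4) + (- 4^-1) * cos (t - b / 2).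

Lemma arcv_itv b t : 0 <= arcv b t <= 1.
Proof.
rewrite /arcv; have := cos_le1 (b / 2); have := cos_geN1 (b / 2).
by have := cos_le1 (t - b / 2); have := cos_geN1 (t - b / 2); lra.
Qed.

Lemma annih_bump b n : annih (fun t => bump (arcv b t) n).
Proof.
have pow m k : annih k -> annih (fun t => arcv b t ^+ m * k t).
  move=> ak; elim: m => [|m IH].
    by rewrite (_ : (fun t => _) = k) //; apply/funext => t; rewrite expr0 mul1r.
  have := annih_cos (2^-1 + cos (b / 2) / 4) (- 4^-1) (b / 2) IH.
  by congr annih; apply/funext => t; rewrite exprS -mulrA.
suff h' m : annih (fun t => (1 - arcv b t ^+ n) ^+ m) by exact: h'.
elim: m => [|m IH].
  by rewrite (_ : (fun t => _) = (fun=> 1)); [exact: annih1|apply/funext => t; rewrite expr0].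
have := annihB IH (pow n _ IH); congr annih; apply/funext => t.
by rewrite exprS mulrBl mul1r.
Qed.

Definition half_line (b t : R) : R := (t <= b)%R%:R.

Lemma half_lineE (b : R) : half_line b = \1_(`]-oo, b]%classic : set R).
Proof. by apply/funext => t; rewrite indicE /half_line; congr (_%:R); rewrite mem_setE in_itv. Qed.

(** Dominated convergence: the trigonometric polynomials [bump (arcv b t) n] annihilate [h] and tend
    to the indicator of the arc off the points 0, [b], [2 pi]. *)
Lemma int_arc (b : R) : 0 < b < 2 * pi -> \int[mu]_t (h t * half_line b t) = 0.
Proof.
move=> b02; have [mh _] := (Lfun2P _ _).1 hL.
pose f_ (n : nat) (t : R) : \bar R := (h t * bump (arcv b t) n)%:E.
pose f (t : R) : \bar R := (h t * half_line b t)%:E.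
have mf_ n : measurable_fun setT (f_ n).
  by apply/measurable_EFinP/measurable_funM => //; apply: continuous_measurable_fun; have [] := annih_bump b n.
have mi : measurable_fun setT (half_line b).
  rewrite half_lineE; exact: measurable_indic.
have mf : measurable_fun setT f by apply/measurable_EFinP/measurable_funM.
have ff : {ae mu, forall t, setT t -> f_ ^~ t @ \oo --> f t}.
  apply: (@circle_ae_null _ _ [:: 0; b; 2 * pi]) => t; rewrite /= in_itv /= => It.
  rewrite !inE !negb_or => /and3P[t0 tb t2] _.
  have [lt gt] := cos_arc b02 It t0 tb t2; have /andP[v0 v1] := arcv_itv b t.
  apply: cvg_EFin; first exact: nearW.
  apply: cvgM; first exact: cvg_cst.
  have [tb'|tb'|tb'] := ltgtP t b; last by rewrite tb' eqxx in tb.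
    have -> : half_line b t = 1 by rewrite /half_line (ltW tb').
    by apply: bump_cvg1; rewrite v0 /= /arcv; have := lt tb'; lra.
  have -> : half_line b t = 0 by rewrite /half_line leNgt tb'.
  by apply: bump_cvg0; rewrite v1 andbT /arcv; have := gt tb'; lra.
have ih := L2_integrable hL.
have ig : mu.-integrable setT (fun t => `|h t|%:E).
  by have := integrable_norm ih; congr (_.-integrable _ _).
have fg : {ae mu, forall t n, setT t -> (`|f_ n t| <= `|h t|%:E)%E}.
  apply: aeW => t n _; rewrite /f_ abse_EFin lee_fin normrM ler_piMr //.
  by have /andP[b0 b1] := bump_itv n (arcv_itv b t); rewrite ger0_norm.
have [_ _] := @dominated_convergence _ (measurableTypeR R) R mu setT measurableT f_ f (fun t => `|h t|%:E) mf_ mf ff ig fg.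
rewrite (_ : (fun n => _) = cst 0%E); last first.
  apply/funext => n /=; have := annih_int (annih_bump b n); rewrite /Rintegral => h0.
  rewrite -[LHS]fineK ?h0 //; apply: integrable_fin_num => //.
  by apply: mul_cont_int; have [] := annih_bump b n.
move=> hc; rewrite /Rintegral (_ : (\int[mu]_x _)%E = 0%E) //.
by apply: (cvg_unique _ hc); [exact: ereal_hausdorff|exact: cvg_cst].
Qed.

Lemma int_half_line (b : R) : \int[mu]_t (h t * half_line b t) = 0.
Proof.
have [mh _] := (Lfun2P _ _).1 hL.
have mi : measurable_fun setT (half_line b).
  rewrite half_lineE; exact: measurable_indic.
have mf : measurable_fun setT (fun t => h t * half_line b t) by exact: measurable_funM.
have [b0|b0] := leP b 0.
  rewrite (@ae_eq_Rintegral _ _ (fun=> 0)) ?Rintegral_cst ?mul0r //.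
  apply: (@circle_ae_null _ _ [:: 0]) => t; rewrite /= in_itv /= inE => /andP[t0 _] tn.
  rewrite /half_line; have -> : (t <= b)%R = false by apply/negbTE; rewrite -ltNge lt_def (le_trans b0) // andbT; apply: contra_neq tn => tb; lra.
  by rewrite mulr0.
have [b2|b2] := ltP b (2 * pi); first by apply: int_arc; rewrite b0.
rewrite -(annih_int annih1); apply: ae_eq_Rintegral => //; first exact: measurable_funM.
by apply: circle_ae => t; rewrite /= in_itv /= => /andP[_ t2]; rewrite /half_line (le_trans t2 b2).
Qed.

(** Extended by 0, [h] has vanishing primitive, and by Lebesgue differentiation it is almost
    everywhere the derivative of that primitive. *)
Lemma annihilator_zero : {ae mu, forall t, h t = 0}.
Proof.
have [mh _] := (Lfun2P _ _).1 hL; have ih := L2_integrable hL.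
pose hh : R -> R := h \_ I.
have ihI : leb.-integrable I (EFin \o h).
  apply/integrableP; split; first by apply/measurable_EFinP/measurable_funTS.
  have /integrableP [_] := ih; apply: le_lt_trans.
  have -> : (\int[leb]_(x in I) `|(EFin \o h) x| = \int[mu]_(x in I) `|(EFin \o h) x|)%E.
    by apply: eq_measure_integral => A mA AI; rewrite /circle_measure /= /mrestr setIidl.
  apply: ge0_subset_integral => //.
  by apply: measurableT_comp => //; exact/measurable_EFinP.
have ihh : leb.-integrable setT (EFin \o hh).
  by have /(integrable_mkcond _ measurable_circle) := ihI; rewrite restrict_EFin.
have F0 y : \int[leb]_(t in `]-oo, y]) hh t = 0.
  rewrite /hh -Rintegral_mkcondr setIC Rintegral_mkcondr.
  rewrite -[RHS](int_half_line y) integral_circle.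
    apply: eq_Rintegral => t _; rewrite patchE.
    rewrite mem_setE in_itv /= /half_line; by case: (t <= y); rewrite ?mulr1 ?mulr0.
  apply: (le_integrable measurableT _ _ ih).
    apply/measurable_EFinP/measurable_funM => //.
    by rewrite half_lineE; exact: measurable_indic.
  by move=> t _ /=; rewrite lee_fin normrM /half_line; case: (t <= y); rewrite ?normr0 ?normr1 ?mulr1 ?mulr0.
have loc : locally_integrable setT hh by apply: open_integrable_locally => //; exact: openT.
have iy y : leb.-integrable `]-oo, y] (EFin \o hh).
  by apply: (integrableS measurableT _ _ ihh) => //; exact: measurable_itv.
have ft := @FTC1Ny R hh iy loc.
have [N [mN N0 sN]] := ft.
exists (N `|` ~` I); split.
- by apply: measurableU => //; exact: measurableC measurable_circle.
- apply/eqP; rewrite eq_le measure_ge0 andbT; apply: le_trans (measureU2 _ mN _) _.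
    exact: measurableC measurable_circle.
  apply: (@le_trans _ _ (mu N + 0)%E).
    by apply: leeD => //; rewrite le_eqVlt; apply/orP; left; apply/eqP; exact: circle_measureC.
  rewrite adde0 /circle_measure /= /mrestr -N0.
  by apply: le_measure; rewrite ?inE //; apply: measurableI => //; exact: measurable_circle.
move=> t /= ht; have [It|nIt] := pselect (I t); last by right.
left; apply: sN => /= -[_ ht']; apply: ht.
have : hh t = 0.
  rewrite -ht' (_ : (fun x => _) = cst 0); last by apply/funext => y; exact: F0.
  exact: derive1_cst.
by rewrite /hh patchE mem_set.
Qed.

End Annihilator.
End FourierCompleteness.

(** * The Fourier basis and the diagonal form of D *)

Section FourierBasis.
Context {R : realType}.
Notation C := R[i].
Notation pi := (@trigo.pi R).
Notation mu := (circle_measure R).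
Notation ip := (L2dot R).
Notation nrm := (hnorm ip).
Notation H := (L2 R).
Implicit Types (f g : R -> C) (p q : R -> R) (x y : H).

(** The enumeration [0, 1, -1, 2, -2, ...]. *)
Definition freq (k : nat) : int := if odd k then (k./2.+1)%:Z else - (k./2)%:Z.

Lemma freq_inj : injective freq.
Proof.
move=> j k; rewrite /freq; have := odd_double_half j; have := odd_double_half k.
by case: (odd j); case: (odd k) => /=; lia.
Qed.

Lemma freq_surj (n : int) : exists k, freq k = n.
Proof.
case: n => [[|n]|n]; first by exists 0%N.
  by exists n.*2.+1; rewrite /freq /= odd_double /= uphalf_double.
by exists n.*2.+2; rewrite /freq /= odd_double /= doubleK NegzE.
Qed.

Lemma conjM (a b : C) : (a * b)^* = a^* * b^*.
Proof. exact: rmorphM. Qed.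

Lemma conjN (a : C) : (- a)^* = - a^*.
Proof. exact: rmorphN. Qed.

Lemma cintegralD f g : sq f -> sq g -> cintegral (fun t => f t + g t) = cintegral f + cintegral g.
Proof.
move=> /sqP [/L2_integrable r1 /L2_integrable i1] /sqP [/L2_integrable r2 /L2_integrable i2].
rewrite /cintegral; apply: complex_eq; rewrite ?reD ?imD /=.
  by rewrite -RintegralD //; apply: eq_Rintegral => t _; rewrite reD.
by rewrite -RintegralD //; apply: eq_Rintegral => t _; rewrite imD.
Qed.

Definition fconst : C := (((Num.sqrt (2 * pi))^-1)%:C)%C.

Lemma fconst_sq : fconst * fconst * ((2 * pi)%:C)%C = 1.
Proof.
have p0 : 0 < 2 * pi by rewrite mulr_gt0 ?pi_gt0.
rewrite /fconst -!RCM -invfM -expr2 sqr_sqrtr ?ltW // mulVf ?gt_eqF //.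
Qed.

Lemma fconst_neq0 : fconst != 0.
Proof. by apply: contra_eqN (fconst_sq) => /eqP ->; rewrite !mul0r eq_sym oner_eq0. Qed.

Lemma fconst_conj : fconst^* = fconst.
Proof. exact: conj_RC. Qed.

Definition fexp (k : nat) (t : R) : C := fconst * E (freq k) t.
Definition fe (k : nat) : H := L2class (fexp k).

Lemma sm_fexp k : sm (fexp k).
Proof. exact/smZ/sm_E. Qed.

Lemma sq_fexp k : sq (fexp k).
Proof. exact/sq_sm/sm_fexp. Qed.

Lemma ip_fe j k : ip (fe j) (fe k) = (j == k)%:R.
Proof.
rewrite ip_class; [|exact: sq_fexp..].
rewrite (_ : (fun t => _) = (fun t => fconst * fconst * E (freq j - freq k) t)); last first.
  apply/funext => t; rewrite /fexp conjM fconst_conj E_conj -E_mul; ring.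
rewrite cintegralZ; last exact/sq_sm/sm_E.
rewrite cintegral_E subr_eq0 (inj_eq freq_inj); case: eqP => _; last by rewrite mulr0.
exact: fconst_sq.
Qed.

(** A Fourier coefficient couples the real and imaginary parts of [F]. The equations for [n] and
    [-n] together decouple them, cosine being even and sine odd, and [annihilator_zero] applies to
    each part. *)
Lemma fe_complete x : (forall k, ip x (fe k) = 0) -> x = 0.
Proof.
move=> hx; pose F := (repr x : L2fun R) : R -> C; have sF : sq F := sq_repr x.
have xF : x = L2class F by rewrite L2class_repr.
have /sqP [rL iL] := sF; pose r t := re (F t); pose s t := im (F t).
have orth n : cintegral (fun t => F t * (E n t)^*) = 0.
  have [k <-] := freq_surj n; have := hx k; rewrite xF ip_class //; last exact: sq_fexp.
  rewrite (_ : (fun t => _) = (fun t => fconst * (F t * (E (freq k) t)^*))); last first.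
    by apply/funext => t; rewrite /fexp conjM fconst_conj; ring.
  rewrite cintegralZ => [/eqP|]; first by rewrite mulf_eq0 (negPf fconst_neq0) => /eqP.
  have := sq_mul (sm_conj (sm_E (freq k))) sF.
  by congr (is_true (sq _)); apply/funext => t; rewrite mulrC.
have cL (n : int) : (fun t : R => cos (n%:~R * t)) \in Lfun mu 2%:E.
  by have /sqP [] := sq_sm (@sm_E R n).
have sL (n : int) : (fun t : R => sin (n%:~R * t)) \in Lfun mu 2%:E.
  by have /sqP [] := sq_sm (@sm_E R n).
have eqs n : \int[mu]_t (r t * cos (n%:~R * t)) + \int[mu]_t (s t * sin (n%:~R * t)) = 0 /\
    \int[mu]_t (s t * cos (n%:~R * t)) - \int[mu]_t (r t * sin (n%:~R * t)) = 0.
  have i1 := mul_integrable rL (cL n); have i2 := mul_integrable iL (sL n).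
  have i3 := mul_integrable iL (cL n); have i4 := mul_integrable rL (sL n).
  have h := orth n; have h1 := congr1 (@complex.Re R) h; have h2 := congr1 (@complex.Im R) h.
  move: h1 h2 => /= h1 h2; split.
    rewrite -h1 -RintegralD //; apply: eq_Rintegral => t _.
    by rewrite reM re_conj im_conj /= mulrN opprK.
  rewrite -h2 -RintegralB //; apply: eq_Rintegral => t _.
  by rewrite imM re_conj im_conj /= mulrN addrC.
have sym n (q : R -> R) (qL : q \in Lfun mu 2%:E) : \int[mu]_t (q t * cos ((- n)%:~R * t)) = \int[mu]_t (q t * cos (n%:~R * t)) /\
    \int[mu]_t (q t * sin ((- n)%:~R * t)) = - \int[mu]_t (q t * sin (n%:~R * t)).
  split; first by apply: eq_Rintegral => t _; rewrite rmorphN mulNr cosN.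
  rewrite -[RHS]mulN1r -RintegralZl //; last exact: mul_integrable qL (sL n).
  by apply: eq_Rintegral => t _; rewrite rmorphN mulNr sinN mulrN mulN1r.
have lin2 (a b : R) : a + b = 0 -> a - b = 0 -> a = 0 /\ b = 0 by move=> ? ?; split; lra.
have key n : [/\ \int[mu]_t (r t * cos (n%:~R * t)) = 0, \int[mu]_t (r t * sin (n%:~R * t)) = 0,
    \int[mu]_t (s t * cos (n%:~R * t)) = 0 & \int[mu]_t (s t * sin (n%:~R * t)) = 0].
  have [e1 e2] := eqs n; have := eqs (- n).
  have [-> ->] := sym n r rL; have [-> ->] := sym n s iL; rewrite opprK.
  by move=> [e3 e4]; have [-> ->] := lin2 _ _ e1 e3; have [-> ->] := lin2 _ _ e4 e2.
have r0 : {ae mu, forall t, r t = 0} by apply: (annihilator_zero rL) => n; have [] := key n.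
have s0 : {ae mu, forall t, s t = 0} by apply: (annihilator_zero iL) => n; have [] := key n.
rewrite xF (@eq_L2class _ F (fun t => 0 * F t)) ?L2classZ ?scale0r //; first exact: sqZ.
apply: (@filterS2 _ _ aeF _ _ _ _ r0 s0) => t h1 h2; rewrite mul0r.
exact: complex_eq.
Qed.

Lemma fe_onb : orthonormal_basis ip fe.
Proof. by split; [exact: ip_fe|exact: fe_complete]. Qed.

Notation hilb := (@circle_hilbert R).
Notation coef := (hcoef ip fe).

Definition T f x : H := L2class (fun t => f t * (repr x : L2fun R) t).

Lemma T_class f g : sm f -> sq g -> T f (L2class g) = L2class (fun t => f t * g t).
Proof.
move=> hf hg; apply: eq_L2class; [exact/sq_mul/sq_repr|exact: sq_mul|].
by apply: (@filterS _ _ aeF _ _ _ (L2class_ae hg)) => t ->.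
Qed.

Lemma T_linear f c x y : sm f -> T f (c *: x + y) = c *: T f x + T f y.
Proof.
move=> hf; rewrite -{1}(L2class_repr x) -{1}(L2class_repr y).
have sx := sq_repr x; have sy := sq_repr y.
rewrite -L2classZD // T_class //; last exact: sqZD.
rewrite -L2classZD; [|exact: sq_mul..].
by congr L2class; apply/funext => t; ring.
Qed.

Lemma T_add f g x : sm f -> sm g -> T (fun t => f t + g t) x = T f x + T g x.
Proof.
move=> hf hg; rewrite /T -L2classD; [|exact/sq_mul/sq_repr..].
by congr L2class; apply/funext => t; rewrite mulrDl.
Qed.

Lemma T_scale f c x : sm f -> T (fun t => c * f t) x = c *: T f x.
Proof.
move=> hf; rewrite /T -L2classZ; last exact/sq_mul/sq_repr.
by congr L2class; apply/funext => t; rewrite mulrA.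
Qed.

Lemma T_mul f g x : sm f -> sm g -> T (fun t => f t * g t) x = T f (T g x).
Proof.
move=> hf hg; rewrite [T g x]/T T_class //; last exact/sq_mul/sq_repr.
by congr L2class; apply/funext => t; rewrite mulrA.
Qed.

Lemma T_one x : T (fun=> 1) x = x.
Proof. by rewrite -[RHS]L2class_repr; congr L2class; apply/funext => t; rewrite mul1r. Qed.

Lemma T_adj f x y : sm f -> ip (T f x) y = ip x (T (fun t => (f t)^*) y).
Proof.
move=> hf; rewrite -{1}(L2class_repr y) -{2}(L2class_repr x).
have sx := sq_repr x; have sy := sq_repr y.
rewrite !ip_class //; [|exact/sq_mul/sy/sm_conj|exact: sq_mul].
by apply: eq_cintegral => t; rewrite conjM conjCK; ring.
Qed.

Lemma T_bounded f : sm f -> exists2 K : R, 0 <= K & forall x, nrm (T f x) <= K * nrm x.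
Proof.
move=> hf; have [K K0 hK] := sm_bounded hf; exists K => // x.
have sx := sq_repr x; have sfx := sq_mul hf sx.
rewrite -(@ler_pXn2r _ 2) ?nnegrE ?nrm_ge0 ?mulr_ge0 ?nrm_ge0 // exprMn.
have e1 := nrm_class sfx; have e2 := nrm_class sx; rewrite L2class_repr in e2.
suff : ((nrm (L2class (fun t => f t * (repr x : L2fun R) t)) ^+ 2)%:E <= (K ^+ 2)%:E * (nrm x ^+ 2)%:E)%E.
  by rewrite -EFinM lee_fin.
rewrite e1 e2 {e1 e2}.
have mE g : sq g -> measurable_fun setT (fun t => ((re (g t)) ^+ 2)%:E) /\
    measurable_fun setT (fun t => ((im (g t)) ^+ 2)%:E).
  by move=> /sqP [/Lfun2_measurable h1 /Lfun2_measurable h2];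
    split; apply/measurable_EFinP/measurable_funX.
have sumE g : sq g -> (\int[mu]_t ((re (g t)) ^+ 2)%:E + \int[mu]_t ((im (g t)) ^+ 2)%:E =
    \int[mu]_t (((cabs (g t)) ^+ 2)%:E))%E.
  move=> hg; have [m1 m2] := mE g hg; rewrite -ge0_integralD //.
  - by apply: eq_integral => t _; rewrite sqr_cabs EFinD.
  - by move=> t _; rewrite lee_fin sqr_ge0.
  - by move=> t _; rewrite lee_fin sqr_ge0.
have mc g : sq g -> measurable_fun setT (fun t => ((cabs (g t)) ^+ 2)%:E).
  move=> hg; have [m1 m2] := mE g hg.
  rewrite (_ : (fun t => _) = (fun t => ((re (g t)) ^+ 2)%:E + ((im (g t)) ^+ 2)%:E)%E).
    exact: emeasurable_funD.
  by apply/funext => t; rewrite sqr_cabs EFinD.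
rewrite !sumE // -ge0_integralZl //; [|exact: mc|by move=> t _; rewrite lee_fin sqr_ge0|by rewrite lee_fin sqr_ge0].
apply: ae_ge0_le_integral => //.
- by move=> t _; rewrite lee_fin sqr_ge0.
- exact: mc.
- by move=> t _; rewrite -EFinM lee_fin mulr_ge0 ?sqr_ge0.
- by apply: emeasurable_funM => //; exact: mc.
apply: (@filterS _ _ aeF _ _ _ hK) => t ht _; rewrite -EFinM lee_fin cabsM exprMn.
by apply: ler_wpM2r; [exact: sqr_ge0|rewrite ler_pXn2r ?nnegrE ?cabs_ge0].
Qed.

Lemma T_fe f k : sm f -> T f (fe k) = L2class (fun t => f t * fexp k t).
Proof. by move=> hf; exact: T_class (sq_fexp k). Qed.

Lemma Df_fexp k : Df (fexp k) = fun t => (freq k)%:~R * fexp k t.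
Proof.
rewrite /fexp Df_mul; [|exact: sm_cst|exact: sm_E].
have h : has_deriv (fun=> re fconst) (fun=> 0 : R) := @has_deriv_cst _ _.
have h' : has_deriv (fun=> im fconst) (fun=> 0 : R) := @has_deriv_cst _ _.
rewrite (@DfE _ (fun=> fconst) _ _ h h') Df_E; apply/funext => t.
rewrite oppr0 (_ : Complex 0 0 = 0 :> C) // mul0r add0r; ring.
Qed.

Lemma int_conj (n : int) : ((n%:~R : C))^* = n%:~R.
Proof. exact: rmorph_int. Qed.

Lemma coef_Df f k : sm f -> coef (L2class (Df f)) k = (freq k)%:~R * coef (L2class f) k.
Proof.
move=> hf; have sD := sm_Df hf; have sc := sm_conj (sm_fexp k).
rewrite /hcoef !ip_class; [|exact: sq_sm|exact: sq_fexp|exact: sq_sm|exact: sq_fexp].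
have := cintegral_Df (smM hf sc); rewrite (Df_mul hf sc) (Df_conj (sm_fexp k)) Df_fexp.
rewrite (_ : (fun t => _) = (fun t => Df f t * (fexp k t)^* +
   - (freq k)%:~R * (f t * (fexp k t)^*))); last first.
  by apply/funext => t; rewrite (conjM (freq k)%:~R) int_conj; ring.
rewrite cintegralD; [|exact/sq_sm/smM|exact/sq_sm/smZ/smM].
rewrite cintegralZ; last exact/sq_sm/smM.
by rewrite mulNr => /eqP; rewrite subr_eq0 => /eqP.
Qed.

Definition dfreq : oper H := Diag ip fe (fun k => (freq k)%:~R).

Lemma dfreq_ip f x y : sm f -> dfreq (x, y) -> ip x (L2class (Df f)) = ip y (L2class f).
Proof.
move=> hf h; apply: (eq_ip hilb fe_onb) => k.
rewrite (h k) coef_Df // (conjM (freq _)%:~R) int_conj; ring.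
Qed.

(** Testing on exponentials determines the coefficients of an adjoint vector; conversely [dfreq_ip]
    gives the adjoint relation on the maximal diagonal domain. *)
Lemma adjoint_deriv : adjoint ip (@deriv_op R) = dfreq.
Proof.
apply/seteqP; split=> -[x y].
  move=> h k /=; have := h (fe k, L2class (Df (fexp k))) => /=.
  have hd : deriv_op (fe k, L2class (Df (fexp k))) by exists (fexp k) => //; exact: sm_fexp.
  move=> /(_ hd); rewrite Df_fexp L2classZ; last exact: sq_fexp.
  by rewrite ipZl => /(congr1 Num.conj); rewrite (conjM (freq _)%:~R) int_conj !ip_conj.
move=> h _ [f hf ->] /=; rewrite -/(Df f) -[LHS]ip_conj -[RHS]ip_conj.
by rewrite (dfreq_ip hf h).
Qed.

Definition dval (k : nat) : R := (freq k)%:~R + (k == 0%N)%:R.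

Lemma orth_proj_const : orth_proj ip [set L2class (fun=> c) | c in [set: C]] =
  Diag ip fe (fun k => (k == 0%N)%:R).
Proof.
have fe0 c : L2class (fun=> c) = (c / fconst) *: fe 0.
  rewrite -L2classZ; last exact: sq_fexp.
  by congr L2class; apply/funext => t; rewrite /fexp E0 mulr1 divfK ?fconst_neq0.
have Wfe0 : [set L2class (fun=> c) | c in [set: C]] (fe 0).
  by exists fconst => //; rewrite fe0 divff ?fconst_neq0 // scale1r.
apply/seteqP; split=> -[x y].
  move=> [[c _ hc] orth] k; change (L2class (fun=> c) = y) in hc.
  change (coef y k = (k == 0%N)%:R * coef x k).
  rewrite -hc fe0 hcoefZ {1}/hcoef ip_fe.
  case: k => [|k]; last by rewrite mul0r mulr0.
  have : ip (x - y) (fe 0) = 0 by exact: orth.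
  rewrite -hc fe0 ipBl ipZl ip_fe eqxx mul1r mulr1.
  by move/eqP; rewrite subr_eq0 => /eqP.
move=> h; have y0 : y = coef x 0 *: fe 0.
  apply: (coef_inj fe_onb) => k; rewrite hcoefZ {3}/hcoef ip_fe.
  have -> : coef y k = (k == 0%N)%:R * coef x k by exact: h.
  by case: k => [|k]; rewrite ?mul1r ?mulr1 ?mul0r ?mulr0.
split.
  exists (coef x 0 * fconst) => //.
  by rewrite fe0 mulfK ?fconst_neq0.
move=> _ [c _ <-]; change (ip (x - y) (L2class (fun=> c)) = 0).
by rewrite fe0 ipZr ipBl y0 ipZl ip_fe eqxx mulr1 subrr mulr0.
Qed.

(** The projection is bounded and everywhere defined, so the sum keeps the domain of its unbounded
    summand. *)
Lemma circle_DE : circle_D R = Diag ip fe (fun k => ((dval k)%:C)%C).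
Proof.
have e k : ((dval k)%:C)%C = (freq k)%:~R + (k == 0%N)%:R :> C.
  by rewrite /dval RCD; congr (_ + _); [rewrite rmorph_int|case: (k == 0%N)].
rewrite /circle_D adjoint_deriv orth_proj_const; apply/seteqP; split=> -[x y].
  move=> [u [v [h1 h2 hy]]] k; change (y = u + v) in hy.
  change (coef y k = ((dval k)%:C)%C * coef x k).
  have h1k : coef u k = (freq k)%:~R * coef x k by exact: h1.
  have h2k : coef v k = (k == 0%N)%:R * coef x k by exact: h2.
  by rewrite hy hcoefD h1k h2k e mulrDl.
move=> h; have [|v hv _] := @Diag_ex _ _ _ hilb _ fe_onb (fun k => (k == 0%N)%:R) 1 ler01 _ x.
  by move=> k; case: (k == 0%N); rewrite ?cabs1 ?cabs0.
exists (y - v), v; split=> //; last by rewrite subrK.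
move=> k; change (coef (y - v) k = (freq k)%:~R * coef x k).
have hk : coef y k = ((dval k)%:C)%C * coef x k by exact: h.
have hvk : coef v k = (k == 0%N)%:R * coef x k by exact: hv.
by rewrite hcoefB hk hvk e mulrDl addrK.
Qed.

(** Leibniz' rule in weak form: it is used on the test functions [fexp k], so that [x] need not be
    classically differentiable. *)
Lemma dfreq_T f x y : sm f -> dfreq (x, y) -> dfreq (T f x, T f y + T (Df f) x).
Proof.
move=> hf h k; have sc := sm_conj hf; have sD := sm_Df hf.
change (ip (T f y + T (Df f) x) (fe k) = (freq k)%:~R * ip (T f x) (fe k)).
rewrite ipDl !T_adj //.
have hk : sm (fun t => (f t)^* * fexp k t) by exact/smM/sm_fexp.
have := dfreq_ip hk h; rewrite (Df_mul sc (sm_fexp k)) Df_conj // Df_fexp.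
rewrite (_ : (fun t => _) = (fun t => (-1) * ((Df f t)^* * fexp k t) +
   (freq k)%:~R * ((f t)^* * fexp k t))); last by apply/funext => t; ring.
have sqD : sq (fun t => (Df f t)^* * fexp k t) by exact/sq_sm/smM/sm_fexp/sm_conj.
rewrite L2classZD //; last exact/sq_sm/smZ.
have e1 := L2classZ (freq k)%:~R (sq_sm hk); have e2 := T_fe k sc.
have e3 := T_fe k (sm_conj sD); rewrite e1 -e2 -e3.
rewrite ipDr !ipZr int_conj conjN rmorph1 mulN1r => <-.
by rewrite addrAC addNr add0r.
Qed.

Lemma T_shift n k : T (E n) (fe k) = L2class (fun t => fconst * E (n + freq k) t).
Proof.
rewrite T_fe; last exact: sm_E.
by congr L2class; apply/funext => t; rewrite /fexp mulrCA E_mul.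
Qed.

(** [fexp k] and its conjugate multiply to a constant independent of [k]. *)
Lemma T_diag f : sm f -> exists c, forall k, ip (T f (fe k)) (fe k) = c.
Proof.
move=> hf; exists (cintegral (fun t => fconst * fconst * f t)) => k.
rewrite T_fe // ip_class; [|exact/sq_sm/smM/sm_fexp|exact: sq_fexp].
apply: eq_cintegral => t; rewrite /fexp conjM fconst_conj.
by have := E_norm (freq k) t; set z := E _ _ => hz; rewrite -[RHS]mulr1 -hz; ring.
Qed.

End FourierBasis.

(** * The triple of the circle and the index of the shift *)

Section CircleTriple.
Context {R : realType}.
Notation C := R[i].
Notation ip := (L2dot R).
Notation H := (L2 R).
Notation hilb := (@circle_hilbert R).
Notation onb := (@fe_onb R).
Notation e := (@fe R).
Notation d := (@dval R).
Notation coef := (hcoef ip e).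

Definition nu (k : nat) : R := (freq k)%:~R.

Lemma freq_odd n : freq n.*2.+1 = n.+1%:Z.
Proof. by rewrite /freq /= odd_double /= uphalf_double. Qed.

Lemma freq_even n : freq n.*2.+2 = - n.+1%:Z.
Proof. by rewrite /freq /= odd_double /= doubleK. Qed.

Lemma nat_cases k : exists n : nat, [\/ k = 0%N, k = n.*2.+1 | k = n.*2.+2].
Proof.
case: k => [|k]; first by exists 0%N; constructor 1.
exists k./2; have := odd_double_half k; case: (odd k) => h; [constructor 3|constructor 2]; lia.
Qed.

Lemma dval_cases k : exists n : nat, [\/ [/\ k = 0%N, nu k = 0 & d k = 1],
  [/\ k = n.*2.+1, nu k = n.+1%:R & d k = n.+1%:R] |
  [/\ k = n.*2.+2, nu k = - n.+1%:R & d k = - n.+1%:R]].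
Proof.
have [n [->|->|->]] := nat_cases k; exists n.
- by constructor 1; split; rewrite // /dval /nu /freq /= oppr0 ?add0r.
- by constructor 2; split; rewrite // /dval /nu freq_odd /= ?addr0.
- by constructor 3; split; rewrite // /dval /nu freq_even /= rmorphN /= ?addr0.
Qed.

Lemma d_zero : d 0%N = 1.
Proof. by have [n [[]|[]|[]]] := dval_cases 0. Qed.

Lemma d_odd n : d n.*2.+1 = n.+1%:R.
Proof.
have [m [[]|[]|[]]] := dval_cases n.*2.+1 => //; last by lia.
by move=> h _ ->; congr (_%:R); lia.
Qed.

Lemma d_even n : d n.*2.+2 = - n.+1%:R.
Proof.
have [m [[]|[]|[]]] := dval_cases n.*2.+2 => //; first by lia.
by move=> h _ ->; congr (- _%:R); lia.
Qed.

Lemma d_ge1 k : 1 <= `|d k|.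
Proof.
have [n [[_ _ ->]|[_ _ ->]|[_ _ ->]]] := dval_cases k; rewrite ?normr1 ?normrN ?normr_nat //.
- by rewrite ler1n.
- by rewrite ler1n.
Qed.

Lemma d_growth k : k.+1%:R <= 3 * `|d k|.
Proof.
have [n [[-> _ ->]|[-> _ ->]|[-> _ ->]]] := dval_cases k; rewrite ?normr1 ?normrN ?normr_nat ?mulr1.
- by rewrite ler_nat.
- by rewrite -natrM ler_nat; lia.
- by rewrite -natrM ler_nat; lia.
Qed.

(** The constant mode counts as positive, since D is 1 there; its distance to a negative frequency
    is at least 1, which is [|d 0|]. *)
Lemma nu_gap j k : sgd d j != sgd d k -> `|d j| <= `|nu k - nu j| /\ `|d k| <= `|nu k - nu j|.
Proof.
have n0 (n : nat) : 0 < n.+1%:R :> R by [].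
have n1 (n : nat) : 1 <= n.+1%:R :> R by rewrite ler1n.
rewrite /sgd; have [m hm] := dval_cases j; have [n hn] := dval_cases k.
have := n1 m; have := n1 n; have := n0 m; have := n0 n.
case: hm => -[_ -> ->]; case: hn => -[_ -> ->]; move: (m.+1%:R : R) (n.+1%:R : R) => a b b0 a0 b1 a1;
  rewrite ?sgrN ?sgr1 ?(gtr0_sg a0) ?(gtr0_sg b0) ?eqxx // => _;
  rewrite ?normrN ?normr1 ?(gtr0_norm a0) ?(gtr0_norm b0);
  (split; first [rewrite ger0_norm; lra|rewrite ler0_norm; lra]).
Qed.

Definition symbol := {f : R -> C | sm f}.
Definition sT (s : symbol) : H -> H := T (sval s).
Definition scj (s : symbol) : symbol := exist _ _ (sm_conj (svalP s)).
Definition sdr (s : symbol) : symbol := exist _ _ (sm_Df (svalP s)).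
Definition sone : symbol := exist _ _ (@sm_cst R 1).
Definition smul (s t : symbol) : symbol := exist _ _ (smM (svalP s) (svalP t)).

Lemma nu_int k : ((nu k)%:C)%C = (freq k)%:~R :> C.
Proof. exact: rmorph_int. Qed.

Lemma sT_dr s x y : Diag ip e (fun k => ((nu k)%:C)%C) (x, y) ->
  Diag ip e (fun k => ((nu k)%:C)%C) (sT s x, sT s y + sT (sdr s) x).
Proof.
have -> : (fun k => ((nu k)%:C)%C) = (fun k => (freq k)%:~R : C) by apply/funext => k; exact: nu_int.
exact: (dfreq_T (svalP s)).
Qed.

Lemma nu0 : nu 0%N = 0. Proof. by rewrite /nu /freq /= oppr0. Qed.
Lemma nu_d k : d k = nu k + (k == 0%N)%:R. Proof. by []. Qed.

Notation MM := (mops hilb onb d_growth (T := sT) (dr := sdr) (nu := nu) nu0 nu_d sT_dr).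

Lemma MM_class : mult_class onb MM.
Proof.
apply: (@mops_class _ _ _ hilb _ onb _ d_ge1 d_growth symbol sT scj sdr sone smul nu).
- exact: nu_gap.
- by move=> s c x y; exact: T_linear (svalP s).
- by move=> s; exact: T_bounded (svalP s).
- by move=> s x y; exact: T_adj (svalP s).
- by move=> x; exact: T_one.
- by move=> s t x; exact: T_mul (svalP s) (svalP t).
- by move=> s; exact: T_diag (svalP s).
Qed.

Lemma smooth_Bsub : circle_smooth R `<=` Bsub onb (Psd MM).
Proof.
move=> _ [f hf <-]; have hs := @mop_Bsub _ _ _ hilb _ onb _ d_ge1 d_growth symbol sT scj sdr sone smul nu
  nu0 nu_d nu_gap _ _ _ sT_dr _ _ _ (exist _ f hf).
apply: hs.
- by move=> s c x y; exact: T_linear (svalP s).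
- by move=> s; exact: T_bounded (svalP s).
- by move=> s x y; exact: T_adj (svalP s).
- by move=> x; exact: T_one.
- by move=> s t x; exact: T_mul (svalP s) (svalP t).
- by move=> s; exact: T_diag (svalP s).
Qed.

Implicit Types f g : R -> C.

Lemma mult_opM f g : sm f -> sm g -> opM (mult_op f) (mult_op g) = mult_op (fun t => f t * g t).
Proof.
move=> hf hg; apply/seteqP; split=> -[x y].
  by move=> [z hz hy]; change (y = T (fun t => f t * g t) x); rewrite T_mul // -[T g x]hz.
by move=> h; exists (T g x) => //; change (y = T f (T g x)); rewrite -T_mul.
Qed.

Lemma mult_opD f g : sm f -> sm g -> opD (mult_op f) (mult_op g) = mult_op (fun t => f t + g t).
Proof.
move=> hf hg; apply/seteqP; split=> -[x y].
  move=> [u [v [hu hv hy]]]; change (y = T (fun t => f t + g t) x).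
  by rewrite T_add // -[T f x]hu -[T g x]hv; exact: hy.
move=> h; exists (T f x), (T g x); split=> //; change (y = T f x + T g x).
by rewrite -T_add.
Qed.

Lemma mult_opZ c f : sm f -> opZ c (mult_op f) = mult_op (fun t => c * f t).
Proof.
move=> hf; apply/seteqP; split=> -[x y].
  move=> [u hu hy]; change (y = T (fun t => c * f t) x).
  by rewrite T_scale // -[T f x]hu; exact: hy.
by move=> h; exists (T f x) => //; change (y = c *: T f x); rewrite -T_scale.
Qed.

Lemma mult_op_adjoint f : sm f -> adjoint ip (mult_op f) = mult_op (fun t => (f t)^*).
Proof.
move=> hf; apply/seteqP; split=> -[x y].
  move=> h; change (y = T (fun t => (f t)^*) x); apply: (coef_inj onb) => k.
  have : ip (T f (e k)) x = ip (e k) y by apply: (h (e k, T f (e k))).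
  by rewrite T_adj // /hcoef => /(congr1 Num.conj); rewrite !ip_conj.
move=> h [u v] hv; change (v = T f u) in hv; change (y = T (fun t => (f t)^*) x) in h.
by change (ip v x = ip u y); rewrite hv h T_adj.
Qed.

Lemma mult_op1 : mult_op (fun=> 1) = op1 :> oper H.
Proof.
apply/seteqP; split=> -[x y] h; first by change (y = x); rewrite -[x]T_one; exact: h.
by change (y = T (fun=> 1) x); rewrite T_one; exact: h.
Qed.

Lemma mult_op0 : mult_op (fun=> 0) = op0 :> oper H.
Proof.
have T0 (x : H) : T (fun=> 0) x = 0.
  have := @T_scale R (fun=> 1) 0 x (sm_cst 1); rewrite scale0r => <-.
  by congr (T _ x); apply/funext => t; rewrite mul0r.
apply/seteqP; split=> -[x y] h; first by change (y = 0); rewrite -(T0 x); exact: h.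
by change (y = T (fun=> 0) x); rewrite T0; exact: h.
Qed.

Lemma smooth_star : star_algebra ip (circle_smooth R).
Proof.
split.
- by move=> S /smooth_Bsub/Bsub_BT hS; exact: (BT_bounded hilb d_ge1 d_growth hS).
- by exists (fun=> 0); [exact: sm_cst|exact: mult_op0].
- split=> [_ _ [f hf <-] [g hg <-]|c _ [f hf <-]|_ _ [f hf <-] [g hg <-]].
  + by exists (fun t => f t + g t); [exact: smD hf hg|exact: (esym (mult_opD hf hg))].
  + by exists (fun t => c * f t); [exact: smZ|exact: (esym (mult_opZ c hf))].
  + by exists (fun t => f t * g t); [exact: smM hf hg|exact: (esym (mult_opM hf hg))].
- by move=> _ [f hf <-]; exists (fun t => (f t)^*); [exact: sm_conj|exact: (esym (mult_op_adjoint hf))].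
Qed.

Lemma circle_DopE : circle_D R = Dop ip e d.
Proof. exact: circle_DE. Qed.

Lemma smooth_algebra f : sm f -> circle_algebra R (mult_op f).
Proof.
move=> hf; have hG : circle_smooth R (mult_op f) by exists f.
have := @saturation_gen _ _ ip e d _ 0 _ hG.
rewrite (sig0 hilb d_ge1 d_growth (Bsub_BT (smooth_Bsub hG))).
by rewrite /circle_algebra circle_DopE; exact.
Qed.

(** The eigenvalues of [P = (F + 1)/2]; the constant mode belongs to its range. *)
Definition pos (k : nat) : C := 2^-1 * (sgd d k + 1).

Lemma pos_cases k : pos k = if freq k < 0 then 0 else 1.
Proof.
have n0 (n : nat) : 0 < n.+1%:R :> R by [].
rewrite /pos /sgd -(ltrz0 R) -/(nu k).
have [n [[_ -> ->]|[_ -> ->]|[_ -> ->]]] := dval_cases k.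
- by rewrite sgr1 ltxx -mulr2n mulVf // pnatr_eq0.
- by rewrite (gtr0_sg (n0 n)) ltNge ler0n /= -mulr2n mulVf // pnatr_eq0.
- by rewrite sgrN (gtr0_sg (n0 n)) oppr_lt0 n0 rmorphN1 addNr mulr0.
Qed.

Lemma positive_projE : positive_proj ip (circle_D R) = Diag ip e pos.
Proof.
rewrite /positive_proj circle_DopE (opphaseE hilb onb d_ge1) -(Diag1 onb).
apply/seteqP; split=> -[x y].
  move=> [z [u [v [hu hv hz]]] hy] k; change (z = u + v) in hz; change (y = 2^-1 *: z) in hy.
  change (coef y k = pos k * coef x k).
  have e1 : coef u k = sgd d k * coef x k by exact: hu.
  have e2 : coef v k = 1 * coef x k by exact: hv.
  by rewrite hy hz hcoefZ hcoefD e1 e2 /pos -mulrDl mulrA.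
move=> h; have [|u hu _] := @Diag_ex _ _ _ hilb _ onb (sgd d) 1 ler01 _ x.
  by move=> k; rewrite (cabs_sgd d_ge1).
exists (u + x).
  by exists u, x; split=> // k; change (coef x k = 1 * coef x k); rewrite mul1r.
change (y = 2^-1 *: (u + x)); apply: (coef_inj onb) => k.
have -> : coef y k = pos k * coef x k by exact: h.
have e1 : coef u k = sgd d k * coef x k by exact: hu.
by rewrite hcoefZ hcoefD e1 /pos -mulrA mulrDl mul1r.
Qed.

Lemma ran_positive_proj x : ran (positive_proj ip (circle_D R)) x <->
  forall k, freq k < 0 -> coef x k = 0.
Proof.
rewrite positive_projE; split=> [[z hz] k fk|h].
  have -> : coef x k = pos k * coef z k by exact: hz.
  by rewrite pos_cases fk mul0r.
exists x => k; change (coef x k = pos k * coef x k); rewrite pos_cases.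
by case: ifP => [/h ->|_]; rewrite ?mulr0 ?mul1r.
Qed.

Lemma coef_shift n j k x : freq k = freq j + n -> coef (T (E n) x) k = coef x j.
Proof.
move=> h; rewrite /hcoef T_adj; last exact: sm_E.
congr (ip x _); rewrite (_ : (fun t => _) = E (- n)); last by apply/funext => t; exact: E_conj.
rewrite T_shift h addrCA addNr addr0 //.
Qed.

Lemma freq_succ k : exists j, freq j = freq k + 1.
Proof. exact: freq_surj. Qed.

Lemma freq_pred k : exists j, freq k = freq j + 1.
Proof. by have [j hj] := freq_surj (freq k - 1); exists j; rewrite hj subrK. Qed.

Definition shift_unitary (i j : 'I_1) : oper H := mult_op (E 1).

Lemma shift_unitary_over : unitary_over ip (circle_algebra R) shift_unitary.
Proof.
have big1 (F : 'I_1 -> oper H) : \big[@opD C H/op0]_(l < 1) F l = F ord0.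
  rewrite big_ord_recl big_ord0; apply/seteqP; split=> -[x y].
    move=> [u [v [hu hv hy]]]; change (v = 0) in hv; change (y = u + v) in hy.
    by rewrite hy hv addr0.
  by move=> h; exists y, 0; split=> //; change (y = y + 0); rewrite addr0.
have s1 := @sm_E R 1; have s1' := sm_conj s1.
split=> [i j|i j|i j]; first exact: smooth_algebra.
- rewrite big1 /shift_unitary (ord1 i) (ord1 j) eqxx mult_op_adjoint // mult_opM //.
  rewrite -mult_op1; congr mult_op; apply/funext => t; rewrite mulrC; exact: E_norm.
rewrite big1 /shift_unitary (ord1 i) (ord1 j) eqxx mult_op_adjoint // mult_opM //.
by rewrite -mult_op1; congr mult_op; apply/funext => t; exact: E_norm.
Qed.

(** The compression raises nonnegative frequencies by one, so it is the unilateral shift: injective,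
    with cokernel spanned by the constant mode. *)
Lemma shift_index : index_pairing ip (circle_D R) shift_unitary (-1).
Proof.
exists 0%N, 1%N; split; last by [].
- exists (fun _ => 0); split=> [[]//|x hx].
  exists (fun=> 0); split.
    change (x - \sum_(i < 0) 0 *: 0 = 0); rewrite big_ord0 subr0.
    apply/funext => i; rewrite (ord1 i).
    have [Wx [y [hy hp]]] := hx; change (forall i, ran (positive_proj ip (circle_D R)) (x i)) in Wx.
    have y0 : y ord0 ord0 = T (E 1) (x ord0) by exact: hy.
    have := hp ord0; rewrite big_ord_recl big_ord0 addr0 y0 positive_projE => hP.
    apply: (coef_inj onb) => j; rewrite hcoef0.
    have [jn|jn] := ltP (freq j) 0; first by have /ran_positive_proj := Wx ord0; apply.
    have [k hk] := freq_succ j; rewrite -(@coef_shift 1 j k) //.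
    have : coef 0 k = pos k * coef (T (E 1) (x ord0)) k by exact: hP.
    rewrite hcoef0 pos_cases hk ltNge (le_trans jn) ?lerDl //= mul1r => <-.
    by [].
  by move=> c _; apply/funext => -[].
exists (fun _ _ => fe 0); split.
  move=> i; change (forall j : 'I_1, ran (positive_proj ip (circle_D R)) (fe 0)) => _.
  apply/ran_positive_proj => k; rewrite /hcoef ip_fe.
  by case: k => [|k] //; rewrite /freq /= oppr0 ltxx.
move=> x Wx; exists (fun=> coef (x ord0) 0); split.
  rewrite big_ord_recl big_ord0 addr0.
  set z := x - _; have z0 : coef (z ord0) 0 = 0.
    change (coef (x ord0 - coef (x ord0) 0 *: fe 0) 0 = 0).
    by rewrite hcoefB hcoefZ [hcoef _ _ (fe 0) 0]ip_fe mulr1 subrr.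
  have zn k : freq k < 0 -> coef (z ord0) k = 0.
    move=> fk; change (coef (x ord0 - coef (x ord0) 0 *: fe 0) k = 0).
    rewrite hcoefB hcoefZ [hcoef _ _ (fe 0) k]ip_fe.
    have /ran_positive_proj /(_ k fk) -> := Wx ord0.
    case: k fk => [|k] fk; first by move: fk; rewrite /freq /= oppr0 ltxx.
    by rewrite mulr0 subrr.
  have s1 := @sm_E R 1; have sN := @sm_E R (- 1).
  (* With its constant mode removed, a vector can be shifted back by [e^(-ix)] without leaving the
     range of [P]. *)
  exists (fun=> T (E (- 1)) (z ord0)); split.
    move=> i; apply/ran_positive_proj => j fj.
    have [k hk] := freq_succ j; rewrite (@coef_shift (- 1) k j); last by rewrite hk addrK.
    have [k0|k0] := eqVneq k 0%N; first by rewrite k0.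
    apply: zn; rewrite hk; have : freq k != 0.
      by apply: contra_neq k0 => f0; apply: freq_inj; rewrite f0 /freq /= oppr0.
    by rewrite hk; move: (freq j) fj => n; lia.
  exists (fun _ _ => z ord0); split=> [i j|i].
    change (z ord0 = T (E 1) (T (E (- 1)) (z ord0))); rewrite -T_mul //.
    rewrite -[LHS]T_one; congr (T _ _); apply/funext => t.
    by rewrite E_mul addrN E0.
  rewrite big_ord_recl big_ord0 addr0 (ord1 i) positive_projE => k.
  change (coef (z ord0) k = pos k * coef (z ord0) k); rewrite pos_cases.
  by case: ifP => [/zn ->|_]; rewrite ?mulr0 ?mul1r.
(* Uniqueness: the constant mode of a vector in the range of the shift comes from frequency -1,
   where vectors in the range of [P] vanish. *)
move=> c [v [Wv [y [hy hp]]]]; apply/funext => i; rewrite (ord1 i).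
change (forall i, ran (positive_proj ip (circle_D R)) (v i)) in Wv.
have y0 : y ord0 ord0 = T (E 1) (v ord0) by exact: hy.
have := hp ord0; rewrite big_ord_recl big_ord0 addr0 y0 positive_projE.
rewrite big_ord_recl big_ord0 addr0 => hP.
have : coef (x ord0 - c ord0 *: fe 0) 0 = pos 0 * coef (T (E 1) (v ord0)) 0 by exact: hP.
have [j hj] := freq_pred 0; rewrite (coef_shift _ hj).
have jn : freq j < 0 by have : freq 0 = 0 by []; rewrite hj; lia.
have /ran_positive_proj/(_ j jn) -> := Wv ord0.
rewrite hcoefB hcoefZ [hcoef _ _ (fe 0) 0]ip_fe mulr1 mulr0 => /eqP.
by rewrite subr_eq0 => /eqP.
Qed.

End CircleTriple.

Theorem theorem3p3 (R : realType) :
  let ip := L2dot R in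
  let D := circle_D R in
  let A := circle_algebra R in
  [/\ invertible_op ip D /\
      weakly_twisted_triple ip (circle_smooth R) D (circle_sigma R),
      [/\ twisted_triple ip A D (circle_sigma R),
          regular_triple ip A D (circle_sigma R),
          finitely_summable ip D &
          simple_discrete_dimension_spectrum ip A D],
      exists (N : nat) (u : 'I_N -> 'I_N -> oper (L2 R)) (n : int),
        [/\ unitary_over ip A u, index_pairing ip D u n & n != 0] &
      exists phi : cochain (L2 R),
        [/\ moscovici_cochain ip A D phi,
            odd_zero_cochain A phi &
            forall kappa : R[i],
              ~ (forall (N : nat) (u : 'I_N -> 'I_N -> oper (L2 R)) (n : int),
                   unitary_over ip A u -> index_pairing ip D u n ->
                   chern_pairing ip kappa phi u n%:~R)]].
Proof.
have hilb := @circle_hilbert R; have mc := @MM_class R; have GB := @smooth_Bsub R.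
have g1 := @d_ge1 R; have gr := @d_growth R.
have AB := saturation_sub hilb g1 gr mc GB.
move=> ip D A; rewrite /A /circle_algebra /circle_sigma /D circle_DopE; split.
- split; first exact: (Dop_invertible hilb (@fe_onb R) g1).
  exact: (Dop_weakly_twisted hilb g1 gr mc GB (@smooth_star R)).
- split.
  + exact: (saturation_twisted hilb g1 gr mc GB).
  + exact: (saturation_regular hilb g1 gr mc GB).
  + exact: (Dop_finitely_summable hilb (@fe_onb R) g1 gr).
  + exact: (dimension_spectrum hilb g1 gr (@d_zero R) (@d_odd R) (@d_even R) mc AB).
- exists 1%N, (@shift_unitary R), (-1).
  have := @shift_unitary_over R; have := @shift_index R.
  by rewrite /circle_algebra circle_DopE.
(* The witness is the zero cochain; what remains is that the ansatz takes the value 0. *)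
exists (fun _ _ => 0); split=> //.
  move=> m a om Aa.
  exact: (moscovici_value_zero hilb g1 gr (@d_zero R) (@d_odd R) (@d_even R) mc AB om Aa).
(* For every normalisation the partial sums of the pairing with the zero cochain are 0, while the
   index of the shift is -1. *)
move=> kappa h; have su := @shift_unitary_over R; have si := @shift_index R.
rewrite /circle_algebra circle_DopE in su; rewrite circle_DopE in si.
have := h _ _ _ su si; rewrite /chern_pairing.
rewrite (_ : series _ = fun=> 0); last first.
  apply/funext => n; rewrite /series /=; apply: big1 => l _.
  by rewrite /chern_term big1 ?mulr0.
move=> hc; have : (-1)%:~R = 0 :> R[i].
  by apply: (cvg_unique _ hc); [exact: norm_hausdorff|exact: cvg_cst].
by apply/eqP; rewrite rmorphN1 oppr_eq0 oner_eq0.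
Qed.
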